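(* Let $N\ge2$, $s\in(0,1)$, $p>2$ with $ps<N$, let $\Omega\subset\mathbb{R}^N$ be a bounded regular domain with $0\in\Omega$, and let $T>0$. Let $u_0\in L^1(\Omega)$ be such that $u_0\ge0$, $u_0\not\equiv0$, and let $\lambda>\Lambda_{N,p,s}$. Then the problem $$\begin{cases} u_t+(-\Delta^s_p)u=\lambda\,\dfrac{u^{p-1}}{|x|^{ps}} & \text{in }\Omega_T=\Omega\times(0,T),\\ u\ge 0 & \text{in }\mathbb{R}^N\times(0,T),\\ u=0 & \text{in }(\mathbb{R}^N\setminus\Omega)\times(0,T),\\ u(x,0)=u_0(x) & \text{in }\Omega,\end{cases}$$ has no positive solution obtained as limit of approximations (SOLA).
   Context: Operator: $(-\Delta^s_p)u(x,t)=\mathrm{P.V.}\int_{\mathbb{R}^N}\frac{|u(x,t)-u(y,t)|^{p-2}(u(x,t)-u(y,t))}{|x-y|^{N+ps}}\,dy$. Hardy constant: $\Lambda_{N,p,s}>0$ is the optimal constant in $\frac12\iint_{\mathbb{R}^{2N}}\frac{|u(x)-u(y)|^p}{|x-y|^{N+ps}}dxdy\ge\Lambda_{N,p,s}\int_{\mathbb{R}^N}\frac{|u(x)|^p}{|x|^{ps}}dx$ for all $u\in W^{s,p}(\mathbb{R}^N)$. SOLA: a solution obtained as limit of approximations is a nonnegative (a.e. finite) function $u$ on $\Omega_T$ which is the a.e. limit $u=\lim_{n\to\infty}u_n$, where, for each $n\ge1$, $u_n$ is the nonnegative energy solution on $\Omega_T$ of $$\begin{cases} u_{nt}+(-\Delta^s_p)u_n=\lambda\,a_n(x)u_n^{p-1}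 & \text{in }\Omega_T,\\ u_n=0 & \text{in }(\mathbb{R}^N\setminus\Omega)\times(0,T),\\ u_n(x,0)=T_n(u_0)(x) & \text{in }\Omega,\end{cases}\qquad a_n(x)=\min\Big\{n,\frac1{|x|^{ps}}\Big\},\quad T_n(\sigma)=\min\{\sigma,n\}.$$ The sequence $\{u_n\}$ is nondecreasing in $n$. Energy solution: with $d\nu=\frac{dx\,dy}{|x-y|^{N+ps}}$, $D_\Omega=(\mathbb{R}^N\times\mathbb{R}^N)\setminus(\mathcal{C}\Omega\times\mathcal{C}\Omega)$, $\mathcal{C}\Omega=\mathbb{R}^N\setminus\Omega$, $W^{s,p}_0(\Omega)$ the completion of $\mathcal{C}_0^\infty(\Omega)$ in the norm $\left(\int_\Omega|\phi|^pdx\right)^{1/p}+\left(\int_\Omega\int_\Omega|\phi(x)-\phi(y)|^pd\nu\right)^{1/p}$ (elements extended by $0$ outside $\Omega$), $L^p(0,T;W^{s,p}_0(\Omega))$ with norm $\left(\int_0^T\iint_{D_\Omega}|\phi(x,t)-\phi(y,t)|^pd\nu\,dt\right)^{1/p}$, and $W^{-s,p'}_0(\Omega)$ the dual of $W^{s,p}_0(\Omega)$, $p'=p/(p-1)$: $w$ is an energy solution of $w_t+(-\Delta^s_p)w=g$ with initial datum $w_0$ if $w\in L^p(0,T;W^{s,p}_0(\Omega))\cap\mathcal{C}([0,T],L^p(\Omega))$, $w_t\in L^{p'}(0,T;W^{-s,p'}_0(\Omega))$, $w(\cdot,t)\to w_0$ in $L^2(\Omega)$ as $t\to0$, and $$\int_0^T\langle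 w_t,v\rangle dt+\frac12\int_0^T\iint_{D_\Omega}|w(x,t)-w(y,t)|^{p-2}(w(x,t)-w(y,t))(v(x,t)-v(y,t))\,d\nu\,dt=\iint_{\Omega_T}g\,v\,dx\,dt$$ for all $v\in L^p(0,T;W^{s,p}_0(\Omega))$. *)

(* Defs.v *)
From HB Require Import structures.
From mathcomp Require Import all_boot all_order all_algebra.
From mathcomp Require Import all_classical all_reals all_analysis.

Set Implicit Arguments.
Unset Strict Implicit.
Unset Printing Implicit Defensive.

Import Order.TTheory GRing.Theory Num.Theory.
Import numFieldNormedType.Exports.

Local Open Scope classical_set_scope.
Local Open Scope ring_scope.

(* R^N is 'rV[R]_N; its sigma-algebra is the one generated by the coordinates,
   i.e. the Borel sigma-algebra when T is R. *)
Definition rV_display : measure_display -> measure_display.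
Proof. exact. Qed.

Section measurable_rV.
Context {d} {T : sigmaRingType d}.
Variable n : nat.

Let coors : 'I_n -> 'rV[T]_n -> T := fun i x => x ord0 i.

Let rV_set0 : g_sigma_preimage coors set0.
Proof. exact: sigma_algebra0. Qed.

Let rV_setC A : g_sigma_preimage coors A -> g_sigma_preimage coors (~` A).
Proof. exact: sigma_algebraC. Qed.

Let rV_bigcup (F : _^nat) : (forall i, g_sigma_preimage coors (F i)) ->
  g_sigma_preimage coors (\bigcup_i (F i)).
Proof. exact: sigma_algebra_bigcup. Qed.

HB.instance Definition _ := @isMeasurable.Build (rV_display d)
  'rV[T]_n (g_sigma_preimage coors) rV_set0 rV_setC rV_bigcup.

End measurable_rV.

Lemma measurable_coord d (T : sigmaRingType d) n (i : 'I_n) :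
  measurable_fun [set: 'rV[T]_n] (fun x : 'rV[T]_n => x ord0 i).
Proof.
move=> _ Y mY; rewrite setTI; apply: sub_sigma_algebra => /=.
rewrite -bigcup_seq/=; exists i => /=; first by rewrite mem_index_enum.
by exists Y => //; rewrite setTI.
Qed.

Lemma measurable_fun_coordP d1 d2 (T1 : measurableType d1)
    (T2 : sigmaRingType d2) n (f : T1 -> 'rV[T2]_n) :
  (forall i, measurable_fun [set: T1] (fun x => f x ord0 i)) ->
  measurable_fun [set: T1] f.
Proof.
move=> mf _ A mA; rewrite setTI.
move: A mA; apply: smallest_sub.
  split=> [|A mfA|F mF] /=.
  - by rewrite preimage_set0.
  - by rewrite setTD preimage_setC; exact: measurableC.
  - by rewrite preimage_bigcup; exact: bigcup_measurable.
rewrite -bigcup_seq/=; apply: bigcup_sub => i _ _ [B mB <-] /=.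
by rewrite setTI; have := mf i measurableT B mB; rewrite setTI.
Qed.

Section lebesgue_rV.
Variable R : realType.

Definition cons_rV n (z : R * 'rV[R]_n) : 'rV[R]_n.+1 :=
  row_mx (z.1%:M : 'rV[R]_1) z.2.

Lemma measurable_cons_rV n :
  measurable_fun [set: measurableTypeR R * 'rV[R]_n] (@cons_rV n).
Proof.
apply: measurable_fun_coordP => i.
pose j := fintype.split (i : 'I_(1 + n)).
have -> : (fun z : measurableTypeR R * 'rV[R]_n => cons_rV z ord0 i) =
    match j with
    | inl _ => fst | inr k => (fun x : 'rV[R]_n => x ord0 k) \o snd
    end.
  apply/funext => z; rewrite /cons_rV /j mxE; case: fintype.split => k //.
  by rewrite mxE !ord1.
case: j => k; first exact: measurable_fst.
by apply: measurableT_comp => //; exact: measurable_coord.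
Qed.

Definition cons_measure n (mu : {sigma_finite_measure set 'rV[R]_n -> \bar R}) :
    set 'rV[R]_n.+1 -> \bar R :=
  pushforward (@lebesgue_measure R \x mu)%E (@cons_rV n).

Section cons_measure.
Variables (n : nat) (mu : {sigma_finite_measure set 'rV[R]_n -> \bar R}).

Let cons_measure0 : cons_measure mu set0 = 0%E.
Proof. by rewrite /cons_measure /pushforward preimage_set0 measure0. Qed.

Let cons_measure_ge0 A : (0 <= cons_measure mu A)%E.
Proof. by rewrite /cons_measure /pushforward measure_ge0. Qed.

Let cons_measure_sigma_additive : semi_sigma_additive (cons_measure mu).
Proof.
move=> F mF tF mUF; rewrite /cons_measure /pushforward preimage_bigcup.
have mpre A : measurable A -> measurable (@cons_rV n @^-1` A).
  by move=> mA; rewrite -[X in measurable X]setTI; exact: measurable_cons_rV.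
apply: measure_semi_sigma_additive.
- by move=> k; exact: mpre.
- apply/trivIsetP => /= i j _ _ ij; rewrite -preimage_setI.
  by move/trivIsetP : tF => /(_ _ _ _ _ ij) ->//; rewrite preimage_set0.
- by rewrite -preimage_bigcup; exact: mpre.
Qed.

HB.instance Definition _ := isMeasure.Build _ _ _ (cons_measure mu)
  cons_measure0 cons_measure_ge0 cons_measure_sigma_additive.

Let uncons (x : 'rV[R]_n.+1) : measurableTypeR R * 'rV[R]_n :=
  (x ord0 ord0, \row_(i < n) x ord0 (lift ord0 i)).

Let unconsK : cancel (@cons_rV n) uncons.
Proof.
case=> a x; rewrite /uncons /cons_rV; congr pair => /=.
  have e : ord0 = lshift n ord0 :> 'I_(1 + n) by exact/val_inj.
  by rewrite [LHS](congr1 (row_mx _ _ ord0) e) row_mxEl mxE eqxx mulr1n.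
apply/rowP => i; rewrite mxE.
have e : lift ord0 i = rshift 1 i :> 'I_(1 + n) by exact/val_inj.
by rewrite [LHS](congr1 (row_mx _ _ ord0) e) row_mxEr.
Qed.

Let measurable_uncons : measurable_fun [set: 'rV[R]_n.+1] uncons.
Proof.
apply/measurable_fun_pairP; split; first exact: measurable_coord.
apply: measurable_fun_coordP => i /=.
under eq_fun do rewrite mxE; exact: measurable_coord.
Qed.

Let cons_measure_sigma_finite : sigma_finite setT (cons_measure mu).
Proof.
have /sigma_finiteP[F [TF ndF Foo]] := sigma_finiteT (@lebesgue_measure R).
have /sigma_finiteP[G [TG ndG Goo]] := sigma_finiteT mu.
exists (fun k => uncons @^-1` (F k `*` G k)).
  rewrite -preimage_bigcup; apply/seteqP; split => // x _ /=.
  have [i _ Fi] : (\bigcup_k F k) (uncons x).1 by rewrite -TF.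
  have [j _ Gj] : (\bigcup_k G k) (uncons x).2 by rewrite -TG.
  exists (maxn i j) => //; split.
  - by move: Fi; exact/subsetPset/ndF/leq_maxl.
  - by move: Gj; exact/subsetPset/ndG/leq_maxr.
move=> k; have [mF Fk] := Foo k; have [mG Gk] := Goo k; split.
  rewrite -[X in measurable X]setTI; apply: measurable_uncons => //.
  exact: measurableX.
rewrite /= /cons_measure /pushforward.
rewrite (_ : _ @^-1` _ = F k `*` G k); last first.
  rewrite -comp_preimage (_ : uncons \o @cons_rV n = id) ?preimage_id//.
  by apply/funext => z; exact: unconsK.
by rewrite product_measure1E// lte_mul_pinfty// ge0_fin_numE.
Qed.

HB.instance Definition _ := Measure_isSigmaFinite.Build _ _ _
  (cons_measure mu) cons_measure_sigma_finite.

End cons_measure.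

(* Lebesgue measure on R^n, as the n-fold product of lebesgue_measure *)
Fixpoint lebesgue_rV (n : nat) : {sigma_finite_measure set 'rV[R]_n -> \bar R} :=
  match n with
  | 0 => \d_(0 : 'rV[R]_0)
  | k.+1 => cons_measure (lebesgue_rV k)
  end.

End lebesgue_rV.

Section euclidean.
Variables (R : realType) (N : nat).
Implicit Types (x y : 'rV[R]_N) (Om : set 'rV[R]_N).

Definition dotp x y : R := \sum_(i < N) x ord0 i * y ord0 i.

(* `|x| is the sup norm on 'rV[R]_N, so the Euclidean norm is defined here *)
Definition enorm x : R := Num.sqrt (dotp x x).

(* Near each of its boundary points x0, Om is the hypograph, in a direction e,
   of a Lipschitz function g of the projection of x onto the hyperplane
   orthogonal to e. *)
Definition lipschitz_boundary Om : Prop :=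
  forall x0, (closure Om `\` Om°) x0 ->
  exists (e : 'rV[R]_N) (g : 'rV[R]_N -> R) (k r : R),
    [/\ enorm e = 1, 0 < r,
        (forall y z, `|g y - g z| <= k * enorm (y - z)) &
        (forall x, enorm (x - x0) < r ->
           (Om x <-> dotp x e < g (x - dotp x e *: e)))].

Definition regular_domain Om : Prop :=
  [/\ open Om, connected Om & lipschitz_boundary Om].

End euclidean.

Section test_functions.
Variables (R : realType) (V : normedModType R).

Fixpoint iter_derive (vs : seq V) (f : V -> R) : V -> R :=
  if vs is v :: vs' then fun x => 'D_v (iter_derive vs' f) x else f.

Definition smooth (f : V -> R) : Prop :=
  forall (vs : seq V) (x : V), differentiable (iter_derive vs f) x.

Definition test_function (U : set V) (f : V -> R) : Prop :=
  smooth f /\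
  exists K : set V, [/\ compact K, K `<=` U & forall x, ~ K x -> f x = 0].

End test_functions.

Section fractional_spaces.
Variables (R : realType) (N : nat) (s p : R).
Local Notation E := 'rV[R]_N.
Local Notation mu := (lebesgue_rV R N).
Implicit Types (Om : set E) (f phi : E -> R) (F : (E -> R) -> R).

(* the density of dnu; its value on the null set x = y is irrelevant *)
Definition nu_density (x y : E) : R := (enorm (x - y) `^ (N%:R + p * s))^-1.

(* the integral of |f(x) - f(y)|^p dnu over D *)
Definition gagliardo (D : set (E * E)) f : \bar R :=
  (\int[mu \x mu]_(z in D)
     (`|f z.1 - f z.2| `^ p * nu_density z.1 z.2)%R%:E)%E.

Definition Wsp f : Prop :=
  [/\ measurable_fun setT f,
      (\int[mu]_x (`|f x| `^ p)%:E < +oo)%E &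
      (gagliardo setT f < +oo)%E].

Definition hardy_inequality (c : R) : Prop :=
  forall f, Wsp f ->
    (c%:E * \int[mu]_x (`|f x| `^ p / enorm x `^ (p * s))%:E
       <= (2^-1)%:E * gagliardo setT f)%E.

Definition hardy_constant : \bar R :=
  ereal_sup [set c%:E | c in [set c | hardy_inequality c]].

Definition W0_norm Om f : \bar R :=
  ((\int[mu]_(x in Om) (`|f x| `^ p)%:E) `^ p^-1
   + gagliardo (Om `*` Om) f `^ p^-1)%E.

(* The completion of C_0^oo(Om), realized by functions on R^N that vanish a.e.
   outside Om. *)
Definition W0 Om f : Prop :=
  [/\ measurable_fun setT f,
      {ae mu, forall x, ~ Om x -> f x = 0} &
      exists phi_ : nat -> E -> R,
        (forall k, test_function Om (phi_ k)) /\
        W0_norm Om (fun x => f x - phi_ k x) @[k --> \oo] --> 0%E].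

Definition W0_dual Om F : Prop :=
  (forall (a : R) f phi, W0 Om f -> W0 Om phi ->
     F (fun x => a * f x + phi x) = a * F f + F phi) /\
  (exists C : R, forall f, W0 Om f -> (`|F f|%:E <= C%:E * W0_norm Om f)%E).

Definition W0_dual_norm Om F : \bar R :=
  ereal_sup [set (`|F f|)%:E | f in [set f | W0 Om f /\ (W0_norm Om f <= 1)%E]].

Definition D_ Om : set (E * E) := ~` (~` Om `*` ~` Om).

End fractional_spaces.

Section evolution.
Variables (R : realType) (N : nat) (s p : R) (Om : set 'rV[R]_N) (T : R).
Local Notation E := 'rV[R]_N.
Local Notation mu := (lebesgue_rV R N).
Local Notation leb := (@lebesgue_measure R).
Implicit Types (w v g : E -> R -> R) (xi : R -> (E -> R) -> R).

Definition cylinder (A : set E) : set (E * measurableTypeR R) :=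
  A `*` `]0, T[%classic.

(* L^p(0,T; W_0^{s,p}(Om)); as W_0^{s,p}(Om) is separable, its strongly
   measurable maps are the jointly measurable functions of (x, t) with sections
   in W_0^{s,p}(Om). *)
Definition Lp_W0 v : Prop :=
  [/\ measurable_fun (cylinder setT) (fun z => v z.1 z.2),
      {ae leb, forall t, `]0, T[%classic t -> W0 s p Om (v ^~ t)} &
      (\int[leb]_(t in `]0%R, T[) gagliardo s p (D_ Om) (v ^~ t) < +oo)%E].

(* w is the representative for which t |-> w(., t) is continuous *)
Definition C_Lp w : Prop :=
  (forall t, `[0, T]%classic t ->
     measurable_fun Om (w ^~ t) /\
     (\int[mu]_(x in Om) (`|w x t| `^ p)%:E < +oo)%E) /\
  (forall t0, `[0, T]%classic t0 ->
     (\int[mu]_(x in Om) (`|w x t - w x t0| `^ p)%:E)%E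
       @[t --> within `[0, T]%classic (nbhs t0)] --> 0%E).

(* L^{p'}(0,T; W_0^{-s,p'}(Om)), p' = p / (p - 1); the dual being separable,
   strong and weak measurability agree. *)
Definition Lp'_W0_dual xi : Prop :=
  [/\ {ae leb, forall t, `]0, T[%classic t -> W0_dual s p Om (xi t)},
      (forall phi, W0 s p Om phi ->
         measurable_fun (`]0, T[%classic : set (measurableTypeR R))
           (fun t => xi t phi)) &
      (\int[leb]_(t in `]0%R, T[)
         W0_dual_norm s p Om (xi t) `^ (p / (p - 1)) < +oo)%E].

(* xi = w_t in the sense of distributions on (0,T) *)
Definition time_derivative w xi : Prop :=
  forall (eta : R -> R) (phi : E -> R),
    test_function `]0, T[%classic eta -> W0 s p Om phi ->
    \int[leb]_(t in `]0%R, T[)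
        (derive1 eta t * \int[mu]_(x in Om) (w x t * phi x))
    = - \int[leb]_(t in `]0%R, T[) (eta t * xi t phi).

Definition jump (a : R) : R := `|a| `^ (p - 2) * a.

Definition energy_solution w g (w0 : E -> R) : Prop :=
  [/\ Lp_W0 w,
      C_Lp w,
      (\int[mu]_(x in Om) ((w x t - w0 x) ^+ 2)%:E)%E
        @[t --> at_right (0 : R)] --> 0%E &
      exists xi, [/\ Lp'_W0_dual xi, time_derivative w xi &
        forall v, Lp_W0 v ->
          \int[leb]_(t in `]0%R, T[) xi t (v ^~ t)
          + 2^-1 * \int[leb]_(t in `]0%R, T[)
              \int[(mu \x mu)%E]_(z in D_ Om)
                (jump (w z.1 t - w z.2 t) * (v z.1 t - v z.2 t)
                 * nu_density s p z.1 z.2)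
          = \int[(mu \x leb)%E]_(z in cylinder Om) (g z.1 z.2 * v z.1 z.2)]].

Definition trunc (n : nat) (sigma : R) : R := Num.min sigma n%:R.

(* 1/|x|^{ps}, truncated; its value at x = 0 is irrelevant *)
Definition a_ (n : nat) (x : E) : R := Num.min n%:R (enorm x `^ (p * s))^-1.

Definition sola (lambda : R) (u0 : E -> R) (u : E -> R -> \bar R) : Prop :=
  exists u_ : nat -> E -> R -> R,
    [/\ (forall n, (1 <= n)%N ->
           {ae (mu \x leb)%E, forall z, cylinder Om z -> 0 <= u_ n z.1 z.2} /\
           energy_solution (u_ n)
             (fun x t => lambda * a_ n x * u_ n x t `^ (p - 1))
             (fun x => trunc n (u0 x))),
        (forall n, (1 <= n)%N ->
           {ae (mu \x leb)%E, forall z, cylinder Om z ->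
              u_ n z.1 z.2 <= u_ n.+1 z.1 z.2}) &
        {ae (mu \x leb)%E, forall z, cylinder Om z ->
           [/\ (0 <= u z.1 z.2)%E, u z.1 z.2 \is a fin_num &
               (u_ n z.1 z.2)%:E @[n --> \oo] --> u z.1 z.2]}].

End evolution.

(* Main.v *)
Require Import Defs.
From HB Require Import structures.
From mathcomp Require Import all_boot all_order all_algebra.
From mathcomp Require Import all_classical all_reals all_analysis.
From mathcomp Require Import measurable_realfun.
From mathcomp Require Import ring lra.

Set Implicit Arguments.
Unset Strict Implicit.
Unset Printing Implicit Defensive.

Import Order.TTheory GRing.Theory Num.Theory.
Import numFieldNormedType.Exports.

Local Open Scope classical_set_scope.
Local Open Scope ring_scope.

(* Let [W] be one of the approximations [u_n] and [phi >= 0] a bounded function of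
   finite energy supported near [0].  Test the equation with
   [v = phi^p (W + e)^(1-p)], localized in time by a cutoff [zeta].  Picone's
   inequality bounds the nonlocal term by half the energy of [phi], with a surplus
   [kappa * int zeta v]: points near [0] interact with the mass of [W] away from
   [0], which is bounded below by that of [u_1 <= u_n], uniformly in [n].  This
   surplus absorbs, by Young's inequality, the term
   [int zeta' phi^p (W + e)^(2-p) / (p - 2)] coming from the time derivative, as
   well as the error of replacing [W / (W + e)] by [1].  Hence
     [lambda int a_n phi^p <= 1/2 [phi]^p + K int phi^p]
   with [K] independent of [n] and [phi].  Letting [n] tend to infinity and
   rescaling [phi] by [x |-> phi (k x)], which kills the last term, one gets the
   Hardy inequality with constant [lambda], first for bounded functions of bounded
   support and then, by mollification and truncation, on the whole of [W^{s,p}].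

   As [W] has no pointwise time derivative, the test function at time [t] is used
   in the increments of [W] between [t - h] and [t]; concavity of [r^(2-p)/(2-p)]
   replaces the chain rule, and the limit [h -> 0] is taken by Fatou's lemma,
   since the pointwise gap in Young's inequality is nonnegative. *)

(** * Product measures and Lebesgue measure *)

(** Near [0] no positive lower bound on [W] is used, and [v] is largest where [W] is small; since
    [p > 2], the weight [(W + e)^(2-p)] left by the time derivative also grows there. It is one
    power weaker than the weight [(W + e)^(1-p)] of the surplus, and this gap in homogeneity makes
    the absorption possible, provided [zeta] is a power of a tent high enough to control [zeta']
    where [zeta] vanishes. The surplus is a nonlocal effect: a point near [0] feels the mass at a
    positive distance, which [u_1] keeps for a short time because its initial datum is nonzero away
    from [0]. The regularization [e] may depend on [n]: it only has to make [n e] small, and it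
    enters no constant that survives in [K]. The energies of [W] and [v] have no bound uniform in
    [n]; they are added to both sides of the tested equation to make its integrand nonnegative, and
    they cancel at the end. The contradiction is with the optimality of the Hardy constant, since a
    [lambda] above it would be admissible in the Hardy inequality. *)

Section product_sigma_finite.
Local Open Scope ereal_scope.
Context d1 d2 (X : measurableType d1) (Y : measurableType d2) (R : realType).
Variables (m1 : {sigma_finite_measure set X -> \bar R})
  (m2 : {sigma_finite_measure set Y -> \bar R}).

(* The canonical instance attached to [\x] concerns probability measures only,
   which is why the product is given a name here. *)
Definition prodm : set (X * Y) -> \bar R := m1 \x m2.

HB.instance Definition _ := Measure.on prodm.

Let prodm_sigma_finite : sigma_finite setT prodm.
Proof.
have /sigma_finiteP[F [TF ndF Foo]] := sigma_finiteT m1.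
have /sigma_finiteP[G [TG ndG Goo]] := sigma_finiteT m2.
exists (fun n => F n `*` G n).
  rewrite -setXTT TF TG predeqE => -[x y]; split.
    move=> [/= [n _ Fnx] [k _ Gky]]; exists (maxn n k) => //; split.
    - by move: x Fnx; exact/subsetPset/ndF/leq_maxl.
    - by move: y Gky; exact/subsetPset/ndG/leq_maxr.
  by move=> [n _ []/= ? ?]; split; exists n.
move=> k; have [? ?] := Foo k; have [? ?] := Goo k.
split; first exact: measurableX.
by rewrite /prodm product_measure1E// lte_mul_pinfty// ge0_fin_numE.
Qed.

HB.instance Definition _ := Measure_isSigmaFinite.Build _ _ _ prodm
  prodm_sigma_finite.

(** The exceptional set lies in a measurable null set, and Tonelli applied to its indicator makes
    almost every section of it null. This turns space-time statements into statements at almost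
    every time. *)
Lemma ae_prod2 (P : X -> Y -> Prop) :
  {ae (m1 \x m2), forall z, P z.1 z.2} ->
  {ae m2, forall y, {ae m1, forall x, P x y}}.
Proof.
move=> [A [mA A0 PA]].
have mA1 : measurable_fun setT (fun z : X * Y => (\1_A z)%:E : \bar R).
  by apply/measurable_EFinP; exact: measurable_indic.
have : \int[m2]_y `|m1 (ysection A y)| = 0.
  transitivity (\int[m1 \x m2]_z (\1_A z)%:E); last first.
    by rewrite integral_indic// setIT.
  rewrite fubini_tonelli2//.
  apply: eq_integral => y _; rewrite gee0_abs//.
  rewrite /fubini_G (eq_integral (fun x => (\1_(ysection A y) x)%:E)); last first.
    by move=> x _; rewrite /= !indicE mem_ysection.
  by rewrite integral_indic ?setIT//; exact: measurable_ysection.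
move/(ae_eq_integral_abs _ measurableT (measurable_fun_ysection _ mA)).
apply: filterS => y /(_ I) A0y; exists (ysection A y); split => //.
- exact: measurable_ysection.
- by move=> x /= nPxy; rewrite /ysection/= inE; apply: PA.
Qed.

Lemma ae_prod_fst (P : X -> Prop) :
  {ae m1, forall x, P x} -> {ae (m1 \x m2), forall z, P z.1}.
Proof.
move=> [A [mA A0 PA]]; exists (A `*` setT); split.
- exact: measurableX.
- by rewrite product_measure1E//; move: A0; rewrite /= => ->; rewrite mul0e.
- by move=> z /= nP; split => //; apply: PA.
Qed.

Lemma ae_prod_snd (P : Y -> Prop) :
  {ae m2, forall x, P x} -> {ae (m1 \x m2), forall z, P z.2}.
Proof.
move=> [A [mA A0 PA]]; exists (setT `*` A); split.
- exact: measurableX.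
- by rewrite product_measure1E//; move: A0; rewrite /= => ->; rewrite mule0.
- by move=> z /= nP; split => //; apply: PA.
Qed.

Lemma tonelli_swap (f : X -> Y -> \bar R) :
  measurable_fun setT (fun z : X * Y => f z.1 z.2) ->
  (forall x y, 0 <= f x y) ->
  \int[m1]_x \int[m2]_y f x y = \int[m2]_y \int[m1]_x f x y.
Proof. by move=> mf f0; exact: (fubini_tonelli (m1 := m1) (m2 := m2) _ mf (fun z => f0 z.1 z.2)). Qed.

Lemma tonelli_prod (f : X -> Y -> \bar R) :
  measurable_fun setT (fun z : X * Y => f z.1 z.2) ->
  (forall x y, 0 <= f x y) ->
  \int[m1 \x m2]_z f z.1 z.2 = \int[m1]_x \int[m2]_y f x y.
Proof. by move=> mf f0; exact: (fubini_tonelli1 (m1 := m1) (m2 := m2) _ mf (fun z => f0 z.1 z.2)). Qed.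

Lemma measurable_integral_snd (f : X -> Y -> \bar R) :
  measurable_fun setT (fun z : X * Y => f z.1 z.2) ->
  (forall x y, 0 <= f x y) ->
  measurable_fun setT (fun x => \int[m2]_y f x y).
Proof. by move=> mf f0; exact: (measurable_fun_fubini_tonelli_F (m2 := m2) _ mf (fun z => f0 z.1 z.2)). Qed.

Lemma measurable_integral_fst (f : X -> Y -> \bar R) :
  measurable_fun setT (fun z : X * Y => f z.1 z.2) ->
  (forall x y, 0 <= f x y) ->
  measurable_fun setT (fun y => \int[m1]_x f x y).
Proof. by move=> mf f0; exact: (measurable_fun_fubini_tonelli_G (m1 := m1) _ mf (fun z => f0 z.1 z.2)). Qed.

End product_sigma_finite.

(** * Affine changes of variables on the line and on [R^n] *)

Section affine_lebesgue.
Variables (R : realType) (c b : R).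
Local Notation leb := (@lebesgue_measure R).

Definition affine (x : measurableTypeR R) : measurableTypeR R := c * x + b.

Lemma measurable_affine : measurable_fun setT affine.
Proof. by apply: measurable_funD => //; exact: measurable_funM. Qed.

Hypothesis c0 : 0 < c.

(** Both sides are measures that agree on half-open intervals, and Lebesgue measure is determined by
    its values there. *)
Lemma lebesgue_measure_affine (A : set R) : measurable A ->
  leb A = (c%:E * leb (affine @^-1` A))%E.
Proof.
pose k := NngNum (ltW c0).
pose m0 := pushforward leb affine : {measure set (measurableTypeR R) -> \bar R}.
pose m := mscale k (m0 measurable_affine) : {measure set _ -> \bar R}.
suff H X : ocitv X -> leb X = m X.
  by move=> mA; rewrite (lebesgue_measure_unique H).
move=> [[u v] /= _ <-]; rewrite /m /mscale/= /pushforward.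
have -> : affine @^-1` `]u, v]%classic = `](u - b) / c, (v - b) / c]%classic.
  apply/seteqP; split=> x; rewrite /affine /= !in_itv/=;
   by rewrite ltr_pdivrMr// ler_pdivlMr// ltrBlDr lerBrDr (mulrC x).
rewrite !lebesgue_measure_itv/= !lte_fin ltr_pM2r ?invr_gt0// ltrD2r.
case: ifPn => _; last by rewrite mule0.
rewrite -!EFinD -EFinM; congr EFin; field.
by rewrite gt_eqF.
Qed.

Lemma ge0_integral_affine (f : R -> \bar R) : measurable_fun setT f ->
  (forall x, 0 <= f x)%E ->
  (\int[leb]_x f x = c%:E * \int[leb]_x f (c * x + b)%R)%E.
Proof.
move=> mf f0; pose k := NngNum (ltW c0).
pose m0 := pushforward leb affine : {measure set (measurableTypeR R) -> \bar R}.
pose m := m0 measurable_affine.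
have H A : measurable A -> A `<=` setT -> leb A = mscale k m A.
  by move=> mA _; rewrite lebesgue_measure_affine.
rewrite (eq_measure_integral _ H) ge0_integral_mscale//=.
by rewrite (ge0_integral_pushforward measurable_affine).
Qed.

End affine_lebesgue.

Section rV_measurability.
Variables (R : realType) (N : nat) (d : measure_display) (X : measurableType d).
Local Notation E := 'rV[R]_N.

Lemma measurable_rVD (f g : X -> E) : measurable_fun setT f ->
  measurable_fun setT g -> measurable_fun setT (fun x => f x + g x).
Proof.
move=> mf mg; apply: measurable_fun_coordP => i.
under eq_fun do rewrite mxE.
by apply: measurable_funD; apply: (measurableT_comp (measurable_coord i)).
Qed.

Lemma measurable_rVZ (k : R) (f : X -> E) : measurable_fun setT f ->
  measurable_fun setT (fun x => k *: f x).
Proof.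
move=> mf; apply: measurable_fun_coordP => i.
under eq_fun do rewrite mxE.
by apply: measurable_funM => //; apply: (measurableT_comp (measurable_coord i)).
Qed.

Lemma measurable_rVB (f g : X -> E) : measurable_fun setT f ->
  measurable_fun setT g -> measurable_fun setT (fun x => f x - g x).
Proof.
move=> mf mg; apply: measurable_rVD => //.
by under eq_fun do rewrite -scaleN1r; exact: measurable_rVZ.
Qed.

Lemma measurable_enorm (f : X -> E) : measurable_fun setT f ->
  measurable_fun setT (fun x => enorm (f x)).
Proof.
move=> mf; rewrite /enorm /dotp.
apply: (measurableT_comp (continuous_measurable_fun (@sqrt_continuous R))).
apply: measurable_sum => i.
by apply: measurable_funM; apply: (measurableT_comp (measurable_coord i)).
Qed.

End rV_measurability.

Section lebesgue_rV_theory.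
Variable R : realType.
Local Notation leb := (@lebesgue_measure R).

Lemma ge0_integral_cons_rV n (f : 'rV[R]_n.+1 -> \bar R) :
  measurable_fun setT f -> (forall x, 0 <= f x)%E ->
  (\int[lebesgue_rV R n.+1]_x f x =
   \int[leb]_a \int[lebesgue_rV R n]_x f (cons_rV (a, x)))%E.
Proof.
move=> mf f0; have mc := @measurable_cons_rV R n.
pose m := pushforward (leb \x lebesgue_rV R n)%E (@cons_rV R n) : {measure set _ -> \bar R}.
transitivity (\int[m mc]_x f x)%E; first by apply: eq_measure_integral.
rewrite (ge0_integral_pushforward mc)//.
have mfc : measurable_fun setT (f \o @cons_rV R n).
  by apply: measurableT_comp => //; exact: mc.
rewrite preimage_setT.
exact: (fubini_tonelli1 (m1 := leb) (m2 := lebesgue_rV R n) _ mfc (fun z => f0 _)).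
Qed.

Lemma cons_rV_head n (z : R * 'rV[R]_n) : cons_rV z ord0 ord0 = z.1.
Proof.
have e : ord0 = lshift n ord0 :> 'I_(1 + n) by exact/val_inj.
by rewrite [LHS](congr1 (row_mx _ _ ord0) e) row_mxEl mxE eqxx mulr1n.
Qed.

Lemma cons_rV_tail n (z : R * 'rV[R]_n) j :
  cons_rV z ord0 (lift ord0 j) = z.2 ord0 j.
Proof.
have e : lift ord0 j = rshift 1 j :> 'I_(1 + n) by exact/val_inj.
by rewrite [LHS](congr1 (row_mx _ _ ord0) e) row_mxEr.
Qed.

Lemma cons_rV_affine n c (b : 'rV[R]_n.+1) a x :
  c *: cons_rV (a, x) + b =
  cons_rV (c * a + b ord0 ord0, c *: x + \row_(i < n) b ord0 (lift ord0 i)).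
Proof.
apply/rowP => i; rewrite 2!mxE.
by case: (unliftP ord0 i) => [j|] ->; rewrite ?cons_rV_head ?cons_rV_tail//= !mxE.
Qed.

(** Induction on the dimension, one factor [c] per coordinate. The case [c = 1] is translation
    invariance, on which the convolution estimates rest, and the case [b = 0] is the scaling used
    for the Hardy inequality. *)
Lemma ge0_integral_affine_rV n (c : R) (b : 'rV[R]_n) (f : 'rV[R]_n -> \bar R) :
  0 < c -> measurable_fun setT f -> (forall x, 0 <= f x)%E ->
  (\int[lebesgue_rV R n]_x f x =
   (c ^+ n)%:E * \int[lebesgue_rV R n]_x f (c *: x + b)%R)%E.
Proof.
move=> c0; elim: n b f => [|n ih] b f mf f0.
  rewrite expr0 mul1e; apply: eq_integral => x _; congr (f _).
  by apply/rowP => -[].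
have mfb : measurable_fun setT (fun x : 'rV[R]_n.+1 => f (c *: x + b)).
  apply: (measurableT_comp mf); apply: measurable_rVD => //.
  exact: measurable_rVZ.
have mcons (g : 'rV[R]_n.+1 -> \bar R) : measurable_fun setT g ->
    measurable_fun [set: measurableTypeR R * 'rV[R]_n]
      (fun z => g (cons_rV (z.1, z.2))).
  move=> mg; apply: measurableT_comp => //.
  rewrite (_ : (fun z => _) = @cons_rV R n); first exact: measurable_cons_rV.
  by apply/funext => -[].
rewrite !ge0_integral_cons_rV//.
rewrite (ge0_integral_affine (b ord0 ord0) c0); last 2 first.
- by apply: measurable_integral_snd => //; exact: mcons.
- by move=> x; exact: integral_ge0.
rewrite exprS EFinM -muleA; congr (_ * _)%E.
rewrite -ge0_integralZl//; last 3 first.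
- apply: measurable_integral_snd => //; exact: (mcons (fun x : 'rV[R]_n.+1 => f (c *: x + b))).
- by move=> x _; exact: integral_ge0.
- by rewrite lee_fin exprn_ge0// ltW.
apply: eq_integral => a _.
rewrite (ih (\row_(i < n) b ord0 (lift ord0 i))); last 2 first.
- apply: (measurableT_comp mf).
  apply: (measurableT_comp (@measurable_cons_rV R n)).
  apply/measurable_fun_pairP; split; first exact: measurable_cst.
  exact: measurable_id.
- by move=> x; exact: f0.
by congr (_ * _)%E; apply: eq_integral => x _; rewrite cons_rV_affine.
Qed.

End lebesgue_rV_theory.

Section rV_norm.
Variables (R : realType).

Lemma norm_rV_lt n (x : 'rV[R]_n) r : 0 < r ->
  (`|x| < r) <-> forall i, `|x ord0 i| < r.
Proof.
move=> r0; have -> : `|x| < r <-> ball (0 : 'rV[R]_n) r x.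
  by rewrite -ball_normE /ball_/= sub0r normrN.
split=> [[_ H] i|H]; first by have := H ord0 i; rewrite /ball/= mxE sub0r normrN.
by split => // i j; rewrite ord1 /ball/= mxE sub0r normrN.
Qed.

Lemma coord_le_norm n (x : 'rV[R]_n) i : `|x ord0 i| <= `|x|.
Proof.
apply/ler_addgt0Pr => e e0; apply/ltW; move: i; apply/norm_rV_lt.
  by rewrite ltr_wpDl.
by rewrite ltrDl.
Qed.

Lemma norm_le_enorm n (x : 'rV[R]_n) : `|x| <= enorm x.
Proof.
apply/ler_addgt0Pr => e e0; apply/ltW/norm_rV_lt.
  by rewrite ltr_wpDl// sqrtr_ge0.
move=> i; apply: le_lt_trans (_ : enorm x < _); last by rewrite ltrDl.
rewrite /enorm -sqrtr_sqr ler_wsqrtr// /dotp (bigD1 i)//= -expr2 lerDl.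
by apply: sumr_ge0 => j _; rewrite -expr2 sqr_ge0.
Qed.

Lemma enorm_le_norm n (x : 'rV[R]_n) : enorm x <= Num.sqrt n%:R * `|x|.
Proof.
rewrite /enorm -[X in _ * X]normr_id -sqrtr_sqr -sqrtrM ?ler0n//.
rewrite ler_wsqrtr// /dotp.
apply: le_trans (_ : \sum_(i < n) `|x| ^+ 2 <= _).
  apply: ler_sum => i _; rewrite -expr2 -real_normK ?num_real//.
  by rewrite ler_pXn2r ?nnegrE// coord_le_norm.
by rewrite sumr_const card_ord mulr_natl.
Qed.

Lemma measurable_norm_rV n d (X : measurableType d) (f : X -> 'rV[R]_n) :
  measurable_fun setT f -> measurable_fun setT (fun x => `|f x|).
Proof.
move=> mf; rewrite (_ : (fun x => _) =
  fun x => \big[Num.max/0]_ij `|f x ij.1 ij.2|); last first.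
  by apply/funext => x; rewrite -mx_normrE.
elim: (index_enum _) => [|ij s ih].
  rewrite [X in measurable_fun _ X](_ : _ = cst 0)//.
  by apply/funext => x; rewrite big_nil.
rewrite [X in measurable_fun _ X](_ : _ = fun x => Num.max `|f x ij.1 ij.2|
    (\big[Num.max/0]_(ij <- s) `|f x ij.1 ij.2|)); last first.
  by apply/funext => x; rewrite big_cons.
apply: measurable_maxr => //.
apply: measurableT_comp => //.
by rewrite ord1; apply: (measurableT_comp (measurable_coord _)).
Qed.

(** The sigma-algebra is generated by the coordinates, so an open set is written as the countable
    union of the cubes with rational centre and side governed by [k] that it contains. *)
Lemma open_measurable_rV n (A : set 'rV[R]_n) : open A -> measurable A.
Proof.
move=> oA.
pose B (q : 'rV[rat]_n) k : set 'rV[R]_n :=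
  [set x | forall i, `|ratr (q ord0 i) - x ord0 i| < k.+1%:R^-1].
have mB q k : measurable (B q k).
  have -> : B q k = \bigcap_(i in [set: 'I_n])
      [set x : 'rV[R]_n | `|ratr (q ord0 i) - x ord0 i| < k.+1%:R^-1].
    by apply/seteqP; split => [x H i _|x H i]; exact: H.
  apply: fin_bigcap_measurable => // i _.
  have -> : [set x : 'rV[R]_n | `|ratr (q ord0 i) - x ord0 i| < k.+1%:R^-1] =
      (fun x : 'rV[R]_n => x ord0 i) @^-1` ball (ratr (q ord0 i) : R) k.+1%:R^-1.
    by apply/seteqP; split => x; rewrite /= -ball_normE.
  rewrite -[X in measurable X]setTI; apply: measurable_coord => //.
  exact: measurable_ball.
have -> : A = \bigcup_(qk : 'rV[rat]_n * nat)
    if `[< B qk.1 qk.2 `<=` A >] then B qk.1 qk.2 else set0.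
  apply/seteqP; split => [x Ax|x [qk _]]; last first.
    by case: asboolP => // BA /BA.
  have /nbhs_ballP[e /= e0 xeA] := open_nbhs_nbhs (conj oA Ax).
  have [k ke] : exists k : nat, 2 * k.+1%:R^-1 < e.
    have [k _ ke] := near_infty_natSinv_lt (PosNum (divr_gt0 e0 (ltr0Sn R 1))).
    by exists k; rewrite mulrC -ltr_pdivlMr//; exact: ke (leqnn k).
  have k0 : 0 < k.+1%:R^-1 :> R by rewrite invr_gt0.
  have Q i : {q : rat | `|ratr q - x ord0 i| < k.+1%:R^-1}.
    apply: cid; have [|q] := @rat_in_itvoo R (x ord0 i - k.+1%:R^-1) (x ord0 i + k.+1%:R^-1).
      by rewrite ltrBlDr -addrA ltrDl addr_gt0.
    by rewrite in_itv/= => /andP[q1 q2]; exists q; rewrite ltr_distl q1 q2.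
  pose q : 'rV[rat]_n := \row_i sval (Q i).
  exists (q, k) => //=; case: asboolP => [_ i|].
    by rewrite mxE; exact: (svalP (Q i)).
  case=> y By; apply: xeA; rewrite -ball_normE/=; apply/norm_rV_lt => // i.
  rewrite !mxE -[_ - _](subrK (ratr (q ord0 i))) .
  have -> : x ord0 i - y ord0 i - ratr (q ord0 i) + ratr (q ord0 i) =
    (ratr (q ord0 i) - y ord0 i) - (ratr (q ord0 i) - x ord0 i) by ring.
  rewrite (le_lt_trans (ler_normB _ _))// (lt_trans _ ke)// mulr_natl mulr2n.
  by rewrite ltrD// mxE; exact: (svalP (Q i)).
apply: countable_bigcupT_measurable => [|qk]; first exact: countableP.
by case: ifPn.
Qed.

End rV_norm.

Section boxes.
Variables (R : realType).
Local Notation leb := (@lebesgue_measure R).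

Lemma measurable_box n (r : R) : measurable [set x : 'rV[R]_n | `|x| < r].
Proof.
apply: open_measurable_rV; apply: (@open_comp _ _ (fun x : 'rV[R]_n => `|x|) [set x | x < r]).
  by move=> ? _; exact: norm_continuous.
exact: open_lt.
Qed.

Lemma lebesgue_rV_box n (r : R) : 0 < r ->
  lebesgue_rV R n [set x | `|x| < r] = ((2 * r) ^+ n)%:E.
Proof.
move=> r0; elim: n => [|n ih].
  rewrite expr0 /= diracE mem_set//=; by apply/norm_rV_lt => // -[].
transitivity ((leb \x lebesgue_rV R n)%E (`]-r, r[%classic `*` [set x | `|x| < r])).
  congr ((leb \x lebesgue_rV R n)%E _); apply/seteqP; split => -[a x] /=.
    move=> /(norm_rV_lt _ r0) H; split.
      by have := H ord0; rewrite cons_rV_head/= ltr_norml in_itv.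
    by apply/norm_rV_lt => // i; have := H (lift ord0 i); rewrite cons_rV_tail.
  move=> [ar /(norm_rV_lt _ r0) H]; apply/norm_rV_lt => // i.
  case: (unliftP ord0 i) => [j|] ->; first by rewrite cons_rV_tail.
  by rewrite cons_rV_head/= ltr_norml; move: ar; rewrite in_itv.
rewrite product_measure1E//; last exact: measurable_box.
rewrite ih [X in (X * _)%E](lebesgue_measure_itv `](- r), r[)/= lte_fin gtrN//.
by rewrite opprK -EFinD -EFinM exprS mulr_natl mulr2n.
Qed.

Lemma lebesgue_rV_bounded n (A : set 'rV[R]_n) : measurable A ->
  bounded_set A -> (lebesgue_rV R n A < +oo)%E.
Proof.
move=> mA [M [_ /(_ (`|M| + 1))]]; rewrite (le_lt_trans (ler_norm M)) ?ltrDl//.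
move=> /(_ isT) AM; have r0 : 0 < `|M| + 2 by rewrite ltr_wpDl.
apply: (@le_lt_trans _ _ (lebesgue_rV R n [set x | `|x| < `|M| + 2])).
  rewrite le_measure ?inE//; first exact: measurable_box.
  by move=> x /AM/= xM; rewrite (le_lt_trans xM)// ltrD2l ltr1n.
by rewrite lebesgue_rV_box// ltry.
Qed.

Lemma lebesgue_rV_set0 n : (0 < n)%N ->
  measurable [set (0 : 'rV[R]_n)] /\ lebesgue_rV R n [set 0] = 0%E.
Proof.
move=> n0.
have E : [set (0 : 'rV[R]_n)] = \bigcap_k [set x | `|x| < k.+1%:R^-1].
  apply/seteqP; split => [_ -> k _ /=|x H /=]; first by rewrite normr0 invr_gt0.
  apply/eqP; rewrite -normr_le0; apply/ler_addgt0Pr => e e0; rewrite add0r.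
  have [k _ ke] := near_infty_natSinv_lt (PosNum e0).
  exact: ltW (lt_trans (H k I) (ke k (leqnn k))).
have m0 : measurable [set (0 : 'rV[R]_n)].
  by rewrite E; apply: bigcapT_measurable => k; exact: measurable_box.
split => //; apply/eqP; rewrite eq_le measure_ge0 andbT.
apply/lee_addgt0Pr => e e0; rewrite add0e.
(* With this radius [2 r <= 1], so the volume [(2 r)^n] is at most [2 r <= e] in every dimension
   [n > 0]. *)
pose r := Num.min e 1 / 2; have r0 : 0 < r by rewrite divr_gt0// lt_min e0/=.
apply: (@le_trans _ _ (lebesgue_rV R n [set x | `|x| < r])).
  rewrite le_measure ?inE//; first exact: measurable_box.
  by move=> _ ->; rewrite /= normr0.
rewrite lebesgue_rV_box// lee_fin mulrC divfK//.
case: n n0 {E m0} => // n _; rewrite exprS (@le_trans _ _ (Num.min e 1))//.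
  have m0 : 0 <= Num.min e 1 by rewrite le_min (ltW e0) ler01.
  by rewrite ler_piMr// exprn_ile1// ge_min lexx orbT.
by rewrite ge_min lexx.
Qed.

End boxes.

(** * Pointwise inequalities *)

Section powR_inequalities.
Variable R : realType.
Implicit Types a b f g h p q r t u w x y A B C M : R.

(** Young's inequality for [b] and [a^(p-1)] with exponents [p] and [p/(p-1)], cleared of
    denominators. Read as a lower bound on [b^p], it is the tangent line of [r^p] at [a]. *)
Lemma young_powR p a b : 1 < p -> 0 <= a -> 0 <= b ->
  p * (a `^ (p - 1) * b) <= (p - 1) * a `^ p + b `^ p.
Proof.
move=> p1 a0 b0; have p0 : 0 < p by lra.
have q0 : 0 < p / (p - 1) by rewrite divr_gt0// subr_gt0.
have p10 : p - 1 != 0 by rewrite subr_eq0 gt_eqF.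
have pq : p^-1 + (p / (p - 1))^-1 = 1 by rewrite invf_div; field; rewrite gt_eqF.
have := @conjugate_powR R b (a `^ (p - 1)) p (p / (p - 1)) b0 (powR_ge0 _ _) p0 q0 pq.
rewrite invf_div -powRrM [(p - 1) * _]mulrC divfK// => H.
have E : p * (b `^ p / p + a `^ p * ((p - 1) / p)) = (p - 1) * a `^ p + b `^ p.
  by field; rewrite gt_eqF.
by have := ler_wpM2l (ltW p0) H; rewrite E [b * _]mulrC.
Qed.

Lemma powR_succ x q : 0 <= x -> 0 < q -> x * x `^ (q - 1) = x `^ q.
Proof. exact: mulr_powRB1. Qed.

Lemma powR_succN x q : 0 < x -> x * x `^ (q - 1) = x `^ q.
Proof.
move=> x0; rewrite -{1}(powRr1 (ltW x0)) -powRD ?(gt_eqF x0) ?implybT//.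
by congr (_ `^ _); ring.
Qed.

(** Convexity of a nonpositive power. After division by [A^r], with [x = B/A], it reads
    [1 + r (x - 1) <= exp (r ln x)], which follows from [ln x <= x - 1] and [1 + y <= exp y]. *)
Lemma powR_tangentN r A B : r <= 0 -> 0 < A -> 0 < B ->
  A `^ r + r * A `^ (r - 1) * (B - A) <= B `^ r.
Proof.
move=> r0 A0 B0; have -> : B = A * (B / A) by field; rewrite gt_eqF.
set x := B / A; have x0 : 0 < x by rewrite divr_gt0.
rewrite powRM ?(ltW A0) ?(ltW x0)// -(powR_succN r A0).
have -> : A * A `^ (r - 1) + r * A `^ (r - 1) * (A * x - A) =
  A * A `^ (r - 1) * (1 + r * (x - 1)) by ring.
rewrite ler_wpM2l ?mulr_ge0 ?powR_ge0 ?(ltW A0)//.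
rewrite /powR gt_eqF// (le_trans _ (expR_ge1Dx _))// lerD2l ler_wnM2l//.
by have := @le_ln1Dx R (x - 1); rewrite [1 + _]addrC subrK; apply; lra.
Qed.

Lemma powR_mono q x y : 0 <= q -> 0 <= x -> x <= y -> x `^ q <= y `^ q.
Proof.
by move=> q0 x0 xy; apply: ge0_ler_powR; rewrite ?nnegrE ?(le_trans x0 xy).
Qed.

Lemma powRD_le q x y : 0 <= q -> 0 <= x -> 0 <= y ->
  (x + y) `^ q <= 2 `^ q * (x `^ q + y `^ q).
Proof.
move=> q0 x0 y0; pose m := Num.max x y.
have m0 : 0 <= m by rewrite le_max x0.
apply: (@le_trans _ _ ((2 * m) `^ q)).
  apply: powR_mono => //; first exact: addr_ge0.
  by rewrite mulr_natl mulr2n lerD// le_max lexx ?orbT.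
rewrite powRM// ler_wpM2l ?powR_ge0// /m.
by case: (leP x y) => _; rewrite ?lerDr ?lerDl powR_ge0.
Qed.

Lemma powRB_le q x y : 0 <= q -> `|x - y| `^ q <= 2 `^ q * (`|x| `^ q + `|y| `^ q).
Proof.
move=> q0; apply: le_trans (powRD_le q0 (normr_ge0 _) (normr_ge0 _)).
by apply: powR_mono => //; exact: ler_normB.
Qed.

Lemma powR_superadd q x y : 1 <= q -> 0 <= x -> 0 <= y ->
  x `^ q + y `^ q <= (x + y) `^ q.
Proof.
move=> q1 x0 y0; have q0 : 0 < q by lra.
rewrite -(powR_succ x0 q0) -(powR_succ y0 q0) -(powR_succ (addr_ge0 x0 y0) q0).
have q10 : 0 <= q - 1 by lra.
by rewrite mulrDl lerD// ler_wpM2l// powR_mono// ?lerDl ?lerDr.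
Qed.

(** The function [x^p B^(1-p)] of the pair [(x, B)] is the perspective of [x^p]: convex and
    homogeneous of degree one, hence subadditive. The proof sums Young's inequality at the common
    slope [m] with weights [B] and [C]. *)
Lemma powR_jensen2 p x y B C : 1 < p -> 0 <= x -> 0 <= y -> 0 < B -> 0 < C ->
  (x + y) `^ p * (B + C) `^ (1 - p) <= x `^ p * B `^ (1 - p) + y `^ p * C `^ (1 - p).
Proof.
move=> p1 x0 y0 B0 C0; have BC0 : 0 < B + C by rewrite addr_gt0.
have E z D : 0 <= z -> 0 < D -> z `^ p * D `^ (1 - p) = D * (z / D) `^ p.
  move=> z0 D0; rewrite powRM ?invr_ge0 ?(ltW D0)//.
  rewrite mulrCA; congr (_ * _); rewrite -(powR_succN (1 - p) D0); congr (_ * _).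
  by rewrite -(powR_inv1 (ltW D0)) -powRrM; congr (_ `^ _); ring.
rewrite !E ?addr_ge0//; set m := (x + y) / (B + C).
have m0 : 0 <= m by rewrite divr_ge0 ?(ltW BC0)// addr_ge0.
have H1 := young_powR p1 m0 (divr_ge0 x0 (ltW B0)).
have H2 := young_powR p1 m0 (divr_ge0 y0 (ltW C0)).
have H3 := ler_wpM2l (ltW B0) H1; have H4 := ler_wpM2l (ltW C0) H2.
have pm : m * m `^ (p - 1) = m `^ p by rewrite powR_succ//; lra.
have F1 : B * (p * (m `^ (p - 1) * (x / B))) + C * (p * (m `^ (p - 1) * (y / C))) =
  p * ((B + C) * m `^ p).
  rewrite -pm /m; field; rewrite !gt_eqF//.
nra.
Qed.

Lemma norm_jump p a : 1 < p -> `|jump p a| = `|a| `^ (p - 1).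
Proof.
move=> p1; rewrite /jump normrM ger0_norm ?powR_ge0// mulrC.
by rewrite -[RHS]powR_succ//; [congr (_ * _ `^ _); ring|lra].
Qed.

Lemma jumpN p a : jump p (- a) = - jump p a.
Proof. by rewrite /jump normrN mulrN. Qed.

Lemma jump0 p : jump p 0 = 0.
Proof. by rewrite /jump mulr0. Qed.

Lemma ge0_jump p a : 1 < p -> 0 <= a -> jump p a = a `^ (p - 1).
Proof.
move=> p1 a0; rewrite /jump ger0_norm// mulrC -[RHS]powR_succ//; last lra.
by congr (_ * _ `^ _); ring.
Qed.

(** The derivative of [|.|^p] at [a] is [p * jump p a]; this is its tangent-line inequality, valid
    for both signs. *)
Lemma jump_tangent p a b : 1 < p ->
  `|a| `^ p + p * (jump p a * (b - a)) <= `|b| `^ p.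
Proof.
move=> p1; have p0 : 0 < p by lra.
have H := young_powR p1 (normr_ge0 a) (normr_ge0 b).
have E : jump p a * a = `|a| `^ p.
  rewrite -(powR_succ (normr_ge0 a) p0) /jump -mulrA -expr2 -real_normK ?num_real//.
  rewrite -[in RHS](@powR_succ `|a| (p - 1))//; last lra.
  have -> : p - 1 - 1 = p - 2 by ring.
  by ring.
have H2 : jump p a * b <= `|a| `^ (p - 1) * `|b|.
  by rewrite -norm_jump// -normrM ler_norm.
rewrite mulrBr E; have := ler_wpM2l (ltW p0) H2; lra.
Qed.

(** A crude Young inequality that serves twice: it makes the nonlocal form integrable, and it makes
    [young_gap] nonnegative. *)
Lemma jumpM_le p a b : 1 < p -> `|jump p a * b| <= `|a| `^ p + `|b| `^ p.
Proof.
move=> p1; rewrite normrM norm_jump//.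
have := young_powR p1 (normr_ge0 a) (normr_ge0 b).
have := mulr_ge0 (powR_ge0 `|a| (p - 1)) (normr_ge0 b).
have := powR_ge0 `|a| p; have := powR_ge0 `|b| p; nra.
Qed.

(** Discrete Picone inequality. By symmetry [B < A]; with [C = A - B] and [f <= g + |f - g|],
    subadditivity gives [f^p A^(1-p) <= g^p B^(1-p) + |f - g|^p C^(1-p)], and multiplication by
    [C^(p-1)] concludes. *)
Lemma picone p A B f g : 1 < p -> 0 < A -> 0 < B -> 0 <= f -> 0 <= g ->
  jump p (A - B) * (f `^ p * A `^ (1 - p) - g `^ p * B `^ (1 - p)) <= `|f - g| `^ p.
Proof.
move=> p1.
wlog BA : A B f g / B <= A => [H A0 B0 f0 g0|].
  have [BA|/ltW AB] := leP B A; first exact: H.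
  rewrite -[A - B]opprB jumpN mulNr -mulrN opprB distrC.
  exact: H.
move=> A0 B0 f0 g0; move: BA; rewrite le_eqVlt => /predU1P[->|BA].
  by rewrite subrr jump0 mul0r powR_ge0.
have C0 : 0 < A - B by rewrite subr_gt0.
have := powR_jensen2 p1 g0 (normr_ge0 (f - g)) B0 C0.
rewrite [B + _]addrC subrK => H.
have fg : f `^ p * A `^ (1 - p) <= (g + `|f - g|) `^ p * A `^ (1 - p).
  rewrite ler_wpM2r ?powR_ge0// powR_mono//; first lra.
  by have := ler_norm (f - g); lra.
rewrite ge0_jump ?(ltW C0)//.
have E : (A - B) `^ (p - 1) * (A - B) `^ (1 - p) = 1.
  rewrite -powRD ?(gt_eqF C0) ?implybT// (_ : p - 1 + (1 - p) = 0); last by ring.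
  exact: powRr0.
have -> : `|f - g| `^ p = (A - B) `^ (p - 1) * (`|f - g| `^ p * (A - B) `^ (1 - p)).
  by rewrite mulrCA E mulr1.
by rewrite ler_wpM2l ?powR_ge0//; lra.
Qed.

(** The negative term is the origin of the surplus: [y] will be the value of [W + e] at a point away
    from [0]. For [y <= x] the power [p - 1] is superadditive; for [x < y] one has [y^(p-1) <=
    2^(p-1) (x^(p-1) + (y - x)^(p-1))]. *)
Lemma jumpB_le p x y : 2 < p -> 0 <= x -> 0 <= y ->
  jump p (x - y) <= x `^ (p - 1) - 2 `^ (1 - p) * y `^ (p - 1).
Proof.
move=> p2 x0 y0; have p1 : 1 < p by lra.
have c1 : 2 `^ (1 - p) <= 1 :> R.
  rewrite -[X in _ <= X](powRr0 2) ler_powR ?ler1n//; lra.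
have [yx|/ltW xy] := leP y x.
  rewrite ge0_jump// ?subr_ge0//.
  have q1 : 1 <= p - 1 by lra.
  have := @powR_superadd (p - 1) (x - y) y q1; rewrite subr_ge0 subrK => /(_ yx y0).
  have := powR_ge0 y (p - 1); nra.
rewrite -opprB jumpN ge0_jump// ?subr_ge0//.
have q0 : 0 <= p - 1 by lra.
have := @powRD_le (p - 1) x (y - x) q0; rewrite subr_ge0 [x + _]addrC subrK.
move=> /(_ x0 xy)/(ler_wpM2l (powR_ge0 2 (1 - p))); rewrite mulrA -powRD; last by rewrite pnatr_eq0 implybT.
rewrite (_ : 1 - p + (p - 1) = 0); last by ring.
by rewrite powRr0 mul1r; lra.
Qed.

Lemma powR_bernoulli q x : 1 < q -> 0 <= x -> 1 + q * (x - 1) <= x `^ q.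
Proof.
by move=> q1 x0; have := young_powR q1 ler01 x0; rewrite !powR1; lra.
Qed.

Lemma powR_inv_le p r : 2 <= p -> 0 < r -> r^-1 <= r `^ (1 - p) + 1.
Proof.
move=> p2 r0; have [r1|/ltW r1] := leP r 1.
  rewrite -powR_inv1 ?(ltW r0)// (@le_trans _ _ (r `^ (1 - p)))//; last first.
    by rewrite lerDl.
  by apply: ger_powR; [rewrite r0|lra].
by rewrite (@le_trans _ _ 1)// ?invf_le1// lerDr powR_ge0.
Qed.

(** The loss in replacing [w / (w + e)] by [1]. Bernoulli bounds it by [(p - 1) e / (w + e)], and
    [1/r <= r^(1-p) + 1] splits it into a part proportional to the test weight and a constant, both
    small with [e]. *)
Lemma powR_ratio_ge p w e : 2 < p -> 0 <= w -> 0 < e ->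
  1 - (p - 1) * e * ((w + e) `^ (1 - p) + 1) <= w `^ (p - 1) * (w + e) `^ (1 - p).
Proof.
move=> p2 w0 e0; have r0 : 0 < w + e by lra.
have -> : w `^ (p - 1) * (w + e) `^ (1 - p) = (w / (w + e)) `^ (p - 1).
  rewrite powRM ?invr_ge0 ?(ltW r0)// -(powR_inv1 (ltW r0)) -powRrM mulN1r opprB//.
have q1 : 1 < p - 1 by lra.
have := powR_bernoulli q1 (divr_ge0 w0 (ltW r0)).
have -> : w / (w + e) - 1 = - (e * (w + e)^-1) by field; rewrite gt_eqF.
have pe : 0 <= (p - 1) * e by apply: mulr_ge0; lra.
have := ler_wpM2l pe (powR_inv_le (ltW p2) r0); lra.
Qed.

(** Here [q] is the tent and [q^m] the cutoff. If [r <= th * q], the term with [r^(1-p)] dominates.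
    Otherwise [r^(2-p) <= (th * q)^(2-p)], and what remains is [q] to the power [m + 1 - p], bounded
    because this exponent is nonnegative. *)
Lemma young_time p (k T : R) m : 2 < p -> p <= m.+1%:R -> (1 < m)%N -> 0 < k -> 0 <= T ->
  exists2 C, 0 <= C & forall q r, 0 <= q <= T -> 0 < r ->
    m%:R * q ^+ m.-1 * ((p - 2)^-1 * r `^ (2 - p)) <= k * q ^+ m * r `^ (1 - p) + C.
Proof.
case: m => // m p2 pm m1 k0 T0; have m0 : 0 < m.+1%:R :> R by rewrite ltr0n.
have p20 : 0 < p - 2 by lra.
(* The threshold at which the two sides agree when [r = th * q] and [C] is dropped. *)
pose th := k * (p - 2) / m.+1%:R; have th0 : 0 < th by rewrite divr_gt0// mulr_gt0.
pose C := m.+1%:R * (p - 2)^-1 * th `^ (2 - p) * T `^ (m.+2%:R - p).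
have C0 : 0 <= C by rewrite !mulr_ge0 ?powR_ge0 ?invr_ge0 ?(ltW p20).
exists C => // q r /andP[q0 qT] r0 /=.
have q1 : 0 <= q ^+ m by rewrite exprn_ge0.
have [rq|qr] := leP r (th * q).
  apply: (@le_trans _ _ (k * q ^+ m.+1 * r `^ (1 - p))); last by rewrite lerDl.
  have -> : r `^ (2 - p) = r * r `^ (1 - p).
    by rewrite -(powR_succN (2 - p) r0); congr (_ * _ `^ _); ring.
  have -> : k * q ^+ m.+1 * r `^ (1 - p) =
      m.+1%:R * q ^+ m * ((p - 2)^-1 * (th * q * r `^ (1 - p))).
    transitivity (th * m.+1%:R / (p - 2) * (q * q ^+ m * r `^ (1 - p))); last by ring.
    have -> : th * m.+1%:R = k * (p - 2) by rewrite /th divfK// gt_eqF.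
    by rewrite mulfK ?(gt_eqF p20)// exprS; ring.
  rewrite ler_wpM2l ?mulr_ge0// ler_wpM2l ?invr_ge0 ?(ltW p20)//.
  by rewrite ler_wpM2r ?powR_ge0.
apply: (@le_trans _ _ C); last by rewrite lerDr !mulr_ge0 ?powR_ge0 ?exprn_ge0// ltW.
move: q0; rewrite le_eqVlt => /predU1P[<-|q0].
  (* At [q = 0] the left side vanishes only because the exponent of [q] is still positive, which is
     [1 < m] in the statement. *)
  by rewrite expr0n; case: (m) m1 => //= m' _; rewrite mulr0 mul0r.
have H : r `^ (2 - p) <= (th * q) `^ (2 - p).
  rewrite -[2 - p]opprB !powRN lef_pV2 ?posrE ?powR_gt0// ?mulr_gt0//.
  by rewrite powR_mono ?(ltW p20) ?(ltW qr)// mulr_ge0 ?(ltW th0) ?(ltW q0).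
apply: (@le_trans _ _ (m.+1%:R * q ^+ m * ((p - 2)^-1 * (th * q) `^ (2 - p)))).
  by rewrite ler_wpM2l ?mulr_ge0// ler_wpM2l ?invr_ge0 ?(ltW p20).
rewrite powRM ?(ltW th0) ?(ltW q0)// /C.
have -> : m.+1%:R * q ^+ m * ((p - 2)^-1 * (th `^ (2 - p) * q `^ (2 - p))) =
  m.+1%:R * (p - 2)^-1 * th `^ (2 - p) * (q ^+ m * q `^ (2 - p)) by ring.
rewrite ler_wpM2l ?mulr_ge0 ?powR_ge0 ?invr_ge0 ?(ltW p20)//.
rewrite -powR_mulrn ?(ltW q0)// -powRD ?(gt_eqF q0) ?implybT//.
have -> : m%:R + (2 - p) = m.+2%:R - p by rewrite -!natr1; ring.
by rewrite powR_mono ?(ltW q0)// subr_ge0.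
Qed.

(** A linear minorant of [w^(p-1)]: it turns a lower bound on the integral of [w] into one on the
    integral of [w^(p-1)]. *)
Lemma powR_lin_ge p t w : 2 < p -> 0 <= t -> 0 <= w ->
  t `^ (p - 2) * (w - t) <= w `^ (p - 1).
Proof.
move=> p2 t0 w0; have [wt|/ltW tw] := leP w t.
  by rewrite (@le_trans _ _ 0) ?powR_ge0// mulr_ge0_le0 ?powR_ge0// subr_le0.
apply: (@le_trans _ _ (w `^ (p - 2) * w)); last first.
  rewrite mulrC -(@powR_succ w (p - 1))//; last lra.
  by rewrite le_eqVlt; apply/orP; left; apply/eqP; congr (_ * _ `^ _); ring.
rewrite ler_pM ?powR_ge0 ?subr_ge0 ?lerBlDr ?lerDl//.
by apply: powR_mono => //; lra.
Qed.

(** Stands in for differentiability of the time cutoff: a one-sided first-order expansion, uniform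
    on [[0, A]], whose quadratic error disappears after division by the time step. *)
Lemma exprD_quad (m : nat) (A : R) : 0 <= A ->
  exists2 C, 0 <= C & forall a h, 0 <= a <= A -> 0 <= h <= 1 ->
    (a + h) ^+ m <= a ^+ m + m%:R * h * a ^+ m.-1 + C * h ^+ 2.
Proof.
move=> A0; elim: m => [|m [C C0 ih]].
  by exists 0 => // a h _ _; rewrite !expr0 mul0r mul0r addr0 mul0r addr0.
exists (C * (A + 1) + m%:R * A ^+ m.-1); first by rewrite addr_ge0 ?mulr_ge0 ?addr_ge0 ?exprn_ge0.
move=> a h /andP[a0 aA] /andP[h0 h1].
have := ih a h; rewrite a0 aA h0 h1 => /(_ isT isT) {}ih.
rewrite exprS; apply: le_trans (ler_wpM2l (addr_ge0 a0 h0) ih) _.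
have E : m%:R * a * a ^+ m.-1 = m%:R * a ^+ m.
  by case: (m) => [|k]; rewrite ?mul0r//= exprS mulrA.
have F : m%:R * a ^+ m.-1 <= m%:R * A ^+ m.-1.
  by rewrite ler_wpM2l// lerXn2r ?nnegrE.
have G : C * (a + h) <= C * (A + 1) by rewrite ler_wpM2l// lerD.
have -> : (a + h) * (a ^+ m + m%:R * h * a ^+ m.-1 + C * h ^+ 2) =
  a ^+ m.+1 + h * a ^+ m + h * (m%:R * a * a ^+ m.-1) +
  (m%:R * a ^+ m.-1 + C * (a + h)) * h ^+ 2.
  by rewrite [a ^+ m.+1]exprS; ring.
rewrite E /= -natr1; have := ler_wpM2r (sqr_ge0 h) (lerD F G); lra.
Qed.

Lemma powR_sub_le p M f g : 1 < p -> 0 <= f <= M -> 0 <= g <= M ->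
  `|f `^ p - g `^ p| <= p * M `^ (p - 1) * `|f - g|.
Proof.
move=> p1; wlog gf : f g / g <= f => [H fM gM|].
  have [gf|/ltW fg] := leP g f; first exact: H.
  by rewrite distrC [`|f - g|]distrC; exact: H.
move=> /andP[f0 fM] /andP[g0 gM]; have p0 : 0 < p by lra.
rewrite ger0_norm; last first.
  by rewrite subr_ge0 powR_mono ?(ltW p0).
rewrite ger0_norm ?subr_ge0//.
have := young_powR p1 f0 g0; have := powR_succ f0 p0.
have : f `^ (p - 1) <= M `^ (p - 1).
  by apply: powR_mono => //; lra.
set F := f `^ (p - 1); set G := M `^ (p - 1) => FG E Y.
have : F * (f - g) <= G * (f - g) by rewrite ler_wpM2r ?subr_ge0.
rewrite -mulrA -(ler_pM2l p0); nra.
Qed.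

Lemma powRN_sub_le p e A B : 1 < p -> 0 < e -> e <= A -> e <= B ->
  `|A `^ (1 - p) - B `^ (1 - p)| <= (p - 1) * e `^ (- p) * `|A - B|.
Proof.
move=> p1 e0; wlog AB : A B / A <= B => [H eA eB|].
  have [AB|/ltW BA] := leP A B; first exact: H.
  by rewrite distrC [`|A - B|]distrC; exact: H.
move=> eA eB; have A0 : 0 < A by lra.
have B0 : 0 < B by lra.
have N x : x `^ (1 - p) = (x `^ (p - 1))^-1 by rewrite -powRN opprB.
rewrite ger0_norm; last first.
  rewrite subr_ge0 !N lef_pV2 ?posrE ?powR_gt0//.
  by apply: powR_mono => //; lra.
rewrite distrC ger0_norm ?subr_ge0//.
have q0 : 1 - p <= 0 by lra.
have := @powR_tangentN (1 - p) A B q0 A0 B0.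
have -> : 1 - p - 1 = - p by ring.
have : A `^ (- p) <= e `^ (- p).
  rewrite !powRN lef_pV2 ?posrE ?powR_gt0//.
  by apply: powR_mono => //; lra.
set F := A `^ (- p); set G := e `^ (- p) => FG Y.
have : (p - 1) * (F * (B - A)) <= (p - 1) * (G * (B - A)).
  by rewrite ler_wpM2l ?ler_wpM2r ?subr_ge0// ltW.
nra.
Qed.

(** The map [(f, A) |-> f^p A^(1-p)] is Lipschitz where [f] is bounded and [A >= e]. Hence the test
    function has finite energy as soon as [phi] and [W] do; the constant degenerates with [e], but
    only finiteness is drawn from it. *)
Lemma test_sub_le p M e : 1 < p -> 0 < e -> exists2 C, 0 <= C &
  forall f g A B, 0 <= f <= M -> 0 <= g <= M -> e <= A -> e <= B ->
  `|f `^ p * A `^ (1 - p) - g `^ p * B `^ (1 - p)| `^ p <=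
  C * (`|f - g| `^ p + `|A - B| `^ p).
Proof.
move=> p1 e0.
pose a := p * M `^ (p - 1) * e `^ (1 - p).
pose b := M `^ p * ((p - 1) * e `^ (- p)).
have a0 : 0 <= a by rewrite !mulr_ge0 ?powR_ge0//; lra.
have b0 : 0 <= b by rewrite !mulr_ge0 ?powR_ge0//; lra.
have p0 : 0 <= p by lra.
exists (2 `^ p * (a `^ p + b `^ p)); first by rewrite mulr_ge0 ?addr_ge0 ?powR_ge0.
move=> f g A B fM gM eA eB.
have H : `|f `^ p * A `^ (1 - p) - g `^ p * B `^ (1 - p)| <= a * `|f - g| + b * `|A - B|.
  have -> : f `^ p * A `^ (1 - p) - g `^ p * B `^ (1 - p) =
    (f `^ p - g `^ p) * A `^ (1 - p) + g `^ p * (A `^ (1 - p) - B `^ (1 - p)) by ring.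
  rewrite (le_trans (ler_normD _ _))// !normrM lerD//.
    rewrite /a mulrAC ler_pM ?powR_sub_le// ger0_norm ?powR_ge0//.
    have N x : x `^ (1 - p) = (x `^ (p - 1))^-1 by rewrite -powRN opprB.
    rewrite !N lef_pV2 ?posrE ?powR_gt0//; last by lra.
    by apply: powR_mono => //; lra.
  rewrite /b -mulrA ler_pM ?powRN_sub_le// ger0_norm ?powR_ge0//.
  by case/andP : gM => g0 gM; apply: powR_mono.
move: a b a0 b0 H => a b a0 b0 H.
apply: (@le_trans _ _ ((a * `|f - g| + b * `|A - B|) `^ p)).
  by apply: powR_mono.
apply: le_trans (powRD_le p0 _ _) _; rewrite ?mulr_ge0//.
rewrite -mulrA ler_wpM2l ?powR_ge0// !powRM//.
have := powR_ge0 `|f - g| p; have := powR_ge0 `|A - B| p.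
have := powR_ge0 a p; have := powR_ge0 b p; nra.
Qed.

End powR_inequalities.

(** * Smooth mollifiers *)

Section quadratic_approximation.
Variables (R : realType) (V : normedModType R).
Implicit Types (f g : V -> R) (D : V -> V -> R).

(* [D v x] is the derivative of [f] at [x] along [v]. *)
Definition quad_approx f D : Prop :=
  (forall a u v x, D (a *: u + v) x = a * D u x + D v x) /\
  exists2 C : R, 0 <= C & forall x h,
    [/\ `|D h x| <= C * `|h|, `|f (x + h) - f x| <= C * `|h| &
        `|f (x + h) - f x - D h x| <= C * `|h| ^+ 2].

Lemma quad_approx_diff f D x : quad_approx f D ->
  differentiable f x /\ forall v, 'D_v f x = D v x.
Proof.
move=> [lD [C C0 H]].
have L_lin : linear (D ^~ x : V -> R^o) by move=> a u v; rewrite lD.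
pose LM := GRing.isLinear.Build _ _ _ _ _ L_lin.
pose L : {linear V -> R^o} := HB.pack (D ^~ x : V -> R^o) LM.
have cL : continuous (L : V -> R^o).
  apply/linear_bounded_continuous/linear_boundedP.
  near=> r => v /=; have [bD _ _] := H x v.
  by rewrite (le_trans bD)// ler_wpM2r.
have eL : (f : V -> R^o) \o shift x = cst (f x) + L +o_ 0 id.
  apply/eqaddoP => _/posnumP[e]; near=> h.
  have [_ _ qD] := H x h.
  rewrite [X in `|X|](_ : _ = f (x + h) - f x - D h x); last first.
    by rewrite [x + h]addrC -addrA -opprD.
  rewrite (le_trans qD)// expr2 mulrA ler_wpM2r//.
  have hC : `|h| <= e%:num / (C + 1).
    near: h; apply/nbhs0P; near=> h; rewrite add0r; apply/ltW; near: h.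
    by apply: nbhs0_lt; rewrite divr_gt0// ltr_wpDl.
  rewrite (@le_trans _ _ (C * (e%:num / (C + 1))))//; first by rewrite ler_wpM2l.
  by rewrite mulrCA ler_piMr// ler_pdivrMr ?ltr_wpDl// mul1r lerDl.
have dL := diff_unique cL eL.
have df : differentiable (f : V -> R^o) x.
  by apply/diff_locallyP; rewrite dL.
by split => // v; rewrite deriveE// dL.
Unshelve. all: by end_near. Qed.

Definition bounded_by f : Prop := exists2 C : R, 0 <= C & forall x, `|f x| <= C.

(** A quantitative form of [C^k] with bounded derivatives. The bounds are global and the Taylor
    error is uniform in the point, so that the class passes to convolutions by integrating the
    estimates. *)
Fixpoint smoothn (k : nat) f : Prop :=
  bounded_by f /\
  if k is k'.+1 then
    exists D, quad_approx f D /\ forall v, smoothn k' (D v)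
  else True.

Lemma smoothn_bounded k f : smoothn k f -> bounded_by f.
Proof. by case: k => [|k] []. Qed.

Lemma smoothnS k f : smoothn k.+1 f ->
  exists D, quad_approx f D /\ forall v, smoothn k (D v).
Proof. by case. Qed.

Lemma smoothnW k f : smoothn k.+1 f -> smoothn k f.
Proof.
elim: k f => [|k ih] f; first by case.
move=> [bf [D [qD sD]]]; split => //; exists D; split => // v.
exact: ih.
Qed.

Lemma smoothn_cst k c : smoothn k (cst c).
Proof.
elim: k c => [|k ih] c; split => //; try by exists `|c|.
exists (fun _ _ => 0); split => [|v]; last exact: ih.
split => [a u v x|]; first by rewrite mulr0 addr0.
by exists 0 => // x h; rewrite !mul0r subrr subr0 normr0.
Qed.

Lemma smoothnD k f g : smoothn k f -> smoothn k g -> smoothn k (f \+ g).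
Proof.
move=> sf sg; have bfg : bounded_by (f \+ g).
  have [A A0 Af] := smoothn_bounded sf; have [B B0 Bg] := smoothn_bounded sg.
  exists (A + B); first exact: addr_ge0.
  by move=> x; rewrite (le_trans (ler_normD _ _))// lerD.
elim: k f g sf sg bfg => [//|k ih] f g sf sg bfg; split=> //.
have [D [[lD [C C0 HD]] sD]] := smoothnS sf.
have [D' [[lD' [C' C'0 HD']] sD']] := smoothnS sg.
exists (fun v x => D v x + D' v x); split; last first.
  move=> v; apply: ih (sD v) (sD' v) _.
  have [A A0 Af] := smoothn_bounded (sD v); have [B B0 Bg] := smoothn_bounded (sD' v).
  exists (A + B); first exact: addr_ge0.
  by move=> x; rewrite (le_trans (ler_normD _ _))// lerD.
split=> [a u v x|]; first by rewrite lD lD'; ring.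
exists (C + C'); first exact: addr_ge0.
move=> x h; have [a1 a2 a3] := HD x h; have [b1 b2 b3] := HD' x h.
rewrite !mulrDl; split.
- by rewrite (le_trans (ler_normD _ _))// lerD.
- by rewrite /= opprD addrACA (le_trans (ler_normD _ _))// lerD.
- rewrite [X in `|X|](_ : _ = (f (x + h) - f x - D h x) +
    (g (x + h) - g x - D' h x)); last by rewrite /=; ring.
  by rewrite (le_trans (ler_normD _ _))// lerD.
Qed.

Lemma smoothnM k f g : smoothn k f -> smoothn k g -> smoothn k (f \* g).
Proof.
elim: k f g => [|k ih] f g sf sg.
  have [A A0 Af] := smoothn_bounded sf; have [B B0 Bg] := smoothn_bounded sg.
  split => //; exists (A * B); first exact: mulr_ge0.
  by move=> x; rewrite normrM ler_pM.
have [A A0 Af] := smoothn_bounded sf; have [B B0 Bg] := smoothn_bounded sg.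
split.
  by exists (A * B); [exact: mulr_ge0|move=> x; rewrite normrM ler_pM].
have sf' := smoothnW sf; have sg' := smoothnW sg.
have [D [[lD [C C0 HD]] sD]] := smoothnS sf.
have [D' [[lD' [C' C'0 HD']] sD']] := smoothnS sg.
exists (fun v x => f x * D' v x + g x * D v x); split; last first.
  by move=> v; apply: smoothnD; [exact: ih sf' (sD' v)|exact: ih sg' (sD v)].
split=> [a u v x|]; first by rewrite lD lD'; ring.
(* The first two summands come from the product rule, the last one from the product of the two
   increments in the second-order error. *)
exists (A * C' + B * C + C * C').
  by rewrite !addr_ge0 ?mulr_ge0.
have CC h : 0 <= C * C' * `|h| :> R by rewrite !mulr_ge0.
move=> x h; have [a1 a2 a3] := HD x h; have [b1 b2 b3] := HD' x h.
rewrite !mulrDl; split.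
- apply: (@le_trans _ _ (A * (C' * `|h|) + B * (C * `|h|))).
    by rewrite (le_trans (ler_normD _ _))// !normrM lerD// ler_pM.
  by rewrite !mulrA lerDl CC.
- apply: (@le_trans _ _ (A * (C' * `|h|) + B * (C * `|h|))); last first.
    by rewrite !mulrA lerDl CC.
  rewrite [X in `|X|](_ : _ = f x * (g (x + h) - g x) + g (x + h) * (f (x + h) - f x));
    last by rewrite /=; ring.
  by rewrite (le_trans (ler_normD _ _))// !normrM lerD// ler_pM.
- rewrite [X in `|X|](_ : _ = f x * (g (x + h) - g x - D' h x) +
    g x * (f (x + h) - f x - D h x) + (f (x + h) - f x) * (g (x + h) - g x));
    last by rewrite /=; ring.
  rewrite (le_trans (ler_normD _ _))// lerD//.
    rewrite (le_trans (ler_normD _ _))// !normrM -!mulrA lerD// ler_pM//.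
  rewrite normrM [X in _ <= X](_ : _ = (C * `|h|) * (C' * `|h|)); last by ring.
  by rewrite ler_pM.
Qed.

Lemma smoothn_prod (I : Type) (s : seq I) k (F : I -> V -> R) :
  (forall i, smoothn k (F i)) -> smoothn k (fun x => \prod_(i <- s) F i x).
Proof.
move=> sF; elim: s => [|i s ih].
  rewrite (_ : (fun x => _) = cst 1); first exact: smoothn_cst.
  by apply/funext => x; rewrite big_nil.
rewrite (_ : (fun x => _) = F i \* (fun x => \prod_(i <- s) F i x)).
  exact: smoothnM.
by apply/funext => x; rewrite big_cons.
Qed.

Lemma smoothn_iter_derive f vs : (forall k, smoothn k f) ->
  forall k, smoothn k (iter_derive vs f).
Proof.
move=> sf; elim: vs => [|v vs ih] //= k.
have [D [qD sD]] := smoothnS (ih k.+1).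
rewrite (_ : (fun x => _) = D v)//.
by apply/funext => x; have [_ ->] := quad_approx_diff x qD.
Qed.

Lemma smoothn_smooth f : (forall k, smoothn k f) -> smooth f.
Proof.
move=> sf vs x; have [D [qD sD]] := smoothnS (smoothn_iter_derive vs sf 1%N).
by have [] := quad_approx_diff x qD.
Qed.

End quadratic_approximation.

Section flat_function.
Variable R : realType.
Implicit Types (x h C : R) (q : R -> R).

Lemma quad_approx1 q q' q'' C : 0 <= C ->
  (forall x, is_derive x 1 q (q' x)) -> (forall x, is_derive x 1 q' (q'' x)) ->
  (forall x, `|q' x| <= C) -> (forall x, `|q'' x| <= C) ->
  quad_approx q (fun v x => v * q' x).
Proof.
move=> C0 dq dq' bq' bq''.
have mvt (r r' : R -> R) x h : (forall x, is_derive x 1 r (r' x)) ->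
    exists2 c, `|c - x| <= `|h| & r (x + h) - r x = r' c * h.
  move=> dr; have cr : continuous r.
    by move=> y; apply/differentiable_continuous/derivable1_diffP.
  have [h0|/ltW h0] := leP 0 h.
    have xh : x <= x + h by rewrite lerDl.
    have [c] := @MVT_segment R r r' x (x + h) xh (fun y _ => dr y)
      (continuous_subspaceT cr).
    rewrite in_itv/= => /andP[xc cx] ->; exists c; last by rewrite addrAC subrr add0r.
    by rewrite !ger0_norm ?subr_ge0// lerBlDl.
  have xh : x + h <= x by rewrite gerDl.
  have [c] := @MVT_segment R r r' (x + h) x xh (fun y _ => dr y)
    (continuous_subspaceT cr).
  rewrite in_itv/= => /andP[xc cx] E; exists c.
    by rewrite !ler0_norm ?subr_le0//; lra.
  by rewrite -opprB E opprD addrA subrr sub0r mulrN opprK.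
split=> [a u v x|]; first by rewrite mulrDl mulrA.
exists C => // x h; split.
- by rewrite normrM mulrC ler_wpM2r.
- by have [c _ ->] := mvt q q' x h dq; rewrite normrM ler_wpM2r.
- have [c cx ->] := mvt q q' x h dq; rewrite mulrC -mulrBr normrM.
  have [e _] := mvt q' q'' x (c - x) dq'; rewrite [x + _]addrC subrK => ->.
  rewrite expr2 mulrCA ler_wpM2l// normrM mulrC.
  by rewrite [X in _ <= X]mulrC ler_pM.
Qed.

(** The classical [exp (-1/x)], extended by [0]. The factor [x^-m] closes the family under
    differentiation: the derivative of [flat m] is a combination of [flat m.+2] and [flat m.+1]. *)
Definition flat (m : nat) x : R := if 0 < x then x^-1 ^+ m * expR (- x^-1) else 0.

Lemma flat_ge0 m x : 0 <= flat m x.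
Proof.
rewrite /flat; case: ifPn => // x0.
by rewrite mulr_ge0 ?exprn_ge0 ?invr_ge0 ?expR_ge0// ltW.
Qed.

(** One term of the exponential series suffices: [exp (1/x)] is at least [(1/x)^(n+1) / (n+1)!].
    Taking [n] large beats any negative power of [x]. *)
Lemma flat_le m n x : 0 < x -> flat m x <= n.+1`!%:R * x^-1 ^+ m * x ^+ n.+1.
Proof.
move=> x0; rewrite /flat x0 mulrAC mulrC ler_wpM2r ?exprn_ge0 ?invr_ge0 ?(ltW x0)//.
rewrite expRN -[X in _ <= X]invrK lef_pV2 ?posrE ?expR_gt0//; last first.
  by rewrite invr_gt0 mulr_gt0 ?exprn_gt0// ltr0n fact_gt0.
have := @expR_ge1Dxn R x^-1 n; rewrite invr_ge0 (ltW x0) => /(_ isT).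
rewrite invfM exprVn mulrC => /(le_trans _); apply.
by rewrite lerDr.
Qed.

Lemma flat_bounded m : bounded_by (flat m).
Proof.
exists (m`!%:R) => // x; rewrite ger0_norm ?flat_ge0//.
have [x0|x0] := ltP 0 x; last by rewrite /flat ltNge x0.
case: m => [|m].
  rewrite /flat x0 expr0 mul1r fact0 -expR0 ler_expR oppr_le0 invr_ge0.
  exact: ltW.
by rewrite (le_trans (flat_le m.+1 m x0))// -mulrA -exprMn mulVf ?gt_eqF// expr1n mulr1.
Qed.

Lemma flat_derive m x :
  is_derive x 1 (flat m) (flat m.+2 x - m%:R * flat m.+1 x).
Proof.
have [x0|x0|->] := ltgtP x 0.
- have E : {near x, cst 0 =1 flat m}.
    near=> y; rewrite /flat ltNge ltW//; near: y.
    exact: lt_nbhsl.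
  rewrite /flat [in X in is_derive _ _ _ X]ltNge (ltW x0)/= mulr0 subr0.
  by split; [exact: near_eq_derivable E _|rewrite -(near_eq_derive _ E) derive_cst].
- pose g y := y^-1 ^+ m * expR (- y^-1) : R.
  have E : {near x, g =1 flat m}.
    near=> y; rewrite /flat ifT//; near: y.
    exact: lt_nbhsr.
  have xn0 : x != 0 by rewrite gt_eqF.
  have d1 : is_derive x 1 (fun y : R => y^-1) (- x ^- 2 *: 1).
    exact: is_deriveV.
  have d2 : is_derive x 1 (fun y : R => expR (- y^-1)) (expR (- x^-1) * x ^- 2).
    have d3 : is_derive x 1 (fun y : R => - y^-1) (x ^- 2).
      by apply: is_derive_eq; rewrite /GRing.scale/= mulr1 opprK.
    exact: (@is_derive1_comp R expR).
  have dg : is_derive x 1 g (flat m.+2 x - m%:R * flat m.+1 x).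
    have dX := @is_deriveX R R^o (fun y : R => y^-1) m x 1 _ d1.
    have dM := is_deriveM dX d2.
    have -> : g = (fun y : R => y^-1) ^+ m * (fun y : R => expR (- y^-1)).
      by apply/funext => y; rewrite exprfctE.
    apply: is_derive_eq; rewrite exprfctE /flat x0 /GRing.scale/= mulr1 -exprVn.
    case: m {E dX dM g} => [|m] /=; first by rewrite !expr0; ring.
    by rewrite !exprS; ring.
  have dgx := @ex_derive _ _ _ _ _ _ _ dg.
  split; first exact: near_eq_derivable E dgx.
  by rewrite -(near_eq_derive _ E) derive_val.
(* The origin is the only point where the two branches meet; quadratic smallness there makes the
   difference quotient tend to [0]. *)
- have [C C0 Cf] : exists2 C, 0 <= C & forall h, `|flat m h| <= C * `|h| ^+ 2.
    exists (m.+2`!%:R) => // h; rewrite ger0_norm ?flat_ge0//.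
    have [h0|h0] := ltP 0 h; last by rewrite /flat ltNge h0 mulr_ge0.
    rewrite (le_trans (flat_le m m.+1 h0))// -mulrA ler_wpM2l// gtr0_norm//.
    by rewrite -addn2 exprD mulrA -exprMn mulVf ?gt_eqF// expr1n mul1r.
  have f0 : flat m 0 = 0 by rewrite /flat ltxx.
  have -> : flat m.+2 0 - m%:R * flat m.+1 0 = 0 by rewrite /flat ltxx mulr0 subr0.
  suff H : (fun h : R => h^-1 *: ((flat m \o shift 0) (h *: 1) - flat m 0)) @ 0^' --> (0 : R).
    by split; [apply/cvg_ex; exists 0|exact/cvg_lim].
  apply/cvgr0Pnorm_le => e e0; near=> h.
  have hn0 : h != 0 by near: h; exact: nbhs_dnbhs_neq.
  rewrite /= addr0 f0 subr0 /GRing.scale/= mulr1 normrM normfV.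
  rewrite ler_pdivrMl ?normr_gt0// (le_trans (Cf h))// expr2 mulrCA ler_wpM2l//.
  have hC : `|h| <= e / (C + 1).
    by near: h; apply: dnbhs0_le; rewrite divr_gt0// ltr_wpDl.
  rewrite (@le_trans _ _ (C * (e / (C + 1))))//; first by rewrite ler_wpM2l.
  by rewrite mulrCA ler_piMr ?(ltW e0)// ler_pdivrMr ?ltr_wpDl// mul1r lerDl.
Unshelve. all: by end_near. Qed.

Lemma smoothn_flat k m : smoothn k (flat m).
Proof.
elim: k m => [|k ih] m; split => //; try exact: flat_bounded.
have der m' : exists2 C : R, 0 <= C & forall x, `|flat m'.+2 x - m'%:R * flat m'.+1 x| <= C.
  have [A A0 HA] := flat_bounded m'.+2; have [B B0 HB] := flat_bounded m'.+1.
  exists (A + m'%:R * B); first by rewrite addr_ge0 ?mulr_ge0.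
  by move=> x; rewrite (le_trans (ler_normB _ _))// lerD// normrM ger0_norm// ler_wpM2l.
pose d m' x := flat m'.+2 x - m'%:R * flat m'.+1 x.
exists (fun v x => v * d m x); split; last first.
  move=> v; apply: (smoothnM (f := cst v)); first exact: smoothn_cst.
  have -> : d m = flat m.+2 \+ (cst (- m%:R) \* flat m.+1).
    by apply/funext => x; rewrite /d /= mulNr.
  by apply: smoothnD => //; apply: smoothnM => //; exact: smoothn_cst.
have [A A0 HA] := der m; have [B B0 HB] := der m.+2; have [C C0 HC] := der m.+1.
pose dd x := d m.+2 x - m%:R * d m.+1 x.
have H0 : 0 <= A + (B + m%:R * C) by rewrite !addr_ge0 ?mulr_ge0.
apply: (@quad_approx1 (flat m) (d m) dd _ H0).
- exact: flat_derive.
- move=> x.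
  have d1 := flat_derive m.+2 x; have d2 := flat_derive m.+1 x.
  have -> : d m = flat m.+2 - m%:R *: flat m.+1 by apply/funext.
  by apply: is_derive_eq.
- by move=> x; rewrite (le_trans (HA x))// lerDl addr_ge0 ?mulr_ge0.
- move=> x; rewrite (@le_trans _ _ (B + m%:R * C)) ?lerDr//.
  by rewrite (le_trans (ler_normB _ _))// lerD ?HB// normrM ger0_norm// ler_wpM2l ?HC.
Qed.

End flat_function.

Section smooth_composition.
Variable R : realType.

Lemma smoothn_affine (V : normedModType R) k (f : V -> R) (c : R) (b : V) :
  smoothn k f -> smoothn k (fun x => f (c *: x + b)).
Proof.
elim: k f => [|k ih] f sf.
  by have [C C0 H] := smoothn_bounded sf; split => //; exists C.
split; first by have [C C0 H] := smoothn_bounded sf; exists C.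
have [D [[lD [C C0 H]] sD]] := smoothnS sf.
exists (fun v x => D (c *: v) (c *: x + b)); split; last first.
  by move=> v; exact: ih (sD _).
split=> [a u v x|]; first by rewrite scalerDr scalerA [c * a]mulrC -scalerA lD.
exists (C * `|c| + C * `|c| ^+ 2); first by rewrite addr_ge0 ?mulr_ge0 ?exprn_ge0.
move=> x h; have [h1 h2 h3] := H (c *: x + b) (c *: h).
have c1 : 0 <= C * `|c| * `|h| by rewrite !mulr_ge0.
have c2 : 0 <= C * `|c| ^+ 2 * `|h| by rewrite !mulr_ge0 ?exprn_ge0.
have c3 : 0 <= C * `|c| * `|h| ^+ 2 by rewrite !mulr_ge0 ?exprn_ge0.
have E : c *: (x + h) + b = c *: x + b + c *: h by rewrite scalerDr addrAC.
rewrite E !mulrDl; move: h1 h2 h3; rewrite normrZ exprMn !mulrA => h1 h2 h3.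
by split; lra.
Qed.

Lemma smoothn_coord n (i : 'I_n) k (q : R -> R) :
  smoothn k q -> smoothn k (fun x : 'rV[R]_n => q (x ord0 i)).
Proof.
elim: k q => [|k ih] q sq.
  by have [C C0 H] := smoothn_bounded sq; split => //; exists C.
split; first by have [C C0 H] := smoothn_bounded sq; exists C.
have [D [[lD [C C0 H]] sD]] := smoothnS sq.
exists (fun v x : 'rV[R]_n => D (v ord0 i) (x ord0 i)); split; last by move=> v; exact: ih (sD _).
split=> [a u v x|]; first by rewrite !mxE lD.
exists C => // x h; have [h1 h2 h3] := H (x ord0 i) (h ord0 i).
have hi := coord_le_norm h i.
rewrite mxE; split; [apply: le_trans h1 _|apply: le_trans h2 _|apply: le_trans h3 _].
- by rewrite ler_wpM2l.
- by rewrite ler_wpM2l.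
- by rewrite ler_wpM2l// lerXn2r ?nnegrE.
Qed.

Lemma smoothn_continuous (V : normedModType R) (f : V -> R) : smoothn 1 f -> continuous f.
Proof.
move=> /smoothnS[D [qD _]] x; apply: differentiable_continuous.
by have [] := quad_approx_diff x qD.
Qed.

Lemma continuous_measurable_rV n (f : 'rV[R]_n -> R) : continuous f ->
  measurable_fun setT f.
Proof.
move=> cf; apply: (measurability _ (RGenOInfty.measurableE R)).
move=> _ [_ [a ->] <-]; rewrite setTI.
by apply: open_measurable_rV; apply: open_comp.
Qed.

(** The witness hidden in [smoothn k] could depend on [k]; it is forced to be the directional
    derivative, so one family of derivatives works at every order. *)
Lemma smoothn_derive (V : normedModType R) (f : V -> R) : (forall k, smoothn k f) ->
  quad_approx f (fun v x => 'D_v f x) /\ forall v k, smoothn k (fun x => 'D_v f x).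
Proof.
move=> sf.
have E D : quad_approx f D -> (fun v x => 'D_v f x) = D.
  move=> qD; apply/funext => v; apply/funext => x.
  by have [_ ->] := quad_approx_diff x qD.
split; first by have [D [qD _]] := smoothnS (sf 1%N); rewrite (E _ qD).
move=> v k; have [D [qD sD]] := smoothnS (sf k.+1).
by rewrite (_ : (fun x => _) = D v)// -(E _ qD).
Qed.

(** A product over the coordinates, so that the support is the unit ball of the sup norm and
    smoothness reduces to one variable. *)
Definition bump n (x : 'rV[R]_n) : R :=
  \prod_(i < n) (flat 0 (1 - x ord0 i) * flat 0 (1 + x ord0 i)).

Lemma flat0_gt0 (x : R) : (0 < flat 0 x) = (0 < x).
Proof.
by rewrite /flat; case: ifPn; rewrite ?ltxx// => _; rewrite mulr_gt0 ?expr0 ?expR_gt0.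
Qed.

Lemma smoothn_bump n k : smoothn k (@bump n).
Proof.
apply: smoothn_prod => i.
pose b x := flat 0 (1 - x) * flat 0 (1 + x) : R.
apply: (@smoothn_coord n i k b); apply: smoothnM.
  have := @smoothn_affine _ k (flat 0) (-1) 1 (smoothn_flat R _ 0).
  by under eq_fun do rewrite scaleN1r addrC.
have := @smoothn_affine _ k (flat 0) 1 1 (smoothn_flat R _ 0).
by under eq_fun do rewrite scale1r addrC.
Qed.

Lemma bump_ge0 n (x : 'rV[R]_n) : 0 <= bump x.
Proof. by apply: prodr_ge0 => i _; rewrite mulr_ge0 ?flat_ge0. Qed.

Lemma bump_gt0 n (x : 'rV[R]_n) : `|x| < 1 -> 0 < bump x.
Proof.
move=> /norm_rV_lt H; apply: prodr_gt0 => i _.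
have := H ltr01 i; rewrite ltr_norml => /andP[h1 h2].
by rewrite mulr_gt0 ?flat0_gt0//; lra.
Qed.

Lemma bump_eq0 n (x : 'rV[R]_n) : 1 <= `|x| -> bump x = 0.
Proof.
move=> x1; apply/eqP; rewrite eq_le bump_ge0 andbT leNgt; apply/negP => b0.
move: x1; rewrite leNgt => /negP; apply; apply/norm_rV_lt => // i.
move: b0; rewrite /bump (bigD1 i)//= => b0.
have bi : flat 0 (1 - x ord0 i) * flat 0 (1 + x ord0 i) != 0.
  by apply/eqP => e; move: b0; rewrite e mul0r ltxx.
have p1 : 0 < flat 0 (1 - x ord0 i).
  by rewrite lt0r flat_ge0 andbT; apply/eqP => e; move: bi; rewrite e mul0r eqxx.
have p2 : 0 < flat 0 (1 + x ord0 i).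
  by rewrite lt0r flat_ge0 andbT; apply/eqP => e; move: bi; rewrite e mulr0 eqxx.
by move: p1 p2; rewrite !flat0_gt0 ltr_norml; lra.
Qed.

End smooth_composition.

(** * Smoothness of convolutions *)

Section convolution.
Variables (R : realType) (N : nat).
Local Notation E := 'rV[R]_N.
Local Notation mu := (lebesgue_rV R N).
Implicit Types (f g rho : E -> R).

Lemma integrable_mul_bounded d (X : measurableType d)
    (m : {measure set X -> \bar R}) (f g : X -> R) (C : R) :
  m.-integrable setT (EFin \o f) -> measurable_fun setT g ->
  (forall x, `|g x| <= C) ->
  m.-integrable setT (EFin \o (f \* g)) /\
  `|\int[m]_x (f x * g x)| <= C * \int[m]_x `|f x|.
Proof.
move=> fi mg gC.
have fgi : m.-integrable setT (EFin \o (f \* g)).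
  have := integrableMl measurableT fi mg; apply.
  exists C; split; first by rewrite num_real.
  by move=> M CM x _; rewrite /= (le_trans (gC x))// ltW.
split => //; apply: le_trans (le_normr_Rintegral measurableT fgi) _.
rewrite -RintegralZl//; last exact: integrable_norm.
apply: le_Rintegral => //.
- exact: integrable_norm.
- exact: (integrableZl measurableT C (integrable_norm fi)).
- by move=> x _; rewrite normrM mulrC ler_wpM2r.
Qed.

(** The kernel is read at [y - x], so this is convolution with the reflected kernel; derivatives in
    [x] fall on [rho] with a minus sign. *)
Definition conv f rho x : R := \int[mu]_y (f y * rho (y - x)).

Lemma measurable_shift rho (x : E) : measurable_fun setT rho ->
  measurable_fun setT (fun y : E => rho (y - x)).
Proof. by move=> mr; apply: (measurableT_comp mr); exact: measurable_rVB. Qed.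

(** All derivatives fall on the kernel: each of the three estimates of [quad_approx] for [rho],
    taken with the increment [- h], is integrated against [|f|]. The uniformity built into [smoothn]
    replaces differentiation under the integral sign. *)
Lemma smoothn_conv k f rho : mu.-integrable setT (EFin \o f) ->
  (forall k, smoothn k rho) -> smoothn k (conv f rho).
Proof.
move=> fi; set I := \int[mu]_x `|f x|.
have I0 : 0 <= I by apply: Rintegral_ge0.
have Mr (r : E -> R) : (forall k, smoothn k r) -> measurable_fun setT r.
  by move=> sr; apply: continuous_measurable_rV; exact: smoothn_continuous.
elim: k rho => [|k ih] rho sr; have [C C0 rC] := smoothn_bounded (sr 0%N).
  split => //; exists (C * I); first exact: mulr_ge0.
  move=> x; have [_ h] := integrable_mul_bounded fi (measurable_shift x (Mr _ sr)) (fun y => rC (y - x)).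
  exact: h.
split.
  exists (C * I); first exact: mulr_ge0.
  move=> x; have [_ h] := integrable_mul_bounded fi (measurable_shift x (Mr _ sr)) (fun y => rC (y - x)).
  exact: h.
have [[lD [A A0 H]] sD] := smoothn_derive sr.
have sDN v k' : smoothn k' (fun x => - 'D_v rho x).
  rewrite (_ : (fun x => _) = cst (-1) \* (fun x => 'D_v rho x)).
    by apply: smoothnM => //; exact: smoothn_cst.
  by apply/funext => x; rewrite /= mulN1r.
exists (fun v => conv f (fun x => - 'D_v rho x)); split; last by move=> v; exact: ih.
have int (r : E -> R) x : (forall k, smoothn k r) -> mu.-integrable setT (fun y => (f y * r (y - x))%:E).
  move=> sr'; have [B B0 rB] := smoothn_bounded (sr' 0%N).
  by have [] := integrable_mul_bounded fi (measurable_shift x (Mr _ sr')) (fun y => rB (y - x)).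
split=> [a u v x|].
  have iD w := int (fun y => - 'D_w rho y) x (sDN w).
  rewrite /conv -RintegralZl//; last exact: iD.
  rewrite -RintegralD//; last 2 first.
  - exact: (integrableZl measurableT a (iD u)).
  - exact: iD.
  by apply: eq_Rintegral => y _; rewrite lD; ring.
exists (A * I); first exact: mulr_ge0.
move=> x h; rewrite /conv; split.
- have bD y : `|- 'D_h rho (y - x)| <= A * `|h| by rewrite normrN; have [] := H (y - x) h.
  have [_] := integrable_mul_bounded fi (measurable_shift x (Mr _ (sDN h))) bD.
  by rewrite mulrAC.
- rewrite -RintegralB//; try exact: (int rho).
  have bD y : `|rho (y - (x + h)) - rho (y - x)| <= A * `|h|.
    by have [_ + _] := H (y - x) (- h); rewrite normrN -addrA -opprD.
  have mD : measurable_fun setT (fun y : E => rho (y - (x + h)) - rho (y - x)).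
    by apply: measurable_funB; exact: measurable_shift (Mr _ sr).
  have [_] := integrable_mul_bounded fi mD bD.
  by under eq_Rintegral do rewrite mulrBr; rewrite mulrAC.
- rewrite -!RintegralB//; try exact: (int rho); last 2 first.
  - exact: (integrableB measurableT (int rho (x + h) sr) (int rho x sr)).
  - exact: (int (fun y => - 'D_h rho y) x (sDN h)).
  have bD y : `|rho (y - (x + h)) - rho (y - x) - - 'D_h rho (y - x)| <= A * `|h| ^+ 2.
    have [_ _] := H (y - x) (- h).
    rewrite normrN (_ : y - x - h = y - (x + h)); last by rewrite opprD addrA.
    have -> : 'D_(- h) rho (y - x) = - 'D_h rho (y - x) => //.
    have := lD (-1) h 0 (y - x); rewrite scaleN1r addr0 mulN1r => ->.
    have := lD 0 0 0 (y - x); rewrite scale0r addr0 mul0r add0r => e.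
    have := lD 1 0 0 (y - x); rewrite scale1r addr0 mul1r => /eqP.
    by rewrite -subr_eq0 opprD addrA subrr sub0r oppr_eq0 => /eqP ->; rewrite addr0.
  have mD : measurable_fun setT (fun y : E => rho (y - (x + h)) - rho (y - x) - - 'D_h rho (y - x)).
    apply: measurable_funB; last exact: measurable_shift (Mr _ (sDN h)).
    by apply: measurable_funB; exact: measurable_shift (Mr _ sr).
  have [_] := integrable_mul_bounded fi mD bD.
  by under eq_Rintegral do rewrite !mulrBr; rewrite mulrAC.
Qed.

End convolution.

(** * Steklov averages *)

Section fatou_bounds.
Local Open Scope ereal_scope.
Variable R : realType.

Lemma limn_einf_gt (u : (\bar R)^nat) y : y < limn_einf u ->
  exists n, forall k, (n <= k)%N -> y < u k.
Proof.
rewrite limn_einf_lim.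
have /cvg_lim -> // := ereal_nondecreasing_cvgn (nondecreasing_einfs u).
move=> /ereal_sup_gt[_ [n _ <-]] yn; exists n => k nk; apply: lt_le_trans yn _.
by apply: ereal_inf_lbound; exists k.
Qed.

Lemma limn_einf_ge (u : (\bar R)^nat) y :
  (forall a, a < y -> exists n, forall k, (n <= k)%N -> a < u k) -> y <= limn_einf u.
Proof.
move=> H; rewrite leNgt; apply/negP => uy.
have [a ua ay] : exists2 a, limn_einf u < a & a < y.
  move: uy; case: (limn_einf u) y {H} => [r| |] [t| |]//.
  - rewrite lte_fin => rt; exists ((r + t) / 2)%:E; rewrite lte_fin; lra.
  - move=> _; exists (r + 1)%:E; rewrite ?ltry// lte_fin; lra.
  - move=> _; exists (t - 1)%:E; rewrite ?ltNyr// lte_fin; lra.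
  - by move=> _; exists 0%E; rewrite ?ltNy0 ?lt0y.
have [n Hn] := H a ay; move: ua; rewrite ltNge => /negP; apply.
rewrite limn_einf_lim.
have /cvg_lim -> // := ereal_nondecreasing_cvgn (nondecreasing_einfs u).
apply: (@le_trans _ _ (einfs u n)); last by apply: ereal_sup_ubound; exists n.
by apply: le_ereal_inf_tmp => _ [k /= nk <-]; exact/ltW/Hn.
Qed.

Lemma fatou_ae d (X : measurableType d) (m : {measure set X -> \bar R})
    (h_ : (X -> \bar R)^nat) (h : X -> \bar R) :
  (forall k, measurable_fun setT (h_ k)) -> (forall k x, 0 <= h_ k x) ->
  measurable_fun setT h -> (forall x, 0 <= h x) ->
  {ae m, forall x, h x <= limn_einf (h_ ^~ x)} ->
  \int[m]_x h x <= limn_einf (fun k => \int[m]_x h_ k x).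
Proof.
move=> mh_ h_0 mh h0 hle.
apply: le_trans (fatou m measurableT mh_ (fun k x _ => h_0 k x)).
apply: ae_ge0_le_integral => //.
- by move=> x _; apply: limn_einf_ge => a a0; exists 0%N => k _; exact: lt_le_trans a0 _.
- under eq_fun do rewrite limn_einf_lim.
  apply: (emeasurable_fun_cvg (fun k x => einfs (h_ ^~ x) k)).
    by move=> k; exact: measurable_fun_einfs.
  by move=> x _; exact: is_cvg_einfs.
- by apply: filterS hle => x + _.
Qed.

(** The sum has a finite integral, so it is finite almost everywhere, and the terms of a convergent
    series tend to [0]. *)
Lemma ae_cvg0_summable d (X : measurableType d) (m : {measure set X -> \bar R})
    (g : (X -> \bar R)^nat) :
  (forall k, measurable_fun setT (g k)) -> (forall k x, 0 <= g k x) ->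
  \sum_(0 <= k <oo) \int[m]_x g k x < +oo ->
  {ae m, forall x, g k x @[k --> \oo] --> 0}.
Proof.
move=> mg g0 sg.
have : m.-integrable setT (fun x => \sum_(0 <= k <oo) g k x).
  apply/integrableP; split.
    by apply: ge0_emeasurable_sum => // k x _ _; exact: g0.
  under eq_integral do rewrite gee0_abs ?nneseries_ge0//.
  by rewrite integral_nneseries.
move/(integrable_ae measurableT); apply: filterS => x /(_ I) xfin.
have Sx : \sum_(0 <= k <oo) g k x < +oo by rewrite ltey_eq xfin.
have T0 := nneseries_tail_cvg Sx (fun k _ => g0 k x).
apply: (squeeze_cvge _ (cvg_cst 0) T0).
apply: nearW => k; rewrite g0/=.
rewrite (nneseries_split k 1)//.
by rewrite addn1 big_nat1 leeDl// nneseries_ge0.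
Qed.

End fatou_bounds.

Section steklov.
Variable R : realType.
Local Notation leb := (@lebesgue_measure R).

(** Lebesgue differentiation of the primitive of [f] from minus infinity, read along the backward
    increments [-1/(k+1)]. *)
Lemma steklov_cvg (f : R -> R) : leb.-integrable setT (EFin \o f) ->
  {ae leb, forall t, k.+1%:R * \int[leb]_(x in `]t - k.+1%:R^-1, t]) f x @[k --> \oo] --> f t}.
Proof.
move=> fi; have mT : measurable [set: R] by [].
have fi' y : leb.-integrable `]-oo, y] (EFin \o f).
  by apply: integrableS fi.
have lf : locally_integrable setT f.
  by have := integrable_locally mT fi; rewrite patch_setT.
have FF := ae_filter_ringOfSetsType leb.
have := FTC1Ny fi' lf; apply: filterS => t [].
set F := fun x => _ => dF F't.
have cF : (fun h => h^-1 *: (F (h *: 1 + t) - F t)) @ 0^' --> f t.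
  by rewrite -F't derive1E; exact: dF.
have c0 : - k.+1%:R^-1 @[k --> \oo] --> (0 : R).
  by rewrite -oppr0; apply: cvgN; exact: cvg_harmonic.
have /cvgr_dnbhsP := cF.
move=> /(_ (fun k => - k.+1%:R^-1)); have n0 k : - k.+1%:R^-1 != 0 :> R.
  by rewrite oppr_eq0 invr_eq0 pnatr_eq0.
move=> /(_ (conj n0 c0)); apply: cvg_trans; apply: near_eq_cvg; apply: nearW => k.
rewrite /F /GRing.scale/= mulr1 invrN invrK -[t in RHS](subrK k.+1%:R^-1).
set a := k.+1%:R^-1; have a0 : 0 < a by rewrite invr_gt0.
rewrite subrK [- a + t]addrC mulNr -mulrN opprB; congr (_ * _).
by rewrite Rintegral_itvB//= bnd_simp gerBl ltW.
Qed.

End steklov.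

Section steklov_fatou.
Context d (Z : measurableType d) (R : realType).
Local Notation leb := (@lebesgue_measure R).
Variable m : {sigma_finite_measure set Z -> \bar R}.
Implicit Types (al be ga de : Z -> R -> R).

Variables (zeta : R -> R) (al be ga de : Z -> R -> R) (P : Z -> R -> R -> R).
Hypotheses (mzeta : measurable_fun setT zeta) (zeta0 : forall t, 0 <= zeta t).
Hypothesis mal : measurable_fun [set: Z * measurableTypeR R] (fun x => al x.1 x.2).
Hypothesis mbe : measurable_fun [set: Z * measurableTypeR R] (fun x => be x.1 x.2).
Hypothesis mga : measurable_fun [set: Z * measurableTypeR R] (fun x => ga x.1 x.2).
Hypothesis mde : measurable_fun [set: Z * measurableTypeR R] (fun x => de x.1 x.2).
Hypothesis PE : forall z tau t, P z tau t = al z t + be z tau + ga z tau * de z t.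
Hypothesis P0 : forall z tau t, 0 <= P z tau t.

Let h k z t tau : \bar R :=
  (if (t - k.+1%:R^-1 < tau) && (tau <= t) then zeta t * k.+1%:R * P z tau t else 0)%:E.

Let mh k : measurable_fun [set: (Z * measurableTypeR R) * measurableTypeR R]
    (fun x => h k x.1.1 x.1.2 x.2).
Proof.
apply/measurable_EFinP.
have mt : measurable_fun [set: (Z * measurableTypeR R) * measurableTypeR R]
  (fun x => x.1.2 : R) by exact: (measurableT_comp measurable_snd measurable_fst).
have mtau : measurable_fun [set: (Z * measurableTypeR R) * measurableTypeR R]
  (fun x => x.2 : R) by exact: measurable_snd.
have mz : measurable_fun [set: (Z * measurableTypeR R) * measurableTypeR R]
  (fun x => x.1.1 : Z) by exact: (measurableT_comp measurable_fst measurable_fst).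
have mzt : measurable_fun [set: (Z * measurableTypeR R) * measurableTypeR R]
  (fun x => (x.1.1, x.1.2) : Z * measurableTypeR R).
  by apply/measurable_fun_pairP; split => //=.
have mztau : measurable_fun [set: (Z * measurableTypeR R) * measurableTypeR R]
  (fun x => (x.1.1, x.2) : Z * measurableTypeR R).
  by apply/measurable_fun_pairP; split => //=.
apply: measurable_fun_ifT => //.
  apply: measurable_and; last exact: measurable_fun_ler.
  by apply: measurable_fun_ltr => //; exact: measurable_funB.
apply: measurable_funM.
  by apply: measurable_funM => //; exact: (measurableT_comp mzeta mt).
under eq_fun do rewrite PE.
  apply: measurable_funD; first apply: measurable_funD.
- exact: (measurableT_comp mal mzt).
- exact: (measurableT_comp mbe mztau).
- apply: measurable_funM; first exact: (measurableT_comp mga mztau).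
  exact: (measurableT_comp mde mzt).
Qed.

Let h0 k z t tau : (0 <= h k z t tau)%E.
Proof. by rewrite /h lee_fin; case: ifPn => // _; rewrite !mulr_ge0 ?zeta0 ?P0. Qed.

Let A k z t := (\int[leb]_tau h k z t tau)%E.

Let AE k z t : A k z t = (\int[leb]_(tau in `](t - k.+1%:R^-1)%R, t])
     (zeta t * k.+1%:R * P z tau t)%:E)%E.
Proof.
rewrite [RHS]integral_mkcond; apply: eq_integral => tau _.
by rewrite patchE mem_setE in_itv/= /h; case: ifPn.
Qed.

Let mA k : measurable_fun [set: Z * measurableTypeR R] (fun x => A k x.1 x.2).
Proof.
exact: (measurable_integral_snd leb (f := fun (x : Z * measurableTypeR R) (tau : measurableTypeR R) => h k x.1 x.2 tau) (mh k) (fun x tau => h0 k x.1 x.2 tau)).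
Qed.

Let A0 k z t : (0 <= A k z t)%E. Proof. exact: integral_ge0. Qed.

Lemma measurable_steklov k : measurable_fun [set: measurableTypeR R] (fun t =>
  \int[m]_z \int[leb]_(tau in `](t - k.+1%:R^-1)%R, t]) (zeta t * k.+1%:R * P z tau t)%:E)%E.
Proof.
rewrite (_ : (fun t => _) = (fun t => \int[m]_z A k z t)%E); last first.
  by apply/funext => t; apply: eq_integral => z _; rewrite AE.
exact: (measurable_integral_fst m (f := A k) (mA k) (A0 k)).
Qed.

(* A Fatou lemma for Steklov averages in [tau] of integrands that are nonnegative
   as a whole while their part depending on [tau] is merely integrable. *)
Lemma steklov_fatou :
  {ae m, forall z, leb.-integrable setT (EFin \o be z)} ->
  {ae m, forall z, leb.-integrable setT (EFin \o ga z)} ->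
  (\int[leb]_t \int[m]_z (zeta t * P z t t)%:E <=
   limn_einf (fun k => \int[leb]_t \int[m]_z \int[leb]_(tau in `](t - k.+1%:R^-1)%R, t])
     (zeta t * k.+1%:R * P z tau t)%:E))%E.
Proof.
move=> ibe iga.
pose G z t : \bar R := (zeta t * P z t t)%:E.
have mG : measurable_fun [set: Z * measurableTypeR R] (fun x => G x.1 x.2).
  apply/measurable_EFinP; apply: measurable_funM.
    exact: (measurableT_comp mzeta measurable_snd).
  under eq_fun do rewrite PE.
  by apply: measurable_funD; [exact: measurable_funD|exact: measurable_funM].
have G0 z t : (0 <= G z t)%E by rewrite lee_fin mulr_ge0// P0.
have -> : (\int[leb]_t \int[m]_z (zeta t * P z t t)%:E =
    \int[m]_z \int[leb]_t G z t)%E by rewrite -(tonelli_swap m leb (f := G) mG G0).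
rewrite [leRHS](_ : _ = limn_einf (fun k => \int[m]_z \int[leb]_t A k z t))%E; last first.
  congr limn_einf; apply/funext => k.
  rewrite (tonelli_swap m leb (f := A k) (mA k) (A0 k)).
  by apply: eq_integral => t _; apply: eq_integral => z _; rewrite AE.
apply: fatou_ae.
- by move=> k; exact: measurable_integral_snd.
- by move=> k z; apply: integral_ge0.
- exact: measurable_integral_snd.
- by move=> z; apply: integral_ge0.
apply: filterS2 ibe iga => z iz jz.
apply: fatou_ae => //.
- by move=> k; exact: (measurableT_comp (mA k) (measurable_pair1 z)).
- exact: (measurableT_comp mG (measurable_pair1 z)).
have FF := ae_filter_ringOfSetsType leb.
(* For fixed [z], only [be] and [ga] are averaged in [tau], while [al] and [de] come out as
   constants at time [t]. The averages therefore converge at almost every [t], and Fatou is applied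
   first in [t], then in [z]. *)
apply: filterS2 (steklov_cvg iz) (steklov_cvg jz) => t cb cg.
suff cA : A k z t @[k --> \oo] --> G z t by rewrite (cvg_limn_einf_sup cA).1.
rewrite /G PE.
rewrite (_ : (fun k => A k z t) = (fun k => (zeta t * (al z t +
    k.+1%:R * \int[leb]_(x in `]t - k.+1%:R^-1, t]) be z x +
    (k.+1%:R * \int[leb]_(x in `]t - k.+1%:R^-1, t]) ga z x) * de z t))%:E)).
  apply: cvg_EFin; first exact: nearW.
  apply: cvgMr; apply: cvgD; first by apply: cvgD => //; exact: cvg_cst.
  by apply: cvgMl.
apply/funext => k; rewrite AE.
transitivity (\int[leb]_(tau in `](t - k.+1%:R^-1)%R, t])
    (zeta t * k.+1%:R * (al z t + be z tau + ga z tau * de z t))%:E)%E.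
  by apply: eq_integral => tau _; rewrite PE.
have mI : measurable (`]t - k.+1%:R^-1, t]%classic : set (measurableTypeR R)) by [].
have k0 : 0 < k.+1%:R^-1 :> R by rewrite invr_gt0.
have lI : leb (`]t - k.+1%:R^-1, t]%classic) = (k.+1%:R^-1)%:E.
  rewrite lebesgue_measure_itv/= lte_fin gtrBl k0 -EFinB; congr EFin; ring.
have i1 := integrableS measurableT mI (@subsetT _ _) iz.
have i2 := integrableS measurableT mI (@subsetT _ _) jz.
have i3 : leb.-integrable `]t - k.+1%:R^-1, t] (EFin \o cst (al z t)).
  apply/integrableP; split; first exact/measurable_EFinP/measurable_cst.
  rewrite (_ : (fun x => _) = cst `|al z t|%:E)//.
  by rewrite integral_cst//; apply: lte_mul_pinfty; rewrite ?lee_fin// [ltLHS]lI ltry.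
have i4 := integrableD mI i3 i1.
have i5 := integrableZr mI (de z t) i2.
have i6 := integrableD mI i4 i5.
transitivity ((zeta t * k.+1%:R)%:E * \int[leb]_(tau in `](t - k.+1%:R^-1)%R, t])
    (al z t + be z tau + ga z tau * de z t)%:E)%E.
  by rewrite -integralZl.
rewrite -[X in (_ * X)%E]fineK; last exact: integrable_fin_num.
rewrite -EFinM -/(Rintegral _ _ _) RintegralD// RintegralD// RintegralZr//.
have -> : \int[leb]_(_ in `]t - k.+1%:R^-1, t]) al z t = al z t * k.+1%:R^-1.
  by rewrite Rintegral_cst//; congr (_ * _); rewrite -[RHS]/(fine (k.+1%:R^-1)%:E) -lI.
congr EFin; field.
by rewrite nat1r pnatr_eq0.
Qed.
End steklov_fatou.

(** * From distributional to integrated time derivatives *)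

Section du_bois_reymond.
Variable R : realType.
Local Notation leb := (@lebesgue_measure R).

Lemma integrable_compact_support (f : R -> R) a b : continuous f ->
  (forall x, ~~ (a <= x <= b) -> f x = 0) -> leb.-integrable setT (EFin \o f).
Proof.
move=> cf f0.
have mab : measurable (`[a, b]%classic : set (measurableTypeR R)) by [].
have : leb.-integrable `[a, b] (EFin \o f).
  apply: continuous_compact_integrable; first exact: segment_compact.
  exact: continuous_subspaceT.
move/(integrable_mkcond _ mab).1; congr (integrable _ _ _); apply/funext => x.
by rewrite patchE; case: ifPn => // /negP; rewrite mem_setE in_itv/= => /negP /f0 ->.
Qed.

Lemma is_derive_affine (k c x : R) : is_derive x 1 (fun y : R => k * y + c) k.
Proof.
have h1 : is_derive x 1 (fun y : R => k * y) k.
  have := is_deriveZ k (is_derive_id x (1 : R)).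
  by rewrite /GRing.scale/= mulr1.
by have := is_deriveD h1 (is_derive_cst (c : R) x 1); rewrite addr0.
Qed.

(** In [iter_derive] the last direction of the list acts first, so the list is peeled from the
    right: one derivative of [F] along [v] is [v * b], and the remaining ones act on a smooth
    function. *)
Lemma smooth_primitive (F b : R -> R) :
  (forall x : R, is_derive x 1 F (b x)) -> (forall k, smoothn k b) -> smooth F.
Proof.
move=> dF sb; elim/last_ind => [|vs v _] x /=.
  by apply/derivable1_diffP; case: (dF x).
have -> : iter_derive (rcons vs v) F = iter_derive vs (fun x => v * b x).
  elim: vs => [|w vs ih] /=; last by rewrite ih.
  apply/funext => y; have [dFy E] := dF y.
  have dF' := (derivable1_diffP F y).1 dFy.
  by rewrite -E !deriveE// -[v in LHS]mulr1 -[v * 1]/(v *: (1 : R)) linearZ.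
apply: smoothn_smooth => k; apply: (smoothnM (smoothn_cst _ k v)); exact: sb.
Qed.

Let beta (x : R) : R := flat 0 (1 - x) * flat 0 (1 + x).

Let smoothn_beta k : smoothn k beta.
Proof.
have := smoothnM (smoothn_affine (-1) (1 : R) (smoothn_flat R k 0)) (smoothn_affine 1 (1 : R) (smoothn_flat R k 0)).
congr smoothn; apply/funext => x.
by rewrite /beta /= /GRing.scale/= mulN1r mul1r [- x + 1]addrC [x + 1]addrC.
Qed.

Let beta_ge0 x : 0 <= beta x. Proof. by rewrite mulr_ge0 ?flat_ge0. Qed.

Let beta_eq0 x : ~~ (-1 <= x <= 1) -> beta x = 0.
Proof.
rewrite negb_and -!ltNge => x1; rewrite /beta /flat.
case: ifPn => [x2|]; last by rewrite mul0r.
case: ifPn => [x3|]; last by rewrite mulr0.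
lra.
Qed.

Let beta_cont : continuous beta. Proof. exact: smoothn_continuous. Qed.

Let beta_int : leb.-integrable setT (EFin \o beta).
Proof. exact: (integrable_compact_support beta_cont beta_eq0). Qed.

Let kappa : R := \int[leb]_x beta x.

Let step x : R := \int[leb]_(y in `]-oo, x]) beta y.

Let is_derive_step (x : R) : is_derive x 1 step (beta x).
Proof.
have xx : x < x + 1 by rewrite ltrDl.
have i1 : leb.-integrable [set` `]-oo, x + 1]] (EFin \o beta).
  by apply: integrableS beta_int.
have [d1 d2] := continuous_FTC1 xx i1 (ltNyr x) (@beta_cont x).
by split; [exact: d1|rewrite -derive1E; exact: d2].
Qed.

Let step_bound x : 0 <= step x <= kappa.
Proof.
rewrite Rintegral_ge0//= /step Rintegral_mkcond; apply: le_Rintegral => //.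
  have mI : measurable (`]-oo, x]%classic : set (measurableTypeR R)) by [].
  rewrite (_ : EFin \o _ = (EFin \o beta) \_ `]-oo, x]).
    by apply: (integrable_mkcond _ mI).1; apply: integrableS beta_int.
  by rewrite restrict_EFin.
by move=> y _; rewrite patchE; case: ifPn.
Qed.

Let step0 x : x < -1 -> step x = 0.
Proof.
move=> x1; rewrite /step (@eq_Rintegral _ _ _ leb _ (cst 0)) ?Rintegral_cst ?mul0r//.
move=> y; rewrite inE/= in_itv/= => yx; rewrite beta_eq0// negb_and -!ltNge.
by rewrite (le_lt_trans yx).
Qed.

Let step1 x : 1 < x -> step x = kappa.
Proof.
move=> x1; rewrite /step Rintegral_mkcond; apply: eq_Rintegral => y _.
rewrite patchE; case: ifPn => // /negP; rewrite mem_setE in_itv/= => /negP.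
by rewrite -ltNge => xy; rewrite beta_eq0// negb_and -!ltNge (lt_trans x1 xy) orbT.
Qed.

Let kappa_gt0 : 0 < kappa.
Proof.
have b0 : 0 < beta 0 by rewrite /beta subr0 addr0 mulr_gt0 ?flat0_gt0.
have [e e0 He] : exists2 e : R, 0 < e & forall x, `|x| < e -> beta 0 / 2 < beta x.
  have h : beta 0 / 2 < beta 0 by lra.
  have /cvgr_gt/(_ _ h)/nbhs_ballP[e /= e0 He] := @beta_cont 0; exists e => // x xe.
  by apply: He; rewrite /ball/= sub0r normrN.
have mI : measurable (`[- (e / 2), e / 2]%classic : set (measurableTypeR R)) by [].
have : 0 < e * (beta 0 / 2) by rewrite mulr_gt0// divr_gt0.
move/lt_le_trans; apply.
have lI : fine (leb `[- (e / 2), e / 2]) = e.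
  rewrite lebesgue_measure_itv/= lte_fin (_ : _ < _)/=; last by lra.
  by rewrite opprK -splitr.
rewrite mulrC -[X in _ * X]lI -(Rintegral_cst leb mI).
apply: (@le_trans _ _ (\int[leb]_(x in `[- (e / 2), e / 2]) beta x)).
  apply: le_Rintegral => //.
  - apply/integrableP; split; first exact/measurable_EFinP/measurable_cst.
    rewrite (_ : (fun x => _) = cst `|(beta 0 / 2)%:E|%E)//.
    rewrite integral_cst// lte_mul_pinfty//= lebesgue_measure_itv/=; case: ifP => //.
    by rewrite ltry.
  - by apply: integrableS beta_int.
  - move=> x /=; rewrite in_itv/= => /andP[x1 x2]; apply/ltW/He.
    by rewrite ltr_norml; lra.
rewrite Rintegral_mkcond; apply: le_Rintegral => //.
  rewrite (_ : EFin \o _ = (EFin \o beta) \_ `[- (e / 2), e / 2]).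
    by apply: (integrable_mkcond _ mI).1; apply: integrableS beta_int.
  by rewrite restrict_EFin.
by move=> y _; rewrite patchE; case: ifPn.
Qed.

Let betad (k : nat) a x := k.+1%:R * beta (k.+1%:R * x + - (k.+1%:R * a)).

Let betad_eq0 k a x : ~~ (a - k.+1%:R^-1 <= x <= a + k.+1%:R^-1) -> betad k a x = 0.
Proof.
move=> h; rewrite /betad beta_eq0 ?mulr0//; apply: contra h.
have k0 : 0 < k.+1%:R :> R by [].
have kV : k.+1%:R * k.+1%:R^-1 = 1 :> R by rewrite mulfV// gt_eqF.
move=> /andP[h1 h2]; rewrite -[a - _ <= x](ler_pM2l k0) -[x <= _](ler_pM2l k0).
by rewrite mulrBr mulrDr kV; apply/andP; split; lra.
Qed.

Let smoothn_betad j k a : smoothn j (betad k a).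
Proof.
exact: (smoothnM (smoothn_cst _ j k.+1%:R)
  (smoothn_affine k.+1%:R (- (k.+1%:R * a) : R) (smoothn_beta j))).
Qed.

Let betad_cont k a : continuous (betad k a).
Proof. exact: smoothn_continuous. Qed.

Let betad_int k a : \int[leb]_x betad k a x = kappa.
Proof.
have k0 : 0 < k.+1%:R :> R by [].
have mb : measurable_fun setT (EFin \o beta).
  by apply/measurable_EFinP; exact: continuous_measurable_fun.
have cb' : continuous (fun x : R => beta (k.+1%:R * x + - (k.+1%:R * a))).
  apply: smoothn_continuous.
  exact: (smoothn_affine k.+1%:R (- (k.+1%:R * a) : R) (smoothn_beta 1)).
have mb' := continuous_measurable_fun cb'.
rewrite /kappa /Rintegral (ge0_integral_affine (- (k.+1%:R * a)) k0 mb) => [|x]; last first.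
  by rewrite lee_fin.
congr fine; apply: (@ge0_integralZl_EFin _ _ _ leb setT measurableT
  (fun x => (beta (k.+1%:R * x + - (k.+1%:R * a)))%:E)) => //.
  by move=> x _; rewrite lee_fin.
exact/measurable_EFinP.
Qed.

Let betad_cvg m a : continuous m ->
  \int[leb]_x (betad k a x * m x) @[k --> \oo] --> kappa * m a.
Proof.
move=> cm; apply/cvgrPdist_le => e e0.
have e'0 : 0 < e / kappa by rewrite divr_gt0.
have /cvgrPdist_le/(_ _ e'0)/nbhs_ballP[d /= d0 Hd] := cm a.
near=> k.
have kd : k.+1%:R^-1 < d by near: k; exact: near_infty_natSinv_lt (PosNum d0).
have i1 g : continuous g -> leb.-integrable setT (EFin \o (fun x => betad k a x * g x)).
  move=> cg; apply: (@integrable_compact_support _ (a - k.+1%:R^-1) (a + k.+1%:R^-1)).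
    by move=> x; apply: cvgM; [exact: betad_cont|exact: cg].
  by move=> x /betad_eq0 ->; rewrite mul0r.
have c1 : continuous (cst 1 : R -> R) by move=> x; exact: cvg_cst.
have i0 : leb.-integrable setT (EFin \o betad k a).
  by have := i1 _ c1; congr (integrable _ _ _); apply/funext => x; rewrite /= mulr1.
have ca : continuous (cst (m a) : R -> R) by move=> x; exact: cvg_cst.
rewrite -(betad_int k a) -RintegralZr// -RintegralB//; last 2 first.
- exact: i1.
- exact: i1.
have cd : continuous (fun x => m a - m x) by move=> x; apply: cvgB; [exact: cvg_cst|exact: cm].
rewrite (@eq_Rintegral _ _ _ leb _ (fun x => betad k a x * (m a - m x))); last by move=> x _; rewrite mulrBr.
apply: le_trans (le_normr_Rintegral measurableT (i1 _ cd)) _.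
have -> : e = \int[leb]_x (betad k a x * (e / kappa)).
  by rewrite RintegralZr// betad_int mulrC divfK// gt_eqF.
apply: le_Rintegral => //.
- exact: integrable_norm (i1 _ cd).
- exact: (i1 (cst (e / kappa)) (fun x => cvg_cst _)).
move=> x _; have b0 : 0 <= betad k a x by rewrite mulr_ge0.
rewrite normrM ger0_norm//.
have [xk|/betad_eq0 ->] := boolP (a - k.+1%:R^-1 <= x <= a + k.+1%:R^-1); last by rewrite !mul0r.
rewrite ler_wpM2l//; apply: Hd; rewrite /ball/= ltr_norml.
move: xk kd; move: (k.+1%:R^-1 : R) => i /andP[x1 x2] id.
by rewrite ltrBrDr ltrBlDl addrC -ltrBlDl; apply/andP; split; lra.
Unshelve. all: by end_near. Qed.

(** The test function is the difference of two smoothed steps at [a] and [b], of width [1/(k+1)] and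
    height [kappa]. Its derivative concentrates to [kappa] times the difference of the point masses
    at [a] and [b], which continuity of [m] evaluates; the function itself tends to [kappa] on []a,
    b[], and dominated convergence handles [B]. *)
Lemma du_bois_reymond (T : R) (m B : R -> R) : continuous m ->
  leb.-integrable `]0, T[ (EFin \o B) ->
  (forall eta, test_function `]0, T[%classic eta ->
    \int[leb]_(t in `]0, T[) (derive1 eta t * m t) = - \int[leb]_(t in `]0, T[) (eta t * B t)) ->
  forall a b, 0 < a -> a < b -> b < T ->
  m b - m a = \int[leb]_(t in `]a, b[) B t.
Proof.
move=> cm iB H a b a0 ab bT.
have mI u v : measurable (`]u, v[%classic : set (measurableTypeR R)) by [].
pose B0 := B \_ `]0, T[.
have iB0 : leb.-integrable setT (EFin \o B0).
  by have := (integrable_mkcond _ (mI 0 T)).1 iB; rewrite /B0 restrict_EFin.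
pose eta k x := step (k.+1%:R * x + - (k.+1%:R * a)) - step (k.+1%:R * x + - (k.+1%:R * b)).
pose eta' k x := betad k a x - betad k b x.
have dstep k c (x : R) : is_derive x 1 (fun x => step (k.+1%:R * x + - (k.+1%:R * c))) (betad k c x).
  pose g (y : R) : R := k.+1%:R * y + - (k.+1%:R * c).
  have dg : is_derive x 1 g k.+1%:R.
    exact: is_derive_affine.
  by have := is_derive1_comp (is_derive_step (g x)) dg; rewrite mulrC.
have deta k (x : R) : is_derive x 1 (eta k) (eta' k x) by apply: is_deriveB; exact: dstep.
have eta_le k x : `|eta k x| <= kappa.
  have /andP[h1 h2] := step_bound (k.+1%:R * x + - (k.+1%:R * a)).
  have /andP[h3 h4] := step_bound (k.+1%:R * x + - (k.+1%:R * b)).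
  by rewrite /eta ler_norml; apply/andP; split; lra.
have sleft k (c x : R) : x < c - k.+1%:R^-1 -> k.+1%:R * x + - (k.+1%:R * c) < -1.
  move=> xc; have k0 : 0 < k.+1%:R :> R by [].
  have kV : k.+1%:R * k.+1%:R^-1 = 1 :> R by rewrite mulfV// gt_eqF.
  by move: xc; rewrite -(ltr_pM2l k0) mulrBr kV; lra.
have sright k (c x : R) : c + k.+1%:R^-1 < x -> 1 < k.+1%:R * x + - (k.+1%:R * c).
  move=> xc; have k0 : 0 < k.+1%:R :> R by [].
  have kV : k.+1%:R * k.+1%:R^-1 = 1 :> R by rewrite mulfV// gt_eqF.
  have : k.+1%:R * (c + k.+1%:R^-1) < k.+1%:R * x by rewrite ltr_pM2l.
  by rewrite [_ * (c + _)]mulrDr kV; lra.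
have eta0 k (x : R) : ~~ (a - k.+1%:R^-1 <= x <= b + k.+1%:R^-1) -> eta k x = 0.
  have i0 : 0 < k.+1%:R^-1 :> R by rewrite invr_gt0.
  rewrite negb_and -!ltNge => /orP[xa|xb]; rewrite /eta.
    rewrite (step0 (sleft _ _ _ xa)) step0 ?subrr//.
    by apply: sleft; rewrite (lt_trans xa)// ltrD2r.
  rewrite (step1 (sright _ _ _ xb)) step1 ?subrr//.
  by apply: sright; rewrite (lt_trans _ xb)// ltrD2r.
have eta'0 k (x : R) : ~~ (a - k.+1%:R^-1 <= x <= b + k.+1%:R^-1) -> eta' k x = 0.
  have i0 : 0 < k.+1%:R^-1 :> R by rewrite invr_gt0.
  by move=> h; rewrite /eta' !betad_eq0 ?subrr//; apply: contra h; move: (k.+1%:R^-1 : R) i0 => i i0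
    /andP[? ?]; apply/andP; split; lra.
have seta k : smooth (eta k).
  apply: smooth_primitive (deta k) _ => j.
  have := smoothnD (smoothn_betad j k a) (smoothnM (smoothn_cst _ j (-1)) (smoothn_betad j k b)).
  by congr smoothn; apply/funext => x; rewrite /eta' /= mulN1r.
(* Once [1/(k+1) < d], the support [[a - 1/(k+1), b + 1/(k+1)]] lies inside []0, T[]. *)
pose d := Num.min a (T - b).
have d0 : 0 < d by rewrite lt_min a0 subr_gt0.
have E k : k.+1%:R^-1 < d -> \int[leb]_x (eta' k x * m x) = - \int[leb]_x (eta k x * B0 x).
  rewrite lt_min => /andP[ka kb].
  have teta : test_function `]0, T[%classic (eta k).
    split; first exact: seta.
    exists `[a - k.+1%:R^-1, b + k.+1%:R^-1]%classic; split.
    - exact: segment_compact.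
    - move=> x /=; rewrite !in_itv/=; move: (k.+1%:R^-1 : R) ka kb => i ka kb.
      by move=> /andP[? ?]; apply/andP; split; lra.
    - by move=> x /negP; rewrite in_itv/= => /eta0.
  have := H _ teta; rewrite Rintegral_mkcond => E1.
  transitivity (\int[leb]_x (((fun t : R => derive1 (eta k) t * m t) \_ `]0, T[) x)); last first.
    rewrite E1 Rintegral_mkcond; congr (- _); apply: eq_Rintegral => x _.
    by rewrite /B0 !patchE; case: ifPn => //; rewrite mulr0.
  apply: eq_Rintegral => x _; rewrite patchE; have [_ <-] := deta k x; rewrite -derive1E.
  case: ifPn => // /negP; rewrite mem_setE in_itv/= => xn.
  rewrite derive1E; have [_ ->] := deta k x; rewrite eta'0 ?mul0r//.
  apply/negP; move: (k.+1%:R^-1 : R) ka kb => i ka kb /andP[? ?].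
  by apply: xn; apply/andP; split; lra.
have c1 : \int[leb]_x (eta' k x * m x) @[k --> \oo] --> kappa * m a - kappa * m b.
  rewrite (_ : (fun k => _) = (fun k => \int[leb]_x (betad k a x * m x) - \int[leb]_x (betad k b x * m x))).
    by apply: cvgB; exact: betad_cvg.
  apply/funext => k.
  have i1 c : leb.-integrable setT (EFin \o (fun x => betad k c x * m x)).
    apply: (@integrable_compact_support _ (c - k.+1%:R^-1) (c + k.+1%:R^-1)).
      by move=> x; apply: cvgM; [exact: betad_cont|exact: cm].
    by move=> x /betad_eq0 ->; rewrite mul0r.
  by rewrite -RintegralB//; apply: eq_Rintegral => x _; rewrite /eta' mulrBl.
have meta k : measurable_fun setT (eta k).
  apply: continuous_measurable_fun => x; apply: differentiable_continuous.
  by apply/derivable1_diffP; have [] := deta k x.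
have iab : leb.-integrable setT (EFin \o (B \_ `]a, b[)).
  rewrite -restrict_EFin; apply/(integrable_mkcond _ (mI a b)).
  by apply: integrableS iB => //; apply: subset_itv; rewrite bnd_simp; lra.
have c2 : \int[leb]_x (eta k x * B0 x) @[k --> \oo] --> kappa * \int[leb]_(t in `]a, b[) B t.
  rewrite Rintegral_mkcond -RintegralZl//.
  have iE k : leb.-integrable setT (EFin \o (fun x => B0 x * eta k x)).
    by have [] := integrable_mul_bounded iB0 (meta k) (eta_le k).
  have i2 := integrableZl measurableT kappa iab.
  apply: fine_cvg; rewrite fineK; last by apply: integrable_fin_num.
  have mE k : measurable_fun setT (fun x => (eta k x * B0 x)%:E).
    have := measurable_int _ (iE k); apply: eq_measurable_fun => x _.
    by rewrite /= mulrC.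
  have mL := measurable_int _ i2.
  have dom : {ae leb, forall x k, setT x -> (`|(eta k x * B0 x)%:E| <= (kappa * `|B0 x|)%:E)%E}.
    by apply: aeW => x k _; rewrite /= lee_fin normrM ler_wpM2r.
  have cv : {ae leb, forall x, setT x ->
      (eta k x * B0 x)%:E @[k --> \oo] --> (kappa * (B \_ `]a, b[) x)%:E}.
    (* The endpoints are left out, since the smoothed steps do not tend to the indicator of []a, b[]
       at their centres. *)
    have nx (c : R) : {ae leb, forall x, x != c}.
      exists [set c]; split => //; first exact: lebesgue_measure_set1.
      by move=> x /= /negP; rewrite negbK => /eqP.
    have FF := ae_filter_ringOfSetsType leb.
    apply: filterS2 (nx a) (nx b) => x xa xb _.
    apply: cvg_EFin; first exact: nearW.
    have [xab|xab] := boolP (a < x < b).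
      have e0 : 0 < Num.min (x - a) (b - x) by rewrite lt_min !subr_gt0.
      apply: cvg_near_cst; near=> k.
      have : k.+1%:R^-1 < Num.min (x - a) (b - x) by near: k; exact: near_infty_natSinv_lt (PosNum e0).
      rewrite lt_min => /andP[x1 x2].
      have x3 : a + k.+1%:R^-1 < x by rewrite addrC -ltrBrDr.
      have x4 : x < b - k.+1%:R^-1 by rewrite ltrBrDr addrC -ltrBrDr.
      rewrite /= /eta (step1 (sright _ _ _ x3)) (step0 (sleft _ _ _ x4)).
      rewrite subr0 patchE mem_setE in_itv/= xab /B0 patchE mem_setE in_itv/= ifT//.
      by move: xab => /andP[? ?]; apply/andP; split; lra.
    have e0 : 0 < Num.max (a - x) (x - b).
      rewrite lt_max !subr_gt0; move: xab xa xb; rewrite negb_and -!leNgt => /orP[] h n1 n2.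
        by rewrite lt_neqAle n1 h.
      by rewrite [b < x]lt_neqAle eq_sym n2 h orbT.
    apply: cvg_near_cst; near=> k.
    have : k.+1%:R^-1 < Num.max (a - x) (x - b) by near: k; exact: near_infty_natSinv_lt (PosNum e0).
    rewrite lt_max => h; rewrite /= patchE mem_setE in_itv/= (negbTE xab) mulr0 eta0 ?mul0r//.
    by apply/negP; move: (k.+1%:R^-1 : R) h => i h /andP[? ?]; case/orP: h => ?; lra.
  have i3 := integrableZl measurableT kappa (integrable_norm iB0).
  by have [] := @dominated_convergence _ _ _ leb setT measurableT
    (fun k x => (eta k x * B0 x)%:E) (fun x => (kappa * (B \_ `]a, b[) x)%:E)
    (fun x => (kappa * `|B0 x|)%:E) mE mL cv i3 dom.
have c1' : \int[leb]_x (eta' k x * m x) @[k --> \oo] --> - (kappa * \int[leb]_(t in `]a, b[) B t).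
  apply: cvg_trans (cvgN c2); apply: near_eq_cvg; near=> k.
  by rewrite E; [|near: k; exact: near_infty_natSinv_lt (PosNum d0)].
have : kappa * (m a - m b) = kappa * - \int[leb]_(t in `]a, b[) B t.
  by rewrite mulrBr mulrN; apply: cvg_unique c1 c1'.
move=> /(mulfI (lt0r_neq0 kappa_gt0)) E2.
by rewrite -[RHS]opprK -E2 opprB.
Unshelve. all: by end_near. Qed.
End du_bois_reymond.

(** * Finite energy functions and the Hardy inequality *)

Section integral_convergence.
Variable R : realType.

Lemma measurable_Rintegral_snd d1 d2 (X : measurableType d1) (Y : measurableType d2)
    (m2 : {sigma_finite_measure set Y -> \bar R}) (f : X -> Y -> R) :
  measurable_fun setT (fun z : X * Y => f z.1 z.2) ->
  measurable_fun setT (fun x => \int[m2]_y f x y).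
Proof.
move=> mf; apply: (measurableT_comp (@fine_measurable R setT measurableT)).
rewrite (_ : (fun x => _) = (fun x => \int[m2]_y ((fun y => (f x y)%:E)^\+ y)
    - \int[m2]_y ((fun y => (f x y)%:E)^\- y))%E); last first.
  by apply/funext => x; rewrite [LHS]integralE.
have mE : measurable_fun setT (fun z : X * Y => (f z.1 z.2)%:E) by exact/measurable_EFinP.
apply: emeasurable_funB.
- rewrite (_ : (fun x => _) = (fun x => \int[m2]_y maxe (f x y)%:E 0)%E).
    apply: (measurable_integral_snd m2 (f := fun x y => maxe (f x y)%:E 0%E)).
      have := measurable_funepos mE; congr measurable_fun.
      by apply/funext => z; rewrite funeposE.
    by move=> x y; rewrite le_max lexx orbT.
  by apply/funext => x; apply: eq_integral => y _; rewrite funeposE.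
- rewrite (_ : (fun x => _) = (fun x => \int[m2]_y maxe (- (f x y)%:E) 0)%E).
    apply: (measurable_integral_snd m2 (f := fun x y => maxe (- (f x y)%:E)%E 0%E)).
      have := measurable_funeneg mE; congr measurable_fun.
      by apply/funext => z; rewrite funenegE.
    by move=> x y; rewrite le_max lexx orbT.
  by apply/funext => x; apply: eq_integral => y _; rewrite funenegE.
Qed.

Lemma cvge0P (u : (\bar R)^nat) : (forall k, 0 <= u k)%E ->
  (forall e : R, 0 < e -> exists n, forall k, (n <= k)%N -> (u k <= e%:E)%E) ->
  u @ \oo --> 0%E.
Proof.
move=> u0 H; have [n1 Hn1] := H 1 ltr01.
have fu k : (n1 <= k)%N -> u k \is a fin_num.
  by move=> /Hn1 uk; rewrite ge0_fin_numE// (le_lt_trans uk)// ltry.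
apply/fine_cvgP; split; first by exists n1.
apply/cvgrPdist_le => e e0; have [n Hn] := H e e0.
exists (maxn n n1) => // k /=; rewrite geq_max => /andP[nk n1k].
rewrite sub0r normrN ger0_norm ?fine_ge0//.
by rewrite -lee_fin fineK ?fu// Hn.
Qed.

Lemma le_integral_ge0 d (X : measurableType d) (m : {measure set X -> \bar R}) (f g : X -> \bar R) :
  measurable_fun setT f -> measurable_fun setT g -> (forall x, 0 <= g x)%E ->
  (forall x, f x <= g x)%E -> (\int[m]_x f x <= \int[m]_x g x)%E.
Proof.
move=> mf mg g0 fg; rewrite [leLHS]integralE.
apply: (@le_trans _ _ (\int[m]_x f^\+ x)%E).
  rewrite -[leRHS]sube0; apply: leeB => //; exact: integral_ge0.
apply: ge0_le_integral => //; first exact: measurable_funepos.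
by move=> x _; rewrite funeposE ge_max fg g0.
Qed.

(** Jensen by integration of the tangent-line inequality at the mean [a] against the density [rho]:
    the linear term integrates to [0]. The right side may be infinite. *)
Lemma jump_jensen p d (X : measurableType d) (m : {measure set X -> \bar R}) (h rho : X -> R) :
  1 < p -> measurable_fun setT h -> measurable_fun setT rho -> (forall x, 0 <= rho x) ->
  m.-integrable setT (EFin \o rho) -> \int[m]_x rho x = 1 ->
  m.-integrable setT (EFin \o (h \* rho)) ->
  ((`|\int[m]_x (h x * rho x)| `^ p)%:E <= \int[m]_x (`|h x| `^ p * rho x)%:E)%E.
Proof.
move=> p1 mh mrho rho0 irho rho1 ihrho; set a := \int[m]_x (h x * rho x).
have i1 := integrableZl measurableT (`|a| `^ p - p * jump p a * a) irho.
have i2 := integrableZl measurableT (p * jump p a) ihrho.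
have i3 := integrableD measurableT i1 i2.
have -> : (`|a| `^ p)%:E = (\int[m]_x ((`|a| `^ p - p * jump p a * a) * rho x +
    p * jump p a * (h x * rho x))%:E)%E.
  rewrite -[RHS]fineK; last exact: (integrable_fin_num measurableT i3).
  rewrite -/(Rintegral _ _ _) RintegralD// !RintegralZl// rho1 -/a mulr1.
  by congr EFin; ring.
apply: le_integral_ge0 => //.
- exact: (measurable_int _ i3).
- apply/measurable_EFinP/measurable_funM => //.
  by apply: (measurableT_comp (measurable_powR p)); exact: measurableT_comp.
- by move=> x; rewrite lee_fin mulr_ge0 ?powR_ge0.
move=> x; rewrite lee_fin.
apply: le_trans (_ : (`|a| `^ p + p * (jump p a * (h x - a))) * rho x <= _).
  by rewrite le_eqVlt; apply/orP; left; apply/eqP; ring.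
by rewrite ler_wpM2r// jump_tangent.
Qed.

Lemma cvg_powR_norm p (q : nat -> R) l : 1 < p -> q @ \oo --> l ->
  `|q j| `^ p @[j --> \oo] --> `|l| `^ p.
Proof.
move=> p1 ql; have p0 : 0 <= p by lra.
 have nl : `|q j| @[j --> \oo] --> `|l| by exact: cvg_norm.
have := nl; move=> /cvgrPdist_lt/(_ _ ltr01) q1.
have C0 : 0 <= p * (`|l| + 1) `^ (p - 1) by rewrite mulr_ge0 ?powR_ge0.
apply/cvgrPdist_le => e e0.
have e1 : 0 < e / (p * (`|l| + 1) `^ (p - 1) + 1) by rewrite divr_gt0// ltr_wpDl.
move: nl => /cvgrPdist_le/(_ _ e1); apply: filterS2 q1 => j q1 q2.
have qj : 0 <= `|q j| <= `|l| + 1.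
  by rewrite normr_ge0/=; move: q1; rewrite ltr_norml => /andP[]; lra.
have lj : 0 <= `|l| <= `|l| + 1 by rewrite normr_ge0/= lerDl.
apply: le_trans (powR_sub_le p1 lj qj) _.
move: q2; rewrite ler_pdivlMr ?ltr_wpDl// => q2; apply: le_trans q2.
by rewrite mulrC ler_wpM2l// lerDl.
Qed.

(** Convergence almost everywhere without loss of norm is strong. Fatou is applied to
    [2^p (|a_j|^p + |a|^p) - |a_j - a|^p], which is nonnegative; its limit already carries the whole
    upper bound of the integrals, so nothing is left for [|a_j - a|^p]. *)
Lemma scheffe_powR p d (X : measurableType d) (m : {measure set X -> \bar R})
    (a_ : nat -> X -> R) (a k : X -> R) :
  1 < p -> (forall j, measurable_fun setT (a_ j)) -> measurable_fun setT a ->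
  measurable_fun setT k -> (forall x, 0 <= k x) ->
  (\int[m]_x (`|a x| `^ p * k x)%:E < +oo)%E ->
  (forall j, \int[m]_x (`|a_ j x| `^ p * k x)%:E <= \int[m]_x (`|a x| `^ p * k x)%:E)%E ->
  {ae m, forall x, a_ j x @[j --> \oo] --> a x} ->
  ((\int[m]_x (`|a_ j x - a x| `^ p * k x)%:E)%E @[j --> \oo] --> 0%E).
Proof.
move=> p1 ma_ ma mk k0 Aoo Ale acv; have p0 : 0 <= p by lra.
have mF (g : X -> R) : measurable_fun setT g -> measurable_fun setT (fun x => `|g x| `^ p * k x).
  move=> mg; apply: measurable_funM => //.
  by apply: (measurableT_comp (measurable_powR p)); exact: measurableT_comp.
have F0 (g : X -> R) x : 0 <= `|g x| `^ p * k x by rewrite mulr_ge0 ?powR_ge0.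
have B0 j x : 0 <= `|a_ j x - a x| `^ p * k x by rewrite mulr_ge0 ?powR_ge0.
set A := (\int[m]_x (`|a x| `^ p * k x)%:E)%E.
have Afin : A \is a fin_num by rewrite ge0_fin_numE// integral_ge0// => x _; rewrite lee_fin.
pose A_ j := (\int[m]_x (`|a_ j x| `^ p * k x)%:E)%E.
pose c : R := 2 `^ p; have c0 : 0 <= c by exact: powR_ge0.
have mS j : measurable_fun setT (fun x => c * (`|a_ j x| `^ p * k x) + c * (`|a x| `^ p * k x)).
  by apply: measurable_funD; apply: measurable_funM => //; exact: mF.
have mB j : measurable_fun setT (fun x => `|a_ j x - a x| `^ p * k x).
  by apply: (mF (fun x => a_ j x - a x)); exact: measurable_funB.
have bound j x : `|a_ j x - a x| `^ p * k x <= c * (`|a_ j x| `^ p * k x) + c * (`|a x| `^ p * k x).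
  by rewrite !mulrA -mulrDl -mulrDr ler_wpM2r// powRB_le.
have intS j : (\int[m]_x (c * (`|a_ j x| `^ p * k x) + c * (`|a x| `^ p * k x))%:E =
    c%:E * A_ j + c%:E * A)%E.
  under eq_integral do rewrite EFinD.
  rewrite ge0_integralD//=; last 4 first.
  - by move=> x _; rewrite lee_fin mulr_ge0.
  - by apply/measurable_EFinP/measurable_funM => //; exact: mF.
  - by move=> x _; rewrite lee_fin mulr_ge0.
  - by apply/measurable_EFinP/measurable_funM => //; exact: mF.
  congr (_ + _)%E; under eq_integral do rewrite EFinM;
    apply: ge0_integralZl => //; try (by move=> x _; rewrite lee_fin);
    by apply/measurable_EFinP; exact: mF.
pose u j := (\int[m]_x (`|a_ j x - a x| `^ p * k x)%:E)%E.
have u0 j : (0 <= u j)%E by apply: integral_ge0 => x _; rewrite lee_fin B0.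
have leA j : (c%:E * A_ j + c%:E * A <= c%:E * A + c%:E * A)%E.
  by apply: leeD2r; apply: lee_wpmul2l; [rewrite lee_fin|exact: Ale].
have uoo j : (u j <= c%:E * A + c%:E * A)%E.
  apply: (@le_trans _ _ (c%:E * A_ j + c%:E * A)%E); last exact: leA.
    rewrite -intS; apply: ge0_le_integral; first by [].
    - by move=> x _; rewrite lee_fin B0.
    - exact/measurable_EFinP.
    - exact/measurable_EFinP.
    - by move=> x _; rewrite lee_fin bound.
have cAfin : (c%:E * A + c%:E * A)%E \is a fin_num by rewrite fin_numD fin_numM.
have ufin j : u j \is a fin_num.
  rewrite ge0_fin_numE; last exact: u0.
  by apply: le_lt_trans (uoo j) _; rewrite -(fineK cAfin) ltry.
have A_0 j : (0 <= A_ j)%E by apply: integral_ge0 => x _; rewrite lee_fin.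
pose h j x := c * (`|a_ j x| `^ p * k x) + c * (`|a x| `^ p * k x) - `|a_ j x - a x| `^ p * k x.
have hint j : (\int[m]_x (h j x)%:E <= c%:E * A + c%:E * A - u j)%E.
  rewrite leeBrDr; last exact: ufin.
  have -> : (\int[m]_x (h j x)%:E + u j = c%:E * A_ j + c%:E * A)%E.
    rewrite -intS /u -ge0_integralD; first by apply: eq_integral => x _; rewrite -EFinD subrK.
    - by [].
    - by move=> x _; rewrite lee_fin subr_ge0 bound.
    - by apply/measurable_EFinP/measurable_funB.
    - by move=> x _; rewrite lee_fin B0.
    - exact/measurable_EFinP.
  exact: leA.
have fat : (c%:E * A + c%:E * A <= limn_einf (fun j => \int[m]_x (h j x)%:E))%E.
  have -> : (c%:E * A + c%:E * A = \int[m]_x (c * (`|a x| `^ p * k x) + c * (`|a x| `^ p * k x))%:E)%E.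
    under eq_integral do rewrite -mulrDl EFinM.
    rewrite ge0_integralZl//; last 3 first.
    - by apply/measurable_EFinP; exact: mF.
    - by move=> x _; rewrite lee_fin.
    - by rewrite lee_fin addr_ge0.
    by rewrite EFinD ge0_muleDl// lee_fin.
  apply: fatou_ae.
  - by move=> j; apply/measurable_EFinP/measurable_funB.
  - by move=> j x; rewrite lee_fin subr_ge0.
  - by apply/measurable_EFinP/measurable_funD; apply: measurable_funM => //; exact: mF.
  - by move=> x; rewrite lee_fin addr_ge0 ?mulr_ge0.
  apply: filterS acv => x ax.
  suff cA : (h j x)%:E @[j --> \oo] --> (c * (`|a x| `^ p * k x) + c * (`|a x| `^ p * k x))%:E.
    by rewrite (cvg_limn_einf_sup cA).1.
  apply: cvg_EFin; first exact: nearW.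
  rewrite -[X in _ --> X]subr0 -(mul0r (k x)) -(@powR0 _ p); last by rewrite gt_eqF//; lra.
  have cpow (q : nat -> R) l := @cvg_powR_norm p q l p1.
  apply: cvgB.
    by apply: cvgD; [apply: cvgMr; apply: cvgMl; exact: cpow|exact: cvg_cst].
  apply: cvgMl; rewrite -[X in X `^ p](@normr0 _ R); apply: (cpow (fun j => a_ j x - a x)).
  by rewrite -(subrr (a x)); apply: cvgB => //; exact: cvg_cst.
apply: cvge0P; [exact: u0|move=> e e0].
have lte : (c%:E * A + c%:E * A - e%:E < limn_einf (fun j => \int[m]_x (h j x)%:E))%E.
  by apply: lt_le_trans fat; rewrite lteBlDr// lteDl// lte_fin.
have [n Hn] := limn_einf_gt lte; exists n => j nj.
have := lt_le_trans (Hn j nj) (hint j).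
rewrite -[X in _ -> (X <= _)%E]/(u j).
move=> H; have := ufin j; move: H; case: (u j) => // r; move: cAfin; case: (c%:E * A + c%:E * A)%E => // r2 _.
by rewrite -!EFinB lte_fin lee_fin => ? _; lra.
Qed.
End integral_convergence.

(** * Mollification in [L^p] and in the energy *)

Section mollification.
Variables (R : realType) (N : nat) (s p : R).
Local Notation E := 'rV[R]_N.
Local Notation mu := (lebesgue_rV R N).
Implicit Types (f rho : E -> R).

Lemma measurable_powR_norm d (X : measurableType d) (g : X -> R) :
  measurable_fun setT g -> measurable_fun setT (fun x => `|g x| `^ p).
Proof.
by move=> mg; apply: (measurableT_comp (measurable_powR p)); exact: measurableT_comp.
Qed.

Lemma integrable_ge0 d (X : measurableType d) (m : {measure set X -> \bar R}) (g : X -> R) :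
  measurable_fun setT g -> (forall x, 0 <= g x) -> (\int[m]_x (g x)%:E < +oo)%E ->
  m.-integrable setT (EFin \o g).
Proof.
move=> mg g0 goo; apply/integrableP; split; first exact/measurable_EFinP.
by under eq_integral do rewrite gee0_abs ?lee_fin//.
Qed.

Lemma integral_scalel d (X : measurableType d) (m : {measure set X -> \bar R}) (k : R) (g : X -> R) :
  measurable_fun setT g -> (forall x, 0 <= g x) -> 0 <= k ->
  (\int[m]_x (k * g x)%:E = k%:E * \int[m]_x (g x)%:E)%E.
Proof.
move=> mg g0 k0; under eq_integral do rewrite EFinM.
by apply: ge0_integralZl_EFin => //; [move=> x _; rewrite lee_fin|exact/measurable_EFinP].
Qed.

Lemma integral_scaler d (X : measurableType d) (m : {measure set X -> \bar R}) (k : R) (g : X -> R) :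
  measurable_fun setT g -> (forall x, 0 <= g x) -> 0 <= k ->
  (\int[m]_x (g x * k)%:E = \int[m]_x (g x)%:E * k%:E)%E.
Proof.
by move=> mg g0 k0; rewrite muleC -integral_scalel//; under eq_integral do rewrite mulrC.
Qed.

Lemma integral_add d (X : measurableType d) (m : {measure set X -> \bar R}) (f g : X -> R) :
  measurable_fun setT f -> (forall x, 0 <= f x) ->
  measurable_fun setT g -> (forall x, 0 <= g x) ->
  (\int[m]_x (f x + g x)%:E = \int[m]_x (f x)%:E + \int[m]_x (g x)%:E)%E.
Proof.
move=> mf f0 mg g0; under eq_integral do rewrite EFinD.
by apply: ge0_integralD => //; try (by move=> x _; rewrite lee_fin); exact/measurable_EFinP.
Qed.

Lemma integral_mono d (X : measurableType d) (m : {measure set X -> \bar R}) (f g : X -> R) :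
  measurable_fun setT f -> (forall x, 0 <= f x) -> measurable_fun setT g ->
  (forall x, f x <= g x) -> (\int[m]_x (f x)%:E <= \int[m]_x (g x)%:E)%E.
Proof.
move=> mf f0 mg fg; apply: ge0_le_integral => //; try (by move=> x _; rewrite lee_fin);
  exact/measurable_EFinP.
Qed.

Lemma measurable_shiftD d (f : E -> R) (X : measurableType d) (g h : X -> E) :
  measurable_fun setT f -> measurable_fun setT g -> measurable_fun setT h ->
  measurable_fun setT (fun x => f (g x + h x)).
Proof. by move=> mf mg mh; apply: (measurableT_comp mf); exact: measurable_rVD. Qed.

Lemma ge0_integral_shift (b : E) (f : E -> \bar R) : measurable_fun setT f ->
  (forall x, 0 <= f x)%E -> (\int[mu]_x f x = \int[mu]_x f (x + b)%R)%E.
Proof.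
move=> mf f0; rewrite (ge0_integral_affine_rV b ltr01 mf f0) expr1n mul1e.
by apply: eq_integral => x _; rewrite scale1r.
Qed.

Lemma Rintegral_shift (b : E) f : measurable_fun setT f ->
  \int[mu]_x f x = \int[mu]_x f (x + b).
Proof.
move=> mf; have mE : measurable_fun setT (EFin \o f) by exact/measurable_EFinP.
rewrite /Rintegral; congr fine; rewrite [LHS]integralE [RHS]integralE; congr (_ - _)%E.
- rewrite (ge0_integral_shift b (measurable_funepos mE)) => [|x]; last exact: funepos_ge0.
  by apply: eq_integral => x _; rewrite !funeposE.
- rewrite (ge0_integral_shift b (measurable_funeneg mE)) => [|x]; last exact: funeneg_ge0.
  by apply: eq_integral => x _; rewrite !funenegE.
Qed.

(** [nu_density s p x y] is [nu0 (x - y)] by conversion; the one-variable form is suited to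
    translations and scaling. *)
Definition nu0 (z : E) : R := (enorm z `^ (N%:R + p * s))^-1.

Lemma nu0_ge0 z : 0 <= nu0 z. Proof. by rewrite invr_ge0 powR_ge0. Qed.

Lemma measurable_inv : measurable_fun [set: R] (fun x : R => x^-1).
Proof.
have E0 : measurable [set x : R | x != 0].
  by apply: open_measurable; exact: open_neq.
rewrite -(setUv [set x : R | x != 0]); apply/measurable_funU => //; first exact: measurableC.
split.
  apply: open_continuous_measurable_fun; first exact: open_neq.
  by move=> x /set_mem /= x0; exact: inv_continuous.
have : measurable_fun (~` [set x : R | x != 0]) (cst (0 : R)) by exact: measurable_cst.
apply: eq_measurable_fun; move=> x /set_mem /= /negP; by rewrite negbK => /eqP ->; rewrite invr0.
Qed.

Lemma measurable_nu0 d (X : measurableType d) (g : X -> E) :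
  measurable_fun setT g -> measurable_fun setT (fun x => nu0 (g x)).
Proof.
move=> mg; apply: (measurableT_comp measurable_inv).
by apply: (measurableT_comp (measurable_powR _)); exact: measurable_enorm.
Qed.

Lemma nu0N z : nu0 (- z) = nu0 z.
Proof.
rewrite /nu0 /enorm /dotp; congr ((Num.sqrt _ `^ _)^-1).
by apply: eq_bigr => i _; rewrite mxE mulrNN.
Qed.

(** The energy becomes a superposition over increments [z] of [L^p] norms of [f (z + x) - f x].
    Convolution commutes with translation, so energy estimates reduce to [L^p] estimates for each
    fixed [z]. *)
Lemma gagliardo_shift f : measurable_fun setT f ->
  gagliardo s p setT f =
  (\int[mu]_z (\int[mu]_x (`|f (z + x)%R - f x| `^ p)%:E * (nu0 z)%:E))%E.
Proof.
move=> mf; transitivity (\int[mu]_x \int[mu]_z (`|f (z + x)%R - f x| `^ p * nu0 z)%:E)%E; last first.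
  rewrite (tonelli_swap mu mu (f := fun x z => (`|f (z + x) - f x| `^ p * nu0 z)%:E)); last 2 first.
  - apply/measurable_EFinP/measurable_funM; last exact: measurable_nu0.
    apply/measurable_powR_norm/measurable_funB; last exact: measurableT_comp.
    exact: measurable_shiftD.
  - by move=> x y; rewrite lee_fin mulr_ge0 ?powR_ge0 ?nu0_ge0.
  apply: eq_integral => z _; rewrite integral_scaler ?nu0_ge0//.
  apply/measurable_powR_norm/measurable_funB => //.
  by apply: measurable_shiftD => //; exact: measurable_cst.
rewrite /gagliardo.
have mF : measurable_fun [set: E * E] (fun z => (`|f z.1 - f z.2| `^ p * nu0 (z.1 - z.2))%:E).
  apply/measurable_EFinP/measurable_funM.
    by apply/measurable_powR_norm/measurable_funB; exact: measurableT_comp.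
  by apply/measurable_nu0/measurable_rVB.
rewrite (tonelli_prod mu mu (f := fun x y => (`|f x - f y| `^ p * nu0 (x - y))%:E) mF); last first.
  by move=> x y; rewrite lee_fin mulr_ge0 ?powR_ge0 ?nu0_ge0.
apply: eq_integral => x _.
rewrite [LHS](ge0_integral_shift x); last 2 first.
- exact: (measurableT_comp mF (measurable_pair1 x)).
- by move=> y; rewrite lee_fin mulr_ge0 ?powR_ge0 ?nu0_ge0.
apply: eq_integral => z _; rewrite distrC -nu0N; congr (_ * nu0 _)%:E.
by rewrite opprB addrK.
Qed.

Section kernel.
Variables (rho : E -> R) (M r : R).
Hypotheses (p1 : 1 < p) (N0 : 0 <= N%:R + p * s) (r0 : 0 < r).
Hypotheses (mrho : measurable_fun setT rho) (rho0 : forall z, 0 <= rho z).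
Hypotheses (rhoM : forall z, rho z <= M) (rhor : forall z, r <= `|z| -> rho z = 0).
Hypotheses (rho1 : (\int[mu]_z (rho z)%:E = 1)%E).

Let p0 : 0 < p. Proof. exact: lt_trans p1. Qed.

Let M0 : 0 <= M. Proof. exact: le_trans (rho0 0) (rhoM 0). Qed.

Let mshift x : measurable_fun setT (fun y : E => rho (y - x)).
Proof. by apply: measurable_shiftD => //; exact: measurable_cst. Qed.

Let rho_shift x : (\int[mu]_y (rho (y - x))%:E = 1)%E.
Proof.
rewrite -[RHS]rho1 [RHS](ge0_integral_shift (- x))//; exact/measurable_EFinP.
Qed.

Let irho x : mu.-integrable setT (EFin \o (fun y => rho (y - x))).
Proof.
by apply: integrable_ge0 => //; rewrite rho_shift ltry.
Qed.

Section Lp_function.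
Variable f : E -> R.
Hypotheses (mf : measurable_fun setT f) (fp : (\int[mu]_x (`|f x| `^ p)%:E < +oo)%E).

Let ifp : mu.-integrable setT (EFin \o (fun x => `|f x| `^ p)).
Proof.
apply: integrable_ge0 => //; exact: measurable_powR_norm.
Qed.

(** Since [|f| <= 1] or [|f| <= |f|^p], the integrand is at most [rho + M |f|^p]. *)
Lemma integrable_conv x : mu.-integrable setT (EFin \o (fun y => f y * rho (y - x))).
Proof.
have := integrableD measurableT (irho x) (integrableZl measurableT M ifp).
apply: le_integrable => //; first exact/measurable_EFinP/measurable_funM.
move=> y _ /=; have S0 : 0 <= rho (y - x) + M * `|f y| `^ p by rewrite addr_ge0 ?mulr_ge0 ?powR_ge0.
rewrite lee_fin normrM (ger0_norm (rho0 _)) (ger0_norm S0).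
have [f1|f1] := leP `|f y| 1.
  apply: (@le_trans _ _ (1 * rho (y - x))); first by rewrite ler_wpM2r.
  by rewrite mul1r lerDl mulr_ge0 ?powR_ge0.
apply: (@le_trans _ _ (M * `|f y| `^ p)); last by rewrite lerDr.
rewrite mulrC; apply: ler_pM => //; rewrite -[leLHS]powRr1//.
by apply: ler_powR; [exact: ltW|exact: ltW].
Qed.

(** The kernel is a probability density, so constants commute with [conv]. The value [c = 0] gives
    norm bounds, and [c = f x] gives the distance to [f]. *)
Lemma conv_jensen x c :
  ((`|conv f rho x - c| `^ p)%:E <= \int[mu]_y (`|f y - c| `^ p * rho (y - x))%:E)%E.
Proof.
have icr := integrableZl measurableT c (irho x).
have ifr := integrable_conv x.
have -> : conv f rho x - c = \int[mu]_y ((f y - c) * rho (y - x)).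
  transitivity (\int[mu]_y (f y * rho (y - x) - c * rho (y - x))); last first.
    by apply: eq_Rintegral => y _; rewrite mulrBl.
  rewrite RintegralB; [|by []|exact: ifr|exact: icr].
  rewrite (RintegralZl c measurableT (irho x)).
  by rewrite /Rintegral rho_shift/= mulr1.
apply: jump_jensen => //.
- exact: measurable_funB.
- by rewrite /Rintegral rho_shift.
- have := integrableB measurableT ifr icr; congr (integrable _ _ _).
  by apply/funext => y; rewrite /= mulrBl EFinB.
Qed.

Lemma measurable_conv : measurable_fun setT (conv f rho).
Proof.
have := @measurable_Rintegral_snd _ _ _ _ _ mu (fun x y : E => f y * rho (y - x)); apply.
apply: measurable_funM; first exact: measurableT_comp.
by apply: (measurableT_comp mrho); exact: measurable_rVB.
Qed.

(** The weight [c] localizes the bound: [c = 1] gives boundedness, and the indicator of the exterior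
    of a large box gives decay at infinity. *)
Lemma conv_powR_le x (c : E -> R) : measurable_fun setT c -> (forall y, 0 <= c y) ->
  (forall y, `|y - x| < r -> 1 <= c y) ->
  ((`|conv f rho x| `^ p)%:E <= M%:E * \int[mu]_y (`|f y| `^ p * c y)%:E)%E.
Proof.
move=> mc c0 c1; have := conv_jensen x 0; rewrite subr0 => /le_trans; apply.
have mfc : measurable_fun setT (fun y => `|f y| `^ p * c y).
  by apply: measurable_funM => //; exact: measurable_powR_norm.
rewrite -integral_scalel//; last by move=> y; rewrite mulr_ge0 ?powR_ge0.
apply: integral_mono.
- by apply: measurable_funM => //; apply: measurable_powR_norm; exact: measurable_funB.
- by move=> y; rewrite mulr_ge0 ?powR_ge0.
- exact: measurable_funM.
move=> y; rewrite subr0 mulrCA; apply: ler_wpM2l; first exact: powR_ge0.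
have [yr|yr] := ltP `|y - x| r.
  by apply: le_trans (rhoM _) _; rewrite ler_peMr// c1.
by rewrite rhor ?mulr_ge0.
Qed.

(** [conv f rho x] sees only the values of [f] within distance [r] of [x], and the integral of
    [|f|^p] over the exterior of growing boxes tends to [0]. *)
Lemma conv_decay (e : R) : 0 < e -> exists2 r' : R, 0 < r' & forall x, r' <= `|x| -> `|conv f rho x| <= e.
Proof.
move=> e0; pose c (k : nat) (y : E) : R := if k%:R <= `|y| then 1 else 0.
have mc k : measurable_fun setT (c k).
  apply: measurable_fun_ifT => //; apply: measurable_fun_ler => //.
  exact: measurable_norm_rV.
have c0 k y : 0 <= c k y by rewrite /c; case: ifP.
have mfp := measurable_powR_norm mf.
have mfc k : measurable_fun setT (fun y => (`|f y| `^ p * c k y)%:E).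
  by apply/measurable_EFinP/measurable_funM.
have H : (\int[mu]_y (`|f y| `^ p * c k y)%:E)%E @[k --> \oo] --> 0%E.
  have cv : {ae mu, forall x, setT x -> (`|f x| `^ p * c k x)%:E @[k --> \oo] --> (cst 0%E : E -> \bar R) x}.
    apply: aeW => x _; apply: cvg_near_cst; near=> k.
    have xk : `|x| < k%:R by near: k; exact: nbhs_infty_gtr.
    by rewrite /c leNgt xk/= mulr0.
  have dom : {ae mu, forall x k, setT x -> (`|(`|f x| `^ p * c k x)%:E| <= (`|f x| `^ p)%:E)%E}.
    apply: aeW => x k _; rewrite gee0_abs ?lee_fin ?mulr_ge0 ?powR_ge0//.
    by rewrite ler_piMr ?powR_ge0// /c; case: ifP.
  have [_ _] := @dominated_convergence _ _ _ mu setT measurableT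
    (fun k y => (`|f y| `^ p * c k y)%:E) (cst 0%E) (fun y => (`|f y| `^ p)%:E)
    mfc (measurable_cst _) cv ifp dom.
  by rewrite integral0.
have ep : 0 < e `^ p / (M + 1) by rewrite divr_gt0 ?powR_gt0// ltr_wpDl.
have fin0 : (0 : \bar R) \is a fin_num by [].
have [k _ Hk] : \forall k \near \oo, (\int[mu]_y (`|f y| `^ p * c k y)%:E < (e `^ p / (M + 1))%:E)%E.
  move: H => /fine_cvgP[Hf /cvgr_lt/(_ _ ep)]; apply: filterS2 Hf => k kf.
  by rewrite /= -lte_fin fineK.
exists (k%:R + r); first by rewrite ltr_wpDl.
move=> x xk; rewrite leNgt; apply/negP => ex.
have := @conv_powR_le x (c k) (mc k) (c0 k).
have cx y : `|y - x| < r -> 1 <= c k y.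
  move=> yx; rewrite /c ifT//.
  have := ler_normB y (y - x); rewrite opprB addrCA subrr addr0 => h.
  by move: xk yx; lra.
move=> /(_ cx); rewrite leNgt => /negP; apply.
apply: (@le_lt_trans _ _ (M%:E * (e `^ p / (M + 1))%:E)%E).
  by apply: lee_wpmul2l; [rewrite lee_fin|apply: ltW; apply: Hk => /=].
rewrite -EFinM lte_fin; apply: (@le_lt_trans _ _ (e `^ p)).
  by rewrite mulrCA ler_piMr ?powR_ge0// ler_pdivrMr ?ltr_wpDl// mul1r lerDl.
by apply: gt0_ltr_powR; rewrite ?nnegrE// ltW.
Unshelve. all: by end_near. Qed.

End Lp_function.

Lemma integral_conv_nonneg (F : E -> R) : measurable_fun setT F -> (forall x, 0 <= F x) ->
  (\int[mu]_x \int[mu]_y (F y * rho (y - x))%:E = \int[mu]_x (F x)%:E)%E.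
Proof.
move=> mF F0.
transitivity (\int[mu]_x \int[mu]_y (F (y + x) * rho y)%:E)%E.
  apply: eq_integral => x _; rewrite [LHS](ge0_integral_shift x); last 2 first.
  - exact/measurable_EFinP/measurable_funM.
  - by move=> y; rewrite lee_fin mulr_ge0.
  by apply: eq_integral => y _; rewrite addrK.
rewrite (tonelli_swap mu mu (f := fun x y => (F (y + x) * rho y)%:E)); last 2 first.
- apply/measurable_EFinP/measurable_funM; last exact: measurableT_comp.
  exact: measurable_shiftD.
- by move=> x y; rewrite lee_fin mulr_ge0.
transitivity (\int[mu]_y ((\int[mu]_x (F x)%:E) * (rho y)%:E))%E.
  apply: eq_integral => y _.
  rewrite integral_scaler//; last by apply: measurable_shiftD => //; exact: measurable_cst.
  congr (_ * _)%E; rewrite [RHS](ge0_integral_shift y).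
  - by apply: eq_integral => x _; rewrite addrC.
  - exact/measurable_EFinP.
  - by move=> x; rewrite lee_fin.
rewrite ge0_integralZl; [|by []|exact/measurable_EFinP|by move=> x _; rewrite lee_fin|].
  by rewrite rho1 mule1.
by apply: integral_ge0 => x _; rewrite lee_fin.
Qed.

Section gagliardo_conv.
Variable f : E -> R.
Hypotheses (mf : measurable_fun setT f) (fp : (\int[mu]_x (`|f x| `^ p)%:E < +oo)%E).

Let df z y := f (y + z) - f y.

Let mdf z : measurable_fun setT (df z).
Proof. by apply: measurable_funB => //; apply: measurable_shiftD => //; exact: measurable_cst. Qed.

Let dfp z : (\int[mu]_x (`|df z x| `^ p)%:E < +oo)%E.
Proof.
have mz : measurable_fun setT (fun y : E => f (y + z)).
  by apply: measurable_shiftD => //; exact: measurable_cst.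
have mp := measurable_powR_norm mf; have mpz := measurable_powR_norm mz.
apply: (@le_lt_trans _ _ (\int[mu]_x (2 `^ p * `|f (x + z)%R| `^ p + 2 `^ p * `|f x| `^ p)%:E)%E).
  apply: integral_mono.
  - exact: measurable_powR_norm.
  - by move=> x; exact: powR_ge0.
  - by apply: measurable_funD; exact: measurable_funM.
  - by move=> x; rewrite -mulrDr; apply: powRB_le; exact: ltW.
rewrite integral_add; last 4 first.
- exact: measurable_funM.
- by move=> x; rewrite mulr_ge0 ?powR_ge0.
- exact: measurable_funM.
- by move=> x; rewrite mulr_ge0 ?powR_ge0.
rewrite !integral_scalel ?powR_ge0//; try by move=> x; exact: powR_ge0.
rewrite -(ge0_integral_shift z (f := fun x => (`|f x| `^ p)%:E)); last 2 first.
- exact/measurable_EFinP.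
- by move=> x; rewrite lee_fin powR_ge0.
by rewrite lte_add_pinfty// lte_mul_pinfty// lee_fin powR_ge0.
Qed.

Let conv_df z x : conv (df z) rho x = conv f rho (z + x) - conv f rho x.
Proof.
have i1 := integrable_conv mf fp x.
have mg : measurable_fun setT (fun y => f y * rho (y - (z + x))) by exact: measurable_funM.
have i2 := integrable_conv (mdf z) (dfp z) x.
have -> : conv f rho (z + x) = \int[mu]_y (f (y + z) * rho (y - x)).
  rewrite /conv (Rintegral_shift z mg); apply: eq_Rintegral => y _.
  by congr (_ * rho _); rewrite opprD addrA addrK.
have i3 : mu.-integrable setT (EFin \o (fun y => f (y + z) * rho (y - x))).
  have := integrableD measurableT i2 i1; congr (integrable _ _ _).
  by apply/funext => y; rewrite /= -EFinD /df; congr EFin; ring.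
by rewrite /conv -RintegralB//; apply: eq_Rintegral => y _; rewrite /df mulrBl.
Qed.

(** For each increment [z], the difference of the convolution is the convolution of the difference
    [df z]; Jensen and Tonelli then show that averaging does not increase the [L^p] norm. *)
Lemma gagliardo_conv_le : (gagliardo s p setT (conv f rho) <= gagliardo s p setT f)%E.
Proof.
have mc := measurable_conv mf.
rewrite (gagliardo_shift mf) (gagliardo_shift mc).
have m0 (g : E -> R) : measurable_fun setT g -> measurable_fun setT (fun z : E =>
    \int[mu]_x (`|g (z + x)%R - g x| `^ p)%:E * (nu0 z)%:E)%E.
  move=> mg; apply: emeasurable_funM; last exact/measurable_EFinP/measurable_nu0.
  apply: (measurable_integral_snd mu (f := fun z x : E => (`|g (z + x) - g x| `^ p)%:E)).
    apply/measurable_EFinP/measurable_powR_norm/measurable_funB; last exact: measurableT_comp.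
    exact: measurable_shiftD.
  by move=> x z; rewrite lee_fin powR_ge0.
apply: ge0_le_integral; [by []| |exact: m0|exact: m0|].
  move=> z _; rewrite mule_ge0 ?lee_fin ?nu0_ge0//.
  by apply: integral_ge0 => x _; rewrite lee_fin powR_ge0.
move=> z _.
have mcz : measurable_fun setT (fun x => conv f rho (z + x) - conv f rho x).
  by apply: measurable_funB => //; apply: measurable_shiftD => //; exact: measurable_cst.
have mfz : measurable_fun setT (fun x => f (z + x) - f x).
  by apply: measurable_funB => //; apply: measurable_shiftD => //; exact: measurable_cst.
rewrite lee_wpmul2r ?lee_fin ?nu0_ge0//.
have -> : (\int[mu]_x (`|f (z + x)%R - f x| `^ p)%:E = \int[mu]_x (`|df z x| `^ p)%:E)%E.
  by apply: eq_integral => x _; rewrite /df [x + z]addrC.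
rewrite -[leRHS](integral_conv_nonneg (measurable_powR_norm (mdf z)) (fun x => powR_ge0 _ _)).
apply: ge0_le_integral => //.
- by apply/measurable_EFinP; exact: measurable_powR_norm.
- apply: (measurable_integral_snd mu (f := fun x y : E => (`|df z y| `^ p * rho (y - x))%:E)).
    apply/measurable_EFinP/measurable_funM.
      by apply: measurable_powR_norm; exact: measurableT_comp.
    by apply: (measurableT_comp mrho); exact: measurable_rVB.
  by move=> x y; rewrite lee_fin mulr_ge0 ?powR_ge0.
move=> x _; rewrite -conv_df.
have := conv_jensen (mdf z) (dfp z) x 0; rewrite subr0 => /le_trans; apply.
by under eq_integral do rewrite subr0.
Qed.

(** On the support of the kernel [|x - y| < r], hence [1 <= (sqrt N r)^(N + ps) nu0 (x - y)]: the
    [L^p] error is paid by the energy, with an explicit rate in [r]. *)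
Lemma conv_sub_le : (\int[mu]_x (`|conv f rho x - f x| `^ p)%:E <=
  (M * (Num.sqrt N%:R * r) `^ (N%:R + p * s))%:E * gagliardo s p setT f)%E.
Proof.
set C := (_ `^ _ : R); have C0 : 0 <= C by exact: powR_ge0.
have mc := measurable_conv mf.
have mF : measurable_fun [set: E * E] (fun z => (`|f z.1 - f z.2| `^ p * nu0 (z.1 - z.2))%:E).
  apply/measurable_EFinP/measurable_funM.
    by apply/measurable_powR_norm/measurable_funB; exact: measurableT_comp.
  by apply/measurable_nu0/measurable_rVB.
have F0 x y : (0 <= (`|f x - f y| `^ p * nu0 (x - y))%:E)%E.
  by rewrite lee_fin mulr_ge0 ?powR_ge0 ?nu0_ge0.
rewrite /gagliardo (tonelli_prod mu mu (f := fun x y => (`|f x - f y| `^ p * nu0 (x - y))%:E) mF F0).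
rewrite -ge0_integralZl; last 4 first.
- by [].
- exact: (measurable_integral_snd mu (f := fun x y => (`|f x - f y| `^ p * nu0 (x - y))%:E)).
- by move=> x _; apply: integral_ge0.
- by rewrite lee_fin mulr_ge0.
apply: ge0_le_integral; [by []|by move=> x _; rewrite lee_fin powR_ge0|
  by apply/measurable_EFinP/measurable_powR_norm/measurable_funB| |].
  apply: measurable_funeM.
  exact: (measurable_integral_snd mu (f := fun x y => (`|f x - f y| `^ p * nu0 (x - y))%:E)).
move=> x _; apply: le_trans (conv_jensen mf fp x (f x)) _.
have mFx : measurable_fun setT (fun y => `|f x - f y| `^ p * nu0 (x - y)).
  by have /measurable_EFinP := measurableT_comp mF (measurable_pair1 x).
rewrite -integral_scalel ?mulr_ge0//; last by move=> y; rewrite mulr_ge0 ?powR_ge0 ?nu0_ge0.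
apply: integral_mono.
- by apply: measurable_funM => //; apply: measurable_powR_norm; exact: measurable_funB.
- by move=> y; rewrite mulr_ge0 ?powR_ge0.
- exact: measurable_funM.
move=> y; rewrite distrC mulrCA; have [->|yx] := eqVneq y x.
  by rewrite subrr normr0 powR0 ?mul0r// gt_eqF.
apply: ler_wpM2l; first exact: powR_ge0.
have [yr|yr] := leP r `|y - x|; first by rewrite rhor// !mulr_ge0 ?nu0_ge0.
apply: le_trans (rhoM _) _; rewrite -[leLHS]mulr1 -mulrA; apply: ler_wpM2l => //.
have xy0 : 0 < enorm (x - y).
  by apply: lt_le_trans (norm_le_enorm _); rewrite normr_gt0 subr_eq0 eq_sym.
rewrite /nu0 ler_pdivlMr ?powR_gt0// mul1r; apply: ge0_ler_powR => //.
- by rewrite nnegrE sqrtr_ge0.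
- by rewrite nnegrE mulr_ge0 ?sqrtr_ge0 ?ltW.
- apply: le_trans (enorm_le_norm _) _; apply: ler_wpM2l; first exact: sqrtr_ge0.
  by rewrite distrC ltW.
Qed.

End gagliardo_conv.
End kernel.
End mollification.

Section mollifier.
Variables (R : realType) (N : nat).
Local Notation E := 'rV[R]_N.
Local Notation mu := (lebesgue_rV R N).

Lemma smoothn_measurable (f : E -> R) : smoothn 1 f -> measurable_fun setT f.
Proof. by move=> /smoothn_continuous; exact: continuous_measurable_rV. Qed.

Lemma integral_box_le (f : E -> R) (B r : R) : 0 < r -> measurable_fun setT f ->
  (forall x, 0 <= f x <= B) -> (forall x, r <= `|x| -> f x = 0) ->
  (\int[mu]_x (f x)%:E < +oo)%E.
Proof.
move=> r0 mf fB fr; have mb := @measurable_box R N r.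
have B0 : 0 <= B by have /andP[h1 h2] := fB 0; exact: le_trans h2.
apply: (@le_lt_trans _ _ (\int[mu]_(x in [set x : E | (`|x| < r)%R]) B%:E)%E).
  rewrite [leRHS]integral_mkcond; apply: ge0_le_integral => //.
  - by move=> x _; rewrite lee_fin; have /andP[] := fB x.
  - exact/measurable_EFinP.
  - by apply/(measurable_restrictT _ mb); exact: measurable_cst.
  move=> x _; rewrite patchE; case: ifPn => [_|xr].
    by rewrite lee_fin; have /andP[] := fB x.
  by rewrite fr// leNgt; apply: contra xr => ?; exact: mem_set.
rewrite integral_cst; last exact: mb.
by rewrite [X in (_ * X)%E](lebesgue_rV_box N r0) -EFinM ltry.
Qed.

Lemma bump_integral : exists2 k : R, 0 < k & (\int[mu]_x (bump x)%:E = k%:E)%E.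
Proof.
have [C C0 bC] := smoothn_bounded (@smoothn_bump R N 0).
have mb : measurable_fun setT (@bump R N) by apply: smoothn_measurable; exact: smoothn_bump.
have ioo : (\int[mu]_x (bump x)%:E < +oo)%E.
  apply: (@integral_box_le _ C 1) => // x; last exact: bump_eq0.
  by rewrite bump_ge0/= (le_trans (ler_norm _)).
have i0 : (0 <= \int[mu]_x (bump x)%:E)%E by apply: integral_ge0 => x _; rewrite lee_fin bump_ge0.
have ifin : (\int[mu]_x (bump x)%:E)%E \is a fin_num by rewrite ge0_fin_numE.
exists (fine (\int[mu]_x (bump x)%:E)%E); last by rewrite fineK.
rewrite lt_neqAle fine_ge0// andbT eq_sym; apply/eqP => E0.
have : (\int[mu]_x `|(bump x)%:E| = 0)%E.
  under eq_integral do rewrite gee0_abs ?lee_fin ?bump_ge0//.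
  by rewrite -[LHS]fineK// E0.
have mE : measurable_fun setT (fun x : E => (bump x)%:E) by exact/measurable_EFinP.
move/(ae_eq_integral_abs _ measurableT mE) => [A [mA A0 HA]].
have : (mu [set x : E | (`|x| < 1)%R] <= mu A)%E.
  apply: le_measure; rewrite ?inE//; first exact: measurable_box.
  move=> x /= x1; apply: HA => /= H0; have := bump_gt0 x1.
  by case: (H0 I) => ->; rewrite ltxx.
by rewrite lebesgue_rV_box// A0 lee_fin leNgt exprn_gt0.
Qed.

(** The height bound [M0 d^N] with [M0] independent of [d] is recorded because it cancels the volume
    factor in [conv_sub_le]. *)
Lemma mollifier_exists : exists2 M0 : R, 0 <= M0 & forall d : R, 0 < d ->
  exists rho : E -> R, [/\ forall k, smoothn k rho, forall z, 0 <= rho z,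
    forall z, rho z <= M0 * d ^+ N, forall z, d^-1 <= `|z| -> rho z = 0 &
    (\int[mu]_z (rho z)%:E = 1)%E].
Proof.
have [k k0 Ek] := bump_integral.
have [C C0 bC] := smoothn_bounded (@smoothn_bump R N 0).
exists (k^-1 * C); first by rewrite mulr_ge0// invr_ge0 ltW.
move=> d d0; have dN0 : 0 <= d ^+ N by rewrite exprn_ge0// ltW.
have c0 : 0 <= k^-1 * d ^+ N by rewrite mulr_ge0// invr_ge0 ltW.
have mb : measurable_fun setT (@bump R N) by apply: smoothn_measurable; exact: smoothn_bump.
exists (fun z => (k^-1 * d ^+ N) * bump (d *: z + 0)); split.
- by move=> j; apply: (smoothnM (smoothn_cst _ j (k^-1 * d ^+ N))); apply: smoothn_affine; exact: smoothn_bump.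
- by move=> z; rewrite mulr_ge0// bump_ge0.
- move=> z; rewrite mulrAC; apply: ler_wpM2r => //; apply: ler_wpM2l; first by rewrite invr_ge0 ltW.
  exact: le_trans (ler_norm _) (bC _).
- move=> z; rewrite addr0 => dz; rewrite bump_eq0 ?mulr0// normrZ gtr0_norm//.
  by rewrite -ler_pdivrMl// mulr1.
have mbd : measurable_fun setT (fun z : E => bump (d *: z + 0)).
  by apply: smoothn_measurable; apply: smoothn_affine; exact: smoothn_bump.
rewrite integral_scalel//; last by move=> x; exact: bump_ge0.
have := ge0_integral_affine_rV (0 : E) d0 (f := fun x => (bump x)%:E).
rewrite Ek => H; rewrite EFinM -muleA -H; last 2 first.
- exact/measurable_EFinP.
- by move=> x; rewrite lee_fin bump_ge0.
by rewrite -EFinM mulVf// gt_eqF.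
Qed.

Variables (s p : R).

(* The [L^p] error is summable along a geometric sequence of scales, and strong
   convergence of the energy then follows from Jensen's inequality by a Scheffe
   type argument. *)
Lemma mollified_approximation (r : R) (f : E -> R) : 1 < p -> 0 < p * s -> 0 < r ->
  measurable_fun setT f -> (\int[mu]_x (`|f x| `^ p)%:E < +oo)%E ->
  (gagliardo s p setT f < +oo)%E ->
  exists rho : nat -> E -> R,
    (forall j, exists M, [/\ forall k, smoothn k (rho j), forall z, 0 <= rho j z,
      forall z, rho j z <= M, forall z, r <= `|z| -> rho j z = 0 &
      (\int[mu]_z (rho j z)%:E = 1)%E]) /\
    (forall j, gagliardo s p setT (conv f (rho j)) <= gagliardo s p setT f)%E /\
    [/\ ((\int[mu]_x (`|conv f (rho j) x - f x| `^ p)%:E)%E @[j --> \oo] --> 0%E),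
      {ae mu, forall x, conv f (rho j) x @[j --> \oo] --> f x} &
      (gagliardo s p setT (fun x => conv f (rho j) x - f x) @[j --> \oo] --> 0%E)].
Proof.
move=> p1 ps r0 mf fp fg; have p0 : 0 < p by exact: lt_trans p1.
have N0 : 0 <= N%:R + p * s by rewrite addr_ge0// ltW.
have [M0 M00 HM] := mollifier_exists.
pose d (j : nat) : R := r^-1 * 2 ^+ j.
have d0 j : 0 < d j by rewrite mulr_gt0 ?invr_gt0 ?exprn_gt0.
have /choice[rho Hrho] j := HM (d j) (d0 j).
have drV j : 0 < (d j)^-1 by rewrite invr_gt0.
have dr j : (d j)^-1 <= r.
  have j1 : (1 : R) <= 2 ^+ j by apply: exprn_ege1; rewrite ler1n.
  rewrite /d invfM invrK -[leRHS]mulr1; apply: ler_wpM2l; first exact: ltW.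
  by rewrite invf_le1// exprn_gt0.
have rhor j z : r <= `|z| -> rho j z = 0.
  by have [_ _ _ h _] := Hrho j; move=> rz; apply: h; exact: le_trans rz.
exists rho; split.
  by move=> j; exists (M0 * d j ^+ N); have [h1 h2 h3 h4 h5] := Hrho j; split => //; exact: rhor.
have mrho j : measurable_fun setT (rho j).
  by have [h1 _ _ _ _] := Hrho j; exact: smoothn_measurable.
have mc j : measurable_fun setT (conv f (rho j)) by apply: measurable_conv.
have gle j : (gagliardo s p setT (conv f (rho j)) <= gagliardo s p setT f)%E.
  have [h1 h2 h3 h4 h5] := Hrho j.
  exact: (gagliardo_conv_le s p1 (mrho j) h2 h3 h5 mf fp).
(* Height [M0 d^N] and width [1/d] leave an [L^p] error of order [d^(-ps)]; [q] is its ratio when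
   [d] doubles, and [0 < ps] makes it smaller than [1]. *)
pose q := 2 `^ (- (p * s)); pose C := M0 * (Num.sqrt N%:R) `^ (N%:R + p * s) * (r^-1) `^ (- (p * s)).
have C0 : 0 <= C by rewrite !mulr_ge0// powR_ge0.
have q0 : 0 <= q by exact: powR_ge0.
have g0 : (0 <= gagliardo s p setT f)%E.
  by apply: integral_ge0 => z _; rewrite lee_fin mulr_ge0 ?powR_ge0// invr_ge0 powR_ge0.
pose G := fine (gagliardo s p setT f).
have EG : gagliardo s p setT f = G%:E by rewrite /G fineK// ge0_fin_numE.
have G0 : 0 <= G by rewrite fine_ge0.
have err j : (\int[mu]_x (`|conv f (rho j) x - f x| `^ p)%:E <= (C * G * q ^+ j)%:E)%E.
  have [h1 h2 h3 h4 h5] := Hrho j.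
  apply: le_trans (conv_sub_le p1 N0 (drV j) (mrho j) h2 h3 h4 h5 mf fp) _.
  rewrite EG -EFinM lee_fin le_eqVlt; apply/orP; left; apply/eqP.
  rewrite powRM ?sqrtr_ge0//; last exact: ltW.
  have -> : (d j)^-1 `^ (N%:R + p * s) = d j `^ (- N%:R) * d j `^ (- (p * s)).
    rewrite -powRD; last by rewrite (gt_eqF (d0 j)) implybT.
    by rewrite -powR_inv1 ?ltW// -powRrM mulN1r opprD.
  have -> : d j `^ (- (p * s)) = r^-1 `^ (- (p * s)) * q ^+ j.
    rewrite /d powRM ?invr_ge0 ?exprn_ge0 ?ltW//; congr (_ * _).
    by rewrite /q -powR_mulrn ?powR_ge0// -powRrM -powR_mulrn// -powRrM mulrC.
  have -> : d j `^ (- N%:R) = (d j ^+ N)^-1 by rewrite powRN powR_mulrn// ltW.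
  rewrite /C; field; rewrite gt_eqF ?exprn_gt0//.
have q1 : q < 1.
  rewrite /q powRN invf_lt1 ?powR_gt0//.
  by rewrite /powR pnatr_eq0/= expR_gt1 mulr_gt0// ln_gt0// ltr1n.
have qcvg : (fun j => (C * G * q ^+ j)%:E) @ \oo --> 0%E.
  apply: cvg_EFin; first exact: nearW.
  rewrite -(mulr0 (C * G)); apply: cvgMr.
  by apply: cvg_expr; rewrite ger0_norm.
have sub0j j : (0 <= \int[mu]_x (`|conv f (rho j) x - f x| `^ p)%:E)%E.
  by apply: integral_ge0 => x _; rewrite lee_fin powR_ge0.
have acv : {ae mu, forall x, conv f (rho j) x @[j --> \oo] --> f x}.
  have msub j : measurable_fun setT (fun x => (`|conv f (rho j) x - f x| `^ p)%:E).
    by apply/measurable_EFinP/measurable_powR_norm/measurable_funB.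
  have geo : series (geometric (C * G) q) @ \oo --> C * G * (1 - q)^-1.
    by apply: cvg_geometric_series; rewrite ger0_norm.
  have sum : (\sum_(0 <= k <oo) \int[mu]_x (`|conv f (rho k) x - f x| `^ p)%:E < +oo)%E.
    apply: (@le_lt_trans _ _ (\sum_(0 <= k <oo) (C * G * q ^+ k)%:E)%E).
      by apply: lee_nneseries => // k _; exact: err.
    rewrite (_ : limn _ = (C * G * (1 - q)^-1)%:E) ?ltry//; apply/cvg_lim => //.
    under eq_cvg do rewrite sumEFin.
    by apply: cvg_EFin; first exact: nearW.
  have FF := ae_filter_ringOfSetsType mu.
  apply: filterS (ae_cvg0_summable msub _ sum) => [x|k x]; last by rewrite lee_fin powR_ge0.
  move=> /fine_cvgP[_ c0]; apply/cvgrPdist_lt => e e0.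
  have ep : 0 < e `^ p by exact: powR_gt0.
  move/cvgr_lt: c0 => /(_ _ ep); apply: filterS => j /= h.
  rewrite distrC ltNge; apply/negP => eh; move: h; rewrite ltNge => /negP; apply.
  by apply: powR_mono => //; exact: ltW.
split => //; split => //.
- apply: (squeeze_cvge _ (cvg_cst 0%E) qcvg).
  by apply: nearW => j; rewrite sub0j err.
pose a_ j (z : E * E) := conv f (rho j) z.1 - conv f (rho j) z.2.
have := @scheffe_powR R p _ _ (mu \x mu)%E a_ (fun z => f z.1 - f z.2)
  (fun z => nu0 s p (z.1 - z.2)) p1.
have md (h : E -> R) : measurable_fun setT h -> measurable_fun setT (fun z : E * E => h z.1 - h z.2).
  by move=> mh; apply: measurable_funB; exact: measurableT_comp.
move=> /(_ (fun j => md _ (mc j)) (md _ mf)).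
move=> /(_ (measurable_nu0 s p (measurable_rVB measurable_fst measurable_snd))).
move=> /(_ (fun x => nu0_ge0 s p _) fg gle).
have aa : {ae (mu \x mu)%E, forall x, a_ j x @[j --> \oo] --> f x.1 - f x.2}.
  have FF := ae_filter_ringOfSetsType (mu \x mu)%E.
  apply: filterS2 (ae_prod_fst mu acv) (ae_prod_snd mu acv) => z z1 z2.
  exact: cvgB.
move=> /(_ aa) cg.
rewrite (_ : (fun j => gagliardo _ _ _ _) = (fun j => \int[mu \x mu]_z
  (`|a_ j z - (f z.1 - f z.2)| `^ p * nu0 s p (z.1 - z.2))%:E)%E); first exact: cg.
apply/funext => j; apply: eq_integral => z _; congr ((`|_| `^ _ * _)%:E).
by rewrite /a_; ring.
Qed.

End mollifier.

(** * Membership in [W0], truncation and scaling *)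

Section approximation_consequences.
Variables (R : realType) (N : nat) (s p : R).
Local Notation E := 'rV[R]_N.
Local Notation mu := (lebesgue_rV R N).
Implicit Types f phi : E -> R.

Lemma gagliardo_ge0 (D : set (E * E)) f : (0 <= gagliardo s p D f)%E.
Proof. by apply: integral_ge0 => z _; rewrite lee_fin mulr_ge0 ?powR_ge0// invr_ge0 powR_ge0. Qed.

Lemma measurable_gagliardo f : measurable_fun setT f ->
  measurable_fun setT (fun z : E * E => (`|f z.1 - f z.2| `^ p * nu_density s p z.1 z.2)%:E).
Proof.
move=> mf; apply/measurable_EFinP/measurable_funM.
  by apply/measurable_powR_norm/measurable_funB; exact: measurableT_comp.
exact: (measurable_nu0 s p (measurable_rVB measurable_fst measurable_snd)).
Qed.

Lemma gagliardo_sub D f : measurable D -> measurable_fun setT f ->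
  (gagliardo s p D f <= gagliardo s p setT f)%E.
Proof.
move=> mD mf; apply: ge0_subset_integral => //; first exact: measurable_gagliardo.
by move=> z _; rewrite lee_fin mulr_ge0 ?powR_ge0// invr_ge0 powR_ge0.
Qed.

Lemma cvg_poweR0 (u : (\bar R)^nat) (q : R) : 0 < q -> (forall k, 0 <= u k)%E -> u @ \oo --> 0%E ->
  (u k `^ q)%E @[k --> \oo] --> 0%E.
Proof.
move=> q0 u0 /fine_cvgP[uf /cvgr_lt uc]; apply: cvge0P => [k|e e0]; first exact: poweR_ge0.
have e1 : 0 < e `^ q^-1 by exact: powR_gt0.
have [n _ H] := filterI uf (uc _ e1); exists n => k nk.
have [/= kf ke] := H k nk; rewrite -(fineK kf) poweR_EFin lee_fin.
apply: le_trans (powR_mono (ltW q0) (fine_ge0 (u0 k)) (ltW ke)) _.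
by rewrite -powRrM mulVf ?gt_eqF// powRr1// ltW.
Qed.

Lemma poweR_mono (q : R) (u v : \bar R) : 0 <= q -> (0 <= u)%E -> (u <= v)%E -> (u `^ q <= v `^ q)%E.
Proof.
move=> q0 u0 uv; apply: gt0_ler_poweR; rewrite ?in_itv/= ?leey ?andbT//.
exact: le_trans uv.
Qed.

(** Kernels of width at most [r] enlarge the support from radius [r] to radius [2 r], still inside
    [Om], so the mollified functions are test functions; they converge in [L^p] and in energy. *)
Lemma W0_bounded_support (Om : set E) f B r : 1 < p -> 0 < p * s -> 0 < r -> measurable Om ->
  (forall x : E, `|x| <= 2 * r -> Om x) -> measurable_fun setT f ->
  (forall x, `|f x| <= B) -> (forall x, r <= `|x| -> f x = 0) ->
  (gagliardo s p setT f < +oo)%E -> W0 s p Om f.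
Proof.
move=> p1 ps r0 mOm rOm mf fB fr fg; have p0 : 0 < p by exact: lt_trans p1.
have fp : (\int[mu]_x (`|f x| `^ p)%:E < +oo)%E.
  apply: (@integral_box_le _ _ _ (B `^ p) r) => //; first exact: measurable_powR_norm.
  - by move=> x; rewrite powR_ge0/=; apply: powR_mono => //; exact: ltW.
  - by move=> x /fr ->; rewrite normr0 powR0// gt_eqF.
have fi : mu.-integrable setT (EFin \o f).
  apply/integrableP; split; first exact/measurable_EFinP.
  apply: (@integral_box_le _ _ (fun x => `|f x|) B r) => //; first exact: measurableT_comp.
  - by move=> x; rewrite normr_ge0/=.
  - by move=> x /fr ->; rewrite normr0.
have [rho [Hrho [gle [c1 _ c2]]]] := mollified_approximation p1 ps r0 mf fp fg.
have mc j : measurable_fun setT (conv f (rho j)).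
  have [M [h1 _ _ _ _]] := Hrho j; apply: measurable_conv => //; exact: smoothn_measurable.
split => //.
  by apply: aeW => x nOm; apply: fr; rewrite leNgt; apply/negP => xr; apply: nOm; apply: rOm; lra.
exists (fun k => conv f (rho k)); split => [k|].
  have [M [h1 h2 h3 h4 h5]] := Hrho k; split.
    by apply: smoothn_smooth => j; exact: smoothn_conv.
  exists [set x : E | `|x| <= 2 * r]; split => //.
  - apply: bounded_closed_compact.
      exists (2 * r); split; first exact: num_real.
      by move=> M' M'r x /= xr; exact: le_trans xr (ltW M'r).
    apply: (@closed_comp _ _ (fun x : E => `|x|) [set x | x <= 2 * r]) => [x _|]; last exact: closed_le.
    exact: norm_continuous.
  - move=> x /= /negP; rewrite -ltNge => xr.
    rewrite /conv (@eq_Rintegral _ _ _ mu _ (cst 0)) ?Rintegral_cst ?mul0r//.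
    move=> y _ /=; have [ry|yr] := leP r `|y|; first by rewrite fr ?mul0r.
    rewrite h4 ?mulr0//; have := ler_normB y (y - x); rewrite opprB addrCA subrr addr0 => h; lra.
have u0 k : (0 <= \int[mu]_x (`|conv f (rho k) x - f x| `^ p)%:E)%E.
  by apply: integral_ge0 => x _; rewrite lee_fin powR_ge0.
have pV : 0 < p^-1 by rewrite invr_gt0.
have C1 := cvg_poweR0 pV u0 c1.
have C2 := cvg_poweR0 pV (fun k => gagliardo_ge0 setT _) c2.
have C3 : ((\int[mu]_x (`|conv f (rho k) x - f x| `^ p)%:E) `^ p^-1 +
    gagliardo s p setT (fun x => conv f (rho k) x - f x)%R `^ p^-1)%E @[k --> \oo] --> (0 + 0)%E.
  exact: cvgeD.
rewrite adde0 in C3.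
apply: (squeeze_cvge _ (cvg_cst 0%E) C3); apply: nearW => k.
apply/andP; split; first by apply: adde_ge0; exact: poweR_ge0.
have msub : measurable_fun setT (fun x => f x - conv f (rho k) x) by exact: measurable_funB.
have E1 : (\int[mu]_x (`|conv f (rho k) x - f x| `^ p)%:E = \int[mu]_x (`|f x - conv f (rho k) x| `^ p)%:E)%E.
  by apply: eq_integral => x _; rewrite distrC.
have E2 : gagliardo s p setT (fun x => conv f (rho k) x - f x) = gagliardo s p setT (fun x => f x - conv f (rho k) x).
  apply: eq_integral => z _; congr (_ `^ _ * _)%:E.
  by rewrite -normrN; congr `|_|; ring.
rewrite E1 E2; apply: leeD.
  apply: poweR_mono; first exact: ltW.
    by apply: integral_ge0 => x _; rewrite lee_fin powR_ge0.
  by apply: ge0_subset_integral => //; exact/measurable_EFinP/measurable_powR_norm.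
apply: poweR_mono; [exact: ltW|exact: gagliardo_ge0|].
by apply: gagliardo_sub => //; exact: measurableX.
Qed.

Definition hardy_integral f := (\int[mu]_x (`|f x| `^ p / enorm x `^ (p * s))%:E)%E.

Lemma measurable_hardy f : measurable_fun setT f ->
  measurable_fun setT (fun x : E => `|f x| `^ p / enorm x `^ (p * s)).
Proof.
move=> mf; apply: measurable_funM; first exact: measurable_powR_norm.
apply: (measurableT_comp (@measurable_inv R)).
apply: (measurableT_comp (measurable_powR _)); exact: measurable_enorm.
Qed.

Lemma gagliardo_lipschitz (q : R -> R) f : 1 < p -> (forall a b, `|q a - q b| <= `|a - b|) ->
  measurable_fun setT f -> measurable_fun setT (fun x => q (f x)) ->
  (gagliardo s p setT (fun x => q (f x)) <= gagliardo s p setT f)%E.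
Proof.
move=> p1 ql mf mqf; apply: ge0_le_integral => //.
- by move=> z _; rewrite lee_fin mulr_ge0 ?powR_ge0// invr_ge0 powR_ge0.
- exact: (measurable_gagliardo mqf).
- exact: (measurable_gagliardo mf).
move=> z _; rewrite lee_fin; apply: ler_wpM2r; first by rewrite invr_ge0 powR_ge0.
by apply: powR_mono => //; rewrite ltW// (lt_trans _ p1).
Qed.

(** [|f|] is mollified and then lowered: the positive part of the convolution minus [1/(j+1)] has
    bounded support because convolutions decay, is bounded, and costs no energy since every
    operation is a contraction for it. Fatou recovers the Hardy integral of [|f|]. *)
Lemma hardy_of_bounded_support (c : R) : 1 < p -> 0 < p * s -> 0 <= c ->
  (forall phi B r, measurable_fun setT phi -> (forall x, 0 <= phi x <= B) -> 0 < r ->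
    (forall x, r <= `|x| -> phi x = 0) -> (gagliardo s p setT phi < +oo)%E ->
    (c%:E * hardy_integral phi <= 2^-1%:E * gagliardo s p setT phi)%E) ->
  hardy_inequality N s p c.
Proof.
move=> p1 ps c0 H f [mf fp fg]; have p0 : 0 < p by exact: lt_trans p1.
pose F x := `|f x|.
have mF : measurable_fun setT F by exact: measurableT_comp.
have Fp : (\int[mu]_x (`|F x| `^ p)%:E < +oo)%E by under eq_integral do rewrite normr_id.
have Fle : (gagliardo s p setT F <= gagliardo s p setT f)%E.
  by apply: (gagliardo_lipschitz p1 _ mf mF) => a b; exact: ler_dist_dist.
have Fg := le_lt_trans Fle fg.
have [rho [Hrho [gle [_ acv _]]]] := mollified_approximation p1 ps ltr01 mF Fp Fg.
pose h j x := Num.max (conv F (rho j) x - j.+1%:R^-1) 0.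
have mc j : measurable_fun setT (conv F (rho j)).
  have [M [h1 _ _ _ _]] := Hrho j; apply: measurable_conv => //; exact: smoothn_measurable.
have mh j : measurable_fun setT (h j).
  by apply: measurable_maxr => //; exact: measurable_funB.
have cle j : (c%:E * hardy_integral (h j) <= 2^-1%:E * gagliardo s p setT f)%E.
  have [M [h1 h2 h3 h4 h5]] := Hrho j.
  have mr : measurable_fun setT (rho j) by exact: smoothn_measurable.
  have gh : (gagliardo s p setT (h j) <= gagliardo s p setT (conv F (rho j)))%E.
    apply: (gagliardo_lipschitz (q := fun a => Num.max (a - j.+1%:R^-1) 0) p1 _ (mc j) (mh j)) => a b.
    move: (j.+1%:R^-1 : R) => i; rewrite -[`|a - b|](_ : `|(a - i) - (b - i)| = _); last by congr `|_|; ring.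
    by rewrite !maxEle; case: ifPn; case: ifPn; rewrite -?ltNge => *; rewrite ?subr0 ?sub0r ?normr0 ?normrN ?lexx//;
      rewrite ?ler_normr; do 2?[case: ler0P => *]; lra.
  have j0 : 0 < j.+1%:R^-1 :> R by rewrite invr_gt0.
  have [r' r'0 Hr] := conv_decay p1 ltr01 mr h2 h3 h4 h5 mF Fp j0.
  have bnd : exists B, forall x, `|conv F (rho j) x| <= B.
    pose I := fine (\int[mu]_x (`|F x| `^ p)%:E)%E.
    exists (1 + M * I) => x.
    have c1 (y : E) : `|y - x| < 1 -> 1 <= (cst 1 : E -> R) y by [].
    have := conv_powR_le p1 mr h2 h3 h4 h5 mF Fp (measurable_cst (1 : R)) (fun=> ler01) c1.
    under eq_integral do rewrite mulr1.
    rewrite -[X in (_ * X)%E](@fineK _ _ _); last first.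
      by rewrite ge0_fin_numE//; apply: integral_ge0 => y _; rewrite lee_fin powR_ge0.
    rewrite -EFinM lee_fin -/I => hle.
    have [x1|x1] := leP `|conv F (rho j) x| 1.
      apply: le_trans x1 _; rewrite lerDl mulr_ge0// ?fine_ge0//; first exact: le_trans (h2 0) (h3 0).
      by apply: integral_ge0 => y _; rewrite lee_fin powR_ge0.
    apply: (@le_trans _ _ (`|conv F (rho j) x| `^ p)); last by lra.
    by rewrite -[leLHS]powRr1//; apply: ler_powR; exact: ltW.
  have [B HB] := bnd.
  apply: le_trans (H (h j) (`|B|) r' (mh j) _ r'0 _ (le_lt_trans gh (le_lt_trans (gle j) Fg))) _.
  - move=> x; rewrite /h le_max lexx orbT/= ge_max normr_ge0 andbT.
    apply: le_trans (ler_norm B); apply: le_trans (HB x); have := ler_norm (conv F (rho j) x).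
    by move: j0; move: (j.+1%:R^-1 : R) => i i0; lra.
  - move=> x /Hr xr; rewrite /h; apply/max_idPr; have := ler_norm (conv F (rho j) x).
    by move: xr; move: (j.+1%:R^-1 : R) => i; lra.
  apply: lee_wpmul2l; first by rewrite lee_fin invr_ge0.
  exact: le_trans gh (le_trans (gle j) Fle).
have hc : {ae mu, forall x, h j x @[j --> \oo] --> F x}.
  apply: filterS acv => x cx.
  have c2 : conv F (rho j) x - j.+1%:R^-1 @[j --> \oo] --> F x.
    by rewrite -[F x]subr0; apply: cvgB => //; exact: cvg_harmonic.
  apply/cvgrPdist_le => e e0; move/cvgrPdist_le : c2 => /(_ _ e0); apply: filterS => j.
  rewrite /h; have : 0 <= F x by exact: normr_ge0.
  move: (F x) (conv F (rho j) x - _) => a b a0; rewrite !ler_norml.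
  by rewrite maxEle; case: ifPn; rewrite -?ltNge => ? /andP[? ?]; apply/andP; split; lra.
have F0 x (phi : E -> R) : 0 <= `|phi x| `^ p / enorm x `^ (p * s).
  by rewrite mulr_ge0 ?powR_ge0// invr_ge0 powR_ge0.
have fat : (hardy_integral F <= limn_einf (fun j => hardy_integral (h j)))%E.
  apply: fatou_ae.
  - by move=> j; apply/measurable_EFinP; exact: measurable_hardy.
  - by move=> j x; rewrite lee_fin F0.
  - apply/measurable_EFinP; exact: measurable_hardy.
  - by move=> x; rewrite lee_fin F0.
  apply: filterS hc => x cx.
  suff cA : (`|h j x| `^ p / enorm x `^ (p * s))%:E @[j --> \oo] --> (`|F x| `^ p / enorm x `^ (p * s))%:E.
    by rewrite (cvg_limn_einf_sup cA).1.
  apply: cvg_EFin; first exact: nearW.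
  by apply: cvgMl; exact: (cvg_powR_norm (q := fun j => h j x) p1).
have -> : (\int[mu]_x (`|f x| `^ p / enorm x `^ (p * s))%:E = hardy_integral F)%E.
  by apply: eq_integral => x _; rewrite /F normr_id.
move: c0; rewrite le_eqVlt => /predU1P[<-|c0].
  by rewrite mul0e mule_ge0 ?gagliardo_ge0// lee_fin invr_ge0.
rewrite -lee_pdivlMl//; rewrite leNgt; apply/negP => lt1.
have [n Hn] := limn_einf_gt (lt_le_trans lt1 fat).
by have := Hn n (leqnn n); rewrite ltNge lee_pdivlMl// cle.
Qed.

Lemma enormZ (k : R) (x : E) : 0 <= k -> enorm (k *: x) = k * enorm x.
Proof.
move=> k0; rewrite /enorm (_ : dotp _ _ = k ^+ 2 * dotp x x).
  by rewrite sqrtrM ?sqr_ge0// sqrtr_sqr ger0_norm.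
by rewrite /dotp mulr_sumr; apply: eq_bigr => i _; rewrite !mxE; ring.
Qed.

Section scaling.
Variables (phi : E -> R) (k : R).
Hypotheses (mphi : measurable_fun setT phi) (k0 : 0 < k).

Let mk : measurable_fun setT (fun x : E => phi (k *: x)).
Proof. by apply: (measurableT_comp mphi); exact: measurable_rVZ. Qed.

Let scale (F : E -> \bar R) : measurable_fun setT F -> (forall x, 0 <= F x)%E ->
  (\int[mu]_x F x = (k ^+ N)%:E * \int[mu]_x F (k *: x)%R)%E.
Proof.
move=> mF F0; rewrite (ge0_integral_affine_rV 0 k0 mF F0); congr (_ * _)%E.
by apply: eq_integral => x _; rewrite addr0.
Qed.

Lemma powR_norm_scale :
  (\int[mu]_x (`|phi x| `^ p)%:E = (k ^+ N)%:E * \int[mu]_x (`|phi (k *: x)%R| `^ p)%:E)%E.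
Proof.
by rewrite [LHS]scale//; exact/measurable_EFinP/measurable_powR_norm.
Qed.

Lemma hardy_scale : (hardy_integral phi =
  (k ^+ N * k `^ (- (p * s)))%:E * hardy_integral (fun x => phi (k *: x)))%E.
Proof.
have F0 x (f : E -> R) : 0 <= `|f x| `^ p / enorm x `^ (p * s).
  by rewrite mulr_ge0 ?powR_ge0// invr_ge0 powR_ge0.
rewrite /hardy_integral [LHS]scale; last 2 first.
- apply/measurable_EFinP; exact: measurable_hardy.
- by move=> x; rewrite lee_fin F0.
rewrite EFinM -muleA; congr (_ * _)%E.
transitivity (\int[mu]_x (k `^ (- (p * s)) * (`|phi (k *: x)%R| `^ p / enorm x `^ (p * s)))%:E)%E; last first.
  rewrite integral_scalel ?powR_ge0//; last by move=> x; exact: F0 (fun x => phi (k *: x)).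
  exact: (measurable_hardy mk).
apply: eq_integral => x _; congr EFin; rewrite enormZ ?powRM ?sqrtr_ge0 ?ltW//.
by rewrite invfM powRN mulrCA !mulrA.
Qed.

(** Two changes of variables give [k^(2N)] and the kernel gives [k^(-N-ps)]. The resulting
    [k^(N-ps)] is also the factor of the Hardy integral, whereas the [L^p] integral scales with
    [k^N]. *)
Lemma gagliardo_scale : (gagliardo s p setT phi =
  (k ^+ N * k `^ (- (p * s)))%:E * gagliardo s p setT (fun x => phi (k *: x)))%E.
Proof.
pose inner (f : E -> R) (z : E) := (\int[mu]_x (`|f (z + x)%R - f x| `^ p)%:E)%E.
have mi f : measurable_fun setT f -> measurable_fun setT (inner f).
  move=> mf; apply: (measurable_integral_snd mu (f := fun z x : E => (`|f (z + x) - f x| `^ p)%:E)).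
    apply/measurable_EFinP/measurable_powR_norm/measurable_funB; last exact: measurableT_comp.
    exact: measurable_shiftD.
  by move=> x z; rewrite lee_fin powR_ge0.
have i0 f z : (0 <= inner f z)%E by apply: integral_ge0 => x _; rewrite lee_fin powR_ge0.
rewrite (gagliardo_shift s p mphi) (gagliardo_shift s p mk) -/(inner _ _).
rewrite [LHS]scale; last 2 first.
- apply: emeasurable_funM; first exact: mi.
  exact/measurable_EFinP/measurable_nu0.
- by move=> z; rewrite mule_ge0 ?i0// lee_fin nu0_ge0.
rewrite EFinM -muleA; congr (_ * _)%E.
rewrite -ge0_integralZl; last 4 first.
- by [].
- apply: emeasurable_funM; first exact: (mi (fun x => phi (k *: x))).
  exact/measurable_EFinP/measurable_nu0.
- by move=> z _; rewrite mule_ge0 ?i0// lee_fin nu0_ge0.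
- by rewrite lee_fin powR_ge0.
apply: eq_integral => z _.
have Ei : inner phi (k *: z) = ((k ^+ N)%:E * inner (fun x => phi (k *: x)) z)%E.
  rewrite /inner [LHS]scale; last 2 first.
  - apply/measurable_EFinP/measurable_powR_norm/measurable_funB => //.
    by apply: measurable_shiftD => //; exact: measurable_cst.
  - by move=> x; rewrite lee_fin powR_ge0.
  have -> // : (\int[mu]_x (`|phi (k *: z + k *: x)%R - phi (k *: x)| `^ p)%:E =
    \int[mu]_x (`|phi (k *: (z + x))%R - phi (k *: x)| `^ p)%:E)%E.
  by apply: eq_integral => x _; rewrite scalerDr.
have Ev : nu0 s p (k *: z) = (k ^+ N)^-1 * k `^ (- (p * s)) * nu0 s p z.
  rewrite /nu0 enormZ ?ltW// powRM ?sqrtr_ge0 ?ltW// invfM.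
  rewrite powRD; last by rewrite (gt_eqF k0) implybT.
  by rewrite invfM powR_mulrn ?ltW// powRN.
rewrite /inner in Ei; rewrite Ei Ev EFinM muleACA -EFinM mulrA mulfV ?mul1r//.
by rewrite gt_eqF// exprn_gt0.
Qed.

End scaling.

(** Applied to [phi (k x)] and scaled back, the hypothesis keeps its two homogeneous terms and
    multiplies the [L^p] term by [k^(-ps)]. *)
Lemma hardy_of_small_support (c C r0 : R) : 1 < p -> 0 < p * s -> 0 <= c -> 0 <= C -> 0 < r0 ->
  (forall phi B, measurable_fun setT phi -> (forall x, 0 <= phi x <= B) ->
    (forall x, r0 <= `|x| -> phi x = 0) -> (gagliardo s p setT phi < +oo)%E ->
    (c%:E * hardy_integral phi <= 2^-1%:E * gagliardo s p setT phi +
       C%:E * \int[mu]_x (`|phi x| `^ p)%:E)%E) ->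
  hardy_inequality N s p c.
Proof.
move=> p1 ps c0 C0 r00 H; apply: hardy_of_bounded_support => // phi B r mphi phiB r_gt0 phir pg.
have p0 : 0 < p by exact: lt_trans p1.
have Ifin : (\int[mu]_x (`|phi x| `^ p)%:E < +oo)%E.
  apply: (@integral_box_le _ _ _ (B `^ p) r) => //; first exact: measurable_powR_norm.
  - move=> x; rewrite powR_ge0/=; apply: powR_mono => //; first exact: ltW.
    by have /andP[h1 h2] := phiB x; rewrite ger0_norm.
  - by move=> x /phir ->; rewrite normr0 powR0// gt_eqF.
pose I := fine (\int[mu]_x (`|phi x| `^ p)%:E)%E.
have EI : (\int[mu]_x (`|phi x| `^ p)%:E)%E = I%:E.
  by rewrite /I fineK// ge0_fin_numE//; apply: integral_ge0 => x _; rewrite lee_fin powR_ge0.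
have I0 : 0 <= I by apply: fine_ge0; apply: integral_ge0 => x _; rewrite lee_fin powR_ge0.
apply/lee_addgt0Pr => e e0.
pose X := (C * I + 1) / e.
have X0 : 0 < X by rewrite divr_gt0// ltr_wpDl// mulr_ge0.
(* The first entry brings the support of [phi (k x)] into radius [r0]; the second makes
   [k^(ps) >= X], so the remaining term is at most [C I / X <= e]. *)
pose k := Num.max (r / r0) (X `^ (p * s)^-1).
have k1 : r / r0 <= k by rewrite /k le_max lexx.
have k2 : X `^ (p * s)^-1 <= k by rewrite /k le_max lexx orbT.
have k0 : 0 < k by apply: lt_le_trans k1; rewrite divr_gt0.
have kps : X <= k `^ (p * s).
  apply: (@le_trans _ _ ((X `^ (p * s)^-1) `^ (p * s))).
    by rewrite -powRrM mulVf ?gt_eqF// powRr1// ltW.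
  by apply: powR_mono k2; [exact: ltW|exact: powR_ge0].
have mk : measurable_fun setT (fun x : E => phi (k *: x)).
  by apply: (measurableT_comp mphi); exact: measurable_rVZ.
have kc0 : 0 < k ^+ N * k `^ (- (p * s)) by rewrite mulr_gt0 ?exprn_gt0// powR_gt0.
have pgk : (gagliardo s p setT (fun x => phi (k *: x)) < +oo)%E.
  move: pg; rewrite (gagliardo_scale mphi k0); rewrite !ltey; apply: contra => /eqP ->.
  by rewrite gt0_muley ?lte_fin.
have := H (fun x => phi (k *: x)) B mk (fun x => phiB _) _ pgk.
have kr x : r0 <= `|x| -> phi (k *: x) = 0.
  move=> xr; apply: phir; rewrite normrZ gtr0_norm//.
  have : r / r0 * r0 <= k * `|x| by apply: ler_pM => //; apply: ltW; rewrite ?divr_gt0.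
  by rewrite divfK// gt_eqF.
move=> /(_ kr) Hk.
rewrite (hardy_scale mphi k0) (gagliardo_scale mphi k0) muleCA [X in (_ <= X + _)%E]muleCA.
have kc0' : (0 <= (k ^+ N * k `^ (- (p * s)))%:E)%E by rewrite lee_fin ltW.
apply: le_trans (lee_wpmul2l kc0' Hk) _.
rewrite ge0_muleDr; last 2 first.
- by rewrite mule_ge0 ?gagliardo_ge0// lee_fin invr_ge0.
- by rewrite mule_ge0 ?lee_fin//; apply: integral_ge0 => x _; rewrite lee_fin powR_ge0.
apply: leeD2l; rewrite muleCA mulrC EFinM -muleA -powR_norm_scale// EI -!EFinM lee_fin.
rewrite powRN mulrCA mulrC ler_pdivrMr ?powR_gt0//.
apply: (@le_trans _ _ (e * X)); last by rewrite ler_wpM2l// ltW.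
by rewrite /X mulrCA mulfV ?gt_eqF// mulr1 lerDl.
Qed.

End approximation_consequences.

(** * From the weak formulation to time increments *)

Section ae_equality.
Context d (X : measurableType d) (R : realType).
Variable m : {measure set X -> \bar R}.
Import HBNNSimple.

Let ge0_le_integral_ae_eq (f g : X -> \bar R) : (forall x, 0 <= f x)%E -> (forall x, 0 <= g x)%E ->
  {ae m, forall x, f x = g x} -> (\int[m]_x f x <= \int[m]_x g x)%E.
Proof.
move=> f0 g0 [A [mA A0 fA]].
rewrite ge0_integralTE// [leRHS]ge0_integralTE//; apply: ge_ereal_sup => _ [h /= hf <-].
(* A simple function below [f] is set to [0] on the null set: it is then below [g] and has the same
   integral, which gives the inequality between the suprema. *)
pose h' : {nnsfun X >-> R} := mul_nnsfun h (indic_nnsfun R (measurableC mA)).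
have -> : sintegral m h = sintegral m h'.
  have I (k : {nnsfun X >-> R}) : sintegral m k = (\int[m]_x (k x)%:E)%E.
    by rewrite integral_nnsfun// patch_setT.
  rewrite !I; apply: ae_eq_integral => //.
  - exact/measurable_EFinP.
  - exact/measurable_EFinP.
  exists A; split => // x /= hx; apply: contrapT => nAx; apply: hx => _.
  by rewrite /h' /= mindicE mem_set//= mulr1.
apply: ereal_sup_ubound; exists h' => //= x; rewrite mindicE.
have [Ax|nAx] := pselect (A x); first by rewrite memNset//= mulr0.
rewrite mem_set//= mulr1; apply: le_trans (hf x) _.
suff -> : f x = g x by [].
by apply: contrapT => fgx; apply: nAx; apply: fA.
Qed.

(* No measurability is needed, integrals being suprema over simple functions. *)
Lemma ae_eq_integral_nomeas (D : set X) (f g : X -> \bar R) :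
  {ae m, forall x, D x -> f x = g x} -> (\int[m]_(x in D) f x = \int[m]_(x in D) g x)%E.
Proof.
move=> fg; rewrite integral_mkcond [RHS]integral_mkcond.
have fg' : {ae m, forall x, (f \_ D) x = (g \_ D) x}.
  apply: filterS fg => x H; rewrite !patchE; case: ifPn => // xD.
  by apply: H; rewrite -in_setE.
rewrite integralE [RHS]integralE.
have P (u v : X -> \bar R) : {ae m, forall x, u x = v x} -> (\int[m]_x u^\+ x = \int[m]_x v^\+ x)%E.
  move=> h; apply/le_anti/andP; split; apply: ge0_le_integral_ae_eq => //; apply: filterS h => x hx.
    by rewrite !funeposE hx.
  by rewrite !funeposE hx.
have Q (u v : X -> \bar R) : {ae m, forall x, u x = v x} -> (\int[m]_x u^\- x = \int[m]_x v^\- x)%E.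
  move=> h; apply/le_anti/andP; split; apply: ge0_le_integral_ae_eq => //; apply: filterS h => x hx.
    by rewrite !funenegE hx.
  by rewrite !funenegE hx.
by rewrite (P _ _ fg') (Q _ _ fg').
Qed.

Lemma ae_eq_Rintegral (D : set X) (f g : X -> R) :
  {ae m, forall x, D x -> f x = g x} -> \int[m]_(x in D) f x = \int[m]_(x in D) g x.
Proof.
move=> fg; congr fine; apply: ae_eq_integral_nomeas.
by apply: filterS fg => x + Dx => /(_ Dx) ->.
Qed.

End ae_equality.

Section iterated_integrals.
Context d1 d2 (X : measurableType d1) (Y : measurableType d2) (R : realType).
Variables (m1 : {sigma_finite_measure set X -> \bar R}) (m2 : {measure set Y -> \bar R}).

Lemma measurable_swapped (f : Y -> X -> R) :
  measurable_fun setT (fun u : X * Y => f u.2 u.1) -> measurable_fun setT (fun u : Y * X => f u.1 u.2).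
Proof.
move=> mf; have ms : measurable_fun setT (fun u : Y * X => (u.2, u.1)).
  by apply/measurable_fun_pairP; split; [exact: measurable_snd|exact: measurable_fst].
exact: (measurableT_comp mf ms).
Qed.

Lemma integrable_Rintegral (f : Y -> X -> R) :
  measurable_fun setT (fun u : Y * X => f u.1 u.2) ->
  (\int[m2]_y \int[m1]_x `|f y x|%:E < +oo)%E ->
  {ae m2, forall y, m1.-integrable setT (EFin \o f y)} /\
  m2.-integrable setT (EFin \o (fun y => \int[m1]_x f y x)).
Proof.
move=> mf foo.
have mfy y : measurable_fun setT (f y) by exact: (measurableT_comp mf (measurable_pair1 y)).
have mI : measurable_fun setT (fun y => \int[m1]_x `|f y x|%:E)%E.
  apply: (measurable_integral_snd m1 (f := fun y x => `|f y x|%:E)) => //.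
  by apply/measurable_EFinP; exact: measurableT_comp.
have I0 y : (0 <= \int[m1]_x `|f y x|%:E)%E by apply: integral_ge0 => x _; rewrite lee_fin.
have iI : m2.-integrable setT (fun y => \int[m1]_x `|f y x|%:E)%E.
  apply/integrableP; split => //.
  by under eq_integral do rewrite gee0_abs//.
have aeI : {ae m2, forall y, m1.-integrable setT (EFin \o f y)}.
  apply: filterS (integrable_ae measurableT iI) => y /(_ I) yfin.
  apply/integrableP; split; first exact/measurable_EFinP.
  by move: yfin; rewrite ge0_fin_numE.
split => //; apply/integrableP; split.
  by apply/measurable_EFinP; exact: (measurable_Rintegral_snd m1 mf).
apply: le_lt_trans foo; apply: ae_ge0_le_integral => //.
- by apply: measurableT_comp => //; apply/measurable_EFinP; exact: (measurable_Rintegral_snd m1 mf).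
apply: filterS aeI => y iy _ /=.
rewrite EFin_normr_Rintegral//.
by apply: le_abse_integral => //; exact/measurable_EFinP.
Qed.

End iterated_integrals.

Section lower_bounds.
Variables (R : realType) (N : nat) (s p : R).
Local Notation E := 'rV[R]_N.
Local Notation mu := (lebesgue_rV R N).

Lemma nu0_lower (r : R) : 0 <= N%:R + p * s -> 0 < r -> (0 < N)%N ->
  exists2 c : R, 0 < c & forall x y : E, `|x| <= r -> `|y| <= r -> x != y -> c <= nu0 s p (x - y).
Proof.
move=> q0 r0 N0; pose K := Num.sqrt N%:R * (2 * r).
have K0 : 0 < K by rewrite mulr_gt0 ?sqrtr_gt0 ?ltr0n// mulr_gt0.
exists (K `^ (N%:R + p * s))^-1; first by rewrite invr_gt0 powR_gt0.
move=> x y xr yr xy.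
have n0 : 0 < enorm (x - y) by apply: lt_le_trans (norm_le_enorm _); rewrite normr_gt0 subr_eq0.
rewrite /nu0 lef_pV2 ?posrE ?powR_gt0//; apply: powR_mono => //; first exact: ltW.
apply: le_trans (enorm_le_norm _) _; apply: ler_wpM2l; first exact: sqrtr_ge0.
by have := ler_normB x y; lra.
Qed.

(** [B] is a shell outside [Om], of positive measure [b]. There [f y = 0], so [|f x|] equals
    [|f x - f y|], and the kernel is at least [c]; integrating over [y] in [B] alone yields the
    factor [c b]. *)
Lemma poincare (Om : set E) : 1 < p -> 0 <= N%:R + p * s -> (0 < N)%N -> bounded_set Om ->
  exists2 C : R, 0 <= C & forall f : E -> R, measurable_fun setT f ->
    (forall x, ~ Om x -> f x = 0) ->
    (\int[mu]_x (`|f x| `^ p)%:E <= C%:E * gagliardo s p setT f)%E.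
Proof.
move=> p1 q0 N0 [M [_ HM]]; have p0 : 0 < p by exact: lt_trans p1.
pose r := `|M| + 1; have r0 : 0 < r by rewrite ltr_wpDl.
have Omr x : Om x -> `|x| <= r.
  by move=> Ox; apply: (HM r _ x Ox); rewrite (le_lt_trans (ler_norm M))// ltrDl.
pose r2 := 2 * r; have r20 : 0 < r2 by rewrite mulr_gt0.
have r23 : r2 < 2 * r2 by rewrite ltr_pMl// ltr1n.
have [c c0 Hc] := nu0_lower q0 (mulr_gt0 (ltr0n R 2) r20 : 0 < 2 * r2) N0.
pose B : set E := [set y | `|y| < 2 * r2] `\` [set y | `|y| < r2].
have mB : measurable B by apply: measurableD; exact: measurable_box.
have muB : mu B = ((2 * (2 * r2)) ^+ N - (2 * r2) ^+ N)%:E.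
  rewrite /B measureD; [|exact: measurable_box|exact: measurable_box|]; last first.
    by rewrite [ltLHS](lebesgue_rV_box N (mulr_gt0 (ltr0n R 2) r20)) ltry.
  rewrite (_ : _ `&` _ = [set y : E | `|y| < r2]).
    rewrite [X in (X - _)%E](lebesgue_rV_box N (mulr_gt0 (ltr0n R 2) r20)).
    by rewrite [X in (_ - X)%E](lebesgue_rV_box N r20).
  by apply/seteqP; split => [y []//|y /= yr]; split => //=; exact: lt_trans r23.
pose b := (2 * (2 * r2)) ^+ N - (2 * r2) ^+ N.
have b0 : 0 < b.
  rewrite subr_gt0; have r22 : 2 * r2 < 2 * (2 * r2) by rewrite ltr_pM2l.
  have r3 : 0 <= 2 * r2 by apply/ltW/mulr_gt0.
  by rewrite (ltrXn2r N r3 r22) -lt0n.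
have cb0 : 0 < c * b by rewrite mulr_gt0.
exists (c * b)^-1; first by rewrite invr_ge0 ltW.
move=> f mf f0; rewrite lee_pdivlMl//.
rewrite -(integral_scalel mu (measurable_powR_norm p mf) (fun x => powR_ge0 _ _) (ltW cb0)).
have mF := measurable_gagliardo s p mf.
rewrite /gagliardo (tonelli_prod mu mu (f := fun x y => (`|f x - f y| `^ p * nu_density s p x y)%:E) mF); last first.
  by move=> x y; rewrite lee_fin mulr_ge0 ?powR_ge0// invr_ge0 powR_ge0.
apply: ge0_le_integral => //.
- by move=> x _; rewrite lee_fin mulr_ge0 ?powR_ge0// ltW.
- by apply/measurable_EFinP/measurable_funM => //; exact: measurable_powR_norm.
- apply: (measurable_integral_snd mu (f := fun x y => (`|f x - f y| `^ p * nu_density s p x y)%:E)) => //.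
  by move=> x y; rewrite lee_fin mulr_ge0 ?powR_ge0// invr_ge0 powR_ge0.
move=> x _.
have -> : (c * b * `|f x| `^ p)%:E = (\int[mu]_(y in B) (cst (c * `|f x| `^ p)%:E) y)%E.
  by rewrite integral_cst// [X in (_ * X)%E]muB -EFinM; congr EFin; rewrite -/b; ring.
rewrite integral_mkcond; apply: ge0_le_integral => //.
- by move=> y _; rewrite patchE; case: ifP => // _; rewrite lee_fin mulr_ge0 ?powR_ge0// ltW.
- by apply/(measurable_restrictT _ mB); exact: measurable_cst.
- exact: (measurableT_comp mF (measurable_pair1 x)).
move=> y _; rewrite patchE; case: ifPn => [|_]; last first.
  by rewrite lee_fin mulr_ge0 ?powR_ge0// invr_ge0 powR_ge0.
rewrite inE => -[/= y1 /negP]; rewrite -leNgt => y2.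
have fy : f y = 0.
  by apply: f0 => /Omr h; have := le_trans y2 h; rewrite leNgt ltr_pMl ?ltr1n.
rewrite fy subr0 lee_fin mulrC; have [Ox|nOx] := pselect (Om x); last first.
  by rewrite f0// normr0 powR0 ?mul0r// gt_eqF.
apply: ler_wpM2l; first exact: powR_ge0.
apply: Hc; [|exact: ltW|].
  by apply: le_trans (Omr _ Ox) _; rewrite /r2; lra.
by apply/eqP => xy; have := le_trans y2 (Omr y _); rewrite -xy leNgt ltr_pMl ?ltr1n// => /(_ Ox).
Qed.

End lower_bounds.

Section flow.
Variables (R : realType) (N : nat) (s p : R) (Om : set 'rV[R]_N) (T : R).
Local Notation E := 'rV[R]_N.
Local Notation mu := (lebesgue_rV R N).
Local Notation leb := (@lebesgue_measure R).
Local Notation RR := (measurableTypeR R).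
Local Notation nu := (nu_density s p).

Lemma measurable_jump d (X : measurableType d) (f : X -> R) :
  measurable_fun setT f -> measurable_fun setT (fun x => jump p (f x)).
Proof.
move=> mf; apply: measurable_funM => //.
by apply: (measurableT_comp (measurable_powR (p - 2))); exact: measurableT_comp.
Qed.

(** Taken over the whole space instead of [D_ Om]: when [f] vanishes outside [Om], the integrand is
    [0] off [D_ Om]. *)
Definition flux (f phi : E -> R) : R :=
  \int[prodm mu mu]_z (jump p (f z.1 - f z.2) * (phi z.1 - phi z.2) * nu z.1 z.2).

Definition reaction (a f phi : E -> R) : R := \int[mu]_x (a x * f x `^ (p - 1) * phi x).

(** These conditions put [phi] in [W0] once the ball of radius [2 r] lies in [Om], and they are
    inherited by [phi^p (f + e)^(1-p)] when [f >= 0] has finite energy. *)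
Definition bounded_test (r : R) (phi : E -> R) : Prop :=
  [/\ measurable_fun setT phi, exists B, forall x, 0 <= phi x <= B,
      forall x, r <= `|x| -> phi x = 0 & (gagliardo s p setT phi < +oo)%E].

(* What is retained of an energy solution: its positive part, extended by [0]. *)
Definition finite_energy (W : E -> R -> R) : Prop :=
  [/\ measurable_fun [set: E * RR] (fun z => W z.1 z.2), forall x t, 0 <= W x t,
      forall x t, ~ Om x -> W x t = 0, forall x t, ~~ (0 < t < T) -> W x t = 0 &
      (\int[leb]_t gagliardo s p setT (W ^~ t) < +oo)%E].

Hypotheses (p2 : 2 < p) (q0 : 0 <= N%:R + p * s) (N0 : (0 < N)%N) (bOm : bounded_set Om) (T0 : 0 < T).

Let p1 : 1 < p. Proof. by have := p2; lra. Qed.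
Let p0 : 0 < p. Proof. by have := p2; lra. Qed.

Let mnu : measurable_fun setT (fun z : E * E => nu z.1 z.2).
Proof. exact: (measurable_nu0 s p (measurable_rVB measurable_fst measurable_snd)). Qed.

Let nuge0 (x y : E) : 0 <= nu x y. Proof. by rewrite invr_ge0 powR_ge0. Qed.

Let mind : measurable_fun [set: RR] (fun t => if 0 < t < T then 1 else 0 : R).
Proof.
apply: measurable_fun_ifT => //; apply: measurable_and; exact: measurable_fun_ltr.
Qed.

Let int_ind (k : R) : 0 <= k -> (\int[leb]_t (k * (if (0 < t < T)%R then 1 else 0))%:E < +oo)%E.
Proof.
move=> k0; have mI : measurable (`]0, T[%classic : set RR) by [].
rewrite integral_scalel//; last by move=> t; case: ifP.
apply: lte_mul_pinfty; rewrite ?lee_fin//.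
rewrite (_ : (\int[leb]_t _)%E = (\int[leb]_(t in `]0%R, T[) (cst 1%E) t)%E); last first.
  rewrite [RHS]integral_mkcond; apply: eq_integral => t _.
  by rewrite patchE mem_setE in_itv/=; case: ifP.
by rewrite integral_cst// mul1e/= lebesgue_measure_itv/= lte_fin T0 -EFinB ltry.
Qed.

Section one_flow.
Variable W : E -> R -> R.
Hypothesis fW : finite_energy W.

Lemma measurable_flow : measurable_fun [set: RR * E] (fun u => W u.2 u.1).
Proof. by have [mW _ _ _ _] := fW; exact: (measurable_swapped (f := fun t x => W x t)). Qed.

Lemma measurable_flow_section t : measurable_fun setT (W ^~ t).
Proof. exact: (measurableT_comp measurable_flow (measurable_pair1 (t : RR))). Qed.

Lemma measurable_flow_diff : measurable_fun [set: RR * (E * E)] (fun u => W u.2.1 u.1 - W u.2.2 u.1).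
Proof.
have m1 : measurable_fun [set: RR * (E * E)] (fun u => (u.1, u.2.1) : RR * E).
  apply/measurable_fun_pairP; split; first exact: measurable_fst.
  exact: (measurableT_comp measurable_fst measurable_snd).
have m2 : measurable_fun [set: RR * (E * E)] (fun u => (u.1, u.2.2) : RR * E).
  apply/measurable_fun_pairP; split; first exact: measurable_fst.
  exact: (measurableT_comp measurable_snd measurable_snd).
apply: measurable_funB; first exact: (measurableT_comp measurable_flow m1).
exact: (measurableT_comp measurable_flow m2).
Qed.

Lemma measurable_flow_energy :
  measurable_fun [set: RR * (E * E)] (fun u => `|W u.2.1 u.1 - W u.2.2 u.1| `^ p * nu u.2.1 u.2.2).
Proof.
apply: measurable_funM; first by apply: measurable_powR_norm; exact: measurable_flow_diff.
exact: (measurableT_comp mnu measurable_snd).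
Qed.

Lemma measurable_flow_gagliardo : measurable_fun [set: RR] (fun t => gagliardo s p setT (W ^~ t)).
Proof.
apply: (measurable_integral_snd (prodm mu mu)
  (f := fun (t : RR) z => (`|W z.1 t - W z.2 t| `^ p * nu z.1 z.2)%:E)).
  by apply/measurable_EFinP; exact: measurable_flow_energy.
by move=> t z; rewrite lee_fin mulr_ge0 ?powR_ge0.
Qed.

Lemma ae_flow_gagliardo_fin : {ae leb, forall t, (gagliardo s p setT (W ^~ t) < +oo)%E}.
Proof.
have [_ _ _ _ Woo] := fW.
have : leb.-integrable setT (fun t => gagliardo s p setT (W ^~ t)).
  apply/integrableP; split; first exact: measurable_flow_gagliardo.
  by under eq_integral do rewrite gee0_abs ?gagliardo_ge0//.
have FF := ae_filter_ringOfSetsType leb.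
move/(integrable_ae measurableT); apply: filterS => t /(_ I).
by rewrite ge0_fin_numE// gagliardo_ge0.
Qed.

(** The Poincare inequality at each time, available because [W] vanishes outside the bounded set
    [Om]. *)
Lemma flow_Lp : (\int[leb]_t \int[mu]_x (W x t `^ p)%:E < +oo)%E.
Proof.
have [_ W0 Wout _ Woo] := fW.
have [C C0 HC] := poincare p1 q0 N0 bOm.
apply: (@le_lt_trans _ _ (C%:E * \int[leb]_t gagliardo s p setT (W ^~ t))%E); last first.
  by apply: lte_mul_pinfty; rewrite ?lee_fin.
rewrite -ge0_integralZl; last 4 first.
- by [].
- exact: measurable_flow_gagliardo.
- by move=> t _; exact: gagliardo_ge0.
- by rewrite lee_fin.
apply: ge0_le_integral; first by [].
- by move=> t _; apply: integral_ge0 => x _; rewrite lee_fin powR_ge0.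
- apply: (measurable_integral_snd mu (f := fun (t : RR) x => (W x t `^ p)%:E)).
    apply/measurable_EFinP; exact: (measurableT_comp (measurable_powR p) measurable_flow).
  by move=> t x; rewrite lee_fin powR_ge0.
- by apply: measurable_funeM; exact: measurable_flow_gagliardo.
move=> t _; apply: le_trans (HC _ (measurable_flow_section t) _); last by move=> x; exact: Wout.
by rewrite le_eqVlt; apply/orP; left; apply/eqP/eq_integral => x _; rewrite ger0_norm.
Qed.

(** Young's inequality dominates the integrand by the energy densities of [W] and [phi]. The second
    one does not depend on time, so it is cut off by the indicator [i] of []0, T[], outside of which
    [W] vanishes. *)
Lemma integrable_flux phi : measurable_fun setT phi -> (gagliardo s p setT phi < +oo)%E ->
  {ae leb, forall t, (prodm mu mu).-integrable setT (EFin \o (fun z =>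
     jump p (W z.1 t - W z.2 t) * (phi z.1 - phi z.2) * nu z.1 z.2))} /\
  leb.-integrable setT (EFin \o (fun t => flux (W ^~ t) phi)).
Proof.
move=> mphi pg; have [_ W0 _ WT Woo] := fW.
pose f (t : RR) (z : E * E) := jump p (W z.1 t - W z.2 t) * (phi z.1 - phi z.2) * nu z.1 z.2.
have mdphi : measurable_fun [set: E * E] (fun z => phi z.1 - phi z.2).
  by apply: measurable_funB; exact: measurableT_comp.
have mf : measurable_fun [set: RR * (E * E)] (fun u => f u.1 u.2).
  apply: measurable_funM; last exact: (measurableT_comp mnu measurable_snd).
  apply: measurable_funM; last exact: (measurableT_comp mdphi measurable_snd).
  exact: measurable_jump measurable_flow_diff.
apply: (integrable_Rintegral (m1 := prodm mu mu) (m2 := leb) mf).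
pose e (t : RR) (z : E * E) := `|W z.1 t - W z.2 t| `^ p * nu z.1 z.2.
pose i (t : RR) : R := if 0 < t < T then 1 else 0.
pose h (z : E * E) := `|phi z.1 - phi z.2| `^ p * nu z.1 z.2.
have i0 t : 0 <= i t by rewrite /i; case: ifP.
have e0 t z : 0 <= e t z by rewrite mulr_ge0 ?powR_ge0.
have h0 z : 0 <= h z by rewrite mulr_ge0 ?powR_ge0.
have me : measurable_fun [set: RR * (E * E)] (fun u => e u.1 u.2) by exact: measurable_flow_energy.
have mh : measurable_fun setT h by apply/measurable_EFinP; exact: (measurable_gagliardo s p mphi).
have met t : measurable_fun setT (e t) by exact: (measurableT_comp me (measurable_pair1 t)).
have Eh : (\int[prodm mu mu]_z (h z)%:E = (fine (gagliardo s p setT phi))%:E)%E.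
  by rewrite fineK// ge0_fin_numE// gagliardo_ge0.
apply: (@le_lt_trans _ _ (\int[leb]_t (gagliardo s p setT (W ^~ t) + (fine (gagliardo s p setT phi) * i t)%:E))%E); last first.
  rewrite ge0_integralD; last 5 first.
  - by [].
  - by move=> t _; exact: gagliardo_ge0.
  - exact: measurable_flow_gagliardo.
  - by move=> t _; rewrite lee_fin mulr_ge0// fine_ge0// gagliardo_ge0.
  - exact/measurable_EFinP/measurable_funM.
  apply: lte_add_pinfty => //; apply: int_ind.
  by rewrite fine_ge0// gagliardo_ge0.
apply: ge0_le_integral; first by [].
- by move=> t _; apply: integral_ge0 => z _; rewrite lee_fin.
- apply: (measurable_integral_snd (prodm mu mu) (f := fun t z => (`|f t z|)%:E)) => //.
  by apply/measurable_EFinP; exact: measurableT_comp.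
- apply: emeasurable_funD; first exact: measurable_flow_gagliardo.
  exact/measurable_EFinP/measurable_funM.
move=> t _; rewrite mulrC EFinM -Eh -(integral_scalel (prodm mu mu) mh h0 (i0 t)).
rewrite -[gagliardo _ _ _ _]/(\int[prodm mu mu]_z (e t z)%:E)%E.
rewrite -(integral_add (prodm mu mu) (met t) (e0 t)); last 2 first.
- exact: measurable_funM.
- by move=> z; rewrite mulr_ge0.
apply: integral_mono.
- have mft : measurable_fun setT (f t) by exact: (measurableT_comp mf (measurable_pair1 t)).
  exact: measurableT_comp.
- by [].
- apply: measurable_funD; first exact: met.
  by apply: measurable_funM; [exact: measurable_cst|exact: mh].
move=> z; rewrite /f normrM (ger0_norm (nuge0 _ _)) /e /h mulrA -mulrDl; apply: ler_wpM2r => //.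
rewrite /i; case: ifPn => tT; first by rewrite mul1r; exact: jumpM_le.
by rewrite !(WT _ _ tT) subrr jump0 !mul0r normr0 addr0 powR_ge0.
Qed.

(** With [a] and [phi] bounded, [W^(p-1) <= 1 + W^p] on []0, T[] reduces the claim to [flow_Lp] and
    to the bounded support of [phi]. *)
Lemma integrable_reaction (a phi : E -> R) (A B r : R) : measurable_fun setT a -> (forall x, 0 <= a x <= A) ->
  measurable_fun setT phi -> (forall x, 0 <= phi x <= B) -> 0 < r -> (forall x, r <= `|x| -> phi x = 0) ->
  {ae leb, forall t, mu.-integrable setT (EFin \o (fun x => a x * W x t `^ (p - 1) * phi x))} /\
  leb.-integrable setT (EFin \o (fun t => reaction a (W ^~ t) phi)).
Proof.
move=> ma aA mphi phiB r0 phir; have [_ W0 _ WT Woo] := fW.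
have A0 : 0 <= A by have /andP[h1 h2] := aA 0; exact: le_trans h2.
have B0 : 0 <= B by have /andP[h1 h2] := phiB 0; exact: le_trans h2.
pose f (t : RR) (x : E) := a x * W x t `^ (p - 1) * phi x.
have mWp q : measurable_fun [set: RR * E] (fun u => W u.2 u.1 `^ q).
  exact: (measurableT_comp (measurable_powR q) measurable_flow).
have mf : measurable_fun [set: RR * E] (fun u => f u.1 u.2).
  apply: measurable_funM; last exact: (measurableT_comp mphi measurable_snd).
  by apply: measurable_funM => //; exact: (measurableT_comp ma measurable_snd).
apply: (integrable_Rintegral (m1 := mu) (m2 := leb) mf).
pose i (t : RR) : R := if 0 < t < T then 1 else 0.
have i0 t : 0 <= i t by rewrite /i; case: ifP.
pose h (x : E) := A * phi x.
have h0 x : 0 <= h x by rewrite mulr_ge0//; have /andP[] := phiB x.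
have mh : measurable_fun setT h by exact: measurable_funM.
have hoo : (\int[mu]_x (h x)%:E < +oo)%E.
  apply: (@integral_box_le _ _ _ (A * B) r) => //.
  - by move=> x; rewrite h0 /h ler_wpM2l//; have /andP[] := phiB x.
  - by move=> x /phir; rewrite /h => ->; rewrite mulr0.
have Eh : (\int[mu]_x (h x)%:E = (fine (\int[mu]_x (h x)%:E))%:E)%E.
  by rewrite fineK// ge0_fin_numE//; apply: integral_ge0 => x _; rewrite lee_fin.
set H := fine _ in Eh.
have H0 : 0 <= H by apply: fine_ge0; apply: integral_ge0 => x _; rewrite lee_fin.
pose e (t : RR) (x : E) := A * B * W x t `^ p.
have e0 t x : 0 <= e t x by rewrite !mulr_ge0 ?powR_ge0.
have me : measurable_fun [set: RR * E] (fun u => e u.1 u.2) by exact: measurable_funM.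
have met t : measurable_fun setT (e t) by exact: (measurableT_comp me (measurable_pair1 t)).
have mWt q t : measurable_fun setT (fun x => W x t `^ q) by exact: (measurableT_comp (mWp q) (measurable_pair1 (t : RR))).
have mIW : measurable_fun [set: RR] (fun t => \int[mu]_x (W x t `^ p)%:E)%E.
  apply: (measurable_integral_snd mu (f := fun (t : RR) x => (W x t `^ p)%:E)); first exact/measurable_EFinP.
  by move=> t x; rewrite lee_fin powR_ge0.
have IW0 t : (0 <= \int[mu]_x (W x t `^ p)%:E)%E by apply: integral_ge0 => x _; rewrite lee_fin powR_ge0.
apply: (@le_lt_trans _ _ (\int[leb]_t ((A * B)%:E * (\int[mu]_x (W x t `^ p)%:E) + (H * i t)%:E))%E); last first.
  rewrite ge0_integralD; last 5 first.
  - by [].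
  - by move=> t _; rewrite mule_ge0// lee_fin mulr_ge0.
  - exact: measurable_funeM.
  - by move=> t _; rewrite lee_fin mulr_ge0.
  - exact/measurable_EFinP/measurable_funM.
  apply: lte_add_pinfty; last exact: int_ind.
  rewrite ge0_integralZl; [|by []|exact: mIW|by []|by rewrite lee_fin mulr_ge0].
  by apply: lte_mul_pinfty; rewrite ?lee_fin ?mulr_ge0//; exact: flow_Lp.
apply: ge0_le_integral; first by [].
- by move=> t _; apply: integral_ge0 => z _; rewrite lee_fin.
- apply: (measurable_integral_snd mu (f := fun t z => (`|f t z|)%:E)) => //.
  by apply/measurable_EFinP; exact: measurableT_comp.
- apply: emeasurable_funD; first exact: measurable_funeM.
  exact/measurable_EFinP/measurable_funM.
move=> t _; have -> : (H * i t)%:E = ((i t)%:E * \int[mu]_x (h x)%:E)%E by rewrite Eh -EFinM mulrC.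
rewrite -(integral_scalel mu mh h0 (i0 t)).
rewrite -(integral_scalel mu (mWt p t) (fun x => powR_ge0 _ _) (mulr_ge0 A0 B0)).
rewrite -(integral_add mu (met t) (e0 t)); last 2 first.
- exact: measurable_funM.
- by move=> z; rewrite mulr_ge0.
apply: integral_mono.
- have mft : measurable_fun setT (f t) by exact: (measurableT_comp mf (measurable_pair1 t)).
  exact: measurableT_comp.
- by [].
- apply: measurable_funD; first exact: met.
  by apply: measurable_funM; [exact: measurable_cst|exact: mh].
move=> x; have /andP[a0 aA'] := aA x; have /andP[f0 fB] := phiB x.
rewrite /f ger0_norm; last by rewrite !mulr_ge0 ?powR_ge0.
rewrite /i; case: ifPn => tT; last first.
  by rewrite (WT _ _ tT) powR0 ?mulr0 ?mul0r ?addr0 ?e0// gt_eqF// subr_gt0.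
rewrite mul1r /e /h; have [W1|W1] := leP (W x t) 1.
  have : W x t `^ (p - 1) <= 1 `^ (p - 1) by apply: powR_mono => //; rewrite subr_ge0 ltW.
  rewrite powR1 => Wp1; apply: (@le_trans _ _ (A * phi x)); last by rewrite lerDr !mulr_ge0 ?powR_ge0.
  apply: ler_wpM2r => //; rewrite -[leRHS]mulr1; apply: ler_pM => //; exact: powR_ge0.
have : W x t `^ (p - 1) <= W x t `^ p.
  by apply: ler_powR; [exact: ltW|rewrite gerBl].
move=> Wp1; apply: (@le_trans _ _ (A * B * W x t `^ p)); last by rewrite lerDl h0.
rewrite mulrAC; apply: ler_pM => //; rewrite ?mulr_ge0 ?powR_ge0//.
exact: ler_pM.
Qed.

End one_flow.
End flow.

Lemma clamp_lipschitz (R : realType) (T t u : R) : 0 < T ->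
  `|Num.max 0 (Num.min t T) - Num.max 0 (Num.min u T)| <= `|t - u|.
Proof.
move=> T0; wlog tu : t u / t <= u.
  by move=> h; have [/h//|/ltW/h] := leP t u; rewrite distrC [leRHS]distrC.
rewrite distrC [leRHS]distrC (ger0_norm (x := u - t)) ?subr_ge0//.
have [ct cu] : Num.max 0 (Num.min t T) <= Num.max 0 (Num.min u T) /\
    Num.max 0 (Num.min u T) <= Num.max 0 (Num.min t T) + (u - t).
  rewrite !minEle !maxEle; case: (leP t T) => ?; case: (leP u T) => ?;
    case: (leP 0 t) => ?; case: (leP 0 u) => ?; case: (leP 0 T) => ?; split; lra.
by rewrite ger0_norm ?subr_ge0// lerBlDl.
Qed.

(** * The increment identity for energy solutions *)

Section positive_part.
Variables (R : realType) (N : nat) (s p : R) (Om : set 'rV[R]_N) (T : R).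
Local Notation E := 'rV[R]_N.
Local Notation mu := (lebesgue_rV R N).
Local Notation leb := (@lebesgue_measure R).
Local Notation RR := (measurableTypeR R).
Local Notation nu := (nu_density s p).

(** For a nonnegative energy solution it agrees almost everywhere with [w] at almost every time,
    while its sign, its vanishing outside the cylinder and its joint measurability hold without
    exception. *)
Definition positive_part (w : E -> R -> R) (x : E) (t : R) : R :=
  if `[< cylinder T Om (x, t) >] then Num.max (w x t) 0 else 0.

Definition agree (W w : E -> R -> R) (t : R) : Prop := {ae mu, forall x, W x t = w x t}.

Lemma gagliardoZ (D : set (E * E)) (c : R) (phi : E -> R) : measurable D -> measurable_fun setT phi ->
  (gagliardo s p D (fun x => (c * phi x)%R) = (`|c| `^ p)%:E * gagliardo s p D phi)%E.
Proof.
move=> mD mphi; rewrite /gagliardo -ge0_integralZl_EFin ?powR_ge0//.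
- apply: eq_integral => z _; rewrite -EFinM; congr EFin.
  by rewrite -mulrBr normrM powRM// mulrA.
- by move=> z _; rewrite lee_fin mulr_ge0 ?powR_ge0// invr_ge0 powR_ge0.
- by apply: measurable_funTS; exact: (measurable_gagliardo s p mphi).
Qed.

Lemma test_function_bounded (eta : R -> R) : test_function `]0, T[%classic eta ->
  [/\ measurable_fun [set: RR] eta, continuous eta & exists2 C : R, 0 <= C & forall t, `|eta t| <= C].
Proof.
move=> [seta [K [cK KT K0]]].
have ceta : continuous eta by move=> t; apply: differentiable_continuous; exact: (seta [::] t).
split => //; first exact: continuous_measurable_fun.
have [M [_ HM]] := compact_bounded (continuous_compact (continuous_subspaceT ceta) cK).
exists (`|M| + 1); first by rewrite addr_ge0.
move=> t; have [Kt|nKt] := pselect (K t); last by rewrite K0// normr0 addr_ge0.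
apply: (HM (`|M| + 1)); last by exists t.
by rewrite (le_lt_trans (ler_norm M))// ltrDl.
Qed.

Hypotheses (p2 : 2 < p) (ps0 : 0 < p * s) (N0 : (0 < N)%N) (bOm : bounded_set Om) (mOm : measurable Om) (T0 : 0 < T).
Variables (r : R) (w : E -> R -> R) (a w0 : E -> R) (lam A : R).
Hypotheses (r0 : 0 < r) (rOm : forall x : E, `|x| <= 2 * r -> Om x).
Hypotheses (ma : measurable_fun setT a) (aA : forall x, 0 <= a x <= A).
Hypothesis hsol : energy_solution s p Om T w (fun x t => lam * a x * w x t `^ (p - 1)) w0.
Hypothesis hpos : {ae (mu \x leb)%E, forall z, cylinder T Om z -> 0 <= w z.1 z.2}.

Let p1 : 1 < p. Proof. by have := p2; lra. Qed.
Let p0 : 0 < p. Proof. by have := p2; lra. Qed.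
Let q0 : 0 <= N%:R + p * s. Proof. by apply: addr_ge0 => //; exact: ltW. Qed.
Let mI : measurable (`]0, T[%classic : set RR). Proof. by []. Qed.

Local Notation W := (positive_part w).

Let WE x t : Om x -> 0 < t < T -> W x t = Num.max (w x t) 0.
Proof.
move=> Ox tT; rewrite /positive_part; case: asboolP => // -[]; split => //=.
Qed.

Let W0_ x t : ~ Om x -> W x t = 0.
Proof. by move=> nOx; rewrite /positive_part; case: asboolP => // -[]. Qed.

Let WT x t : ~~ (0 < t < T) -> W x t = 0.
Proof. by move=> tT; rewrite /positive_part; case: asboolP => // -[_] /=; rewrite in_itv/= (negbTE tT). Qed.

Let mw : measurable_fun (cylinder T Om) (fun z : E * RR => w z.1 z.2).
Proof.
have [[mw _ _] _ _ _] := hsol; apply: measurable_funS mw; first exact: measurableX.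
by move=> z [].
Qed.

Let mW : measurable_fun [set: E * RR] (fun z => W z.1 z.2).
Proof.
have mC : measurable (cylinder T Om : set (E * RR)) by exact: measurableX.
have := (measurable_restrictT (fun z : E * RR => Num.max (w z.1 z.2) 0) mC).1.
move=> /(_ (measurable_maxr mw (measurable_cst _))); congr measurable_fun.
Qed.

Lemma ae_agree : {ae leb, forall t, `]0, T[%classic t -> agree W w t}.
Proof.
have [[_ aeW _] _ _ _] := hsol.
have FF := ae_filter_ringOfSetsType leb.
have pos := ae_prod2 (m1 := mu) (m2 := leb) (P := fun x t => cylinder T Om (x, t) -> 0 <= w x t) hpos.
apply: filterS2 aeW pos => t H1 H2 tT; have [_ H3 _] := H1 tT.
apply: filterS2 H2 H3 => x h2 h3; have [Ox|nOx] := pselect (Om x); last by rewrite W0_// h3.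
have tT' : 0 < t < T by move: tT; rewrite /= in_itv/=.
rewrite (WE Ox tT').
by apply/max_idPl; exact: h2.
Qed.

Let agree_fst t : agree W w t -> {ae (mu \x mu)%E, forall z, W z.1 t = w z.1 t /\ W z.2 t = w z.2 t}.
Proof.
move=> h; have FF := ae_filter_ringOfSetsType (mu \x mu)%E.
exact: filterS2 (ae_prod_fst mu h) (ae_prod_snd mu h) => z ? ?.
Qed.

Let D_out (z : E * E) : z \notin D_ Om -> ~ Om z.1 /\ ~ Om z.2.
Proof.
move=> /negP; rewrite inE /D_ /= => /contrapT; by case: z.
Qed.

Let agree_gagliardo t : agree W w t -> gagliardo s p setT (W ^~ t) = gagliardo s p (D_ Om) (w ^~ t).
Proof.
move=> /agree_fst h; rewrite /gagliardo [RHS]integral_mkcond.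
apply: ae_eq_integral_nomeas; apply: filterS h => z [h1 h2] _.
rewrite patchE; case: ifPn => [_|/D_out[n1 n2]]; first by rewrite h1 h2.
by rewrite !W0_// subrr normr0 powR0 ?mul0r// gt_eqF.
Qed.

Lemma positive_part_finite : finite_energy s p Om T W.
Proof.
have [[_ _ woo] _ _ _] := hsol; split; [exact: mW| |exact: W0_|exact: WT|].
- by move=> x t; rewrite /positive_part; case: ifP => // _; rewrite le_max lexx orbT.
have -> : (\int[leb]_t gagliardo s p setT (W ^~ t) =
    \int[leb]_(t in `]0%R, T[) gagliardo s p (D_ Om) (w ^~ t))%E; last exact: woo.
rewrite [RHS]integral_mkcond; apply: ae_eq_integral_nomeas.
have FF := ae_filter_ringOfSetsType leb.
apply: filterS ae_agree => t h _; rewrite patchE; case: ifPn => [tT|].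
  by apply: agree_gagliardo; apply: h; rewrite -in_setE.
rewrite mem_setE in_itv/= => tT; rewrite /gagliardo integral0_eq// => z _.
by rewrite !(WT _ tT) subrr normr0 powR0 ?mul0r// gt_eqF.
Qed.

Let fW := positive_part_finite.

Section one_test.
Variable phi : E -> R.
Hypothesis tphi : bounded_test s p r phi.

Let W0phi c : W0 s p Om (fun x => c * phi x).
Proof.
have [mphi [B phiB] phir pg] := tphi.
apply: (W0_bounded_support p1 ps0 r0 mOm rOm (B := `|c| * B)).
- exact: measurable_funM.
- by move=> x; rewrite normrM; apply: ler_wpM2l => //; have /andP[h1 h2] := phiB x; rewrite ger0_norm.
- by move=> x /phir ->; rewrite mulr0.
- by rewrite gagliardoZ//; apply: lte_mul_pinfty; rewrite ?lee_fin ?powR_ge0.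
Qed.

Let phi_out x : ~ Om x -> phi x = 0.
Proof.
have [_ _ phir _] := tphi; move=> nOx; apply: phir; rewrite leNgt; apply/negP => xr; apply: nOx.
by apply: rOm; have := r0; move: xr; lra.
Qed.

Let Lp_W0_product (eta : R -> R) : test_function `]0, T[%classic eta ->
  Lp_W0 s p Om T (fun x t => eta t * phi x).
Proof.
move=> teta; have [meta _ [C C0 HC]] := test_function_bounded teta.
have [mphi _ _ pg] := tphi; split.
- apply: measurable_funTS; apply: measurable_funM.
    exact: (measurableT_comp meta measurable_snd).
  exact: (measurableT_comp mphi measurable_fst).
- by apply: aeW => t _; exact: W0phi.
have Eg : gagliardo s p setT phi = (fine (gagliardo s p setT phi))%:E.
  by rewrite fineK// ge0_fin_numE// gagliardo_ge0.
have mD : measurable (D_ Om) by apply: measurableC; apply: measurableX; exact: measurableC.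
have gD : (0 <= gagliardo s p (D_ Om) phi)%E by exact: gagliardo_ge0.
apply: (@le_lt_trans _ _ (\int[leb]_(t in `]0%R, T[) cst ((C `^ p)%:E * gagliardo s p setT phi)%E t)%E).
  under eq_integral do rewrite (gagliardoZ _ mD mphi).
  apply: ge0_le_integral => //.
  - by move=> t _; rewrite mule_ge0// lee_fin powR_ge0.
  - apply: emeasurable_funM => //; apply/measurable_EFinP/measurable_funTS.
    exact: measurable_powR_norm.
  move=> t _; apply: lee_pmul; [by rewrite lee_fin powR_ge0|exact: gD| |exact: gagliardo_sub].
  by rewrite lee_fin; apply: powR_mono => //; exact: ltW.
rewrite integral_cst// Eg -EFinM; apply: lte_mul_pinfty => //.
- by rewrite lee_fin mulr_ge0 ?powR_ge0// fine_ge0 ?gagliardo_ge0.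
- by rewrite /= lebesgue_measure_itv/=; case: ifP; rewrite ?ltry.
Qed.

Let fun_scale t (eta : R -> R) (F : (E -> R) -> R) : W0_dual s p Om F ->
  F (fun x => eta t * phi x) = eta t * F phi.
Proof.
move=> [lF _].
have W00 : W0 s p Om (fun=> 0).
  by have := W0phi 0; congr W0; apply/funext => x; rewrite mul0r.
have W01 : W0 s p Om phi.
  by have := W0phi 1; congr W0; apply/funext => x; rewrite mul1r.
have F0 : F (fun=> 0) = 0.
  have := lF 1 (fun=> 0) (fun=> 0) W00 W00.
  rewrite (_ : (fun x => _) = (fun=> 0)); last by apply/funext => x; rewrite mul1r addr0.
  by rewrite mul1r => /eqP; rewrite -subr_eq0 opprD addrA subrr sub0r oppr_eq0 => /eqP.
have := lF (eta t) phi (fun=> 0) W01 W00; rewrite F0 addr0 => <-; congr F.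
by apply/funext => x; rewrite addr0.
Qed.

(** Time is clamped to [[0, T]], so that continuity of [w] into [L^p] yields a function continuous
    on the whole line, as [du_bois_reymond] requires. *)
Let mean t : R := \int[mu]_(x in Om) (w x (Num.max 0 (Num.min t T)) * phi x).

Let meanE t : agree W w t -> 0 < t < T -> mean t = \int[mu]_x (W x t * phi x).
Proof.
move=> h /andP[t0 tT]; rewrite /mean (min_idPl (ltW tT)) (max_idPr (ltW t0)) Rintegral_mkcond.
apply: ae_eq_Rintegral; apply: filterS h => x hx _; rewrite patchE; case: ifPn => [_|]; first by rewrite hx.
by move=> /negP; rewrite in_setE => nOx; rewrite phi_out// mulr0.
Qed.

Let clamp t := Num.max 0 (Num.min t T).

Let clamp_in t : `[0, T]%classic (clamp t).
Proof.
rewrite /= in_itv/= /clamp le_max lexx/= ge_max ltW//= ge_min lexx orbT//.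
Qed.

Let clamp_lip t u : `|clamp t - clamp u| <= `|t - u|.
Proof.
exact: clamp_lipschitz T0.
Qed.

Let mean_continuous : continuous mean.
Proof.
move=> t0; have [mphi [B phiB] _ _] := tphi.
have B0 : 0 <= B by have /andP[h1 h2] := phiB 0; exact: le_trans h2.
have [_ [C1 C2] _ _] := hsol.
pose s0 := clamp t0.
pose K t := (\int[mu]_(x in Om) (`|w x t - w x s0| `^ p)%:E)%E.
have K0 t : (0 <= K t)%E by apply: integral_ge0 => x _; rewrite lee_fin powR_ge0.
have muO : mu Om \is a fin_num by rewrite ge0_fin_numE//; exact: lebesgue_rV_bounded.
pose m := fine (mu Om); have m0 : 0 <= m by rewrite fine_ge0.
have mpow (f : E -> R) : measurable_fun Om f -> measurable_fun Om (fun x => `|f x| `^ p).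
  move=> mf; apply: (measurableT_comp (measurable_powR p)); exact: measurableT_comp.
have icst (k : R) : mu.-integrable Om (EFin \o cst k).
  apply/integrableP; split; first exact/measurable_EFinP.
  rewrite (_ : (fun x => _) = cst `|k|%:E)// integral_cst//.
  by apply: lte_mul_pinfty; rewrite ?lee_fin// -ge0_fin_numE.
have ipow (f : E -> R) : measurable_fun Om f -> (\int[mu]_(x in Om) (`|f x| `^ p)%:E < +oo)%E ->
    mu.-integrable Om (EFin \o (fun x => `|f x| `^ p)).
  move=> mf foo; apply/integrableP; split; first by apply/measurable_EFinP; exact: mpow.
  by under eq_integral do rewrite gee0_abs ?lee_fin ?powR_ge0//.
(* On a set of finite measure this passes from [L^p] to [L^1] convergence: the term [d] contributes
   at most [d] times the volume, and the other one is small once the [L^p] distance is. *)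
have young (d : R) u : 0 < d -> `|u| <= d + d `^ (1 - p) * `|u| `^ p.
  move=> d0; have [ud|du] := leP `|u| d; first by apply: le_trans ud _; rewrite lerDl mulr_ge0 ?powR_ge0.
  apply: (@le_trans _ _ (d `^ (1 - p) * `|u| `^ p)); last by rewrite lerDr ltW.
  have u0 : 0 < `|u| by exact: lt_trans du.
  rewrite -opprB powRN mulrC ler_pdivlMr ?powR_gt0//.
  rewrite -[leRHS](powR_succ (normr_ge0 u) p0); apply: ler_wpM2l => //.
  by apply: powR_mono; [rewrite subr_ge0 ltW|exact: ltW|exact: ltW].
have est (f : E -> R) (d : R) : 0 < d -> measurable_fun Om f ->
    (\int[mu]_(x in Om) (`|f x| `^ p)%:E < +oo)%E ->
    mu.-integrable Om (EFin \o (fun x => f x * phi x)) /\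
    `|\int[mu]_(x in Om) (f x * phi x)| <= B * (d * m + d `^ (1 - p) * fine (\int[mu]_(x in Om) (`|f x| `^ p)%:E)%E).
  move=> d0 mf foo; have ip := ipow _ mf foo.
  have i3 := integrableD mOm (icst d) (integrableZl mOm (d `^ (1 - p)) ip).
  have i4 := integrableZl mOm B i3.
  have le1 x : `|f x * phi x| <= B * (d + d `^ (1 - p) * `|f x| `^ p).
    rewrite normrM mulrC; apply: ler_pM => //; last exact: young.
    by have /andP[h1 h2] := phiB x; rewrite ger0_norm.
  have i5 : mu.-integrable Om (EFin \o (fun x => f x * phi x)).
    apply: le_integrable i4 => //.
      by apply/measurable_EFinP/measurable_funM => //; exact: measurable_funTS.
    move=> x _ /=; rewrite lee_fin; apply: le_trans (le1 x) _; exact: ler_norm.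
  split => //; apply: le_trans (le_normr_Rintegral mOm i5) _.
  have -> : B * (d * m + d `^ (1 - p) * fine (\int[mu]_(x in Om) (`|f x| `^ p)%:E)%E) =
      \int[mu]_(x in Om) (B * (d + d `^ (1 - p) * `|f x| `^ p)).
    rewrite RintegralZl; [|by []|exact: i3].
    rewrite RintegralD; [|by []|exact: icst|exact: (integrableZl mOm _ ip)].
    by rewrite RintegralZl; [|by []|exact: ip]; rewrite Rintegral_cst.
  apply: le_Rintegral => //; exact: integrable_norm.
have mws u : `[0, T]%classic u -> measurable_fun Om (w ^~ u) by move=> /C1[].
have iws u : `[0, T]%classic u -> mu.-integrable Om (EFin \o (fun x => w x u * phi x)).
  by move=> uT; have [h1 h2] := C1 _ uT; have [] := est _ 1 ltr01 h1 h2.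
apply/cvgrPdist_le => e e0.
pose d := e / (2 * (B * m + 1)); have d0 : 0 < d by rewrite divr_gt0// mulr_gt0// ltr_wpDl// mulr_ge0.
pose D := B * d `^ (1 - p) + 1; have D0 : 0 < D by rewrite ltr_wpDl// mulr_ge0 ?powR_ge0.
have eD : 0 < e / 2 / D by rewrite !divr_gt0.
have near0 : \forall t \near within `[0, T]%classic (nbhs s0), K t \is a fin_num /\ fine (K t) < e / 2 / D.
  have /fine_cvgP[Kf /cvgr_lt/(_ _ eD) Kl] := C2 _ (clamp_in t0).
  by apply: filterS2 Kf Kl.
move: near0 => /nbhs_ballP[g /= g0 Hg].
apply/nbhs_ballP; exists g => // t tg.
have ctg : ball s0 g (clamp t) by apply: le_lt_trans tg; exact: clamp_lip.
have [Kf Kl] := Hg _ ctg (clamp_in t).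
have md : measurable_fun Om (fun x => w x (clamp t) - w x s0).
  by apply: measurable_funB; apply: mws; exact: clamp_in.
have Koo : (\int[mu]_(x in Om) (`|w x (clamp t) - w x s0| `^ p)%:E < +oo)%E.
  by have := Kf; rewrite ge0_fin_numE//; exact: K0.
have [_ H] := est _ d d0 md Koo.
rewrite distrC -[mean t]/(\int[mu]_(x in Om) (w x (clamp t) * phi x)) -[mean t0]/(\int[mu]_(x in Om) (w x s0 * phi x)).
have ict := iws _ (clamp_in t); have ic0 := iws _ (clamp_in t0).
rewrite -(RintegralB mOm ict ic0).
rewrite (@eq_Rintegral _ _ _ mu _ (fun x => (w x (clamp t) - w x s0) * phi x)); last by move=> x _; rewrite mulrBl.
apply: le_trans H _; rewrite -/(K (clamp t)) mulrDr.
have h1 : B * (d * m) <= e / 2.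
  have dE : d * (2 * (B * m + 1)) = e.
    by rewrite divfK// gt_eqF// mulr_gt0// ltr_wpDl// mulr_ge0.
  by move: dE d0; lra.
have h2 : B * (d `^ (1 - p) * fine (K (clamp t))) <= e / 2.
  rewrite mulrA; apply: (@le_trans _ _ (D * (e / 2 / D))); last by rewrite mulrC divfK// gt_eqF.
  by apply: ler_pM; rewrite ?mulr_ge0 ?powR_ge0 ?fine_ge0 ?(ltW Kl)// /D lerDl.
by rewrite [leRHS]splitr lerD.
Qed.

Let b t := flux s p (W ^~ t) phi.
Let c t := lam * reaction p a (W ^~ t) phi.

Let ib := integrable_flux p2 T0 fW.
Let ibphi := ib (let: And4 mphi _ _ _ := tphi in mphi) (let: And4 _ _ _ pg := tphi in pg).

Let ic : {ae leb, forall t, mu.-integrable setT (EFin \o (fun x => a x * W x t `^ (p - 1) * phi x))} /\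
  leb.-integrable setT (EFin \o (fun t => reaction p a (W ^~ t) phi)).
Proof.
have [mphi [B phiB] phir _] := tphi.
exact: (integrable_reaction p2 q0 N0 bOm T0 fW ma aA mphi phiB r0 phir).
Qed.

Section one_time_test.
Variable eta : R -> R.
Hypothesis teta : test_function `]0, T[%classic eta.

Let dual_term (xi : R -> (E -> R) -> R) : Lp'_W0_dual s p Om T xi ->
  \int[leb]_(t in `]0, T[) xi t (fun x => eta t * phi x) = \int[leb]_(t in `]0, T[) (eta t * xi t phi).
Proof.
move=> [ae_xi _ _]; have FF := ae_filter_ringOfSetsType leb.
apply: ae_eq_Rintegral; apply: filterS ae_xi => t h tT.
exact: fun_scale (h tT).
Qed.

Let flux_term : \int[leb]_(t in `]0, T[)
    \int[(mu \x mu)%E]_(z in D_ Om)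
      (jump p (w z.1 t - w z.2 t) * (eta t * phi z.1 - eta t * phi z.2) * nu z.1 z.2)
  = \int[leb]_(t in `]0, T[) (eta t * b t).
Proof.
apply: ae_eq_Rintegral; have FF := ae_filter_ringOfSetsType leb.
apply: filterS2 ae_agree ibphi.1 => t h it tT.
rewrite Rintegral_mkcond /b /flux -(RintegralZl (eta t) measurableT it).
apply: ae_eq_Rintegral; apply: filterS (agree_fst (h tT)) => z [h1 h2] _.
rewrite patchE; case: ifPn => [_|/D_out[n1 n2]]; first by rewrite h1 h2; ring.
by rewrite !W0_// subrr jump0 !mul0r mulr0.
Qed.

Let reaction_term : \int[(mu \x leb)%E]_(z in cylinder T Om)
    (lam * a z.1 * w z.1 z.2 `^ (p - 1) * (eta z.2 * phi z.1))
  = \int[leb]_(t in `]0, T[) (eta t * c t).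
Proof.
have [meta ceta [C C0 HC]] := test_function_bounded teta.
have [mphi [B phiB] phir _] := tphi.
pose f (x : E) (t : RR) := a x * W x t `^ (p - 1) * phi x.
have f0 x t : 0 <= f x t.
  by have /andP[h1 _] := phiB x; have /andP[h2 _] := aA x; rewrite !mulr_ge0 ?powR_ge0.
have mf : measurable_fun [set: E * RR] (fun z => f z.1 z.2).
  apply: measurable_funM; last exact: (measurableT_comp mphi measurable_fst).
  apply: measurable_funM; first exact: (measurableT_comp ma measurable_fst).
  exact: (measurableT_comp (measurable_powR _) mW).
pose F (z : E * RR) : \bar R := (eta z.2 * lam * f z.1 z.2)%:E.
have mF : measurable_fun setT F.
  apply/measurable_EFinP/measurable_funM => //; apply: measurable_funM => //.
  exact: (measurableT_comp meta measurable_snd).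
have [ic1 ic2] := ic.
have iF : (mu \x leb)%E.-integrable setT F.
  apply/integrableP; split; first exact: mF.
  have mabs : measurable_fun [set: E * RR] (fun z => `|eta z.2 * lam * f z.1 z.2|%:E).
    by apply/measurable_EFinP; apply: measurableT_comp => //; exact/measurable_EFinP.
  rewrite (tonelli_prod mu leb (f := fun (x : E) (t : RR) => `|eta t * lam * f x t|%:E) mabs); last first.
    by move=> x t; rewrite lee_fin.
  rewrite (tonelli_swap mu leb (f := fun (x : E) (t : RR) => `|eta t * lam * f x t|%:E) mabs); last first.
    by move=> x t; rewrite lee_fin.
  have i2 := integrableZl measurableT (C * `|lam|) ic2.
  apply: (@le_lt_trans _ _ (\int[leb]_t ((C * `|lam|) * reaction p a (W ^~ t) phi)%:E)%E); last first.
    exact: (integrable_lty measurableT i2).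
  have R0 t : 0 <= reaction p a (W ^~ t) phi by apply: Rintegral_ge0 => x _; exact: f0.
  apply: ae_ge0_le_integral; first by [].
  - by move=> t _; apply: integral_ge0 => x _; rewrite lee_fin.
  - apply: (measurable_integral_fst mu (f := fun (x : E) (t : RR) => `|eta t * lam * f x t|%:E) mabs).
    by move=> x t; rewrite lee_fin.
  - by move=> t _; rewrite lee_fin !mulr_ge0.
  - exact: (measurable_int _ i2).
  have FF := ae_filter_ringOfSetsType leb.
  apply: filterS ic1 => t it _.
  have mft : measurable_fun setT (f ^~ t).
    by exact: (measurableT_comp (measurable_swapped (f := fun t x => f x t) mf) (measurable_pair1 (t : RR))).
  have -> : (\int[mu]_x `|eta t * lam * f x t|%:E = \int[mu]_x (`|eta t * lam| * f x t)%:E)%E.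
    by apply: eq_integral => x _; rewrite normrM [in X in _ * X]ger0_norm.
  rewrite (integral_scalel mu mft (fun x => f0 x t) (normr_ge0 _)).
  rewrite -[X in (_ * X)%E]fineK; last exact: (integrable_fin_num measurableT it).
  rewrite -EFinM lee_fin; apply: ler_wpM2r; first exact: R0.
  by rewrite normrM; apply: ler_wpM2r.
have E1 : \int[(mu \x leb)%E]_(z in cylinder T Om)
    (lam * a z.1 * w z.1 z.2 `^ (p - 1) * (eta z.2 * phi z.1)) = fine (\int[(mu \x leb)%E]_z F z)%E.
  (* The weak formulation contains the power [p - 1] of [w]; the sign of [w], known almost
     everywhere in the cylinder, identifies it with that of [W]. *)
  rewrite Rintegral_mkcond; congr fine; apply: ae_eq_integral_nomeas.
  apply: filterS hpos => -[x t] h _; rewrite patchE; case: ifPn => [|].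
    rewrite in_setE => xt; rewrite /F /f /= WE//; [|by case: xt|]; last first.
      by case: xt => _ /=; rewrite in_itv.
    by rewrite (max_idPl (h xt)); congr EFin => /=; ring.
  rewrite notin_setE => xt; rewrite /F /f /=.
  rewrite (_ : W x t = 0); last by rewrite /positive_part; case: asboolP.
  by rewrite powR0 ?gt_eqF ?subr_gt0// mulr0 mul0r mulr0.
rewrite E1 -(integral21_prod_meas1 iF) Rintegral_mkcond; congr fine.
have FF := ae_filter_ringOfSetsType leb.
apply: ae_eq_integral_nomeas; apply: filterS ic1 => t it _; rewrite /fubini_G.
have -> : (\int[mu]_x F (x, t))%E = (eta t * c t)%:E.
  rewrite /F /= -[LHS]fineK; last first.
    exact: (integrable_fin_num measurableT (integrableZl measurableT (eta t * lam) it)).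
  by congr EFin; rewrite -/(Rintegral _ _ _) RintegralZl// /c mulrA.
rewrite patchE; case: ifPn => // ; rewrite mem_setE in_itv/= => tT; congr EFin.
rewrite /c /reaction (@eq_Rintegral _ _ _ mu _ (cst 0)) ?Rintegral_cst ?mul0r ?mulr0//.
by move=> x _; rewrite (WT _ tT) powR0 ?mulr0 ?mul0r// gt_eqF// subr_gt0.
Qed.

(** Separated test functions [eta t * phi x] reduce the weak formulation to a distributional
    differential equation for the scalar function [mean]. *)
Lemma weak_identity : \int[leb]_(t in `]0, T[) (derive1 eta t * mean t) =
  - \int[leb]_(t in `]0, T[) (eta t * (c t - 2^-1 * b t)).
Proof.
have [_ _ _ [xi [hxi tdx weak]]] := hsol.
have W01 : W0 s p Om phi.
  by have := W0phi 1; congr W0; apply/funext => x; rewrite mul1r.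
have E1 : \int[leb]_(t in `]0, T[) (derive1 eta t * mean t) = - \int[leb]_(t in `]0, T[) (eta t * xi t phi).
  rewrite -(tdx eta phi teta W01); apply: eq_Rintegral => t; rewrite inE/= in_itv/= => /andP[t0 tT].
  by rewrite /mean (min_idPl (ltW tT)) (max_idPr (ltW t0)).
have := weak _ (Lp_W0_product teta); rewrite (dual_term hxi) flux_term reaction_term => E2.
have [meta _ [C C0 HC]] := test_function_bounded teta.
have i1 : leb.-integrable `]0, T[ (EFin \o (fun t => eta t * b t)).
  apply: integrableS measurableT mI (@subsetT _ _) _.
  have [+ _] := integrable_mul_bounded ibphi.2 meta HC.
  by congr (integrable _ _ _); apply/funext => t; rewrite /= mulrC.
have i2 : leb.-integrable `]0, T[ (EFin \o (fun t => eta t * c t)).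
  apply: integrableS measurableT mI (@subsetT _ _) _.
  have [+ _] := integrable_mul_bounded ic.2 meta HC.
  move/(integrableZl measurableT lam).
  by congr (integrable _ _ _); apply/funext => t; rewrite /= -EFinM /c; congr EFin; ring.
rewrite E1; congr (- _).
transitivity (\int[leb]_(t in `]0, T[) (eta t * c t - 2^-1 * (eta t * b t))); last first.
  by apply: eq_Rintegral => t _; ring.
rewrite RintegralB; [|by []|exact: i2|exact: (integrableZl mI 2^-1 i1)].
by rewrite RintegralZl//; move: E2; lra.
Qed.

End one_time_test.

(** Stated for one fixed [phi] and all good pairs of times, so that [phi] may afterwards be chosen
    in terms of [W] at the later time. *)
Lemma evolution_increment t' t : agree W w t' -> agree W w t -> 0 < t' -> t' < t -> t < T ->
  \int[mu]_x (W x t * phi x) - \int[mu]_x (W x t' * phi x) =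
  \int[leb]_(tau in `]t', t[) (lam * reaction p a (W ^~ tau) phi - 2^-1 * flux s p (W ^~ tau) phi).
Proof.
move=> h' h t'0 t't tT.
rewrite -meanE//; last by rewrite tT (lt_trans t'0 t't).
rewrite -meanE//; last by rewrite t'0 (lt_trans t't tT).
apply: (du_bois_reymond (T := T) mean_continuous (B := fun t => c t - 2^-1 * b t)) => //.
- have i1 := integrableZl measurableT lam ic.2; have i2 := integrableZl measurableT 2^-1 ibphi.2.
  by apply: integrableS (integrableB measurableT i1 i2).
- exact: weak_identity.
Qed.

End one_test.
End positive_part.

(** * The test function *)

Section weighted_test.
Variables (R : realType) (N : nat) (s p : R).
Local Notation E := 'rV[R]_N.
Local Notation mu := (lebesgue_rV R N).
Local Notation leb := (@lebesgue_measure R).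
Local Notation RR := (measurableTypeR R).
Local Notation nu := (nu_density s p).
Implicit Types f g phi : E -> R.

(** For [q = 1 - p] this is the test function [v]; for [q = 2 - p] it is, up to the factor
    [1 / (2 - p)], the density of which [v] is the derivative in [f]. *)
Definition weighted phi f (e q : R) (x : E) : R := phi x `^ p * (f x + e) `^ q.

Variables (r B e : R) (phi : E -> R).
Hypotheses (p2 : 2 < p) (r0 : 0 < r) (e0 : 0 < e).
Hypotheses (mphi : measurable_fun setT phi) (phiB : forall x, 0 <= phi x <= B).
Hypothesis phir : forall x, r <= `|x| -> phi x = 0.

Let p1 : 1 < p. Proof. by have := p2; lra. Qed.
Let p0 : 0 < p. Proof. by have := p2; lra. Qed.
Let B0 : 0 <= B. Proof. by have /andP[h1 h2] := phiB 0; exact: le_trans h2. Qed.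

Lemma weighted_ge0 f q x : 0 <= weighted phi f e q x.
Proof. by rewrite mulr_ge0 ?powR_ge0. Qed.

Lemma measurable_weighted d (X : measurableType d) (f : X -> R) (g : X -> E) q :
  measurable_fun setT f -> measurable_fun setT g ->
  measurable_fun setT (fun x => phi (g x) `^ p * (f x + e) `^ q).
Proof.
move=> mf mg; apply: measurable_funM.
  by apply: (measurableT_comp (measurable_powR p)); exact: (measurableT_comp mphi mg).
by apply: (measurableT_comp (measurable_powR q)); exact: measurable_funD.
Qed.

Lemma weighted_le f q x : q <= 0 -> 0 <= f x -> weighted phi f e q x <= B `^ p * e `^ q.
Proof.
move=> q0 f0; have /andP[h1 h2] := phiB x.
apply: ler_pM; rewrite ?powR_ge0//; first by apply: powR_mono => //; exact: ltW.
rewrite -[q]opprK powRN [leRHS]powRN lef_pV2 ?posrE ?powR_gt0 ?ltr_wpDl//.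
by apply: powR_mono; rewrite ?oppr_ge0 ?(ltW e0)// lerDr.
Qed.

Lemma weighted_out f q x : r <= `|x| -> weighted phi f e q x = 0.
Proof. by move=> /phir xr; rewrite /weighted xr powR0 ?mul0r// gt_eqF. Qed.

Let q10 : 1 - p <= 0. Proof. by have := p2; lra. Qed.
Let q20 : 2 - p <= 0. Proof. by have := p2; lra. Qed.

Lemma weighted_gagliardo : exists2 C : R, 0 <= C & forall f, measurable_fun setT f -> (forall x, 0 <= f x) ->
  (gagliardo s p setT (weighted phi f e (1 - p)) <=
   C%:E * (gagliardo s p setT phi + gagliardo s p setT f))%E.
Proof.
have [C C0 HC] := test_sub_le B p1 e0; exists C => // f mf f0.
have m1 g : measurable_fun setT g -> measurable_fun setT (fun z : E * E => `|g z.1 - g z.2| `^ p * nu z.1 z.2).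
  by move=> mg; apply/measurable_EFinP; exact: measurable_gagliardo.
have g0 g (z : E * E) : 0 <= `|g z.1 - g z.2| `^ p * nu z.1 z.2.
  by rewrite mulr_ge0 ?powR_ge0// invr_ge0 powR_ge0.
have mv := measurable_weighted (1 - p) mf (measurable_id (D := setT)).
rewrite /gagliardo -(integral_add _ (m1 _ mphi) (g0 phi) (m1 _ mf) (g0 f)).
have m2 := measurable_funD (m1 _ mphi) (m1 _ mf).
rewrite -(integral_scalel _ m2 _ C0); last by move=> z; rewrite addr_ge0.
apply: integral_mono; [exact: (m1 _ mv)|exact: (g0 (weighted phi f e (1 - p)))|exact: measurable_funM|].
move=> z /=; rewrite -mulrDl mulrA ler_wpM2r ?invr_ge0 ?powR_ge0//.
have := HC (phi z.1) (phi z.2) (f z.1 + e) (f z.2 + e) (phiB _) (phiB _).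
rewrite opprD addrACA subrr addr0; apply.
  by rewrite lerDr.
by rewrite lerDr.
Qed.

Lemma weighted_bounded_test f : measurable_fun setT f -> (forall x, 0 <= f x) ->
  (gagliardo s p setT phi < +oo)%E -> (gagliardo s p setT f < +oo)%E ->
  bounded_test s p r (weighted phi f e (1 - p)).
Proof.
move=> mf f0 pg fg; split.
- exact: (measurable_weighted (1 - p) mf (measurable_id (D := setT))).
- exists (B `^ p * e `^ (1 - p)) => x; rewrite weighted_ge0; exact: weighted_le.
- by move=> x; exact: weighted_out.
have [C C0 HC] := weighted_gagliardo.
apply: le_lt_trans (HC f mf f0) _; apply: lte_mul_pinfty; rewrite ?lee_fin//.
exact: (lte_add_pinfty pg fg).
Qed.

Lemma integrable_box (g : E -> R) (M : R) : measurable_fun setT g -> (forall x, 0 <= g x <= M) ->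
  (forall x, r <= `|x| -> g x = 0) -> mu.-integrable setT (EFin \o g).
Proof.
move=> mg gM gr; apply: integrable_ge0 => //; first by move=> x; case/andP: (gM x).
exact: integral_box_le r0 mg gM gr.
Qed.

Lemma integrable_weighted f q : q <= 0 -> measurable_fun setT f -> (forall x, 0 <= f x) ->
  mu.-integrable setT (EFin \o weighted phi f e q).
Proof.
move=> q0 mf f0; apply: (integrable_box (M := B `^ p * e `^ q)).
- exact: (measurable_weighted q mf (measurable_id (D := setT))).
- by move=> x; rewrite weighted_ge0; exact: weighted_le.
- by move=> x; exact: weighted_out.
Qed.

Lemma integrable_mul_weighted f g : measurable_fun setT f -> (forall x, 0 <= f x) ->
  measurable_fun setT g -> (forall x, 0 <= g x) -> (\int[mu]_x (g x `^ p)%:E < +oo)%E ->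
  mu.-integrable setT (EFin \o (fun x => g x * weighted phi f e (1 - p) x)).
Proof.
move=> mf f0 mg g0 goo; pose K := B `^ p * e `^ (1 - p).
have K0 : 0 <= K by rewrite mulr_ge0 ?powR_ge0.
have mv := measurable_weighted (1 - p) mf (measurable_id (D := setT)).
have mgp : measurable_fun setT (fun x => g x `^ p).
  exact: (measurableT_comp (measurable_powR p) mg).
have i1 := integrableZl measurableT K (integrable_ge0 mgp (fun x => powR_ge0 _ _) goo).
have i2 := integrable_weighted q10 mf f0.
have i3 := integrableD measurableT i1 i2.
apply: (le_integrable measurableT _ _ i3); first by apply/measurable_EFinP; exact: measurable_funM.
move=> x _ /=; rewrite lee_fin; apply: le_trans (ler_norm _).
rewrite ger0_norm; last by apply: mulr_ge0; rewrite ?weighted_ge0.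
have v0 := weighted_ge0 f (1 - p) x; have vK := @weighted_le f (1 - p) x q10 (f0 x).
have [g1|g1] := leP (g x) 1.
  apply: (@le_trans _ _ (weighted phi f e (1 - p) x)); first exact: ler_piMl.
  by rewrite lerDr; apply: mulr_ge0 => //; exact: powR_ge0.
apply: (@le_trans _ _ (K * g x `^ p)); last by rewrite lerDl.
apply: (@le_trans _ _ (K * g x)); first by rewrite mulrC; exact: ler_wpM2r.
apply: ler_wpM2l => //; rewrite -{1}[g x]powRr1//; apply: ler_powR; exact: ltW.
Qed.

(* Concavity: [r |-> r^(2-p) / (2-p)] has derivative [r^(1-p)]. *)
Lemma weighted_concavity f g : measurable_fun setT f -> (forall x, 0 <= f x) ->
  measurable_fun setT g -> (forall x, 0 <= g x) ->
  (\int[mu]_x (f x `^ p)%:E < +oo)%E -> (\int[mu]_x (g x `^ p)%:E < +oo)%E ->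
  (p - 2) * (\int[mu]_x (f x * weighted phi f e (1 - p) x) - \int[mu]_x (g x * weighted phi f e (1 - p) x))
   <= \int[mu]_x weighted phi g e (2 - p) x - \int[mu]_x weighted phi f e (2 - p) x.
Proof.
move=> mf f0 mg g0 foo goo.
have i1 := integrable_mul_weighted mf f0 mf f0 foo; have i2 := integrable_mul_weighted mf f0 mg g0 goo.
have i3 := integrable_weighted q20 mg g0; have i4 := integrable_weighted q20 mf f0.
have i5 := integrableZl measurableT (p - 2) (integrableB measurableT i1 i2).
have i6 := integrableB measurableT i3 i4.
rewrite -(RintegralB measurableT i1 i2) -(RintegralB measurableT i3 i4).
rewrite -(RintegralZl (p - 2) measurableT (integrableB measurableT i1 i2)).
apply: (le_Rintegral measurableT i5 i6) => x _ /=.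
have fe : 0 < f x + e by rewrite ltr_wpDl. have ge : 0 < g x + e by rewrite ltr_wpDl.
have := powR_tangentN q20 fe ge.
rewrite (_ : 2 - p - 1 = 1 - p); last by ring.
rewrite (_ : g x + e - (f x + e) = g x - f x); last by ring.
move=> /(ler_wpM2l (powR_ge0 (phi x) p)); rewrite /weighted; lra.
Qed.

End weighted_test.

(** * Time cutoffs and discrete integration by parts *)

Section time_cutoff.
Variable R : realType.
Local Notation leb := (@lebesgue_measure R).
Local Notation RR := (measurableTypeR R).

(** [dzeta] is only a majorant of the derivative: it bounds forward increments of [zeta] from above
    to second order. A function with a corner can thus serve, and [dzeta] stays nonnegative where
    [zeta] decreases. *)
Definition time_cutoff (T C : R) (zeta dzeta : R -> R) : Prop :=
  [/\ measurable_fun [set: RR] zeta /\ measurable_fun [set: RR] dzeta,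
      forall t, 0 <= zeta t <= C, forall t, 0 <= dzeta t <= C,
      forall t, ~~ (0 < t < T) -> zeta t = 0 /\ dzeta t = 0 &
      forall t h, 0 <= h <= 1 -> zeta (t + h) <= zeta t + h * dzeta t + C * h ^+ 2].

Lemma integrable_interval (f : R -> R) (M a b : R) : measurable_fun [set: RR] f ->
  (forall t, `|f t| <= M) -> (forall t, ~~ (a < t < b) -> f t = 0) -> leb.-integrable setT (EFin \o f).
Proof.
move=> mf fM f0.
have M0 : 0 <= M by exact: le_trans (fM 0).
have mI : measurable (`]a, b[%classic : set RR) by [].
have i1 : leb.-integrable `]a, b[ (EFin \o cst M).
  apply/integrableP; split; first exact/measurable_EFinP.
  rewrite (_ : (fun x => _) = cst `|M|%:E)// integral_cst//.
  apply: lte_mul_pinfty => //; rewrite /= lebesgue_measure_itv/=; case: ifP => _; first by rewrite -EFinB ltry.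
  exact: ltry.
have i2 : leb.-integrable `]a, b[ (EFin \o f).
  apply: (le_integrable mI _ _ i1); first by apply/measurable_EFinP; exact: measurable_funTS.
  by move=> t _ /=; rewrite lee_fin (ger0_norm M0).
have [H _] := integrable_mkcond (mu := leb) (EFin \o f) mI; have := H i2; congr (integrable _ _ _).
apply/funext => t; rewrite patchE mem_setE in_itv/=; case: ifPn => // /f0 h; by rewrite /= h.
Qed.

Lemma Rintegral_shift_real (f : R -> R) (h : R) : measurable_fun [set: RR] f -> (forall t, 0 <= f t) ->
  \int[leb]_t f t = \int[leb]_t f (t + h).
Proof.
move=> mf f0; congr fine.
rewrite (ge0_integral_affine (f := fun t => (f t)%:E) h ltr01) //; last exact/measurable_EFinP.
by rewrite mul1e; apply: eq_integral => x _; rewrite mul1r.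
Qed.

Variables (T C : R) (zeta dzeta : R -> R).
Hypotheses (T0 : 0 < T) (hz : time_cutoff T C zeta dzeta).

Let mz : measurable_fun [set: RR] zeta. Proof. by have [[]] := hz. Qed.
Let mdz : measurable_fun [set: RR] dzeta. Proof. by have [[]] := hz. Qed.
Let z0 t : 0 <= zeta t. Proof. by have [_ + _ _ _] := hz => /(_ t)/andP[]. Qed.
Let zC t : zeta t <= C. Proof. by have [_ + _ _ _] := hz => /(_ t)/andP[]. Qed.
Let dz0 t : 0 <= dzeta t. Proof. by have [_ _ + _ _] := hz => /(_ t)/andP[]. Qed.
Let dzC t : dzeta t <= C. Proof. by have [_ _ + _ _] := hz => /(_ t)/andP[]. Qed.
Let zout t : ~~ (0 < t < T) -> zeta t = 0. Proof. by have [_ _ _ + _] := hz => /(_ t) H /H[]. Qed.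
Let dzout t : ~~ (0 < t < T) -> dzeta t = 0. Proof. by have [_ _ _ + _] := hz => /(_ t) H /H[]. Qed.
Let C0 : 0 <= C. Proof. exact: le_trans (z0 0) (zC 0). Qed.

Lemma integrable_cutoff (psi : R -> R) (K : R) : measurable_fun [set: RR] psi -> (forall t, 0 <= psi t <= K) ->
  leb.-integrable setT (EFin \o (fun t => zeta t * psi t)) /\
  leb.-integrable setT (EFin \o (fun t => dzeta t * psi t)).
Proof.
move=> mp pK; split; (apply: (integrable_interval (M := C * K) (a := 0) (b := T)); first exact: measurable_funM).
- by move=> t; have /andP[h1 h2] := pK t; rewrite ger0_norm ?mulr_ge0// ler_pM.
- by move=> t /zout ->; rewrite mul0r.
- by move=> t; have /andP[h1 h2] := pK t; rewrite ger0_norm ?mulr_ge0// ler_pM.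
- by move=> t /dzout ->; rewrite mul0r.
Qed.

(** Discrete integration by parts: translation invariance moves the shift from [psi] to [zeta],
    whose increments are controlled by [dzeta]. *)
Lemma cutoff_shift_le (psi : R -> R) (K h : R) : measurable_fun [set: RR] psi -> (forall t, 0 <= psi t <= K) ->
  0 <= h <= 1 ->
  \int[leb]_t (zeta t * psi (t - h)) <=
  \int[leb]_t (zeta t * psi t) + h * \int[leb]_t (dzeta t * psi t) + C * h ^+ 2 * K * (T + 1).
Proof.
move=> mp pK h01; have [i1 i2] := integrable_cutoff mp pK; have /andP[h0 h1] := h01.
have p0 t : 0 <= psi t by have /andP[] := pK t.
have ms (g : R -> R) (u : R) : measurable_fun [set: RR] g -> measurable_fun [set: RR] (fun t => g (t + u)).
  by move=> mg; apply: (measurableT_comp (f := g) mg); exact: measurable_funD.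
rewrite (Rintegral_shift_real (f := fun t => zeta t * psi (t - h)) h); last 2 first.
- by apply: measurable_funM => //; exact: ms.
- by move=> t; rewrite mulr_ge0.
have -> : \int[leb]_t (zeta (t + h) * psi (t + h - h)) = \int[leb]_t (zeta (t + h) * psi t).
  by apply: eq_Rintegral => t _; rewrite addrK.
have K0 : 0 <= K by exact: le_trans (p0 0) (andP (pK 0)).2.
(* As [h <= 1], the shifted cutoff [zeta (t + h)] lives in []-1, T[]; the quadratic error is paid
   there only, hence the length [T + 1]. *)
pose ind (t : R) : R := if -1 < t < T then 1 else 0.
have mind : measurable_fun [set: RR] ind.
  apply: measurable_fun_ifT => //; apply: measurable_and; exact: measurable_fun_ltr.
have i3 : leb.-integrable setT (EFin \o (fun t => ind t * (C * h ^+ 2 * K))).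
  apply: (integrable_interval (M := C * h ^+ 2 * K) (a := -1) (b := T)).
  - exact: measurable_funM.
  - by move=> t; rewrite /ind; case: ifP => _; rewrite ?mul1r ?mul0r ?normr0 ?ger0_norm// !mulr_ge0// exprn_ge0.
  - by move=> t /negbTE; rewrite /ind => ->; rewrite mul0r.
have E3 : \int[leb]_t (ind t * (C * h ^+ 2 * K)) = C * h ^+ 2 * K * (T + 1).
  transitivity (\int[leb]_(t in `]-1, T[) cst (C * h ^+ 2 * K) t).
    rewrite [RHS]Rintegral_mkcond; apply: eq_Rintegral => t _; rewrite patchE mem_setE in_itv/= /ind.
    by case: ifP; rewrite ?mul1r ?mul0r.
  rewrite Rintegral_cst//= lebesgue_measure_itv/= lte_fin; have -> : -1 < T by have := T0; lra.
  by rewrite -EFinB/= opprK.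
have i2' := integrableZl measurableT h i2.
have i4 := integrableD measurableT (integrableD measurableT i1 i2') i3.
rewrite -E3 -(RintegralZl h measurableT i2) -(RintegralD measurableT i1 i2') -(RintegralD measurableT (integrableD measurableT i1 i2') i3).
have le1 t : zeta (t + h) * psi t <= zeta t * psi t + h * (dzeta t * psi t) + ind t * (C * h ^+ 2 * K).
  have /andP[q0 q1] := pK t; rewrite /ind; case: ifPn => tT.
    have [_ _ _ _ /(_ t h h01) H] := hz.
    have X : C * h ^+ 2 * psi t <= C * h ^+ 2 * K by apply: ler_wpM2l => //; rewrite mulr_ge0 ?exprn_ge0.
    by apply: le_trans (ler_wpM2r q0 H) _; move: X; lra.
  rewrite zout ?mul0r ?addr0 ?addr_ge0 ?mulr_ge0//.
  by move: tT; apply: contra => /andP[? ?]; apply/andP; split; have := h0; have := h1; lra.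
apply: (le_Rintegral measurableT _ i4) => [|t _]; last exact: le1.
apply: (le_integrable measurableT _ _ i4).
  by apply/measurable_EFinP; apply: measurable_funM => //; exact: ms.
move=> t _ /=; rewrite lee_fin ger0_norm ?mulr_ge0//; apply: le_trans (le1 t) _; exact: ler_norm.
Qed.

(** After exchanging the order of integration, [t] runs over []tau, tau + h[], where
    [zeta t <= zeta tau + 2 C h]. *)
Lemma cutoff_steklov_le (en : R -> R) (h : R) : leb.-integrable setT (EFin \o en) -> (forall t, 0 <= en t) ->
  0 < h <= 1 ->
  leb.-integrable setT (EFin \o (fun t => zeta t * \int[leb]_(tau in `]t - h, t[) en tau)) /\
  \int[leb]_t (zeta t * \int[leb]_(tau in `]t - h, t[) en tau) <=
  h * (\int[leb]_t (zeta t * en t) + 2 * C * h * \int[leb]_t en t).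
Proof.
move=> ie e0 /andP[h0 h1].
have me : measurable_fun [set: RR] en by apply/measurable_EFinP; exact: measurable_int ie.
pose f (t tau : RR) : R := if (t - h < tau) && (tau < t) then en tau else 0.
have f0 t tau : 0 <= f t tau by rewrite /f; case: ifP.
have mf : measurable_fun [set: RR * RR] (fun u => f u.1 u.2).
  apply: measurable_fun_ifT => //; last exact: (measurableT_comp me measurable_snd).
  apply: measurable_and; apply: measurable_fun_ltr => //; first by apply: measurable_funB => //; exact: measurable_fst.
have S_ t : \int[leb]_(tau in `]t - h, t[) en tau = \int[leb]_tau f t tau.
  rewrite Rintegral_mkcond; apply: eq_Rintegral => tau _.
  by rewrite patchE mem_setE in_itv/= /f.
have mS : measurable_fun [set: RR] (fun t => \int[leb]_tau f t tau) by exact: (measurable_Rintegral_snd leb mf).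
have ift t : leb.-integrable setT (EFin \o f t).
  apply: (le_integrable measurableT _ _ ie).
    by apply/measurable_EFinP; exact: (measurableT_comp mf (measurable_pair1 (t : RR))).
  by move=> tau _ /=; rewrite lee_fin (ger0_norm (f0 _ _)) (ger0_norm (e0 _)) /f; case: ifP.
pose M := \int[leb]_t en t.
have S0 t : 0 <= \int[leb]_tau f t tau by apply: Rintegral_ge0.
have SM t : \int[leb]_tau f t tau <= M.
  by apply: (le_Rintegral measurableT (ift t) ie) => tau _; rewrite /f; case: ifP.
have [iS _] := integrable_cutoff mS (fun t => introT andP (conj (S0 t) (SM t))).
have -> : (fun t => zeta t * \int[leb]_(tau in `]t - h, t[) en tau) = (fun t => zeta t * \int[leb]_tau f t tau).
  by apply/funext => t; rewrite S_.
split; first exact: iS.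
have mzf : measurable_fun [set: RR * RR] (fun u => (zeta u.1 * f u.1 u.2)%:E).
  by apply/measurable_EFinP; apply: measurable_funM => //; exact: (measurableT_comp mz measurable_fst).
have zf0 t tau : (0 <= (zeta t * f t tau)%:E)%E by rewrite lee_fin mulr_ge0.
have E1 : \int[leb]_t (zeta t * \int[leb]_tau f t tau) = fine (\int[leb]_tau \int[leb]_t (zeta t * f t tau)%:E)%E.
  rewrite -(tonelli_swap leb leb (f := fun t tau : RR => (zeta t * f t tau)%:E) mzf zf0); congr fine.
  apply: eq_integral => t _; rewrite -(RintegralZl (zeta t) measurableT (ift t)).
  by rewrite fineK//; exact: (integrable_fin_num measurableT (integrableZl measurableT (zeta t) (ift t))).
have ize : leb.-integrable setT (EFin \o (fun t => zeta t * en t)).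
  have i := integrableZl measurableT C ie.
  apply: (le_integrable measurableT _ _ i); first by apply/measurable_EFinP; exact: measurable_funM.
  by move=> t _ /=; rewrite lee_fin !ger0_norm ?mulr_ge0// ler_wpM2r.
have i5 := integrableZl measurableT (2 * C * h) ie.
have i6 := integrableD measurableT ize i5; have i7 := integrableZl measurableT h i6.
rewrite E1 -(RintegralZl _ measurableT ie) -(RintegralD measurableT ize i5) -(RintegralZl h measurableT i6).
apply: fine_le.
- rewrite -(tonelli_swap leb leb (f := fun t tau : RR => (zeta t * f t tau)%:E) mzf zf0).
  rewrite (_ : (\int[leb]_t \int[leb]_tau (zeta t * f t tau)%:E)%E = (\int[leb]_t (zeta t * \int[leb]_tau f t tau)%:E)%E).
    exact: (integrable_fin_num measurableT iS).
  apply: eq_integral => t _; rewrite -(RintegralZl (zeta t) measurableT (ift t)).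
  by rewrite fineK//; exact: (integrable_fin_num measurableT (integrableZl measurableT (zeta t) (ift t))).
- exact: (integrable_fin_num measurableT i7).
apply: le_integral_ge0.
- exact: (measurable_integral_fst leb (f := fun t tau : RR => (zeta t * f t tau)%:E) mzf zf0).
- exact: measurable_int i7.
- by move=> tau; rewrite lee_fin !(mulr_ge0, addr_ge0)// ltW.
move=> tau.
have -> : (h * (zeta tau * en tau + 2 * C * h * en tau))%:E =
    (\int[leb]_(t in `]tau, (tau + h)%R[) ((zeta tau + 2 * C * h) * en tau)%:E)%E.
  rewrite integral_cst//= lebesgue_measure_itv/= lte_fin ltrDl h0 -EFinB -EFinM; congr EFin; ring.
rewrite [leRHS]integral_mkcond; apply: le_integral_ge0.
- apply/measurable_EFinP; apply: measurable_funM => //.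
  exact: (measurableT_comp mf (measurable_pair2 (tau : RR))).
- have := (measurable_restrictT (fun _ : RR => ((zeta tau + 2 * C * h) * en tau)%:E) (_ : measurable (`]tau, (tau + h)[%classic : set RR))).1.
  by apply.
- by move=> t; rewrite patchE; case: ifP => // _; rewrite lee_fin !(mulr_ge0, addr_ge0)// ltW.
move=> t; rewrite patchE mem_setE in_itv/= /f ltrBlDr andbC.
case: ifPn => [/andP[a1 a2]|_]; last by rewrite mulr0 lee_fin.
rewrite lee_fin; apply: ler_wpM2r => //.
have [_ _ _ _ /(_ tau (t - tau))] := hz.
rewrite addrCA subrr addr0 => /(_ _)/le_trans; apply.
  by apply/andP; split; have := h1; lra.
rewrite -addrA lerD2l.
have d0 : 0 <= t - tau by lra. have dh : t - tau <= h by lra.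
have X1 : (t - tau) * dzeta tau <= h * C by apply: ler_pM.
have X2 : C * (t - tau) ^+ 2 <= C * h.
  apply: ler_wpM2l => //; rewrite expr2; apply: (@le_trans _ _ (h * 1)); last by rewrite mulr1.
  by apply: ler_pM => //; exact: le_trans h1.
by move: X1 X2; lra.
Qed.

End time_cutoff.

(** * The energy inequality *)

Section interval_lemmas.
Variable R : realType.
Local Notation leb := (@lebesgue_measure R).
Local Notation RR := (measurableTypeR R).

(** Reading: [i = 1/(p-2)]; [A0], [A1], [A2] are the integrals of [zeta psi], of [zeta] times the
    shifted [psi], and of [dzeta psi]; [S] is that of [zeta] times the energy over the past interval
    of length [h], [En] and [G] those of [zeta] times the energies of [W] and [v], and [M] that of
    the energy of [W]. *)
Lemma steklov_algebra (k h i C K T A0 A1 A2 S En M G : R) : 0 <= k -> 0 <= i -> k * h = 1 ->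
  A1 <= A0 + h * A2 + C * h ^+ 2 * K * (T + 1) -> S <= h * (En + 2 * C * h * M) ->
  k * i * A1 + k * 2^-1 * S + 2^-1 * G - k * i * A0 <=
  i * A2 + 2^-1 * En + 2^-1 * G + (i * (C * K * (T + 1)) + C * M) * h.
Proof.
move=> k0 i0 kh H1 H2.
have ki : 0 <= k * i by exact: mulr_ge0.
have k2 : 0 <= k * 2^-1 by rewrite mulr_ge0.
have {}H1 := ler_wpM2l ki H1; have {}H2 := ler_wpM2l k2 H2.
have E1 : k * i * (A0 + h * A2 + C * h ^+ 2 * K * (T + 1)) =
    k * i * A0 + (k * h) * (i * A2) + (k * h) * (i * (C * K * (T + 1)) * h) by ring.
have E2 : k * 2^-1 * (h * (En + 2 * C * h * M)) = (k * h) * (2^-1 * En) + (k * h) * (C * M * h).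
  by field.
move: H1 H2; rewrite E1 E2 kh; lra.
Qed.

(** Adding the first two hypotheses cancels the gap [g] and the energies [x] and [y]. The surplus
    [V] is then spent in two halves, on the time term [D] and on the error [b1]. *)
Lemma absorption_algebra (g q D x y V F L b1 b2 K P : R) : g + q <= D + x + y -> x + y + V <= g + F ->
  L <= q + (b1 + b2) -> D <= V / 2 + K -> b1 <= V / 2 -> b2 <= P -> L <= F + K + P.
Proof. by lra. Qed.

Lemma mul_half_addr (z x y k m : R) :
  z * (2^-1 * (x + y) + k * m) = 2^-1 * (z * x) + 2^-1 * (z * y) + k * (z * m).
Proof. by ring. Qed.

Lemma young_time_algebra (f d i x k y c : R) : f * (d * (i * x)) <= f * (k * y + c) ->
  d * i * (f * x) <= k * (f * y) + c * f.
Proof. by lra. Qed.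

Section linear_combination.
Context d (X : measurableType d) (m : {measure set X -> \bar R}) (f g h : X -> R).
Hypotheses (fi : m.-integrable setT (EFin \o f)) (gi : m.-integrable setT (EFin \o g)).
Hypothesis hi : m.-integrable setT (EFin \o h).

Lemma integral_linear1 (a : R) : (\int[m]_x (a * f x)%:E)%E = (a * \int[m]_x f x)%:E.
Proof.
rewrite -[LHS]fineK; last exact: (integrable_fin_num measurableT (integrableZl measurableT a fi)).
by congr EFin; rewrite -/(Rintegral _ _ _) (RintegralZl a measurableT fi).
Qed.

Lemma integral_linear2 (a b : R) :
  (\int[m]_x (a * f x + b * g x)%:E)%E = (a * \int[m]_x f x + b * \int[m]_x g x)%:E.
Proof.
have j1 := integrableZl measurableT a fi; have j2 := integrableZl measurableT b gi.
rewrite -[LHS]fineK; last exact: (integrable_fin_num measurableT (integrableD measurableT j1 j2)).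
congr EFin; rewrite -/(Rintegral _ _ _) (RintegralD measurableT j1 j2).
by rewrite (RintegralZl a measurableT fi) (RintegralZl b measurableT gi).
Qed.

Lemma integral_linear3 (a b c : R) : (\int[m]_x (a * f x + b * g x + c * h x)%:E)%E =
  (a * \int[m]_x f x + b * \int[m]_x g x + c * \int[m]_x h x)%:E.
Proof.
have j1 := integrableZl measurableT a fi; have j2 := integrableZl measurableT b gi.
have j3 := integrableZl measurableT c hi; have j4 := integrableD measurableT j1 j2.
rewrite -[LHS]fineK; last exact: (integrable_fin_num measurableT (integrableD measurableT j4 j3)).
congr EFin; rewrite -/(Rintegral _ _ _) (RintegralD measurableT j4 j3) (RintegralD measurableT j1 j2).
by rewrite (RintegralZl a measurableT fi) (RintegralZl b measurableT gi) (RintegralZl c measurableT hi).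
Qed.

End linear_combination.

Lemma ae_shift (P : R -> Prop) (h : R) : {ae leb, forall t, P t} -> {ae leb, forall t, P (t - h)}.
Proof.
move=> [A [mA A0 PA]]; exists [set t : RR | A (1 * t - h)]; split.
- rewrite -[X in measurable X]setTI.
  by apply: (measurable_affine 1 (- h)).
- by have := lebesgue_measure_affine (- h) ltr01 mA; rewrite mul1e A0 => <-.
- by move=> t /= ht; rewrite mul1r; exact: PA.
Qed.

(** Fatou controls the two parts separately, while only their sum is bounded above. Comparison with
    reals below [A] and [B] gives the bound and at the same time the finiteness of both limits. *)
Lemma limn_einf_add_le (u v : (\bar R)^nat) (A B : \bar R) (r K : R) :
  (forall k, 0 <= u k)%E -> (forall k, 0 <= v k)%E -> (0 <= A)%E -> (0 <= B)%E ->
  (A <= limn_einf u)%E -> (B <= limn_einf v)%E -> 0 <= K ->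
  (exists n, forall k, (n <= k)%N -> (u k + v k <= (r + K * k.+1%:R^-1)%:E)%E) -> (A + B <= r%:E)%E.
Proof.
move=> u0 v0 A0 B0 Au Bv K0 [n H].
have split_ (x y : R) : (x%:E < A)%E -> (y%:E < B)%E -> x + y <= r.
  move=> xA yB; have [n1 H1] := limn_einf_gt (lt_le_trans xA Au).
  have [n2 H2] := limn_einf_gt (lt_le_trans yB Bv).
  apply/ler_addgt0Pr => e e0.
  have [m Hm] : exists m, forall k, (m <= k)%N -> K * k.+1%:R^-1 <= e.
    exists (Num.truncn (K / e)) => k mk; rewrite ler_pdivrMr// -ler_pdivrMl// mulrC.
    apply: le_trans (ltW (truncnS_gt _)) _; by rewrite ler_nat ltnS.
  pose k := maxn (maxn n1 n2) (maxn n m).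
  have k1 : (n1 <= k)%N by rewrite !leq_max leqnn.
  have k2 : (n2 <= k)%N by rewrite !leq_max leqnn orbT.
  have k3 : (n <= k)%N by rewrite !leq_max leqnn !orbT.
  have k4 : (m <= k)%N by rewrite !leq_max leqnn !orbT.
  have := leeD (ltW (H1 _ k1)) (ltW (H2 _ k2)) => /le_trans/(_ (H _ k3)).
  by rewrite -EFinD lee_fin => /le_trans; apply; rewrite lerD2l; exact: Hm.
have fin (X Y : \bar R) : (0 <= X)%E -> (0 <= Y)%E -> (forall x y : R, (x%:E < X)%E -> (y%:E < Y)%E -> x + y <= r) ->
    X \is a fin_num.
  move=> X0 Y0 h; rewrite ge0_fin_numE// ltNge leye_eq; apply/eqP => Xoo.
  have := h (r + 2) (-1); rewrite Xoo ltry => /(_ isT).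
  have -> : ((-1)%:E < Y)%E by apply: lt_le_trans Y0; rewrite lte_fin; lra.
  by move=> /(_ isT); lra.
have fA := fin _ _ A0 B0 split_.
have fB : B \is a fin_num by apply: (fin _ _ B0 A0) => x y hx hy; rewrite addrC; exact: split_.
rewrite -(fineK fA) -(fineK fB) -EFinD lee_fin; apply/ler_addgt0Pr => e e0.
have hA : ((fine A - e / 2)%:E < A)%E by rewrite -{2}(fineK fA) lte_fin; lra.
have hB : ((fine B - e / 2)%:E < B)%E by rewrite -{2}(fineK fB) lte_fin; lra.
by have := split_ _ _ hA hB; lra.
Qed.

Lemma swap_interval d (Z : measurableType d) (m : {sigma_finite_measure set Z -> \bar R})
    (F : Z -> RR -> R) (H : R -> R) (c t' t : R) : 0 <= c ->
  measurable_fun [set: Z * RR] (fun u => F u.1 u.2) -> (forall z tau, 0 <= F z tau) ->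
  leb.-integrable `]t', t[ (EFin \o H) -> {ae leb, forall tau, (\int[m]_z (F z tau)%:E)%E = (H tau)%:E} ->
  (\int[m]_z \int[leb]_(tau in `]t', t]) (c * F z tau)%:E)%E = (c * \int[leb]_(tau in `]t', t[) H tau)%:E.
Proof.
move=> c0 mF F0 iH' FH.
pose ind (tau : RR) : R := if (t' < tau) && (tau <= t) then 1 else 0.
have ind0 tau : 0 <= ind tau by rewrite /ind; case: ifP.
have mind : measurable_fun setT ind.
  apply: measurable_fun_ifT => //; apply: measurable_and; [exact: measurable_fun_ltr|exact: measurable_fun_ler].
pose f z tau : \bar R := (ind tau * c * F z tau)%:E.
have f0 z tau : (0 <= f z tau)%E by rewrite lee_fin !mulr_ge0.
have mf : measurable_fun [set: Z * RR] (fun u => f u.1 u.2).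
  apply/measurable_EFinP; apply: measurable_funM => //; apply: measurable_funM => //.
  exact: (measurableT_comp mind measurable_snd).
transitivity (\int[m]_z \int[leb]_tau f z tau)%E.
  apply: eq_integral => z _; rewrite integral_mkcond; apply: eq_integral => tau _.
  by rewrite patchE mem_setE in_itv/= /f /ind; case: ifP => _; rewrite ?mul1r ?mul0r.
rewrite (tonelli_swap m leb (f := f) mf f0).
have FF := ae_filter_ringOfSetsType leb.
have mI : measurable (`]t', t[%classic : set RR) by [].
transitivity (\int[leb]_(tau in `]t', t]) (c * H tau)%:E)%E.
  rewrite [RHS]integral_mkcond; apply: ae_eq_integral_nomeas; apply: filterS FH => tau h _.
  have mFt : measurable_fun setT (F ^~ tau) by exact: (measurableT_comp mF (measurable_pair2 (tau : RR))).
  have -> : (\int[m]_z f z tau = (ind tau * c)%:E * \int[m]_z (F z tau)%:E)%E.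
    by apply: integral_scalel => //; rewrite mulr_ge0.
  by rewrite h patchE mem_setE in_itv/= /ind; case: ifP => _; rewrite ?mul1r ?mul0r ?mul0e// EFinM.
rewrite -integral_itv_bndo_bndc; last exact: measurable_int (integrableZl mI c iH').
by rewrite -(RintegralZl c mI iH') fineK//; exact: (integrable_fin_num mI (integrableZl mI c iH')).
Qed.

End interval_lemmas.

Section step_algebra.
Variable R : realType.
Local Notation leb := (@lebesgue_measure R).

(** Half of the energies [en] of [W] and [g] of the test function is added to both sides, so that
    the flux [b] on the left becomes part of the nonnegative quantity [2^-1 * (en + g - b)]. *)
Lemma step_algebra (t' t : R) (b c en : R -> R) (g k P P' : R) : t' < t ->
  leb.-integrable setT (EFin \o b) ->
  leb.-integrable setT (EFin \o c) ->
  leb.-integrable setT (EFin \o en) ->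
  k * \int[leb]_(x in `]t', t[) (c x - 2^-1 * b x) <= P' - P ->
  k * (\int[leb]_(x in `]t', t[) c x
       + \int[leb]_(x in `]t', t[) (2^-1 * (en x + g - b x))) + P <=
  P' + k * (2^-1 * \int[leb]_(x in `]t', t[) en x + 2^-1 * (t - t') * g).
Proof.
move=> t't ib ic ie.
have alg (X Y Z : R) : k * (X - 2^-1 * Y) <= P' - P ->
  k * (X + (2^-1 * Z + 2^-1 * g * (t - t') - 2^-1 * Y)) + P <= P' + k * (2^-1 * Z + 2^-1 * (t - t') * g) by lra.
have mI : measurable (`]t', t[%classic : set (measurableTypeR R)) by [].
have S f : leb.-integrable setT (EFin \o f) -> leb.-integrable `]t', t[ (EFin \o f).
  by move=> h; apply: integrableS measurableT mI _ h.
have i1 := S _ ic; have i2 := S _ ib; have i3 := S _ ie.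
have i2' := integrableZl mI 2^-1 i2; have i3' := integrableZl mI 2^-1 i3.
have i4 : leb.-integrable `]t', t[ (EFin \o cst (2^-1 * g)).
  apply/integrableP; split; first exact/measurable_EFinP.
  rewrite (_ : (fun x => _) = cst `|2^-1 * g|%:E)// integral_cst//.
  by apply: lte_mul_pinfty => //; rewrite /= lebesgue_measure_itv/= lte_fin t't -EFinB ltry.
have E1 : \int[leb]_(x in `]t', t[) (c x - 2^-1 * b x) =
    \int[leb]_(x in `]t', t[) c x - 2^-1 * \int[leb]_(x in `]t', t[) b x.
  by rewrite (RintegralB mI i1 i2') (RintegralZl _ mI i2).
have E2 : \int[leb]_(x in `]t', t[) (2^-1 * (en x + g - b x)) =
    2^-1 * \int[leb]_(x in `]t', t[) en x + 2^-1 * g * (t - t') - 2^-1 * \int[leb]_(x in `]t', t[) b x.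
  transitivity (\int[leb]_(x in `]t', t[) (2^-1 * en x + cst (2^-1 * g) x - 2^-1 * b x)).
    by apply: eq_Rintegral => x _ /=; ring.
  rewrite (RintegralB mI (integrableD mI i3' i4) i2') (RintegralD mI i3' i4).
  rewrite (RintegralZl _ mI i2) (RintegralZl _ mI i3) Rintegral_cst//.
  by rewrite /= lebesgue_measure_itv/= lte_fin t't -EFinB.
rewrite E1 E2; exact: alg.
Qed.

End step_algebra.

(** * Testing time increments with a function frozen at the later time *)

Section time_step.
Variables (R : realType) (N : nat) (s p : R) (Om : set 'rV[R]_N) (T : R).
Local Notation E := 'rV[R]_N.
Local Notation mu := (lebesgue_rV R N).
Local Notation leb := (@lebesgue_measure R).
Local Notation RR := (measurableTypeR R).
Local Notation nu := (nu_density s p).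

(** All that the energy argument retains of the equation; [G] stands for the times at which the
    representative [W] agrees with the continuous one. *)
Definition evolves (r lam : R) (a : E -> R) (W : E -> R -> R) (G : R -> Prop) : Prop :=
  forall phi, bounded_test s p r phi -> forall t' t, G t' -> G t -> 0 < t' -> t' < t -> t < T ->
  \int[mu]_x (W x t * phi x) - \int[mu]_x (W x t' * phi x) =
  \int[leb]_(tau in `]t', t[) (lam * reaction p a (W ^~ tau) phi - 2^-1 * flux s p (W ^~ tau) phi).

(* Nonnegative by Young's inequality, which makes Fatou's lemma applicable. *)
Definition young_gap (f v : E -> R) (z : E * E) : R :=
  2^-1 * (`|f z.1 - f z.2| `^ p + `|v z.1 - v z.2| `^ p
          - jump p (f z.1 - f z.2) * (v z.1 - v z.2)) * nu z.1 z.2.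

Lemma young_gap_ge0 f v z : 1 < p -> 0 <= young_gap f v z.
Proof.
move=> p1; rewrite mulr_ge0 ?invr_ge0 ?powR_ge0// mulr_ge0// subr_ge0.
by apply: le_trans (ler_norm _) _; exact: jumpM_le.
Qed.

Hypotheses (p2 : 2 < p) (ps0 : 0 < p * s) (N0 : (0 < N)%N) (bOm : bounded_set Om) (T0 : 0 < T).
Variables (r lam A B e : R) (a phi : E -> R) (W : E -> R -> R) (G : R -> Prop).
Hypotheses (r0 : 0 < r) (lam0 : 0 <= lam) (e0 : 0 < e).
Hypotheses (ma : measurable_fun setT a) (aA : forall x, 0 <= a x <= A).
Hypotheses (fW : finite_energy s p Om T W) (hW : evolves r lam a W G).
Hypotheses (mphi : measurable_fun setT phi) (phiB : forall x, 0 <= phi x <= B).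
Hypotheses (phir : forall x, r <= `|x| -> phi x = 0) (pg : (gagliardo s p setT phi < +oo)%E).

Let p1 : 1 < p. Proof. by have := p2; lra. Qed.
Let p0 : 0 < p. Proof. by have := p2; lra. Qed.
Let q0 : 0 <= N%:R + p * s. Proof. by apply: addr_ge0 => //; exact: ltW. Qed.

Local Notation v t := (weighted p phi (W ^~ t) e (1 - p)).
Local Notation psi t := (\int[mu]_x weighted p phi (W ^~ t) e (2 - p) x).
Local Notation energy t := (gagliardo s p setT (W ^~ t)).

Let W0 x t : 0 <= W x t. Proof. by have [_ + _ _ _] := fW; apply. Qed.
Let mWt t : measurable_fun setT (W ^~ t). Proof. exact: (measurable_flow_section fW). Qed.

Definition regular_time t := [/\ G t, (energy t < +oo)%E & (\int[mu]_x (W x t `^ p)%:E < +oo)%E].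

Hypothesis aeG : {ae leb, forall t, `]0, T[%classic t -> G t}.

Lemma ae_regular_time : {ae leb, forall t, `]0, T[%classic t -> regular_time t}.
Proof.
have FF := ae_filter_ringOfSetsType leb.
have h1 := ae_flow_gagliardo_fin fW.
have h2 : {ae leb, forall t, (\int[mu]_x (W x t `^ p)%:E < +oo)%E}.
  have mf : measurable_fun [set: RR * E] (fun u => (W u.2 u.1 `^ p)%:E).
    by apply/measurable_EFinP; apply: (measurableT_comp (measurable_powR p)); exact: (measurable_flow fW).
  have h : leb.-integrable setT (fun t => \int[mu]_x (W x t `^ p)%:E)%E.
    apply/integrableP; split.
      apply: (measurable_integral_snd mu (f := fun (t : RR) x => (W x t `^ p)%:E) mf).
      by move=> t x; rewrite lee_fin powR_ge0.
    under eq_integral => t _.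
      rewrite gee0_abs; last by apply: integral_ge0 => x _; rewrite lee_fin powR_ge0.
      over.
    exact: (flow_Lp p2 q0 N0 bOm fW).
  apply: filterS (integrable_ae measurableT h) => t /(_ I) hf.
  by rewrite -ge0_fin_numE//; apply: integral_ge0 => x _; rewrite lee_fin powR_ge0.
apply: filterS3 aeG h1 h2 => t g1 g2 g3 tT; split => //; exact: g1.
Qed.

Let bv t : regular_time t -> bounded_test s p r (v t).
Proof. by move=> [_ e1 _]; exact: (weighted_bounded_test p2 e0 mphi phiB phir (mWt t) (W0 ^~ t) pg e1). Qed.

Let ifl t : regular_time t -> {ae leb, forall tau, (prodm mu mu).-integrable setT (EFin \o (fun z =>
     jump p (W z.1 tau - W z.2 tau) * (v t z.1 - v t z.2) * nu z.1 z.2))} /\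
  leb.-integrable setT (EFin \o (fun tau => flux s p (W ^~ tau) (v t))).
Proof. by move=> /bv[mv _ _ vg]; exact: (integrable_flux p2 T0 fW mv vg). Qed.

Let ire t : regular_time t -> {ae leb, forall tau, mu.-integrable setT (EFin \o (fun x => a x * W x tau `^ (p - 1) * v t x))} /\
  leb.-integrable setT (EFin \o (fun tau => reaction p a (W ^~ tau) (v t))).
Proof.
by move=> /bv[mv [C vC] vr _]; exact: (integrable_reaction p2 q0 N0 bOm T0 fW ma aA mv vC r0 vr).
Qed.

Let ien : leb.-integrable setT (EFin \o (fun tau => fine (energy tau))).
Proof.
have [_ _ _ _ Woo] := fW.
have me : measurable_fun setT (fun tau : RR => fine (energy tau)).
  by apply: (measurableT_comp (f := @fine R)) => //; exact: (measurable_flow_gagliardo fW).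
apply: integrable_ge0 => //; first by move=> tau; rewrite fine_ge0// gagliardo_ge0.
apply: le_lt_trans Woo; apply: le_integral_ge0.
- exact/measurable_EFinP.
- exact: (measurable_flow_gagliardo fW).
- by move=> t; exact: gagliardo_ge0.
move=> t; have := gagliardo_ge0 s p setT (W ^~ t); case: (energy t) => [x| |]//= _; rewrite ?leey//.
Qed.

(** The increment identity is tested with [v t]. By [weighted_concavity] the increment of [W]
    against [v t] is at most that of the integral [psi], with the sign reversed, which is the
    substitute for the chain rule. *)
Lemma step_inequality t' t : regular_time t' -> regular_time t -> 0 < t' -> t' < t -> t < T ->
  (p - 2) * (\int[leb]_(tau in `]t', t[) (lam * reaction p a (W ^~ tau) (v t))
    + \int[leb]_(tau in `]t', t[) (2^-1 * (fine (energy tau) + fine (gagliardo s p setT (v t)) - flux s p (W ^~ tau) (v t))))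
  + psi t <=
  psi t' + (p - 2) * (2^-1 * \int[leb]_(tau in `]t', t[) fine (energy tau)
    + 2^-1 * (t - t') * fine (gagliardo s p setT (v t))).
Proof.
move=> ht' ht t'0 t't tT; have [G' _ Wp'] := ht'; have [Gt _ Wpt] := ht.
have := hW (bv ht) G' Gt t'0 t't tT => hI.
have cc := weighted_concavity p2 r0 e0 mphi phiB phir (mWt t) (W0 ^~ t) (mWt t') (W0 ^~ t') Wpt Wp'.
rewrite hI in cc.
exact: (step_algebra (c := fun tau => lam * reaction p a (W ^~ tau) (v t)) (fine (gagliardo s p setT (v t)))
  t't (ifl ht).2 (integrableZl measurableT lam (ire ht).2) ien cc).
Qed.

Lemma young_gap_integral t : regular_time t -> {ae leb, forall tau,
  (\int[prodm mu mu]_z (young_gap (W ^~ tau) (v t) z)%:E)%E =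
  (2^-1 * (fine (energy tau) + fine (gagliardo s p setT (v t)) - flux s p (W ^~ tau) (v t)))%:E}.
Proof.
move=> ht; have FF := ae_filter_ringOfSetsType leb.
have [mv _ _ vg] := bv ht.
have ig f : measurable_fun setT f -> (gagliardo s p setT f < +oo)%E ->
    (prodm mu mu).-integrable setT (EFin \o (fun z : E * E => `|f z.1 - f z.2| `^ p * nu z.1 z.2)).
  move=> mf fg; apply: integrable_ge0 => //.
    by apply/measurable_EFinP; exact: measurable_gagliardo.
  by move=> z; rewrite mulr_ge0 ?powR_ge0// invr_ge0 powR_ge0.
apply: filterS2 (ifl ht).1 (ae_flow_gagliardo_fin fW) => tau i1 eoo.
have i2 := ig _ (mWt tau) eoo; have i3 := ig _ mv vg.
have i4 := integrableB measurableT (integrableD measurableT i2 i3) i1.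
have i5 := integrableZl measurableT 2^-1 i4.
have -> : (\int[prodm mu mu]_z (young_gap (W ^~ tau) (v t) z)%:E)%E =
    (\int[prodm mu mu]_z (2^-1 * (`|W z.1 tau - W z.2 tau| `^ p * nu z.1 z.2 + `|v t z.1 - v t z.2| `^ p * nu z.1 z.2
       - jump p (W z.1 tau - W z.2 tau) * (v t z.1 - v t z.2) * nu z.1 z.2))%:E)%E.
  by apply: eq_integral => z _; congr EFin; rewrite /young_gap; ring.
rewrite -[LHS]fineK; last exact: (integrable_fin_num measurableT i5).
congr EFin; rewrite -/(Rintegral _ _ _) (RintegralZl 2^-1 measurableT i4).
by rewrite (RintegralB measurableT (integrableD measurableT i2 i3) i1) (RintegralD measurableT i2 i3).
Qed.

Local Notation gv t := (gagliardo s p setT (v t)).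

Variables (C t0 : R) (zeta dzeta : R -> R).
Hypotheses (hz : time_cutoff T C zeta dzeta) (t00 : 0 < t0) (zt0 : forall t, t <= t0 -> zeta t = 0).

Let mz : measurable_fun [set: RR] zeta. Proof. by have [[]] := hz. Qed.
Let z0 t : 0 <= zeta t. Proof. by have [_ + _ _ _] := hz => /(_ t)/andP[]. Qed.
Let C0 : 0 <= C. Proof. by have [_ + _ _ _] := hz => /(_ 0)/andP[h1 h2]; exact: le_trans h2. Qed.
Let zout t : ~~ (0 < t < T) -> zeta t = 0. Proof. by have [_ _ _ + _] := hz => /(_ t) H /H[]. Qed.

Let mWz : measurable_fun [set: E * RR] (fun u => W u.1 u.2). Proof. by have [] := fW. Qed.

Let mv q : measurable_fun [set: E * RR] (fun u => weighted p phi (W ^~ u.2) e q u.1).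
Proof. exact: (measurable_weighted p e mphi q mWz measurable_fst). Qed.

Let mdv : measurable_fun [set: (E * E) * RR] (fun u => v u.2 u.1.1 - v u.2 u.1.2).
Proof.
have f1 : measurable_fun [set: (E * E) * RR] (fun u => u.1.1) by exact: (measurableT_comp measurable_fst measurable_fst).
have f2 : measurable_fun [set: (E * E) * RR] (fun u => u.1.2) by exact: (measurableT_comp measurable_snd measurable_fst).
have m1 : measurable_fun [set: (E * E) * RR] (fun u => (u.1.1, u.2) : E * RR).
  by apply/measurable_fun_pairP; split; [exact: f1|exact: measurable_snd].
have m2 : measurable_fun [set: (E * E) * RR] (fun u => (u.1.2, u.2) : E * RR).
  by apply/measurable_fun_pairP; split; [exact: f2|exact: measurable_snd].
by apply: measurable_funB; [exact: (measurableT_comp (mv (1 - p)) m1)|exact: (measurableT_comp (mv (1 - p)) m2)].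
Qed.

Let mdW : measurable_fun [set: (E * E) * RR] (fun u => W u.1.1 u.2 - W u.1.2 u.2).
Proof.
exact: (measurable_swapped (f := fun (z : E * E) (t : RR) => W z.1 t - W z.2 t) (measurable_flow_diff fW)).
Qed.

Let mnu : measurable_fun [set: (E * E) * RR] (fun u => nu u.1.1 u.1.2).
Proof.
apply: (measurableT_comp (f := fun z : E * E => nu z.1 z.2) _ measurable_fst).
exact: (measurable_nu0 s p (measurable_rVB measurable_fst measurable_snd)).
Qed.

Let nuge0 (x y : E) : 0 <= nu x y. Proof. by rewrite invr_ge0 powR_ge0. Qed.

(** The decomposition that [steklov_fatou] asks for: [v] is frozen at [t] and enters through [al]
    and [de], while [W] is averaged in [tau] and enters through [be] and [ga]. The reaction term
    fits the same scheme with zero additive parts. *)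
Let al (z : E * E) t := 2^-1 * `|v t z.1 - v t z.2| `^ p * nu z.1 z.2.
Let be (z : E * E) tau := 2^-1 * `|W z.1 tau - W z.2 tau| `^ p * nu z.1 z.2.
Let ga (z : E * E) tau := - 2^-1 * jump p (W z.1 tau - W z.2 tau) * nu z.1 z.2.
Let de (z : E * E) t := v t z.1 - v t z.2.
Let gap (z : E * E) tau t := young_gap (W ^~ tau) (v t) z.

Let gapE z tau t : gap z tau t = al z t + be z tau + ga z tau * de z t.
Proof. by rewrite /gap /young_gap /al /be /ga /de; ring. Qed.

Let gap0 z tau t : 0 <= gap z tau t. Proof. exact: young_gap_ge0. Qed.

Let mal : measurable_fun [set: (E * E) * RR] (fun u => al u.1 u.2).
Proof. exact: (measurable_funM (measurable_funM (measurable_cst _) (measurable_powR_norm p mdv)) mnu). Qed.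

Let mbe : measurable_fun [set: (E * E) * RR] (fun u => be u.1 u.2).
Proof. exact: (measurable_funM (measurable_funM (measurable_cst _) (measurable_powR_norm p mdW)) mnu). Qed.

Let mga : measurable_fun [set: (E * E) * RR] (fun u => ga u.1 u.2).
Proof. exact: (measurable_funM (measurable_funM (measurable_cst _) (measurable_jump p mdW)) mnu). Qed.

Let re (x : E) tau t := lam * (a x * W x tau `^ (p - 1) * v t x).
Let rga (x : E) tau := lam * (a x * W x tau `^ (p - 1)).

Let reE x tau t : re x tau t = 0 + 0 + rga x tau * v t x.
Proof. by rewrite /re /rga; ring. Qed.

Let re0 x tau t : 0 <= re x tau t.
Proof.
have /andP[a0 _] := aA x; apply: mulr_ge0 => //; apply: mulr_ge0; last exact: weighted_ge0.
by apply: mulr_ge0 => //; exact: powR_ge0.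
Qed.

Let mrga : measurable_fun [set: E * RR] (fun u => rga u.1 u.2).
Proof.
apply: measurable_funM => //; apply: measurable_funM; first exact: (measurableT_comp ma measurable_fst).
exact: (measurableT_comp (measurable_powR (p - 1)) mWz).
Qed.

Let ind (t : RR) : R := if 0 < t < T then 1 else 0.

Let iind k : leb.-integrable setT (EFin \o (fun t => k * ind t)).
Proof.
apply: (integrable_interval (M := `|k|) (a := 0) (b := T)).
- apply: measurable_funM => //; apply: measurable_fun_ifT => //; apply: measurable_and; exact: measurable_fun_ltr.
- by move=> t; rewrite /ind; case: ifP => _; rewrite ?mulr1// mulr0 normr0.
- by move=> t /negbTE h; rewrite /ind h mulr0.
Qed.

Let powR_succ_le (x : R) t : 0 <= x -> (~~ (0 < t < T) -> x = 0) -> x `^ (p - 1) <= ind t + x `^ p.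
Proof.
move=> x0; rewrite /ind; case: ifPn => [_ _|_ /(_ isT) ->]; last first.
  by rewrite !powR0 ?addr0// gt_eqF// subr_gt0.
have [x1|x1] := leP x 1.
  apply: (@le_trans _ _ 1); last by rewrite lerDl powR_ge0.
  by have := powR_mono (q := p - 1) (ltW _) x0 x1; rewrite powR1; apply; rewrite subr_gt0.
apply: (@le_trans _ _ (x `^ p)); last by rewrite lerDr.
by apply: ler_powR; [exact: ltW|rewrite gerBl].
Qed.

Let ae_be : {ae prodm mu mu, forall z, leb.-integrable setT (EFin \o be z)}.
Proof.
have [_ _ _ _ Woo] := fW.
have mb : measurable_fun [set: RR * (E * E)] (fun u => be u.2 u.1).
  exact: (measurable_swapped (f := fun (t : RR) (z : E * E) => be z t) mbe).
have b0 z t : 0 <= be z t by rewrite !mulr_ge0 ?powR_ge0.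
apply: (integrable_Rintegral (m1 := leb) (m2 := prodm mu mu) (f := be) mbe _).1.
rewrite (_ : (\int[prodm mu mu]_z _)%E = (\int[prodm mu mu]_z \int[leb]_t (be z t)%:E)%E); last first.
  by apply: eq_integral => z _; apply: eq_integral => t _; rewrite ger0_norm.
rewrite (tonelli_swap (prodm mu mu) leb (f := fun z (t : RR) => (be z t)%:E)); last 2 first.
- exact/measurable_EFinP.
- by move=> z t; rewrite lee_fin.
apply: le_lt_trans Woo; apply: le_integral_ge0.
- apply: (measurable_integral_fst (prodm mu mu) (f := fun z (t : RR) => (be z t)%:E)); first exact/measurable_EFinP.
  by move=> z t; rewrite lee_fin.
- exact: (measurable_flow_gagliardo fW).
- by move=> t; exact: gagliardo_ge0.
move=> t; rewrite /gagliardo; apply: integral_mono.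
- exact: (measurableT_comp mbe (measurable_pair2 (t : RR))).
- by move=> z.
- by apply/measurable_EFinP; exact: (measurable_gagliardo s p (mWt t)).
by move=> z; apply: ler_wpM2r => //; rewrite ler_piMl ?powR_ge0// invf_le1// ler1n.
Qed.

Let ae_ga : {ae prodm mu mu, forall z, leb.-integrable setT (EFin \o ga z)}.
Proof.
have FF := ae_filter_ringOfSetsType (prodm mu mu).
apply: filterS ae_be => z iz.
have i := integrableD measurableT (iind (nu z.1 z.2)) (integrableZl measurableT 2 iz).
apply: (le_integrable measurableT _ _ i).
  by apply/measurable_EFinP; exact: (measurableT_comp mga (measurable_pair1 z)).
move=> t _ /=; rewrite lee_fin; apply: le_trans (ler_norm _).
have -> : `|ga z t| = 2^-1 * `|W z.1 t - W z.2 t| `^ (p - 1) * nu z.1 z.2.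
  rewrite /ga [LHS]normrM (ger0_norm (nuge0 _ _)); congr (_ * _).
  by rewrite [LHS]normrM norm_jump// normrN ger0_norm.
rewrite /be.
rewrite mulrA mulrA divff ?mul1r// [X in _ <= X + _]mulrC -mulrDl; apply: ler_wpM2r => //.
apply: (@le_trans _ _ (`|W z.1 t - W z.2 t| `^ (p - 1))).
  by rewrite ler_piMl ?powR_ge0// invf_le1// ler1n.
apply: powR_succ_le => // tT; have [_ _ _ WT _] := fW.
by rewrite !(WT _ _ tT) subrr normr0.
Qed.

Let ae_rga : {ae mu, forall x, leb.-integrable setT (EFin \o rga x)}.
Proof.
have FF := ae_filter_ringOfSetsType mu.
have mp : measurable_fun [set: E * RR] (fun u => W u.1 u.2 `^ p).
  exact: (measurableT_comp (measurable_powR p) mWz).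
have : {ae mu, forall x, leb.-integrable setT (EFin \o (fun t => W x t `^ p))}.
  apply: (integrable_Rintegral (m1 := leb) (m2 := mu) (f := fun x t => W x t `^ p) mp _).1.
  rewrite (_ : (\int[mu]_x _)%E = (\int[mu]_x \int[leb]_t (W x t `^ p)%:E)%E); last first.
    by apply: eq_integral => x _; apply: eq_integral => t _; rewrite ger0_norm ?powR_ge0.
  rewrite (tonelli_swap mu leb (f := fun x (t : RR) => (W x t `^ p)%:E)).
  - exact: (flow_Lp p2 q0 N0 bOm fW).
  - exact/measurable_EFinP.
  - by move=> x t; rewrite lee_fin powR_ge0.
apply: filterS => x ix; have /andP[a0 _] := aA x.
have i := integrableZl measurableT (lam * a x) (integrableD measurableT (iind 1) ix).
apply: (le_integrable measurableT _ _ i).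
  by apply/measurable_EFinP; exact: (measurableT_comp mrga (measurable_pair1 x)).
move=> t _ /=; rewrite lee_fin; apply: le_trans (ler_norm _).
rewrite /rga ger0_norm; last by apply: mulr_ge0 => //; apply: mulr_ge0 => //; exact: powR_ge0.
rewrite mulrA mul1r; apply: ler_wpM2l; first exact: mulr_ge0.
apply: powR_succ_le => // tT; have [_ _ _ WT _] := fW; exact: WT.
Qed.

Let gagliardo_fin (f : E -> R) : (gagliardo s p setT f < +oo)%E -> gagliardo s p setT f \is a fin_num.
Proof. by rewrite (ge0_fin_numE (gagliardo_ge0 _ _ _ _)). Qed.

Let hk k : 0 < k.+1%:R^-1 :> R. Proof. by rewrite invr_gt0. Qed.

Let Ak k t := (\int[prodm mu mu]_z \int[leb]_(tau in `](t - k.+1%:R^-1)%R, t]) (zeta t * k.+1%:R * gap z tau t)%:E)%E.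
Let Bk k t := (\int[mu]_x \int[leb]_(tau in `](t - k.+1%:R^-1)%R, t]) (zeta t * k.+1%:R * re x tau t)%:E)%E.

Let rho' k t := zeta t * k.+1%:R * ((p - 2)^-1 * psi (t - k.+1%:R^-1)
  + 2^-1 * \int[leb]_(tau in `]t - k.+1%:R^-1, t[) fine (energy tau) + 2^-1 * k.+1%:R^-1 * fine (gv t)).

Let rho k t := zeta t * k.+1%:R * ((p - 2)^-1 * psi t).

(** [step_inequality] with [t' = t - 1/(k+1)], multiplied by [zeta t * (k+1) / (p-2)], and with its
    time integrals moved inside the space integrals to match the averages of [steklov_fatou]. *)
Let step k t : regular_time (t - k.+1%:R^-1) -> regular_time t -> 0 < t - k.+1%:R^-1 -> t < T ->
  (Ak k t + Bk k t + (rho k t)%:E <= (rho' k t)%:E)%E.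
Proof.
move=> ht' ht t'0 tT; pose c := zeta t * k.+1%:R; have c0 : 0 <= c by rewrite mulr_ge0.
have p20 : 0 < p - 2 by have := p2; lra.
have alg (i X Y P' P Z h g : R) : (p - 2) * i = 1 -> (p - 2) * (Y + X) + P <= P' + (p - 2) * (Z + 2^-1 * (t - (t - h)) * g) ->
    X + Y + i * P <= i * P' + Z + 2^-1 * h * g.
  move=> hi; rewrite (_ : t - (t - h) = h); last by ring.
  have K x : (p - 2) * (i * x) = x by rewrite mulrA hi mul1r.
  by move=> H; rewrite -(ler_pM2l p20) !mulrDr !K; move: H; lra.
have t't : t - k.+1%:R^-1 < t by rewrite gtrBl.
have := step_inequality ht' ht t'0 t't tT.
have ma1 : measurable_fun [set: (E * E)] (al ^~ t) by exact: (measurableT_comp mal (measurable_pair2 (t : RR))).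
have md1 : measurable_fun [set: (E * E)] (de ^~ t) by exact: (measurableT_comp mdv (measurable_pair2 (t : RR))).
have mv1 : measurable_fun [set: E] (v t) by exact: (measurableT_comp (mv (1 - p)) (measurable_pair2 (t : RR))).
have ma2 : measurable_fun [set: (E * E) * RR] (fun u => al u.1 t) by exact: (measurableT_comp ma1 measurable_fst).
have md2 : measurable_fun [set: (E * E) * RR] (fun u => de u.1 t) by exact: (measurableT_comp md1 measurable_fst).
have mv2 : measurable_fun [set: E * RR] (fun u => v t u.1) by exact: (measurableT_comp mv1 measurable_fst).
have mgt : measurable_fun [set: (E * E) * RR] (fun u => gap u.1 u.2 t).
  under eq_fun do rewrite gapE.
  exact: (measurable_funD (measurable_funD ma2 mbe) (measurable_funM mga md2)).
have mrt : measurable_fun [set: E * RR] (fun u => re u.1 u.2 t).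
  under eq_fun do rewrite reE add0r add0r.
  exact: (measurable_funM mrga mv2).
have mI : measurable (`]t - k.+1%:R^-1, t[%classic : set RR) by [].
have S f : leb.-integrable setT (EFin \o f) -> leb.-integrable `]t - k.+1%:R^-1, t[ (EFin \o f).
  by move=> h; apply: integrableS measurableT mI _ h.
have icst (g : R) : leb.-integrable `]t - k.+1%:R^-1, t[ (EFin \o cst g).
  apply/integrableP; split; first exact/measurable_EFinP.
  rewrite (_ : (fun x => _) = cst `|g|%:E)// integral_cst//.
  by apply: lte_mul_pinfty => //; rewrite /= lebesgue_measure_itv/= lte_fin t't -EFinB ltry.
have i1 := integrableZl mI 2^-1 (integrableB mI (integrableD mI (S _ ien) (icst (fine (gv t)))) (S _ (ifl ht).2)).
have i2 := S _ (integrableZl measurableT lam (ire ht).2).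
have FF := ae_filter_ringOfSetsType leb.
have aeR : {ae leb, forall tau, (\int[mu]_x (re x tau t)%:E)%E = (lam * reaction p a (W ^~ tau) (v t))%:E}.
  apply: filterS (ire ht).1 => tau it; rewrite /reaction -(RintegralZl lam measurableT it) fineK//.
  exact: (integrable_fin_num measurableT (integrableZl measurableT lam it)).
have E1 := swap_interval c0 mgt (fun z tau => gap0 z tau t) i1 (young_gap_integral ht).
have E2 := swap_interval c0 mrt (fun x tau => re0 x tau t) i2 aeR.
rewrite (_ : (Ak k t + Bk k t)%E = (c * (\int[leb]_(tau in `]t - k.+1%:R^-1, t[)
   (2^-1 * (fine (energy tau) + fine (gv t) - flux s p (W ^~ tau) (v t)))
   + \int[leb]_(tau in `]t - k.+1%:R^-1, t[) (lam * reaction p a (W ^~ tau) (v t))))%:E); last first.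
  by rewrite mulrDr EFinD -E1 -E2.
rewrite -EFinD lee_fin /rho /rho' -/c -mulrDr => H; apply: (ler_wpM2l c0); apply: alg => //.
by rewrite divff// lt0r_neq0.
Qed.

(** [W + e >= e] gives a bound uniform in [t]. It depends on [e], but in the energy inequality it
    only enters errors that vanish with the time step. *)
Lemma mass_bounded q : q <= 0 -> exists K, forall t, 0 <= \int[mu]_x weighted p phi (W ^~ t) e q x <= K.
Proof.
move=> q_le0; pose Bp := B `^ p * e `^ q; pose g (x : E) := if `|x| < r then Bp else 0.
have Bp0 : 0 <= Bp by rewrite mulr_ge0 ?powR_ge0.
have mg : measurable_fun setT g.
  by apply: measurable_fun_ifT => //; apply: measurable_fun_ltr => //; exact: measurable_norm_rV.
have ig : mu.-integrable setT (EFin \o g).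
  apply: (integrable_box (M := Bp) r0 mg); first by move=> x; rewrite /g; case: ifP; rewrite ?lexx ?Bp0.
  by move=> x; rewrite leNgt /g => /negbTE ->.
exists (\int[mu]_x g x) => t; apply/andP; split; first by apply: Rintegral_ge0 => x _; exact: weighted_ge0.
have iw := integrable_weighted p2 r0 e0 mphi phiB phir q_le0 (mWt t) (W0 ^~ t).
apply: (le_Rintegral measurableT iw ig) => x _; rewrite /g; case: ifPn => [_|].
  exact: (weighted_le p2 e0 phiB q_le0 (W0 x t)).
by rewrite -leNgt => h; rewrite (weighted_out e p2 phir (W ^~ t) q h).
Qed.

Let mmass q : measurable_fun [set: RR] (fun t => \int[mu]_x weighted p phi (W ^~ t) e q x).
Proof.
apply: (measurable_Rintegral_snd mu (f := fun (t : RR) x => weighted p phi (W ^~ t) e q x)).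
exact: (measurable_swapped (f := fun (t : RR) x => weighted p phi (W ^~ t) e q x) (mv q)).
Qed.

Let mgv : measurable_fun [set: RR] (fun t => gv t).
Proof.
have m : measurable_fun [set: (E * E) * RR] (fun u => (`|v u.2 u.1.1 - v u.2 u.1.2| `^ p * nu u.1.1 u.1.2)%:E).
  by apply/measurable_EFinP; exact: (measurable_funM (measurable_powR_norm p mdv) mnu).
apply: (measurable_integral_fst (prodm mu mu)
  (f := fun (z : E * E) (t : RR) => (`|v t z.1 - v t z.2| `^ p * nu z.1 z.2)%:E) m).
by move=> z t; rewrite lee_fin mulr_ge0 ?powR_ge0.
Qed.

Let zC t : zeta t <= C. Proof. by have [_ + _ _ _] := hz => /(_ t)/andP[]. Qed.

Let fen0 t : 0 <= fine (energy t). Proof. by rewrite fine_ge0// gagliardo_ge0. Qed.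
Let fgv0 t : 0 <= fine (gv t). Proof. by rewrite fine_ge0// gagliardo_ge0. Qed.

Lemma integrable_cutoff_energy : leb.-integrable setT (EFin \o (fun t => zeta t * fine (energy t))).
Proof.
have i := integrableZl measurableT C ien.
have me : measurable_fun setT (fun t : RR => fine (energy t)).
  by apply/measurable_EFinP; exact: measurable_int ien.
apply: (le_integrable measurableT _ _ i); first by apply/measurable_EFinP; exact: measurable_funM.
by move=> t _ /=; rewrite lee_fin !ger0_norm ?mulr_ge0// ler_wpM2r.
Qed.

Lemma integrable_cutoff_test : leb.-integrable setT (EFin \o (fun t => zeta t * fine (gv t))).
Proof.
have mg : measurable_fun setT (fun t : RR => fine (gv t)) by exact: (measurableT_comp (f := @fine R)).
apply: integrable_ge0; [exact: measurable_funM|by move=> t; rewrite mulr_ge0|].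
have [D D0 HD] := weighted_gagliardo s p2 e0 mphi phiB.
have i := integrableD measurableT (iind (C * (D * fine (gagliardo s p setT phi)))) (integrableZl measurableT (C * D) ien).
apply: (@le_lt_trans _ _ (\int[leb]_t (C * (D * fine (gagliardo s p setT phi)) * ind t + C * D * fine (energy t))%:E)%E); last first.
  exact: (integrable_lty measurableT i).
have FF := ae_filter_ringOfSetsType leb.
have ind0 t : 0 <= ind t by rewrite /ind; case: ifP.
have fp0 : 0 <= fine (gagliardo s p setT phi) by rewrite fine_ge0// gagliardo_ge0.
have c1 : 0 <= C * (D * fine (gagliardo s p setT phi)) by exact: (mulr_ge0 C0 (mulr_ge0 D0 fp0)).
have rhs0 t : 0 <= C * (D * fine (gagliardo s p setT phi)) * ind t + C * D * fine (energy t).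
  exact: (addr_ge0 (mulr_ge0 c1 (ind0 t)) (mulr_ge0 (mulr_ge0 C0 D0) (fen0 t))).
apply: ae_ge0_le_integral; first by [].
- by move=> t _; rewrite lee_fin; exact: (mulr_ge0 (z0 t) (fgv0 t)).
- by apply/measurable_EFinP; exact: measurable_funM.
- by move=> t _; rewrite lee_fin; exact: rhs0.
- exact: measurable_int i.
apply: filterS (ae_flow_gagliardo_fin fW) => t eoo _; rewrite lee_fin.
case: (boolP (0 < t < T)) => [tT|/zout ->]; last first.
  by rewrite mul0r; exact: rhs0.
rewrite /ind tT mulr1 -mulrA -mulrDr -mulrDr; apply: (ler_pM (z0 t) (fgv0 t) (zC t)).
have := HD _ (mWt t) (W0 ^~ t).
move: (gagliardo_fin pg) (gagliardo_fin eoo) (gagliardo_ge0 s p setT (v t)).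
move: (gagliardo s p setT phi) (gagliardo s p setT (W ^~ t)) (gv t).
by case=> [x| |]// [y| |]// [u| |]//=; rewrite -EFinD -EFinM ?leye_eq ?lee_fin.
Qed.

(** The step inequality is integrated in [t] and the step tends to [0]. On the left, both integrands
    are nonnegative and [steklov_fatou] applies to each; on the right, [cutoff_shift_le] produces
    the [dzeta] term and [cutoff_steklov_le] the energy of [W], with errors of the order of the
    step. *)
Lemma energy_inequality :
  (\int[leb]_t \int[prodm mu mu]_z (zeta t * young_gap (W ^~ t) (v t) z)%:E
   + \int[leb]_t \int[mu]_x (zeta t * (lam * (a x * W x t `^ (p - 1) * v t x)))%:E <=
   ((p - 2)^-1 * \int[leb]_t (dzeta t * psi t) + 2^-1 * \int[leb]_t (zeta t * fine (energy t))
    + 2^-1 * \int[leb]_t (zeta t * fine (gv t)))%:E)%E.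
Proof.
have p20 : 0 < (p - 2)^-1 by rewrite invr_gt0; have := p2; lra.
have mv' : measurable_fun [set: E * RR] (fun u => v u.2 u.1) by exact: (mv (1 - p)).
have m0 : measurable_fun [set: E * RR] (fun u => (fun (_ : E) (_ : R) => 0 : R) u.1 u.2) by [].
have i0 : {ae mu, forall x : E, leb.-integrable setT (EFin \o (fun _ : R => 0 : R))}.
  by apply/nearW => x; exact: integrable0.
have S1 := steklov_fatou (m := prodm mu mu) mz z0 mal mbe mga mdv gapE gap0 ae_be ae_ga.
have S2 := steklov_fatou (m := mu) mz z0 m0 m0 mrga mv' reE re0 i0 ae_rga.
have mA k := measurable_steklov (prodm mu mu) mz z0 mal mbe mga mdv gapE gap0 k.
have mB k := measurable_steklov mu mz z0 m0 m0 mrga mv' reE re0 k.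
have A0 k t : (0 <= Ak k t)%E.
  by apply: integral_ge0 => z _; apply: integral_ge0 => tau _; rewrite lee_fin; exact: (mulr_ge0 (mulr_ge0 (z0 t) (ler0n _ _)) (gap0 _ _ _)).
have B0' k t : (0 <= Bk k t)%E.
  by apply: integral_ge0 => z _; apply: integral_ge0 => tau _; rewrite lee_fin; exact: (mulr_ge0 (mulr_ge0 (z0 t) (ler0n _ _)) (re0 _ _ _)).
have q20 : 2 - p <= 0 by have := p2; lra.
have [Kp psiK] := mass_bounded q20; have mpsi := mmass (2 - p).
have psi0 t : 0 <= psi t by have /andP[] := psiK t.
have Kp0 : 0 <= Kp by have /andP[h1 h2] := psiK 0; exact: le_trans h2.
pose K := (p - 2)^-1 * (C * Kp * (T + 1)) + C * \int[leb]_t fine (energy t).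
have K0 : 0 <= K.
  apply: addr_ge0; apply: mulr_ge0 => //; first exact: ltW.
    by apply: mulr_ge0; [exact: mulr_ge0|have := T0; lra].
  by apply: Rintegral_ge0 => t _; exact: fen0.
have hU k : (0 <= \int[leb]_t Ak k t)%E by exact: integral_ge0.
have hV k : (0 <= \int[leb]_t Bk k t)%E by exact: integral_ge0.
have gA : (0 <= \int[leb]_t \int[prodm mu mu]_z (zeta t * gap z t t)%:E)%E.
  by apply: integral_ge0 => t _; apply: integral_ge0 => z _; rewrite lee_fin; exact: (mulr_ge0 (z0 t) (gap0 _ _ _)).
have gB : (0 <= \int[leb]_t \int[mu]_x (zeta t * re x t t)%:E)%E.
  by apply: integral_ge0 => t _; apply: integral_ge0 => z _; rewrite lee_fin; exact: (mulr_ge0 (z0 t) (re0 _ _ _)).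
apply: (limn_einf_add_le hU hV gA gB S1 S2 K0).
(* From this index on the step [h] is smaller than [t0], so [t - h] is a positive time wherever
   [zeta t] is nonzero. *)
exists (Num.truncn t0^-1) => k nk.
pose h : R := k.+1%:R^-1; have h0 : 0 < h := hk k.
have ht0 : h < t0.
  rewrite -(invrK t0) ltf_pV2 ?posrE ?invr_gt0//.
  by apply: lt_le_trans (truncnS_gt _) _; rewrite ler_nat ltnS.
have h1 : h <= 1 by rewrite invf_le1// ler1n.
have kh : k.+1%:R * h = 1 by rewrite divff// pnatr_eq0.
have [iS SM] := cutoff_steklov_le hz ien fen0 (introT andP (conj h0 h1)).
have shl := cutoff_shift_le T0 hz mpsi psiK (introT andP (conj (ltW h0) h1)).
have [ipsi _] := integrable_cutoff hz mpsi psiK.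
have mshift : measurable_fun [set: RR] (fun t => psi (t - h)).
  by apply: (measurableT_comp (f := fun t : RR => psi t) mpsi); exact: measurable_funB.
have [ish _] := integrable_cutoff hz mshift (fun t => psiK (t - h)).
have ien' := integrable_cutoff_energy; have igv := integrable_cutoff_test.
pose S t := \int[leb]_(tau in `]t - h, t[) fine (energy tau).
have S0 t : 0 <= S t by apply: Rintegral_ge0 => tau _; exact: fen0.
pose c1 : R := k.+1%:R * (p - 2)^-1; pose c2 : R := k.+1%:R * 2^-1.
have c10 : 0 <= c1 by rewrite mulr_ge0// ltW. have c20 : 0 <= c2 by rewrite mulr_ge0.
have j1 := integrableZl measurableT c1 ish; have j2 := integrableZl measurableT c2 iS.
have j3 := integrableZl measurableT 2^-1 igv; have j4 := integrableZl measurableT c1 ipsi.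
have j5 := integrableD measurableT (integrableD measurableT j1 j2) j3.
pose F t := c1 * (zeta t * psi (t - h)) + c2 * (zeta t * S t) + 2^-1 * (zeta t * fine (gv t)).
have F0 t : 0 <= F t.
  apply: addr_ge0; last exact: (mulr_ge0 _ (mulr_ge0 (z0 t) (fgv0 t))).
  by apply: addr_ge0; apply: mulr_ge0 => //; apply: mulr_ge0.
have rho'E t : rho' k t = F t.
  rewrite /rho' -/h -/(S t) /F /c1 /c2 -mulrA !mulrDr; congr (_ + _ + _); try ring.
  by transitivity (k.+1%:R * h * (2^-1 * (zeta t * fine (gv t)))); [ring|rewrite kh mul1r].
have rhoE t : rho k t = c1 * (zeta t * psi t) by rewrite /rho /c1; ring.
have rho0 t : 0 <= rho k t by rewrite rhoE; apply: mulr_ge0 => //; exact: mulr_ge0.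
have mrho : measurable_fun setT (fun t : RR => (rho k t)%:E).
  by rewrite (_ : (fun t => _) = EFin \o (fun t => c1 * (zeta t * psi t))); [exact: measurable_int j4|apply/funext => t; rewrite rhoE].
have FF := ae_filter_ringOfSetsType leb.
have aeS : {ae leb, forall t, (Ak k t + Bk k t + (rho k t)%:E <= (F t)%:E)%E}.
  apply: filterS2 ae_regular_time (ae_shift h ae_regular_time) => t H1 H2.
  rewrite -rho'E; have [zt|zt] := eqVneq (zeta t) 0.
    have a0 : Ak k t = 0%E.
      by rewrite /Ak zt; apply: integral0_eq => z _; apply: integral0_eq => tau _; rewrite !mul0r.
    have b0 : Bk k t = 0%E.
      by rewrite /Bk zt; apply: integral0_eq => z _; apply: integral0_eq => tau _; rewrite !mul0r.
    by rewrite a0 b0 /rho /rho' zt !mul0r !add0e.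
  have tt0 : t0 < t by rewrite ltNge; apply: contra zt => /zt0 ->.
  have /andP[tp tT] : 0 < t < T by apply: contraNT zt => /zout ->.
  have th : 0 < t - h by rewrite subr_gt0; exact: lt_trans ht0 tt0.
  have thT : t - h < T by apply: lt_trans tT; rewrite gtrBl.
  have i1 : `]0, T[%classic t by rewrite /= in_itv/= tp tT.
  have i2 : `]0, T[%classic (t - h) by rewrite /= in_itv/= th thT.
  exact: (step (H2 i2) (H1 i1) th tT).
have I1 : (\int[leb]_t Ak k t + \int[leb]_t Bk k t + \int[leb]_t (rho k t)%:E <= \int[leb]_t (F t)%:E)%E.
  rewrite -(ge0_integralD leb measurableT (fun t _ => A0 k t) (mA k) (fun t _ => B0' k t) (mB k)).
  rewrite -(ge0_integralD leb measurableT _ (emeasurable_funD (mA k) (mB k)) _ mrho); last 2 first.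
  - by move=> t _; exact: (adde_ge0 (A0 k t) (B0' k t)).
  - by move=> t _; rewrite lee_fin; exact: rho0.
  apply: ae_ge0_le_integral; first by [].
  - move=> t _; apply: adde_ge0; first exact: (adde_ge0 (A0 k t) (B0' k t)).
    by rewrite lee_fin; exact: rho0.
  - exact: (emeasurable_funD (emeasurable_funD (mA k) (mB k)) mrho).
  - by move=> t _; rewrite lee_fin; exact: F0.
  - exact: measurable_int j5.
  by apply: filterS aeS => t + _.
have I2 : (\int[leb]_t (rho k t)%:E = (c1 * \int[leb]_t (zeta t * psi t))%:E)%E.
  rewrite -(RintegralZl c1 measurableT ipsi) /Rintegral fineK; last exact: (integrable_fin_num measurableT j4).
  by apply: eq_integral => t _; rewrite rhoE.
have I3 : (\int[leb]_t (F t)%:E = (c1 * \int[leb]_t (zeta t * psi (t - h)) + c2 * \int[leb]_t (zeta t * S t)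
    + 2^-1 * \int[leb]_t (zeta t * fine (gv t)))%:E)%E.
  rewrite -(RintegralZl c1 measurableT ish) -(RintegralZl c2 measurableT iS) -(RintegralZl 2^-1 measurableT igv).
  rewrite -(RintegralD measurableT j1 j2) -(RintegralD measurableT (integrableD measurableT j1 j2) j3).
  by rewrite /Rintegral fineK//; exact: (integrable_fin_num measurableT j5).
move: I1; rewrite I2 I3 => I1.
have ub : c1 * \int[leb]_t (zeta t * psi (t - h)) + c2 * \int[leb]_t (zeta t * S t)
    + 2^-1 * \int[leb]_t (zeta t * fine (gv t)) - c1 * \int[leb]_t (zeta t * psi t) <=
    (p - 2)^-1 * \int[leb]_t (dzeta t * psi t) + 2^-1 * \int[leb]_t (zeta t * fine (energy t))
    + 2^-1 * \int[leb]_t (zeta t * fine (gv t)) + K * k.+1%:R^-1.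
  exact: (steklov_algebra _ (ler0n _ _) (ltW p20) kh shl SM).
have I4 : (\int[leb]_t Ak k t + \int[leb]_t Bk k t <= (c1 * \int[leb]_t (zeta t * psi (t - h)) + c2 * \int[leb]_t (zeta t * S t)
    + 2^-1 * \int[leb]_t (zeta t * fine (gv t)) - c1 * \int[leb]_t (zeta t * psi t))%:E)%E.
  by rewrite EFinB leeBrDr.
by apply: le_trans I4 _; rewrite lee_fin.
Qed.
Variables (c m2 : R).
Hypotheses (c0 : 0 < c) (m20 : 0 < m2).
Hypothesis nu_low : forall x y : E, `|x| < r -> Om y -> r <= `|y| -> c <= nu x y.

(** One factor per source: [2^-1] from the nonlocal form, [2^(1-p)] from [jumpB_le], [c] from the
    kernel between a near and a far point, [m2] from the mass of [W] away from [0]. *)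
Let kap := 2^-1 * 2 `^ (1 - p) * c * m2.
Local Notation mass t := (\int[mu]_x v t x).
Let far (t : R) (y : E) : R := if r <= `|y| then W y t `^ (p - 1) else 0.

Let far0 t y : 0 <= far t y. Proof. by rewrite /far; case: ifP => // _; exact: powR_ge0. Qed.

(** If the second point is far, [phi] and hence [v] vanish there, and [jumpB_le] replaces Picone;
    the positive term becomes exactly [phi^p] since [(W + e)^(p-1) v = phi^p]. Other pairs have no
    surplus and are left to [picone]. *)
Let far_picone t (z : E * E) :
  jump p (W z.1 t - W z.2 t) * (v t z.1 - v t z.2) + 2 `^ (1 - p) * (v t z.1 * far t z.2)
  <= `|phi z.1 - phi z.2| `^ p.
Proof.
case: z => x y /=.
have X0 : 0 < W x t + e by rewrite ltr_wpDl. have Y0 : 0 < W y t + e by rewrite ltr_wpDl.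
have /andP[fx _] := phiB x; have /andP[fy _] := phiB y.
have dE : W x t - W y t = (W x t + e) - (W y t + e) by ring.
rewrite /far; case: ifPn => [ry|_]; last first.
  by rewrite !mulr0 addr0 dE; exact: picone.
have py := phir ry; rewrite (weighted_out e p2 phir _ _ ry) subr0 py subr0 (ger0_norm fx) dE.
have J := jumpB_le p2 (ltW X0) (ltW Y0).
have v0 : 0 <= v t x by exact: weighted_ge0.
have H1 := ler_wpM2r v0 J.
have H2 : W y t `^ (p - 1) <= (W y t + e) `^ (p - 1).
  by apply: powR_mono; [have := p1; lra|exact: W0|rewrite lerDl ltW].
have H3 : 2 `^ (1 - p) * (v t x * W y t `^ (p - 1)) <= 2 `^ (1 - p) * (v t x * (W y t + e) `^ (p - 1)).
  by apply: ler_wpM2l; [exact: powR_ge0|exact: ler_wpM2l].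
have H4 : (W x t + e) `^ (p - 1) * v t x = phi x `^ p.
  rewrite /weighted mulrCA -powRD; last by apply/implyP => _; exact: lt0r_neq0.
  by rewrite (_ : p - 1 + (1 - p) = 0) ?powRr0 ?mulr1//; ring.
by move: H1 H3 H4; rewrite mulrBl; lra.
Qed.

Let mfar t : measurable_fun setT (far t).
Proof.
apply: measurable_fun_ifT => //.
  by apply: measurable_fun_ler => //; exact: measurable_norm_rV.
by apply: (measurableT_comp (measurable_powR (p - 1))); exact: mWt.
Qed.

Let mvt t : measurable_fun setT (v t).
Proof. exact: (measurableT_comp (mv (1 - p)) (measurable_pair2 (t : RR))). Qed.

Let v0 t x : 0 <= v t x. Proof. exact: weighted_ge0. Qed.

Let iv t : mu.-integrable setT (EFin \o v t).
Proof.
have q10 : 1 - p <= 0 by have := p2; lra.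
exact: (integrable_weighted p2 r0 e0 mphi phiB phir q10 (mWt t) (W0 ^~ t)).
Qed.

Lemma gap_lower t : regular_time t -> (m2%:E <= \int[mu]_y (far t y)%:E)%E ->
  ((2^-1 * (fine (energy t) + fine (gv t)) + kap * mass t)%:E <=
   \int[prodm mu mu]_z (young_gap (W ^~ t) (v t) z)%:E + (2^-1 * fine (gagliardo s p setT phi))%:E)%E.
Proof.
move=> ht hm; have [_ eoo _] := ht.
have half0 : 0 <= 2^-1 :> R by [].
pose D (f : E -> R) (z : E * E) := `|f z.1 - f z.2| `^ p * nu z.1 z.2.
have mD f : measurable_fun setT f -> measurable_fun setT (D f).
  by move=> mf; apply/measurable_EFinP; exact: (measurable_gagliardo s p mf).
have D0 f z : 0 <= D f z by rewrite mulr_ge0 ?powR_ge0.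
have goo : (gv t < +oo)%E by have [] := bv ht.
have GE f : measurable_fun setT f -> (gagliardo s p setT f < +oo)%E ->
    (\int[prodm mu mu]_z (2^-1 * D f z)%:E)%E = (2^-1 * fine (gagliardo s p setT f))%:E.
  move=> mf foo; rewrite (integral_scalel _ (mD f mf) (D0 f) half0) EFinM (fineK (gagliardo_fin foo)).
  by [].
pose k1 := 2^-1 * 2 `^ (1 - p) * c.
have k10 : 0 <= k1 by apply: mulr_ge0; [apply: mulr_ge0 => //; exact: powR_ge0|exact: ltW].
pose F (z : E * E) := k1 * (v t z.1 * far t z.2).
have F0 z : 0 <= F z by apply: mulr_ge0 => //; exact: (mulr_ge0 (v0 _ _) (far0 _ _)).
have mvf : measurable_fun [set: E * E] (fun z => v t z.1 * far t z.2).
  by apply: measurable_funM; [exact: (measurableT_comp (mvt t) measurable_fst)|exact: (measurableT_comp (mfar t) measurable_snd)].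
have mF : measurable_fun [set: E * E] F by apply: measurable_funM.
have FE : ((kap * mass t)%:E <= \int[prodm mu mu]_z (F z)%:E)%E.
  rewrite (tonelli_prod mu mu (f := fun x y => (F (x, y))%:E)); last 2 first.
  - by apply/measurable_EFinP; rewrite (_ : (fun z : E * E => F (z.1, z.2)) = F)//; apply/funext => -[].
  - by move=> x y; rewrite lee_fin.
  apply: (@le_trans _ _ (\int[mu]_x (k1 * m2 * v t x)%:E)%E); last first.
    apply: le_integral_ge0.
    - by apply/measurable_EFinP; exact: measurable_funM.
    - apply: (measurable_integral_snd mu (f := fun x y => (F (x, y))%:E)).
        by apply/measurable_EFinP; rewrite (_ : (fun z : E * E => F (z.1, z.2)) = F)//; apply/funext => -[].
      by move=> x y; rewrite lee_fin.
    - by move=> x; apply: integral_ge0 => y _; rewrite lee_fin.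
    move=> x; rewrite (_ : (\int[mu]_y (F (x, y))%:E)%E = ((k1 * v t x)%:E * \int[mu]_y (far t y)%:E)%E); last first.
      rewrite -(integral_scalel mu (mfar t) (far0 t) (mulr_ge0 k10 (v0 t x))).
      by apply: eq_integral => y _; rewrite /F mulrA.
    rewrite mulrAC EFinM; apply: lee_wpmul2l => //; rewrite lee_fin; exact: (mulr_ge0 k10 (v0 t x)).
  rewrite (_ : (\int[mu]_x _)%E = (kap * mass t)%:E)//.
  rewrite -(RintegralZl kap measurableT (iv t)) fineK//.
  exact: (integrable_fin_num measurableT (integrableZl measurableT kap (iv t))).
have mW' : measurable_fun setT (W ^~ t) := mWt t.
have ms f : measurable_fun setT f -> measurable_fun setT (fun z => 2^-1 * D f z).
  by move=> mf; exact: (measurable_funM (measurable_cst _) (mD f mf)).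
have s0 f z : 0 <= 2^-1 * D f z by exact: mulr_ge0.
have mgap1 : measurable_fun setT (young_gap (W ^~ t) (v t)).
  have ma1 : measurable_fun [set: (E * E)] (al ^~ t) by exact: (measurableT_comp mal (measurable_pair2 (t : RR))).
  have mb1 : measurable_fun [set: (E * E)] (be ^~ t) by exact: (measurableT_comp mbe (measurable_pair2 (t : RR))).
  have mg1 : measurable_fun [set: (E * E)] (ga ^~ t) by exact: (measurableT_comp mga (measurable_pair2 (t : RR))).
  have md1 : measurable_fun [set: (E * E)] (de ^~ t) by exact: (measurableT_comp mdv (measurable_pair2 (t : RR))).
  rewrite (_ : young_gap _ _ = (fun z => al z t + be z t + ga z t * de z t)); last by apply/funext => z; exact: gapE.
  exact: (measurable_funD (measurable_funD ma1 mb1) (measurable_funM mg1 md1)).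
have gapge0 z : 0 <= young_gap (W ^~ t) (v t) z by exact: young_gap_ge0.
rewrite -(GE _ mphi pg) -(integral_add (prodm mu mu) mgap1 gapge0 (ms _ mphi) (s0 phi)).
apply: (@le_trans _ _ (\int[prodm mu mu]_z (2^-1 * D (W ^~ t) z + 2^-1 * D (v t) z + F z)%:E)%E).
  rewrite (integral_add (prodm mu mu) (measurable_funD (ms _ mW') (ms _ (mvt t))) (fun z => addr_ge0 (s0 _ z) (s0 _ z)) mF F0).
  rewrite (integral_add (prodm mu mu) (ms _ mW') (s0 _) (ms _ (mvt t)) (s0 _)).
  rewrite (GE _ mW' eoo) (GE _ (mvt t) goo) -EFinD -mulrDr EFinD; exact: leeD2l.
apply: integral_mono.
- exact: (measurable_funD (measurable_funD (ms _ mW') (ms _ (mvt t))) mF).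
- by move=> z; apply: addr_ge0 => //; apply: addr_ge0.
- exact: (measurable_funD mgap1 (ms _ mphi)).
move=> z; have pz := far_picone t z; rewrite /young_gap /D /F.
(* The kernel is bounded below only between a point of the support of [v] and a far point of [Om]; a
   nonzero product places the pair exactly there. *)
have [vf|vf] := eqVneq (v t z.1 * far t z.2) 0.
  move: pz; rewrite vf !mulr0 !addr0 => pz.
  have := ler_wpM2r (nuge0 z.1 z.2) pz; lra.
have cn : c <= nu z.1 z.2.
  have vn : v t z.1 != 0 by apply: contraNneq vf => ->; rewrite mul0r.
  have fn : far t z.2 != 0 by apply: contraNneq vf => ->; rewrite mulr0.
  apply: nu_low.
  - by rewrite ltNge; apply: contraNN vn => h; rewrite (weighted_out e p2 phir _ _ h).
  - apply: contrapT => nO; have [_ _ Wo _ _] := fW; move/eqP: fn; apply; rewrite /far Wo// powR0 ?if_same//.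
    by have := p1; rewrite -subr_gt0 => /lt0r_neq0.
  - by apply: contraNT fn => h; rewrite /far (negbTE h).
have h1 := ler_wpM2r (nuge0 z.1 z.2) pz.
have q0' : 0 <= 2 `^ (1 - p) * (v t z.1 * far t z.2) by apply: mulr_ge0; [exact: powR_ge0|exact: (mulr_ge0 (v0 _ _) (far0 _ _))].
have h2 := ler_wpM2l q0' cn.
have -> : k1 * (v t z.1 * far t z.2) = 2^-1 * (2 `^ (1 - p) * (v t z.1 * far t z.2) * c) by rewrite /k1; ring.
by move: h1 h2; lra.
Qed.
Variables (tau0 Ck : R).
Hypotheses (zt1 : forall t, tau0 <= t -> zeta t = 0) (Ck0 : 0 <= Ck).
Hypothesis hfar : {ae leb, forall t, 0 < t < tau0 -> (m2%:E <= \int[mu]_y (far t y)%:E)%E}.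
Hypothesis hyoung : forall t x, 0 < x ->
  dzeta t * ((p - 2)^-1 * x `^ (2 - p)) <= kap / 2 * zeta t * x `^ (1 - p) + Ck.

Local Notation Z := (\int[leb]_t zeta t).
Local Notation Phi := (\int[mu]_x (phi x `^ p)).
Let FP := fine (gagliardo s p setT phi).

Let q10 : 1 - p <= 0. Proof. by have := p2; lra. Qed.
Let q20 : 2 - p <= 0. Proof. by have := p2; lra. Qed.
Let kap0 : 0 < kap. Proof. by rewrite !mulr_gt0 ?powR_gt0. Qed.
Let FP0 : 0 <= FP. Proof. by rewrite /FP fine_ge0// gagliardo_ge0. Qed.
Let dz0 t : 0 <= dzeta t. Proof. by have [_ _ + _ _] := hz => /(_ t)/andP[]. Qed.
Let dzout t : ~~ (0 < t < T) -> dzeta t = 0. Proof. by have [_ _ _ + _] := hz => /(_ t) H /H[]. Qed.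

Let iz : leb.-integrable setT (EFin \o zeta).
Proof.
apply: (integrable_interval (M := C) (a := 0) (b := T)); [exact: mz| |exact: zout].
by move=> t; rewrite ger0_norm.
Qed.

Let mphip : measurable_fun setT (fun x => phi x `^ p).
Proof. exact: (measurableT_comp (measurable_powR p) mphi). Qed.

Let phip0 x : 0 <= phi x `^ p. Proof. exact: powR_ge0. Qed.

Let iphip : mu.-integrable setT (EFin \o (fun x => phi x `^ p)).
Proof.
apply: (integrable_box (M := B `^ p) r0 mphip).
  move=> x; rewrite powR_ge0/=; have /andP[h1 h2] := phiB x.
  by apply: powR_mono => //; exact: ltW.
by move=> x /phir ->; rewrite powR0// gt_eqF.
Qed.

Let Phi0 : 0 <= Phi. Proof. by apply: Rintegral_ge0 => x _; exact: phip0. Qed.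

Let izm : leb.-integrable setT (EFin \o (fun t => zeta t * mass t)).
Proof. by have [K HK] := mass_bounded q10; have [] := integrable_cutoff hz (mmass (1 - p)) HK. Qed.

Let mass0 t : 0 <= mass t. Proof. by apply: Rintegral_ge0 => x _; exact: v0. Qed.

Let mgapt : measurable_fun [set: (E * E) * RR] (fun u => zeta u.2 * young_gap (W ^~ u.2) (v u.2) u.1).
Proof.
rewrite (_ : (fun u => _) = (fun u : (E * E) * RR => zeta u.2 * (al u.1 u.2 + be u.1 u.2 + ga u.1 u.2 * de u.1 u.2))).
  exact: (measurable_funM (measurableT_comp mz measurable_snd) (measurable_funD (measurable_funD mal mbe) (measurable_funM mga mdv))).
by apply/funext => u; rewrite -gapE.
Qed.

Lemma cutoff_gap_lower :
  ((2^-1 * \int[leb]_t (zeta t * fine (energy t)) + 2^-1 * \int[leb]_t (zeta t * fine (gv t))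
    + kap * \int[leb]_t (zeta t * mass t))%:E <=
   \int[leb]_t \int[prodm mu mu]_z (zeta t * young_gap (W ^~ t) (v t) z)%:E + (2^-1 * FP * Z)%:E)%E.
Proof.
have half0 : 0 <= 2^-1 :> R by [].
have ien' := integrable_cutoff_energy; have igv := integrable_cutoff_test.
have j1 := integrableZl measurableT 2^-1 ien'; have j2 := integrableZl measurableT 2^-1 igv.
have j3 := integrableZl measurableT kap izm; have j4 := integrableZl measurableT (2^-1 * FP) iz.
have j5 := integrableD measurableT (integrableD measurableT j1 j2) j3.
rewrite -(integral_linear3 ien' igv izm 2^-1 2^-1 kap) -(integral_linear1 iz (2^-1 * FP)).
have g0 t : (0 <= \int[prodm mu mu]_z (zeta t * young_gap (W ^~ t) (v t) z)%:E)%E.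
  by apply: integral_ge0 => z _; rewrite lee_fin; exact: (mulr_ge0 (z0 t) (young_gap_ge0 _ _ _ p1)).
have mg : measurable_fun setT (fun t : RR => \int[prodm mu mu]_z (zeta t * young_gap (W ^~ t) (v t) z)%:E)%E.
  apply: (measurable_integral_fst (prodm mu mu) (f := fun (z : E * E) (t : RR) => (zeta t * young_gap (W ^~ t) (v t) z)%:E)).
    exact/measurable_EFinP.
  by move=> z t; rewrite lee_fin; exact: (mulr_ge0 (z0 t) (young_gap_ge0 _ _ _ p1)).
have f0 t : 0 <= 2^-1 * FP * zeta t by apply: mulr_ge0 => //; exact: mulr_ge0.
have mf : measurable_fun setT (fun t : RR => (2^-1 * FP * zeta t)%:E) by exact: (measurable_int _ j4).
rewrite -(ge0_integralD leb measurableT (fun t _ => g0 t) mg (fun t _ => f0 t : (0 <= (2^-1 * FP * zeta t)%:E)%E) mf).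
have FF := ae_filter_ringOfSetsType leb.
apply: ae_ge0_le_integral; first by [].
- move=> t _; rewrite lee_fin -mul_half_addr; apply: (mulr_ge0 (z0 t)).
  exact: (addr_ge0 (mulr_ge0 half0 (addr_ge0 (fen0 t) (fgv0 t))) (mulr_ge0 (ltW kap0) (mass0 t))).
- exact: (measurable_int _ j5).
- by move=> t _; apply: adde_ge0; [exact: g0|rewrite lee_fin; exact: f0].
- exact: (emeasurable_funD mg mf).
apply: filterS2 ae_regular_time hfar => t H1 H2 _.
have [zt|zt] := eqVneq (zeta t) 0.
  apply: (@le_trans _ _ 0%E); first by rewrite -mul_half_addr zt mul0r.
  by apply: adde_ge0; [exact: g0|rewrite lee_fin; exact: f0].
have tT : 0 < t < T by apply: contraNT zt => /zout ->.
have tt : 0 < t < tau0.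
  by have /andP[-> _] := tT; rewrite ltNge; apply: contra zt => /zt1 ->.
have i1 : `]0, T[%classic t by rewrite /= in_itv/= tT.
have H := gap_lower (H1 i1) (H2 tt).
have gm : measurable_fun setT (young_gap (W ^~ t) (v t)).
  have ma1 : measurable_fun [set: (E * E)] (al ^~ t) by exact: (measurableT_comp mal (measurable_pair2 (t : RR))).
  have mb1 : measurable_fun [set: (E * E)] (be ^~ t) by exact: (measurableT_comp mbe (measurable_pair2 (t : RR))).
  have mg1 : measurable_fun [set: (E * E)] (ga ^~ t) by exact: (measurableT_comp mga (measurable_pair2 (t : RR))).
  have md1 : measurable_fun [set: (E * E)] (de ^~ t) by exact: (measurableT_comp mdv (measurable_pair2 (t : RR))).
  rewrite (_ : young_gap _ _ = (fun z => al z t + be z t + ga z t * de z t)); last by apply/funext => z; exact: gapE.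
  exact: (measurable_funD (measurable_funD ma1 mb1) (measurable_funM mg1 md1)).
rewrite (integral_scalel _ gm (fun z => young_gap_ge0 _ _ z p1) (z0 t)).
have zt0' : (0 <= (zeta t)%:E)%E by rewrite lee_fin.
have := lee_wpmul2l zt0' H.
rewrite ge0_muleDr ?lee_fin; [|by apply: integral_ge0 => z _; rewrite lee_fin; exact: (young_gap_ge0 _ _ _ p1)|exact: mulr_ge0].
rewrite -!EFinM (_ : zeta t * (2^-1 * fine (gagliardo s p setT phi)) = 2^-1 * FP * zeta t); last by rewrite /FP; ring.
by rewrite mul_half_addr.
Qed.

(** [powR_ratio_ge] multiplied by [lam a phi^p], with [a] replaced by its bound [A] in the error.
    Only the error feels [A], through the product [A e]. *)
Lemma cutoff_reaction_lower (b : R) : b = lam * A * (p - 1) * e ->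
  ((lam * \int[mu]_x (a x * phi x `^ p) * Z)%:E <=
   \int[leb]_t \int[mu]_x (zeta t * (lam * (a x * W x t `^ (p - 1) * v t x)))%:E
   + (b * \int[leb]_t (zeta t * mass t) + b * Phi * Z)%:E)%E.
Proof.
move=> bE.
have A0 : 0 <= A by have /andP[h1 h2] := aA 0; exact: le_trans h2.
have b0 : 0 <= b by rewrite bE; apply: mulr_ge0; [apply: mulr_ge0; [exact: mulr_ge0|have := p1; lra]|exact: ltW].
have ia : mu.-integrable setT (EFin \o (fun x => a x * phi x `^ p)).
  have i := integrableZl measurableT A iphip.
  apply: (le_integrable measurableT _ _ i); first by apply/measurable_EFinP; exact: measurable_funM.
  move=> x _ /=; have /andP[h1 h2] := aA x.
  by rewrite lee_fin !ger0_norm; [exact: ler_wpM2r|exact: mulr_ge0|exact: mulr_ge0].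
have pt x t : lam * (a x * phi x `^ p) <= lam * (a x * W x t `^ (p - 1) * v t x) + b * (v t x + phi x `^ p).
  have H := powR_ratio_ge p2 (W0 x t) e0; have /andP[h1 h2] := aA x.
  have {}H := ler_wpM2l (phip0 x) H.
  have vE : v t x = phi x `^ p * (W x t + e) `^ (1 - p) by [].
  have {}H := ler_wpM2l (mulr_ge0 lam0 h1) H.
  have h3 : 0 <= lam * (p - 1) * e * (v t x + phi x `^ p).
    apply: mulr_ge0; [apply: mulr_ge0; [apply: mulr_ge0 => //; have := p1; lra|exact: ltW]|exact: (addr_ge0 (v0 t x) (phip0 x))].
  have := ler_wpM2l h3 h2; rewrite bE; move: H; rewrite vE; lra.
have mre1 t : measurable_fun setT (fun x => lam * (a x * W x t `^ (p - 1) * v t x)).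
  have -> : (fun x : E => lam * (a x * W x t `^ (p - 1) * v t x)) = (fun x => rga x t * v t x).
    by apply/funext => x; exact: mulrA.
  exact: (measurable_funM (measurableT_comp mrga (measurable_pair2 (t : RR))) (mvt t)).
have re1 t x : 0 <= lam * (a x * W x t `^ (p - 1) * v t x) := re0 x t t.
have sx t : ((lam * \int[mu]_x (a x * phi x `^ p))%:E <=
    \int[mu]_x (lam * (a x * W x t `^ (p - 1) * v t x))%:E + (b * (mass t + Phi))%:E)%E.
  have i1 := integrableZl measurableT b (integrableD measurableT (iv t) iphip).
  have Eb : (b * (mass t + Phi))%:E = (\int[mu]_x (b * (v t x + phi x `^ p))%:E)%E.
    rewrite mulrDr -(integral_linear2 (iv t) iphip b b).
    by apply: eq_integral => x _; rewrite mulrDr.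
  rewrite -(integral_linear1 ia lam) Eb.
  have f0 x : 0 <= b * (v t x + phi x `^ p) by apply: mulr_ge0 => //; exact: (addr_ge0 (v0 t x) (phip0 x)).
  have mf : measurable_fun setT (fun x => b * (v t x + phi x `^ p)).
    exact: (measurable_funM (measurable_cst _) (measurable_funD (mvt t) mphip)).
  rewrite -(integral_add mu (mre1 t) (re1 t) mf f0).
  apply: integral_mono; [exact: (measurable_funM (measurable_cst _) (measurable_funM ma mphip))| |exact: (measurable_funD (mre1 t) mf)|].
    by move=> x; have /andP[h1 _] := aA x; exact: (mulr_ge0 lam0 (mulr_ge0 h1 (phip0 x))).
  by move=> x; exact: pt.
have j1 := integrableZl measurableT b izm; have j2 := integrableZl measurableT (b * Phi) iz.
have j3 := integrableZl measurableT (lam * \int[mu]_x (a x * phi x `^ p)) iz.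
rewrite -(integral_linear1 iz (lam * \int[mu]_x (a x * phi x `^ p))) -(integral_linear2 izm iz b (b * Phi)).
have g0 t : (0 <= \int[mu]_x (zeta t * (lam * (a x * W x t `^ (p - 1) * v t x)))%:E)%E.
  by apply: integral_ge0 => x _; rewrite lee_fin; exact: (mulr_ge0 (z0 t) (re1 t x)).
have mg : measurable_fun setT (fun t : RR => \int[mu]_x (zeta t * (lam * (a x * W x t `^ (p - 1) * v t x)))%:E)%E.
  apply: (measurable_integral_fst mu (f := fun (x : E) (t : RR) => (zeta t * (lam * (a x * W x t `^ (p - 1) * v t x)))%:E)).
    apply/measurable_EFinP.
    have -> : (fun u : E * RR => zeta u.2 * (lam * (a u.1 * W u.1 u.2 `^ (p - 1) * v u.2 u.1))) =
        (fun u => zeta u.2 * (rga u.1 u.2 * v u.2 u.1)).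
      by apply/funext => u; congr (_ * _); exact: mulrA.
    exact: (measurable_funM (measurableT_comp mz measurable_snd) (measurable_funM mrga (mv (1 - p)))).
  by move=> x t; rewrite lee_fin; exact: (mulr_ge0 (z0 t) (re1 t x)).
have f0 t : 0 <= b * (zeta t * mass t) + b * Phi * zeta t.
  by apply: addr_ge0; [exact: (mulr_ge0 b0 (mulr_ge0 (z0 t) (mass0 t)))|exact: (mulr_ge0 (mulr_ge0 b0 Phi0) (z0 t))].
have mf : measurable_fun setT (fun t : RR => (b * (zeta t * mass t) + b * Phi * zeta t)%:E).
  exact: (measurable_int _ (integrableD measurableT j1 j2)).
rewrite -(ge0_integralD leb measurableT (fun t _ => g0 t) mg (fun t _ => f0 t : (0 <= (b * (zeta t * mass t) + b * Phi * zeta t)%:E)%E) mf).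
apply: le_integral_ge0.
- exact: (measurable_int _ j3).
- exact: (emeasurable_funD mg mf).
- by move=> t; apply: adde_ge0; [exact: g0|rewrite lee_fin; exact: f0].
move=> t; rewrite (integral_scalel _ (mre1 t) (re1 t) (z0 t)).
have zt0' : (0 <= (zeta t)%:E)%E by rewrite lee_fin.
have := lee_wpmul2l zt0' (sx t).
rewrite ge0_muleDr ?lee_fin; [|by apply: integral_ge0 => x _; rewrite lee_fin; exact: (re1 t x)|by apply: mulr_ge0 => //; exact: addr_ge0].
rewrite -!EFinM (_ : zeta t * (b * (mass t + Phi)) = b * (zeta t * mass t) + b * Phi * zeta t); last by ring.
by rewrite [X in (X%:E <= _)%E -> _]mulrC.
Qed.

(** Young's inequality [hyoung] at [x = W + e], multiplied by [phi^p] and integrated; it costs half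
    of the surplus and a constant that does not depend on [e]. *)
Lemma cutoff_time_upper : (p - 2)^-1 * \int[leb]_t (dzeta t * psi t) <=
  kap / 2 * \int[leb]_t (zeta t * mass t) + Ck * Phi * T.
Proof.
have [K HK] := mass_bounded q20; have [_ id] := integrable_cutoff hz (mmass (2 - p)) HK.
have j1 := integrableZl measurableT (kap / 2) izm.
have iT := iind (Ck * Phi).
have E1 : \int[leb]_t (Ck * Phi * ind t) = Ck * Phi * T.
  transitivity (\int[leb]_(t in `]0, T[) cst (Ck * Phi) t).
    rewrite [RHS]Rintegral_mkcond; apply: eq_Rintegral => t _; rewrite patchE mem_setE in_itv/= /ind.
    by case: ifP; rewrite ?mulr1 ?mulr0.
  by rewrite Rintegral_cst//= lebesgue_measure_itv/= lte_fin T0 -EFinB/= subr0.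
have E2 : kap / 2 * \int[leb]_t (zeta t * mass t) + Ck * Phi * T = \int[leb]_t (kap / 2 * (zeta t * mass t) + Ck * Phi * ind t).
  by rewrite (RintegralD measurableT j1 iT) (RintegralZl (kap / 2) measurableT izm) E1.
have E3 : (p - 2)^-1 * \int[leb]_t (dzeta t * psi t) = \int[leb]_t ((p - 2)^-1 * (dzeta t * psi t)).
  by rewrite (RintegralZl (p - 2)^-1 measurableT id).
rewrite E2 E3.
apply: (le_Rintegral measurableT (integrableZl measurableT (p - 2)^-1 id) (integrableD measurableT j1 iT)) => t _.
case: (boolP (0 < t < T)) => [tT|tT]; last first.
  by rewrite dzout// zout// /ind (negbTE tT) !mul0r !mulr0 addr0.
rewrite /ind tT mulr1.
have iw := integrable_weighted p2 r0 e0 mphi phiB phir q20 (mWt t) (W0 ^~ t).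
have -> : (p - 2)^-1 * (dzeta t * psi t) = \int[mu]_x (dzeta t * (p - 2)^-1 * weighted p phi (W ^~ t) e (2 - p) x).
  by rewrite (RintegralZl _ measurableT iw); ring.
have -> : kap / 2 * (zeta t * mass t) + Ck * Phi = \int[mu]_x (kap / 2 * zeta t * v t x + Ck * phi x `^ p).
  rewrite (RintegralD measurableT (integrableZl measurableT _ (iv t)) (integrableZl measurableT _ iphip)).
  by rewrite (RintegralZl _ measurableT (iv t)) (RintegralZl _ measurableT iphip) mulrA.
apply: (le_Rintegral measurableT (integrableZl measurableT _ iw)
  (integrableD measurableT (integrableZl measurableT _ (iv t)) (integrableZl measurableT _ iphip))) => x _.
have X0 : 0 < W x t + e by rewrite ltr_wpDl.
exact: young_time_algebra (ler_wpM2l (phip0 x) (hyoung t X0)).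
Qed.

(** The first smallness condition lets the second half of the surplus absorb the reaction error; the
    other one bounds the remaining error by [Phi]. Division by [Z], the integral of [zeta], removes
    time. *)
Lemma local_hardy : lam * A * (p - 1) * e <= kap / 2 -> lam * A * (p - 1) * e <= 1 -> 0 < Z ->
  lam * \int[mu]_x (a x * phi x `^ p) <= 2^-1 * FP + (Ck * T / Z + 1) * Phi.
Proof.
move=> hb1 hb2 Z0.
have H1 := energy_inequality; have H2 := cutoff_gap_lower; have H3 := cutoff_reaction_lower erefl.
have H4 := cutoff_time_upper.
have G0 : (0 <= \int[leb]_t \int[prodm mu mu]_z (zeta t * young_gap (W ^~ t) (v t) z)%:E)%E.
  by apply: integral_ge0 => t _; apply: integral_ge0 => z _; rewrite lee_fin; exact: (mulr_ge0 (z0 t) (young_gap_ge0 _ _ _ p1)).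
have R0 : (0 <= \int[leb]_t \int[mu]_x (zeta t * (lam * (a x * W x t `^ (p - 1) * v t x)))%:E)%E.
  by apply: integral_ge0 => t _; apply: integral_ge0 => x _; rewrite lee_fin; exact: (mulr_ge0 (z0 t) (re0 x t t)).
have ZV0 : 0 <= \int[leb]_t (zeta t * mass t) by apply: Rintegral_ge0 => t _; exact: (mulr_ge0 (z0 t) (mass0 t)).
rewrite -(ler_pM2r Z0) (_ : (2^-1 * FP + (Ck * T / Z + 1) * Phi) * Z = 2^-1 * FP * Z + Ck * T * Phi + Z * Phi); last first.
  by field; exact: lt0r_neq0.
have hb3 := ler_wpM2r ZV0 hb1; have hb4 := ler_wpM2r (mulr_ge0 Phi0 (ltW Z0)) hb2.
move: H1 H2 H3 H4 G0 R0 hb3 hb4.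
(* Infinite values are excluded by [energy_inequality], which bounds a sum of two nonnegative terms
   by a real number. *)
move: (\int[leb]_t \int[prodm mu mu]_z (zeta t * young_gap (W ^~ t) (v t) z)%:E)%E => [g| |]//;
move: (\int[leb]_t \int[mu]_x (zeta t * (lam * (a x * W x t `^ (p - 1) * v t x)))%:E)%E => [q| |]//.
rewrite -!EFinD !lee_fin => H1 H2 H3 H4 _ _ hb3 hb4.
rewrite (_ : Ck * Phi * T = Ck * T * Phi) in H4; last by ring.
apply: (absorption_algebra H1 H2 H3 _ _ _).
- by apply: le_trans H4 _; rewrite le_eqVlt; apply/orP; left; apply/eqP; ring.
- by apply: le_trans hb3 _; rewrite le_eqVlt; apply/orP; left; apply/eqP; ring.
- by rewrite mul1r in hb4; rewrite -mulrA [leRHS]mulrC.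
Qed.

End time_step.

(** * Cutoffs, mass away from the origin, and conclusion *)

Section cutoff_existence.
Variable R : realType.
Local Notation leb := (@lebesgue_measure R).
Local Notation RR := (measurableTypeR R).

Lemma time_cutoff_widen (T T' C : R) (zeta dzeta : R -> R) : T <= T' ->
  time_cutoff T C zeta dzeta -> time_cutoff T' C zeta dzeta.
Proof.
move=> TT' [h1 h2 h3 h4 h5]; split => // t tT'; apply: h4; apply: contra tT' => /andP[-> tT] /=.
exact: lt_le_trans TT'.
Qed.

(* A power of the tent function: the exponent makes [dzeta] absorbable by [young_time]. *)
Lemma time_cutoff_exists (p tau k : R) : 2 < p -> 0 < tau -> 0 < k ->
  exists (zeta dzeta : R -> R) (C Ck t0 : R),
  [/\ time_cutoff tau C zeta dzeta, 0 < t0 /\ (forall t, t <= t0 -> zeta t = 0),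
      forall t, tau <= t -> zeta t = 0,
      0 <= Ck /\ (forall t x, 0 < x ->
        dzeta t * ((p - 2)^-1 * x `^ (2 - p)) <= k * zeta t * x `^ (1 - p) + Ck) &
      0 < \int[leb]_t zeta t].
Proof.
(* This exponent exceeds [p], hence satisfies [p <= m + 1], and it exceeds [1] since the integer
   part of [p] is positive: the two conditions of [young_time]. *)
move=> p2 tau0 k0; pose m := (Num.truncn p).+1.
have pm : p <= m.+1%:R.
  by apply: le_trans (ltW (truncnS_gt p)) _; rewrite ler_nat.
have m1 : (1 < m)%N.
  by rewrite ltnS truncn_gt0; have := p2; lra.
(* The tent starts at [tau / 4] and not at [0], which leaves room for the backward time step. *)
pose q (t : R) : R := Num.max 0 (Num.min (t - tau / 4) (tau - t)).
have q0 t : 0 <= q t by rewrite /q le_max lexx.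
have qtau t : q t <= tau.
  rewrite /q ge_max ltW// ge_min; apply/orP.
  by have [h|h] := leP t tau; [left; lra|right; lra].
have qout t : ~~ (tau / 4 < t < tau) -> q t = 0.
  move=> h; rewrite /q; apply/max_idPl; rewrite ge_min; apply/orP.
  by move: h; rewrite negb_and -!leNgt => /orP[h|h]; [left|right]; lra.
have qstep t h : 0 <= h -> q (t + h) <= q t + h.
  move=> h0; rewrite /q ge_max; apply/andP; split.
  by apply: addr_ge0 => //; rewrite le_max lexx.
  rewrite -lerBlDr le_max; apply/orP; right.
  rewrite le_min; apply/andP; split; rewrite lerBlDr ge_min; apply/orP; [left|right]; lra.
have [C C0 HC] := exprD_quad m (ltW tau0).
have [Ck Ck0 HCk] := young_time p2 pm m1 k0 (ltW tau0).
have mq : measurable_fun [set: RR] q.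
  apply: measurable_maxr => //; apply: measurable_minr; [exact: measurable_funB|exact: measurable_funB].
pose C' := C + tau ^+ m + m%:R * tau ^+ m.-1.
have qle n t : q t ^+ n <= tau ^+ n by apply: lerXn2r; rewrite ?nnegrE; [exact: q0|exact: ltW|exact: qtau].
have out0 t : ~~ (tau / 4 < t < tau) -> q t ^+ m = 0 /\ m%:R * q t ^+ m.-1 = 0.
  move=> /qout ->; rewrite !expr0n.
  have -> : (m == 0%N) = false by []. have -> : (m.-1 == 0%N) = false by case: (m) m1 => [|[|n]].
  by rewrite mulr0.
exists (fun t => q t ^+ m), (fun t => m%:R * q t ^+ m.-1), C', Ck, (tau / 4).
have X0 : 0 <= tau ^+ m by rewrite exprn_ge0// ltW.
have X1 : 0 <= m%:R * tau ^+ m.-1 by rewrite mulr_ge0// exprn_ge0// ltW.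
split.
- split.
  + by split; [exact: measurable_funX|apply: measurable_funM => //; exact: measurable_funX].
  + move=> t; rewrite exprn_ge0//=; apply: le_trans (qle m t) _; rewrite /C'; move: C0 X1; lra.
  + move=> t; rewrite mulr_ge0 ?exprn_ge0//=; apply: (@le_trans _ _ (m%:R * tau ^+ m.-1)); first exact: ler_wpM2l.
    by rewrite /C'; move: C0 X0; lra.
  + move=> t tT; apply: out0; apply: contra tT => /andP[h1 ->]; rewrite andbT; apply: lt_trans h1; lra.
  + move=> t h /andP[h0 h1].
    apply: (@le_trans _ _ ((q t + h) ^+ m)).
      by apply: lerXn2r; rewrite ?nnegrE ?addr_ge0//; exact: qstep.
    apply: le_trans (HC (q t) h _ _) _; [by rewrite q0 qtau|by rewrite h0 h1|].
    have h2 : C * h ^+ 2 <= C' * h ^+ 2 by apply: ler_wpM2r; rewrite ?sqr_ge0// /C'; move: X0 X1; lra.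
    by rewrite mulrAC [m%:R * _ * h]mulrC; move: h2; lra.
- split; first lra.
  by move=> t tt; have [] := out0 t; rewrite // negb_and -leNgt tt.
- by move=> t tt; have [] := out0 t; rewrite // negb_and -(leNgt tau) tt orbT.
- by split => // t x x0; apply: HCk => //; rewrite q0 qtau.
have iz : leb.-integrable setT (EFin \o (fun t => q t ^+ m)).
  apply: (integrable_interval (M := tau ^+ m) (a := 0) (b := tau)); first exact: measurable_funX.
    by move=> t; rewrite ger0_norm ?exprn_ge0//; exact: qle.
  by move=> t tT; have [] := out0 t; rewrite //; apply: contra tT => /andP[h1 ->]; rewrite andbT; apply: lt_trans h1; lra.
(* A step function below the cutoff: on this interval both sides of the tent are at least
   [tau / 4]. *)
pose g (t : R) : R := if tau / 2 < t < 5 / 8 * tau then (tau / 4) ^+ m else 0.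
have mg : measurable_fun [set: RR] g.
  apply: measurable_fun_ifT => //; apply: measurable_and; exact: measurable_fun_ltr.
have y0 : 0 < (tau / 4) ^+ m by rewrite exprn_gt0// divr_gt0.
have ig : leb.-integrable setT (EFin \o g).
  apply: (integrable_interval (M := (tau / 4) ^+ m) (a := tau / 2) (b := 5 / 8 * tau)) => //.
    by move=> t; rewrite /g; case: ifP => _; rewrite ?normr0 ?gtr0_norm ?(ltW y0).
  by move=> t /negbTE h; rewrite /g h.
apply: (@lt_le_trans _ _ (\int[leb]_t g t)); last first.
  apply: (le_Rintegral measurableT ig iz) => t _; rewrite /g; case: ifPn => [/andP[h1 h2]|_]; last exact: exprn_ge0.
  have h3 : tau / 4 <= q t by rewrite /q le_max le_min; apply/orP; right; apply/andP; split; lra.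
  by apply: lerXn2r; rewrite ?nnegrE; [exact: divr_ge0 (ltW tau0) _|exact: q0|exact: h3].
have -> : \int[leb]_t g t = \int[leb]_(t in `]tau / 2, 5 / 8 * tau[) cst ((tau / 4) ^+ m) t.
  rewrite [RHS]Rintegral_mkcond; apply: eq_Rintegral => t _.
  by rewrite patchE mem_setE in_itv/= /g.
rewrite Rintegral_cst//= lebesgue_measure_itv/= lte_fin.
have -> : tau / 2 < 5 / 8 * tau by lra.
by rewrite -EFinB/= mulr_gt0//; lra.
Qed.

End cutoff_existence.

Section mass_persistence.
Variables (R : realType) (N : nat) (p : R) (Om : set 'rV[R]_N).
Local Notation E := 'rV[R]_N.
Local Notation mu := (lebesgue_rV R N).
Local Notation leb := (@lebesgue_measure R).

Lemma measurable_far (r : R) : measurable [set x : E | (r <= `|x|)%R].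
Proof.
rewrite (_ : [set x : E | (r <= `|x|)%R] = ~` [set x : E | (`|x| < r)%R]).
  by apply: measurableC; exact: measurable_box.
by apply/seteqP; split => x /=; rewrite leNgt => /negP.
Qed.

(** Otherwise [b] would vanish almost everywhere outside the box of radius [1/(k+1)] for every [k],
    hence almost everywhere, the origin being a null set in positive dimension. *)
Lemma positive_mass_off_origin (b : E -> R) : (0 < N)%N -> measurable Om -> measurable_fun Om b ->
  (forall x, 0 <= b x) -> ~ {ae mu, forall x, Om x -> b x = 0} ->
  exists2 r1 : R, 0 < r1 & forall r : R, 0 < r -> r <= r1 ->
    (0 < \int[mu]_(x in Om `&` [set x : E | (r <= `|x|)%R]) (b x)%:E)%E.
Proof.
move=> N0 mOm mb b0 nb.
have mA (r : R) : measurable (Om `&` [set x : E | (r <= `|x|)%R]).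
  by apply: measurableI => //; exact: measurable_far.
apply: contrapT => H; apply: nb.
have H' k : {ae mu, forall x, (Om `&` [set x : E | (k.+1%:R^-1 <= `|x|)%R]) x -> b x = 0}.
  have FF := ae_filter_ringOfSetsType mu.
  apply: contrapT => nk; apply: H; exists k.+1%:R^-1; first by rewrite invr_gt0.
  move=> r r0 rk; rewrite lt_neqAle integral_ge0 ?andbT; last by move=> x _; rewrite lee_fin.
  apply/eqP => I0; apply: nk.
  have mbr : measurable_fun (Om `&` [set x : E | (r <= `|x|)%R]) (EFin \o b).
    by apply/measurable_EFinP; apply: measurable_funS mb => // x [].
  have := ae_eq_integral_abs mu (mA r) mbr => -[h _].
  have {}h := h (_ : _); apply: filterS (h _) => [x hx [Ox kx]|].
    have rx : (Om `&` [set x : E | (r <= `|x|)%R]) x by split => //=; exact: le_trans kx.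
    by have /= [] := hx rx.
  by rewrite [RHS]I0; apply: eq_integral => x _; rewrite /= ger0_norm.
have [m0 z0] := lebesgue_rV_set0 R N0.
have FF := ae_filter_ringOfSetsType mu.
have H0 : {ae mu, forall x : E, x <> 0}.
  by exists [set 0]; split => // x /= /contrapT.
have := ae_foralln H'; apply: filterS2 H0 => x x0 hx Ox.
have nx : 0 < `|x| by rewrite normr_gt0; apply/eqP.
apply: (hx (Num.truncn (`|x|^-1))); split => //=.
rewrite -[leRHS]invrK lef_pV2 ?posrE ?invr_gt0//; exact: ltW (truncnS_gt _).
Qed.

Hypotheses (p2 : 2 < p) (mOm : measurable Om) (bOm : bounded_set Om).

(* Continuity at [t = 0] of one approximation bounds all later masses from below. *)
Lemma mass_persists (T r : R) (w : E -> R -> R) (b : E -> R) : 0 < T ->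
  measurable_fun Om b -> (forall x, 0 <= b x <= 1) ->
  (forall t, `[0, T]%classic t -> measurable_fun Om (w ^~ t)) ->
  (\int[mu]_(x in Om) ((w x t - b x) ^+ 2)%:E)%E @[t --> at_right (0 : R)] --> 0%E ->
  (0 < \int[mu]_(x in Om `&` [set x : E | (r <= `|x|)%R]) (b x)%:E)%E ->
  exists tau m2 : R, [/\ 0 < tau <= T, 0 < m2 & forall t, 0 < t < tau ->
    forall f : E -> R, measurable_fun setT f -> (forall x, 0 <= f x) ->
    {ae mu, forall x, Om x -> w x t <= f x} ->
    (m2%:E <= \int[mu]_x (if r <= `|x| then f x `^ (p - 1) else 0)%:E)%E].
Proof.
move=> T0 mb b01 mw cw bpos.
set A := Om `&` [set x : E | (r <= `|x|)%R] in bpos *.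
have mA : measurable A.
  by apply: measurableI => //; exact: measurable_far.
have b0 x : 0 <= b x by have /andP[] := b01 x.
have muO : mu Om \is a fin_num by rewrite ge0_fin_numE//; exact: lebesgue_rV_bounded.
pose V := fine (mu Om) + 1.
have V0 : 0 < V by rewrite ltr_wpDl// fine_ge0.
have muA : (mu A <= V%:E)%E.
  apply: (@le_trans _ _ (mu Om)); first by apply: le_measure; rewrite ?inE//; move=> x [].
  by rewrite -(fineK muO) lee_fin lerDl.
have mbA : measurable_fun A b by apply: measurable_funS mb => // x [].
have bfin : (\int[mu]_(x in A) (b x)%:E)%E \is a fin_num.
  rewrite ge0_fin_numE ?integral_ge0//; last by move=> x _; rewrite lee_fin.
  apply: (@le_lt_trans _ _ (\int[mu]_(x in A) 1)%E).
    apply: ge0_le_integral => //.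
    - by move=> x _; rewrite lee_fin.
    - exact/measurable_EFinP.
    - by move=> x _; rewrite lee_fin; have /andP[] := b01 x.
  by rewrite integral_cst// mul1e; apply: le_lt_trans muA _; rewrite ltry.
pose beta := fine (\int[mu]_(x in A) (b x)%:E)%E.
have betaE : (\int[mu]_(x in A) (b x)%:E)%E = beta%:E by rewrite fineK.
have beta0 : 0 < beta by rewrite -lte_fin -betaE.
(* Out of the initial mass [beta], the term [2 d] costs at most [2 d V = beta / 2] and the squared
   [L^2] distance, divided by [d], at most [beta / 4]; a quarter of [beta] survives. *)
pose d := beta / (4 * V); have d0 : 0 < d by rewrite divr_gt0// mulr_gt0.
have dV : d * V = beta / 4 by rewrite /d invfM mulrA -mulrA mulVf ?mulr1//; exact: lt0r_neq0.
(* The slope of the linear minorant [powR_lin_ge] of the power [p - 1], taken at the level [d]. *)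
pose th := d `^ (p - 2); have th0 : 0 < th by exact: powR_gt0.
have eps0 : 0 < d * (beta / 4) by rewrite mulr_gt0// divr_gt0.
have [g g0 Hg] : exists2 g : R, 0 < g & forall t, 0 < t -> t < g ->
    (\int[mu]_(x in Om) ((w x t - b x) ^+ 2)%:E <= (d * (beta / 4))%:E)%E.
  have /fine_cvgP[Kf /cvgr_lt/(_ _ eps0) Kl] := cw.
  have : \forall t \near at_right (0 : R), (\int[mu]_(x in Om) ((w x t - b x) ^+ 2)%:E <= (d * (beta / 4))%:E)%E.
    by apply: filterS2 Kf Kl => t kf kl; rewrite -(fineK kf) lee_fin ltW.
  move=> /nbhs_ballP[g /= g0 Hg]; exists g => // t t0 tg; apply: Hg => //=.
  by rewrite /ball /= sub0r normrN gtr0_norm.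
exists (Num.min g T), (th * (beta / 4)); split.
- by rewrite lt_min g0 T0 ge_min lexx orbT.
- by rewrite mulr_gt0// divr_gt0.
move=> t /andP[t0]; rewrite lt_min => /andP[tg tT] f mf f0 wf.
have tin : `[0, T]%classic t by rewrite /= in_itv/= !ltW.
have mwt := mw t tin.
have mwA : measurable_fun A (w ^~ t) by apply: measurable_funS mwt => // x [].
have FF := ae_filter_ringOfSetsType mu.
have th0' := ltW th0; have d0' := ltW d0.
have mfp : measurable_fun setT (fun x => f x `^ (p - 1)) by exact: (measurableT_comp (measurable_powR (p - 1)) mf).
have msq : measurable_fun A (fun x => (w x t - b x) ^+ 2) by apply: measurable_funX; exact: measurable_funB.
have -> : (\int[mu]_x (if r <= `|x| then f x `^ (p - 1) else 0)%:E =
    \int[mu]_(x in [set x : E | (r <= `|x|)%R]) (f x `^ (p - 1))%:E)%E.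
  rewrite [RHS]integral_mkcond; apply: eq_integral => x _; rewrite patchE.
  by case: (boolP (r <= `|x|)) => h; [rewrite mem_set|rewrite memNset//; exact/negP].
apply: (@le_trans _ _ (\int[mu]_(x in A) (f x `^ (p - 1))%:E)%E); last first.
  apply: ge0_subset_integral => //.
  - exact: measurable_far.
  - by apply/measurable_EFinP; exact: measurable_funTS.
  - by move=> x _; rewrite lee_fin powR_ge0.
  - by move=> x [].
have pt x : w x t <= f x -> th * b x <= f x `^ (p - 1) + (th * (2 * d) + th * d^-1 * (w x t - b x) ^+ 2).
  move=> wfx; have H := powR_lin_ge p2 d0' (f0 x).
  (* A completed square: [b - w] is at most [d + (b - w)^2 / d]. It turns the [L^2] convergence to
     the initial datum into a one-sided linear bound. *)
  have bx : b x <= w x t + d + d^-1 * (w x t - b x) ^+ 2.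
    rewrite -subr_ge0 -(pmulr_rge0 _ d0) !mulrDr mulVKf; last exact: lt0r_neq0.
    have := sqr_ge0 (w x t - b x + d / 2); have := sqr_ge0 d; rewrite !expr2; nra.
  have := ler_wpM2l th0' (le_trans bx (lerD (lerD wfx (lexx d)) (lexx _))).
  by move: H; rewrite -/th; lra.
have I1 : (\int[mu]_(x in A) (th * b x)%:E <= \int[mu]_(x in A) (f x `^ (p - 1))%:E +
    \int[mu]_(x in A) (th * (2 * d) + th * d^-1 * (w x t - b x) ^+ 2)%:E)%E.
  have c0 x : 0 <= th * (2 * d) + th * d^-1 * (w x t - b x) ^+ 2.
    apply: addr_ge0; first by apply: mulr_ge0 => //; exact: mulr_ge0.
    by apply: mulr_ge0; [rewrite mulr_ge0// invr_ge0|exact: sqr_ge0].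
  have mc : measurable_fun A (fun x => th * (2 * d) + th * d^-1 * (w x t - b x) ^+ 2).
    by apply: measurable_funD => //; apply: measurable_funM.
  rewrite -ge0_integralD//; last 4 first.
  - by move=> x _; rewrite lee_fin powR_ge0.
  - by apply/measurable_EFinP; exact: measurable_funTS.
  - by move=> x _; rewrite lee_fin.
  - exact/measurable_EFinP.
  apply: ae_ge0_le_integral => //.
  - by move=> x _; rewrite lee_fin mulr_ge0.
  - by apply/measurable_EFinP; exact: measurable_funM.
  - by move=> x _; rewrite -EFinD lee_fin addr_ge0// powR_ge0.
  - by apply: emeasurable_funD; apply/measurable_EFinP => //; exact: measurable_funTS.
  by apply: filterS wf => x wfx [Ox _]; rewrite -EFinD lee_fin; apply: pt; exact: wfx.
have c10 : 0 <= th * (2 * d) by apply: mulr_ge0 => //; exact: mulr_ge0.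
have c20 : 0 <= th * d^-1 by rewrite mulr_ge0// invr_ge0.
have I2 : (\int[mu]_(x in A) (th * (2 * d) + th * d^-1 * (w x t - b x) ^+ 2)%:E <= (th * (3 * (beta / 4)))%:E)%E.
  rewrite (_ : th * (3 * (beta / 4)) = th * (2 * d) * V + th * d^-1 * (d * (beta / 4))); last first.
    have -> : th * (2 * d) * V = th * (2 * (d * V)) by ring.
    by rewrite dV -mulrA [d^-1 * _]mulrA mulVf ?mul1r; [ring|exact: lt0r_neq0].
  under eq_integral do rewrite EFinD.
  rewrite ge0_integralD//; last 2 first.
  - by move=> x _; rewrite lee_fin; apply: mulr_ge0 => //; exact: sqr_ge0.
  - by apply/measurable_EFinP; exact: measurable_funM.
  rewrite EFinD; apply: leeD.
    rewrite (_ : (\int[mu]_(_ in A) _)%E = (th * (2 * d))%:E * mu A)%E; last exact: integral_cst.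
    by rewrite (EFinM (th * (2 * d)) V); apply: lee_wpmul2l => //; rewrite lee_fin.
  under eq_integral do rewrite EFinM.
  rewrite ge0_integralZl_EFin//; last 2 first.
  - by move=> x _; rewrite lee_fin sqr_ge0.
  - exact/measurable_EFinP.
  rewrite (EFinM (th * d^-1)); apply: lee_wpmul2l; first by rewrite lee_fin.
  apply: le_trans (Hg t t0 tg); apply: ge0_subset_integral => //.
  - by apply/measurable_EFinP; apply: measurable_funX; exact: measurable_funB.
  - by move=> x _; rewrite lee_fin sqr_ge0.
  - by move=> x [].
have I3 : (\int[mu]_(x in A) (th * b x)%:E = (th * beta)%:E)%E.
  under eq_integral do rewrite EFinM.
  rewrite ge0_integralZl_EFin ?betaE//; last exact/measurable_EFinP.
  by move=> x _; rewrite lee_fin.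
move: I1; rewrite I3 => /le_trans/(_ (leeD2l _ I2)).
case: (\int[mu]_(x in A) (f x `^ (p - 1))%:E)%E => [y| |]//=; rewrite ?leey//.
by rewrite -EFinD !lee_fin; lra.
Qed.

End mass_persistence.

Section local_hardy_uniform.
Variables (R : realType) (N : nat) (s p : R) (Om : set 'rV[R]_N) (T r : R).
Local Notation E := 'rV[R]_N.
Local Notation mu := (lebesgue_rV R N).
Local Notation leb := (@lebesgue_measure R).
Hypotheses (p2 : 2 < p) (ps0 : 0 < p * s) (N0 : (0 < N)%N).
Hypotheses (bOm : bounded_set Om) (mOm : measurable Om) (T0 : 0 < T).
Hypotheses (r0 : 0 < r) (rOm : forall x : E, `|x| <= 2 * r -> Om x).

(** The order of quantifiers is the point. The kernel bound, [kap] and the time cutoff, hence [K],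
    are fixed by [tau], [m2] and the geometry before the weight [a], its bound [A] and the solution
    are given. *)
Lemma uniform_local_hardy (lam tau m2 : R) : 0 <= lam -> 0 < tau <= T -> 0 < m2 ->
  exists2 K : R, 0 <= K & forall (a : E -> R) (A : R) (w : E -> R -> R) (w0 : E -> R),
  measurable_fun setT a -> (forall x, 0 <= a x <= A) ->
  energy_solution s p Om T w (fun x t => lam * a x * w x t `^ (p - 1)) w0 ->
  {ae (mu \x leb)%E, forall z, cylinder T Om z -> 0 <= w z.1 z.2} ->
  {ae leb, forall t, 0 < t < tau ->
    (m2%:E <= \int[mu]_y (if r <= `|y| then positive_part Om T w y t `^ (p - 1) else 0)%:E)%E} ->
  forall (phi : E -> R) (B : R), measurable_fun setT phi -> (forall x, 0 <= phi x <= B) ->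
  (forall x, r <= `|x| -> phi x = 0) -> (gagliardo s p setT phi < +oo)%E ->
  lam * \int[mu]_x (a x * phi x `^ p) <=
    2^-1 * fine (gagliardo s p setT phi) + K * \int[mu]_x (phi x `^ p).
Proof.
move=> lam0 /andP[tau0 tauT] m20.
have q0 : 0 <= N%:R + p * s by apply: addr_ge0 => //; exact: ltW.
have [M [_ HM]] := bOm.
pose rho := Num.max (`|M| + 1) r.
have rho0 : 0 < rho by rewrite lt_max r0 orbT.
have [c c0 Hc] := nu0_lower q0 rho0 N0.
have nulow (x y : E) : `|x| < r -> Om y -> r <= `|y| -> c <= nu_density s p x y.
  move=> xr Oy ry; apply: Hc.
  - by rewrite le_max (ltW xr) orbT.
  - rewrite le_max; apply/orP; left; apply: (HM (`|M| + 1)) => //.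
    by rewrite (le_lt_trans (ler_norm M))// ltrDl.
  - by apply: contraTneq ry => <-; rewrite -ltNge.
pose kap := 2^-1 * 2 `^ (1 - p) * c * m2.
have kap0 : 0 < kap by rewrite !mulr_gt0 ?powR_gt0.
have kap20 : 0 < kap / 2 by rewrite divr_gt0.
have [zeta [dzeta [C [Ck [t0 [hz [t00 zt0] zt1 [Ck0 hy] Z0]]]]]] := time_cutoff_exists p2 tau0 kap20.
exists (Ck * T / \int[leb]_t zeta t + 1).
  by rewrite addr_ge0// divr_ge0 ?(ltW Z0)// mulr_ge0 ?(ltW T0).
move=> a A w w0 ma aA hsol hpos hfar phi B mphi phiB phir pg.
have A0 : 0 <= A by have /andP[h1 h2] := aA 0; exact: le_trans h2.
pose D := lam * A * (p - 1).
have D0 : 0 <= D by apply: mulr_ge0; [exact: mulr_ge0|have := p2; lra].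
(* [local_hardy] wants the error coefficient [D * e] below both [kap / 2] and [1]. Only [e], chosen
   here, depends on [A]. *)
pose x := Num.min (kap / 2) 1.
have x0 : 0 < x by rewrite lt_min kap20 ltr01.
have D1 : 0 < D + 1 by rewrite ltr_wpDl.
pose e := x / (D + 1); have e0 : 0 < e by rewrite divr_gt0.
have De : D * e <= x.
  rewrite /e mulrA ler_pdivrMr// mulrC; apply: ler_wpM2l; first exact: ltW.
  by rewrite lerDl.
have hW : evolves s p T r lam a (positive_part Om T w) (agree (positive_part Om T w) w).
  move=> psi tpsi t' t h' h t'0 t't tT.
  exact: (evolution_increment p2 ps0 N0 bOm mOm T0 r0 rOm ma aA hsol hpos tpsi h' h t'0 t't tT).
have fW := positive_part_finite p2 mOm hsol hpos.
apply: (local_hardy p2 ps0 N0 bOm T0 r0 lam0 e0 ma aA fW hW mphi phiB phir pg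
  (ae_agree hsol hpos) (time_cutoff_widen tauT hz) t00 zt0 c0 m20 nulow zt1 hfar hy _ _ Z0).
- by apply: le_trans De _; rewrite ge_min lexx.
- by apply: le_trans De _; rewrite ge_min lexx orbT.
Qed.

Lemma measurable_a_ n : measurable_fun setT (a_ s p n : E -> R).
Proof.
apply: measurable_minr => //.
have := measurable_hardy s p (measurable_cst (1 : R) : measurable_fun [set: E] (fun _ : E => 1 : R)).
by under eq_fun do rewrite normr1 powR1 mul1r.
Qed.

Lemma a_bounds n (x : E) : 0 <= a_ s p n x <= n%:R.
Proof. by rewrite /a_ ge_min lexx/= le_min ler0n invr_ge0 powR_ge0. Qed.

(** At each point the truncated weight equals the full one as soon as [n] exceeds it, and Fatou
    passes to the limit under a bound independent of [n]. *)
Lemma hardy_integral_limit (lam M B : R) (phi : E -> R) : 0 < lam -> measurable_fun setT phi ->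
  (forall x, 0 <= phi x <= B) -> (forall x, r <= `|x| -> phi x = 0) ->
  (forall n, (1 <= n)%N -> lam * \int[mu]_x (a_ s p n x * phi x `^ p) <= M) ->
  (lam%:E * hardy_integral s p phi <= M%:E)%E.
Proof.
move=> lam0 mphi phiB phir H; have p0 : 0 < p by have := p2; lra.
have phi0 x : 0 <= phi x by have /andP[] := phiB x.
have mphip : measurable_fun setT (fun x => phi x `^ p) by exact: (measurableT_comp (measurable_powR p) mphi).
pose h k x := (a_ s p k.+1 x * phi x `^ p)%:E.
have mh k : measurable_fun setT (h k).
  by apply/measurable_EFinP; apply: measurable_funM => //; exact: measurable_a_.
have h0 k x : (0 <= h k x)%E.
  by rewrite lee_fin mulr_ge0 ?powR_ge0//; have /andP[] := a_bounds k.+1 x.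
have hM k : (\int[mu]_x h k x <= (M / lam)%:E)%E.
  have i : mu.-integrable setT (EFin \o (fun x => a_ s p k.+1 x * phi x `^ p)).
    apply: (integrable_box (M := k.+1%:R * B `^ p) r0).
    - by apply: measurable_funM => //; exact: measurable_a_.
    - move=> x; have /andP[a0 a1] := a_bounds k.+1 x; have /andP[f0 f1] := phiB x.
      rewrite mulr_ge0 ?powR_ge0//=; apply: ler_pM => //; first exact: powR_ge0.
      by apply: powR_mono => //; exact: ltW.
    - by move=> x /phir ->; rewrite powR0 ?mulr0// gt_eqF.
  rewrite -[leLHS]fineK; last exact: (integrable_fin_num measurableT i).
  by rewrite lee_fin ler_pdivlMr// mulrC; exact: H.
have hl x : ((`|phi x| `^ p / enorm x `^ (p * s))%:E <= limn_einf (h ^~ x))%E.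
  apply: limn_einf_ge => y yx; exists (Num.truncn (enorm x `^ (p * s))^-1) => k nk.
  apply: lt_le_trans yx _; rewrite lee_fin ger0_norm// mulrC /a_ (min_idPr _)//.
  by apply: ltW; apply: lt_le_trans (truncnS_gt _) _; rewrite ler_nat ltnS.
have F : (hardy_integral s p phi <= limn_einf (fun k => \int[mu]_x h k x))%E.
  apply: fatou_ae => //.
  - by apply/measurable_EFinP; exact: (measurable_hardy s p mphi).
  - by move=> x; rewrite lee_fin divr_ge0 ?powR_ge0.
  - exact: nearW.
have G : (limn_einf (fun k => \int[mu]_x h k x) <= (M / lam)%:E)%E.
  by rewrite leNgt; apply/negP => /limn_einf_gt[n Hn]; have := Hn n (leqnn n); rewrite ltNge hM.
have lam0' : (0 <= lam%:E)%E by rewrite lee_fin ltW.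
apply: le_trans (lee_wpmul2l lam0' (le_trans F G)) _.
by rewrite -EFinM mulrC divfK ?lexx// gt_eqF.
Qed.

End local_hardy_uniform.

Theorem theorem6p1 (R : realType) (N : nat) (s p : R) (Om : set 'rV[R]_N)
    (T : R) (u0 : 'rV[R]_N -> R) (lambda : R)
    (hN : (2 <= N)%N) (hs : 0 < s < 1) (hp : 2 < p) (hps : p * s < N%:R)
    (hOm : regular_domain Om) (hbounded : bounded_set Om) (h0 : Om 0)
    (hT : 0 < T)
    (hu0_int : (lebesgue_rV R N).-integrable Om (EFin \o u0))
    (hu0_ge0 : {ae lebesgue_rV R N, forall x, Om x -> 0 <= u0 x})
    (hu0_neq0 : ~ {ae lebesgue_rV R N, forall x, Om x -> u0 x = 0})
    (hlambda : (hardy_constant N s p < lambda%:E)%E) :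
  ~ exists u : 'rV[R]_N -> R -> \bar R,
      [/\ sola s p Om T lambda u0 u,
          {ae (lebesgue_rV R N \x lebesgue_measure)%E,
             forall z, cylinder T setT z -> (0 <= u z.1 z.2)%E},
          {ae (lebesgue_rV R N \x lebesgue_measure)%E,
             forall z, cylinder T (~` Om) z -> u z.1 z.2 = 0%E} &
          {ae (lebesgue_rV R N \x lebesgue_measure)%E,
             forall z, cylinder T Om z -> (0 < u z.1 z.2)%E}].
Proof.
move=> [u [[u_ [Hsol Hmono _]] _ _ _]].
have N0 : (0 < N)%N by exact: ltn_trans hN.
have p1 : 1 < p by move: hp; lra.
have p0 : 0 < p by exact: lt_trans p1.
have ps0 : 0 < p * s by have /andP[s0 _] := hs; exact: mulr_gt0.
have [oOm _ _] := hOm.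
have mOm : measurable Om by exact: open_measurable_rV.
have hardy_le c : hardy_inequality N s p c -> (c%:E <= hardy_constant N s p)%E.
  by move=> hc; apply: ereal_sup_ubound; exists c.
(* The constant [0] is admissible in the Hardy inequality, so the supremum [hardy_constant] is
   nonnegative. *)
have lam0 : 0 < lambda.
  rewrite -lte_fin; apply: le_lt_trans hlambda; apply: hardy_le => f _.
  by rewrite mul0e mule_ge0 ?lee_fin ?invr_ge0//; exact: gagliardo_ge0.
suff : hardy_inequality N s p lambda by move=> /hardy_le; rewrite leNgt hlambda.
have [rho rho0 Hrho] : exists2 rho : R, 0 < rho & forall x, `|x| < rho -> Om x.
  have /nbhs_ballP[rho /= rho0 Hrho] : nbhs (0 : 'rV[R]_N) Om by exact: open_nbhs_nbhs.
  by exists rho => // x xr; apply: Hrho; rewrite -ball_normE/= sub0r normrN.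
(* The initial datum of [u_1], with values forced into [[0, 1]] everywhere; it equals
   [trunc 1 (u0 x)] almost everywhere in [Om]. *)
pose b (x : 'rV[R]_N) : R := Num.max 0 (Num.min (u0 x) 1).
have mb : measurable_fun Om b.
  have mu0 : measurable_fun Om u0 by apply/measurable_EFinP; exact: measurable_int hu0_int.
  by apply: measurable_maxr => //; exact: measurable_minr.
have b01 x : 0 <= b x <= 1 by rewrite /b le_max lexx/= ge_max ler01 ge_min lexx orbT.
have FF := ae_filter_ringOfSetsType (lebesgue_rV R N).
have bE : {ae lebesgue_rV R N, forall x, Om x -> b x = trunc 1 (u0 x)}.
  apply: filterS hu0_ge0 => x hx /hx u00; rewrite /b /trunc; apply/max_idPr.
  by rewrite le_min u00 ler01.
have nb : ~ {ae lebesgue_rV R N, forall x, Om x -> b x = 0}.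
  apply: contra_not hu0_neq0 => hb; apply: filterS2 hu0_ge0 hb => x h1 h2 Ox.
  have u00 := h1 Ox; have := h2 Ox; rewrite /b => bx.
  have : Num.min (u0 x) 1 <= 0 by rewrite -[leRHS]bx le_max lexx orbT.
  rewrite ge_min (lt_geF ltr01) orbF => u0x; apply/eqP; by rewrite eq_le u0x u00.
have b0 x : 0 <= b x by have /andP[] := b01 x.
have [r1 r10 Hr1] := positive_mass_off_origin N0 mOm mb b0 nb.
(* [r <= r1] keeps mass of [b] at distance at least [r] from [0], and [2 r < rho] places the ball of
   radius [2 r] inside [Om]. *)
pose r := Num.min r1 (rho / 4).
have r0 : 0 < r by rewrite lt_min r10 divr_gt0.
have rOm x : `|x| <= 2 * r -> Om x.
  move=> xr; apply: Hrho; apply: le_lt_trans xr _.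
  have : r <= rho / 4 by rewrite ge_min lexx orbT.
  by move: rho0; lra.
have rr1 : r <= r1 by rewrite ge_min lexx.
have bpos := Hr1 r r0 rr1.
have [pos1 sol1] := Hsol 1%N isT.
have [_ [C1 _] init1 _] := sol1.
have mw t : `[0, T]%classic t -> measurable_fun Om (u_ 1%N ^~ t) by move=> /C1[].
have init1' : (\int[lebesgue_rV R N]_(x in Om) ((u_ 1%N x t - b x) ^+ 2)%:E)%E @[t --> at_right (0 : R)] --> 0%E.
  rewrite (_ : (fun t => _) = (fun t => \int[lebesgue_rV R N]_(x in Om) ((u_ 1%N x t - trunc 1 (u0 x)) ^+ 2)%:E)%E)//.
  apply/funext => t; apply: ae_eq_integral_nomeas.
  by apply: filterS bE => x hx Ox; rewrite hx.
have [tau [m2 [tauT m20 Hm]]] := mass_persists hp mOm hbounded hT mb b01 mw init1' bpos.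
have [K K0 HK] := uniform_local_hardy hp ps0 N0 hbounded mOm hT r0 rOm (ltW lam0) tauT m20.
have mono n : (1 <= n)%N -> {ae (lebesgue_rV R N \x @lebesgue_measure R)%E, forall z, cylinder T Om z ->
    u_ 1%N z.1 z.2 <= u_ n z.1 z.2}.
  have FP := ae_filter_ringOfSetsType (lebesgue_rV R N \x @lebesgue_measure R)%E.
  elim: n => // -[|n] IH _; first exact: nearW.
  apply: filterS2 (IH isT) (Hmono n.+1 isT) => z h1 h2 cz.
  exact: le_trans (h1 cz) (h2 cz).
have FL := ae_filter_ringOfSetsType (@lebesgue_measure R).
apply: (hardy_of_small_support p1 ps0 (ltW lam0) K0 r0) => phi B mphi phiB phir pg.
have -> : (\int[lebesgue_rV R N]_x (`|phi x| `^ p)%:E = (\int[lebesgue_rV R N]_x (phi x `^ p))%:E)%E.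
  have i : (lebesgue_rV R N).-integrable setT (EFin \o (fun x => phi x `^ p)).
    apply: (integrable_box (M := B `^ p) r0).
    - exact: (measurableT_comp (measurable_powR p) mphi).
    - move=> x; have /andP[f0 f1] := phiB x; rewrite powR_ge0/=.
      by apply: powR_mono => //; exact: ltW.
    - by move=> x /phir ->; rewrite powR0// gt_eqF.
  rewrite /Rintegral fineK; last exact: (integrable_fin_num measurableT i).
  by apply: eq_integral => x _; have /andP[f0 _] := phiB x; rewrite ger0_norm.
have gfin : gagliardo s p setT phi \is a fin_num by rewrite ge0_fin_numE// gagliardo_ge0.
rewrite -(fineK gfin) -!EFinM -EFinD.
apply: (hardy_integral_limit hp r0 lam0 mphi phiB phir) => n n1.
have [posn soln] := Hsol n n1.
have ma : measurable_fun setT (a_ s p n : 'rV[R]_N -> R) by exact: measurable_a_.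
have hfar : {ae @lebesgue_measure R, forall t, 0 < t < tau -> (m2%:E <= \int[lebesgue_rV R N]_y
    (if r <= `|y| then positive_part Om T (u_ n) y t `^ (p - 1) else 0)%:E)%E}.
  have mono_t := ae_prod2 (m1 := lebesgue_rV R N) (m2 := @lebesgue_measure R)
    (P := fun x t => cylinder T Om (x, t) -> u_ 1%N x t <= u_ n x t) (mono n n1).
  have fW := positive_part_finite hp mOm soln posn.
  apply: filterS2 mono_t (ae_agree soln posn) => t h1 h2 tt.
  have tin : `]0, T[%classic t.
    by have /andP[t0 ttau] := tt; have /andP[_ tauT'] := tauT; rewrite /= in_itv/= t0 (lt_le_trans ttau).
  apply: (Hm t tt (positive_part Om T (u_ n) ^~ t)).
  - exact: (measurable_flow_section fW).
  - by have [_ + _ _ _] := fW; move=> h x; exact: h.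
  by apply: filterS2 h1 (h2 tin) => x g1 g2 Ox; rewrite g2; exact: g1.
exact: (HK _ _ _ _ ma (a_bounds s p n) soln posn hfar phi B mphi phiB phir pg).
Qed.
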